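(* Let $\lambda\in\mathbb R\setminus\{0\}$, let $n>1$, let $Q_1,Q_2$ be non-zero real homogeneous polynomials of degree $n$, and consider the system $\dot x=\lambda x+Q_1(x,y)$, $\dot y=\lambda y+Q_2(x,y)$. Suppose that there is at least one infinite equilibrium and that all the infinite equilibria are hyperbolic. Then the dynamics near the infinite equilibria determines the global dynamics on the plane, as follows. Consider a trajectory at infinity connecting two consecutive infinite equilibria, going from $\mathbf a_-$ to $\mathbf a_+$, and let $C$ be the half-cone determined by them. The possible pairs of angles (angle at $\mathbf a_-$ or $\mathbf a_+$ in $C$) are: (a) $P^-$ at $\mathbf a_-$ and $P^+$ at $\mathbf a_+$; (b) $H^+$ at $\mathbf a_-$ and $H^-$ at $\mathbf a_+$; (c) $H^+$ at $\mathbf a_-$ and $P^+$ at $\mathbf a_+$; (d) $P^-$ at $\mathbf a_-$ and $H^-$ at $\mathbf a_+$. There are no finite equilibria in the interior of $C$, and the trajectories in the interior of $C$ behave as follows, where $p_\pm$ denotes the (unique, when it exists) finite equilibrium other than the origin on the radius ending at $\mathbf a_\pm$. If $\lambda>0$: (a) $p_-$ exists and $p_+$ does not; all trajectories have $\omega$-limit $\mathbf a_+$; the unstable manifold of $p_-$ splits the half-cone into two regions, of trajectories with $\alpha$-limit the origin and of trajectories with $\alpha$-limit $\mathbf a_-$. (b) $p_+$ exists and $p_-$ does not; all trajectories have $\alpha$-limit the origin and $\omega$-limit $p_+$. (c) neither $p_-$ nor $p_+$ exists; all trajectories have $\alpha$-limit the origin and $\omega$-limit $\mathbf a_+$. (d)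 both $p_-$ and $p_+$ exist; there is a robust heteroclinic connection from $p_-$ to $p_+$, all trajectories have $\omega$-limit $p_+$, and the connection separates the trajectories with $\alpha$-limit the origin from those with $\alpha$-limit $\mathbf a_-$. If $\lambda<0$: (a) $p_+$ exists and $p_-$ does not; all trajectories have $\alpha$-limit $\mathbf a_-$; the stable manifold of $p_+$ splits the half-cone into the basins of attraction of the origin and of $\mathbf a_+$. (b) $p_-$ exists and $p_+$ does not; all trajectories have $\alpha$-limit $p_-$ and $\omega$-limit the origin. (c) both $p_-$ and $p_+$ exist; there is a robust heteroclinic connection from $p_-$ to $p_+$, all trajectories have $\alpha$-limit $p_-$, and the connection separates the trajectories with $\omega$-limit the origin from those with $\omega$-limit $\mathbf a_+$. (d) neither $p_-$ nor $p_+$ exists; all trajectories have $\alpha$-limit $\mathbf a_-$ and $\omega$-limit the origin.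
   Context: Polar form: $\dot r=\lambda r+f(\theta)r^n$, $\dot\theta=g(\theta)r^{n-1}$, with $f(\theta)=\cos\theta\,Q_1(\cos\theta,\sin\theta)+\sin\theta\,Q_2(\cos\theta,\sin\theta)$ and $g(\theta)=\cos\theta\,Q_2(\cos\theta,\sin\theta)-\sin\theta\,Q_1(\cos\theta,\sin\theta)$. The radius $\theta=\theta_0$ is the half-line $\{\theta=\theta_0,\ r>0\}$. The Poincaré disk is the compactification of $\mathbb R^2$ by the circle at infinity (one point per direction $\theta$). Near it, with $R=1/r$ and after multiplication by $R^{n-1}>0$, the flow is $\dot R=-\lambda R^n-Rf(\theta)$, $\dot\theta=g(\theta)$, and the circle at infinity is $R=0$. Infinite equilibria are the points $(R,\theta)=(0,\theta_0)$ with $g(\theta_0)=0$; the radius $\theta=\theta_0$ is then flow-invariant. An infinite equilibrium is hyperbolic if it is a hyperbolic equilibrium of this $(R,\theta)$ system, i.e. $f(\theta_0)\ne0$ and $g'(\theta_0)\neq 0$. If $\theta_1<\theta_2$ are two consecutive zeros of $g$ (so $0<\theta_2-\theta_1\le\pi$), the corresponding infinite equilibria are called consecutive and the flow-invariant set $C=\{r\ge0,\ \theta_1\le\theta\le\theta_2\}$ is the half-cone determined by them. The flow on the arc at infinity between them goes from one of them (called $\mathbf a_-$ here) to the other ($\mathbf a_+$). At each of the two infinite equilibria $\mathbf a$, the line at infinity and the invariant radius ending at $\mathbf a$ determine an angle in $C$. It is of type $P^-$ if $\mathbf a$ is repelling both in the line at infinity (on the side of $C$) and along the radius; $P^+$ if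 attracting in both; $H^-$ if attracting in the line at infinity and radially repelling; $H^+$ if repelling in the line at infinity and radially attracting. A heteroclinic connection from $p_-$ to $p_+$ is a trajectory with $\alpha$-limit $p_-$ and $\omega$-limit $p_+$. *)

(* Defs.v *)
From Stdlib Require Import Reals.
From Coquelicot Require Import Coquelicot.

Open Scope R_scope.

Definition plane : Type := (R * R)%type.

Definition origin : plane := (0, 0).

Record curve := Curve { lo : Rbar; hi : Rbar; pos :> R -> plane }.

Definition dom (c : curve) (t : R) : Prop :=
  Rbar_lt (lo c) t /\ Rbar_lt t (hi c).

Definition image (c : curve) (p : plane) : Prop :=
  exists t, dom c t /\ c t = p.

Definition meets (c : curve) (S : plane -> Prop) : Prop :=
  exists t, dom c t /\ S (c t).

Definition equilibrium (X : plane -> plane) (p : plane) : Prop :=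
  X p = (0, 0).

Definition solution (X : plane -> plane) (c : curve) : Prop :=
  Rbar_lt (lo c) (hi c) /\
  forall t, dom c t ->
    is_derive (fun s => fst (c s)) t (fst (X (c t))) /\
    is_derive (fun s => snd (c s)) t (snd (X (c t))).

Definition extends (c' c : curve) : Prop :=
  Rbar_le (lo c') (lo c) /\ Rbar_le (hi c) (hi c') /\
  forall t, dom c t -> c' t = c t.

(* Trajectories live on their maximal interval of existence, which need not be
   the whole line: those going to infinity may do so in finite time. *)
Definition trajectory (X : plane -> plane) (c : curve) : Prop :=
  solution X c /\
  forall c', solution X c' -> extends c' c -> lo c' = lo c /\ hi c' = hi c.

Definition alpha_limit_set (c : curve) (p : plane) : Prop :=
  forall (eps : posreal) t, dom c t ->
    exists s, dom c s /\ s < t /\ ball p eps (c s).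

Definition omega_limit_set (c : curve) (p : plane) : Prop :=
  forall (eps : posreal) t, dom c t ->
    exists s, dom c s /\ t < s /\ ball p eps (c s).

Definition alpha_limit (c : curve) (p : plane) : Prop :=
  forall q, alpha_limit_set c q <-> q = p.

Definition omega_limit (c : curve) (p : plane) : Prop :=
  forall q, omega_limit_set c q <-> q = p.

(* The plane is identified with the open unit disk by [to_disk]; the direction
   [theta] of the circle at infinity is the point [at_infinity theta] of the
   unit circle. *)
Definition to_disk (p : plane) : plane :=
  (fst p / sqrt (1 + fst p ^ 2 + snd p ^ 2),
   snd p / sqrt (1 + fst p ^ 2 + snd p ^ 2)).

Definition at_infinity (theta : R) : plane := (cos theta, sin theta).

Definition in_disk (c : curve) : curve :=
  Curve (lo c) (hi c) (fun t => to_disk (c t)).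

(* In the next two definitions [z] is a point of the closed disk. *)
Definition alpha_basin (X : plane -> plane) (z p : plane) : Prop :=
  exists c, trajectory X c /\ image c p /\ alpha_limit (in_disk c) z.

Definition omega_basin (X : plane -> plane) (z p : plane) : Prop :=
  exists c, trajectory X c /\ image c p /\ omega_limit (in_disk c) z.

Definition unstable_manifold (X : plane -> plane) (p : plane) : plane -> Prop :=
  alpha_basin X (to_disk p).

Definition stable_manifold (X : plane -> plane) (p : plane) : plane -> Prop :=
  omega_basin X (to_disk p).

Definition connected (A : plane -> Prop) : Prop :=
  forall U V : plane -> Prop, open U -> open V ->
    (forall p, A p -> U p \/ V p) ->
    (exists p, A p /\ U p) -> (exists p, A p /\ V p) ->
    exists p, A p /\ U p /\ V p.

Definition region (A : plane -> Prop) : Prop :=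
  (exists p, A p) /\ open A /\ connected A.

(* [S] minus [W] has exactly two connected components, the parts of [A] and
   [B] in [S]. *)
Definition splits (S W A B : plane -> Prop) : Prop :=
  (forall p, S p -> (~ W p <-> A p \/ B p)) /\
  (forall p, S p -> ~ (A p /\ B p)) /\
  region (fun p => S p /\ A p) /\ region (fun p => S p /\ B p).

Definition d1 (h : plane -> R) (p : plane) : R :=
  Derive (fun u => h (u, snd p)) (fst p).

Definition d2 (h : plane -> R) (p : plane) : R :=
  Derive (fun v => h (fst p, v)) (snd p).

Definition comp1 (X : plane -> plane) (p : plane) : R := fst (X p).
Definition comp2 (X : plane -> plane) (p : plane) : R := snd (X p).

(* Here [mu] ranges over the complex eigenvalues of the Jacobian matrix. *)
Definition hyperbolic_equilibrium (X : plane -> plane) (p : plane) : Prop :=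
  equilibrium X p /\
  forall mu : C,
    Cminus (Cmult (Cminus (RtoC (d1 (comp1 X) p)) mu)
                  (Cminus (RtoC (d2 (comp2 X) p)) mu))
           (Cmult (RtoC (d2 (comp1 X) p)) (RtoC (d1 (comp2 X) p))) = RtoC 0 ->
    Re mu <> 0.

Definition C1_function (h : plane -> R) : Prop :=
  forall p : plane,
    ex_derive (fun u => h (u, snd p)) (fst p) /\
    ex_derive (fun v => h (fst p, v)) (snd p) /\
    continuous (d1 h) p /\ continuous (d2 h) p.

Definition C1_field (X : plane -> plane) : Prop :=
  C1_function (comp1 X) /\ C1_function (comp2 X).

Definition C1_close_function (M eps : R) (h k : plane -> R) : Prop :=
  forall p : plane, Rabs (fst p) <= M -> Rabs (snd p) <= M ->
    Rabs (k p - h p) < eps /\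
    Rabs (d1 k p - d1 h p) < eps /\
    Rabs (d2 k p - d2 h p) < eps.

Definition C1_close (M eps : R) (X Y : plane -> plane) : Prop :=
  C1_close_function M eps (comp1 X) (comp1 Y) /\
  C1_close_function M eps (comp2 X) (comp2 Y).

Definition heteroclinic (X : plane -> plane) (c : curve) (p q : plane) : Prop :=
  trajectory X c /\
  alpha_limit (in_disk c) (to_disk p) /\ omega_limit (in_disk c) (to_disk q).

(* Robustness is persistence under perturbations of the vector field that are
   small in the C^1 topology on some compact set: the perturbed field has a
   heteroclinic connection close to [c] between equilibria close to [p] and
   [q]. *)
Definition robust_heteroclinic (X : plane -> plane) (c : curve) (p q : plane)
    : Prop :=
  heteroclinic X c p q /\
  forall eta : posreal, exists M eps : R, 0 < M /\ 0 < eps /\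
    forall Y, C1_field Y -> C1_close M eps X Y ->
      exists p' q' c',
        equilibrium Y p' /\ equilibrium Y q' /\
        ball p eta p' /\ ball q eta q' /\
        heteroclinic Y c' p' q' /\
        forall t, dom c' t -> exists s, dom c s /\ ball (c s) eta (c' t).

Definition homogeneous_polynomial (n : nat) (Q : R -> R -> R) : Prop :=
  exists a : nat -> R, forall x y,
    Q x y = sum_f_R0 (fun i => a i * x ^ (n - i) * y ^ i) n.

Definition system (lambda : R) (Q1 Q2 : R -> R -> R) (p : plane) : plane :=
  (lambda * fst p + Q1 (fst p) (snd p), lambda * snd p + Q2 (fst p) (snd p)).

Definition polar_f (Q1 Q2 : R -> R -> R) (theta : R) : R :=
  cos theta * Q1 (cos theta) (sin theta) + sin theta * Q2 (cos theta) (sin theta).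

Definition polar_g (Q1 Q2 : R -> R -> R) (theta : R) : R :=
  cos theta * Q2 (cos theta) (sin theta) - sin theta * Q1 (cos theta) (sin theta).

(* The field in the coordinates [(R, theta)], [R = 1/r], after multiplication
   by [R^(n-1)]. *)
Definition system_at_infinity (lambda : R) (n : nat) (Q1 Q2 : R -> R -> R)
    (w : plane) : plane :=
  (- lambda * fst w ^ n - fst w * polar_f Q1 Q2 (snd w), polar_g Q1 Q2 (snd w)).

Definition infinite_equilibrium (Q1 Q2 : R -> R -> R) (theta : R) : Prop :=
  polar_g Q1 Q2 theta = 0.

Definition strictly_between (a b x : R) : Prop := a < x < b \/ b < x < a.

(* Angles are real numbers and not classes modulo [2 * PI]; the two equilibria
   may come in either order. *)
Definition consecutive (Q1 Q2 : R -> R -> R) (ta tb : R) : Prop :=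
  infinite_equilibrium Q1 Q2 ta /\ infinite_equilibrium Q1 Q2 tb /\ ta <> tb /\
  forall t, strictly_between ta tb t -> ~ infinite_equilibrium Q1 Q2 t.

Definition half_cone (ta tb : R) (p : plane) : Prop :=
  exists r theta, 0 <= r /\ Rmin ta tb <= theta <= Rmax ta tb /\
    p = (r * cos theta, r * sin theta).

Definition half_cone_interior (ta tb : R) (p : plane) : Prop :=
  locally p (half_cone ta tb).

Definition on_radius (theta : R) (p : plane) : Prop :=
  exists r, 0 < r /\ p = (r * cos theta, r * sin theta).

Definition radius_equilibrium (X : plane -> plane) (theta : R) (p : plane)
    : Prop :=
  on_radius theta p /\ equilibrium X p.

(* A curve in the coordinates [(R, theta)] going from [ta] to [tb] on the
   circle at infinity [R = 0]. *)
Definition connection_at_infinity (Xinf : plane -> plane) (c : curve)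
    (ta tb : R) : Prop :=
  trajectory Xinf c /\ (forall t, dom c t -> fst (c t) = 0) /\
  alpha_limit c (0, ta) /\ omega_limit c (0, tb).

(* [ta] is the infinite equilibrium and [tb] the other one on the half-cone. *)
Definition near_on_line_at_infinity (ta tb delta : R) (w : plane) : Prop :=
  fst w = 0 /\ strictly_between ta tb (snd w) /\ Rabs (snd w - ta) < delta.

Definition near_on_radius (ta delta : R) (w : plane) : Prop :=
  0 < fst w < delta /\ snd w = ta.

Definition line_repelling (Xinf : plane -> plane) (ta tb : R) : Prop :=
  exists delta, 0 < delta /\ forall c, trajectory Xinf c ->
    meets c (near_on_line_at_infinity ta tb delta) -> alpha_limit c (0, ta).

Definition line_attracting (Xinf : plane -> plane) (ta tb : R) : Prop :=
  exists delta, 0 < delta /\ forall c, trajectory Xinf c ->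
    meets c (near_on_line_at_infinity ta tb delta) -> omega_limit c (0, ta).

Definition radially_repelling (Xinf : plane -> plane) (ta : R) : Prop :=
  exists delta, 0 < delta /\ forall c, trajectory Xinf c ->
    meets c (near_on_radius ta delta) -> alpha_limit c (0, ta).

Definition radially_attracting (Xinf : plane -> plane) (ta : R) : Prop :=
  exists delta, 0 < delta /\ forall c, trajectory Xinf c ->
    meets c (near_on_radius ta delta) -> omega_limit c (0, ta).

Definition angle_Pminus (Xinf : plane -> plane) (ta tb : R) : Prop :=
  line_repelling Xinf ta tb /\ radially_repelling Xinf ta.

Definition angle_Pplus (Xinf : plane -> plane) (ta tb : R) : Prop :=
  line_attracting Xinf ta tb /\ radially_attracting Xinf ta.

Definition angle_Hminus (Xinf : plane -> plane) (ta tb : R) : Prop :=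
  line_attracting Xinf ta tb /\ radially_repelling Xinf ta.

Definition angle_Hplus (Xinf : plane -> plane) (ta tb : R) : Prop :=
  line_repelling Xinf ta tb /\ radially_attracting Xinf ta.

(* The four pairs of angles, at [ta] (where the connection at infinity starts)
   and at [tb] (where it ends). *)
Definition case_a (Xinf : plane -> plane) (ta tb : R) : Prop :=
  angle_Pminus Xinf ta tb /\ angle_Pplus Xinf tb ta.

Definition case_b (Xinf : plane -> plane) (ta tb : R) : Prop :=
  angle_Hplus Xinf ta tb /\ angle_Hminus Xinf tb ta.

Definition case_c (Xinf : plane -> plane) (ta tb : R) : Prop :=
  angle_Hplus Xinf ta tb /\ angle_Pplus Xinf tb ta.

Definition case_d (Xinf : plane -> plane) (ta tb : R) : Prop :=
  angle_Pminus Xinf ta tb /\ angle_Hminus Xinf tb ta.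

Definition all_alpha (X : plane -> plane) (S : plane -> Prop) (z : plane)
    : Prop :=
  forall c, trajectory X c -> meets c S -> alpha_limit (in_disk c) z.

Definition all_omega (X : plane -> plane) (S : plane -> Prop) (z : plane)
    : Prop :=
  forall c, trajectory X c -> meets c S -> omega_limit (in_disk c) z.

Definition no_radius_equilibrium (X : plane -> plane) (theta : R) : Prop :=
  forall p, ~ radius_equilibrium X theta p.

(* Main.v *)
Require Import Defs.
From Stdlib Require Import Reals Lra Lia Classical ClassicalEpsilon.
From Stdlib Require Import FunctionalExtensionality PropExtensionality.
From Coquelicot Require Import Coquelicot.

Open Scope R_scope.

(** The idea is to use the logarithm [q] of the radius and the angle, written
    [tm + sg * s] with [sg] the sign that makes [s] run from [0] to [L] between
    the directions [tm] and [tp]. With [m = n - 1], the system becomes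

      [s' = G s * exp (m * q)],   [q' = lambda + F s * exp (m * q)],

    where [F s] and [G s] are [polar_f] and [sg * polar_g] at that angle. The
    function [G] vanishes at both ends of the sector and is positive in between,
    so that [s] increases along every trajectory. Hence there are no interior
    equilibria, and only the ends of the sector matter. The quantity
    [v = exp (m * q)], the power [m] of the radius, satisfies a linear equation
    over [s], so that there is a first integral [H * v - K], with

      [H' = - (m * F / G) * H],   [K' = m * lambda * H / G].

    The trajectories are the graphs [v = (K + C) / H], over the part of the
    sector where [K + C] is positive; the time is then recovered from a scalar
    equation ([scalar_flow], [level_solution]).

    Let [lambda > 0]. Then [K] increases, and the signs of [F] at the ends
    decide everything. Since [G] has at most a linear growth at its zeros, the
    integral of [F / G] diverges there. If [F L > 0], then [H] tends to [0] at
    [L] and [v] to infinity; if [F L < 0], then [H] tends to infinity and, as in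
    the rule of de l'Hospital, [v] tends to [- lambda / F L], which is the
    equilibrium [p_plus]. If [F 0 > 0], then [K] tends to minus infinity at
    [0], so that every graph starts at a zero of [K + C] inside the sector, where
    the radius is [0]: the trajectory comes from the origin. If [F 0 < 0],
    then [H] tends to [0] and [K] to a finite limit [K0]. The levels
    [C < - K0] come from the origin, the levels [C > - K0] from infinity, and
    the level [C = - K0], where [v] tends to [- lambda / F 0], is the unstable
    manifold of the equilibrium [p_minus]; it is the graph of a continuous
    function over the whole sector and so has two connected sides
    ([sector_trajectory_limits], [sector_splits]). Finally, integration of the
    field on an invariant radius and on the line at infinity shows that the
    four cases of the theorem are the four pairs of signs of [F] at the ends
    ([cases_iff_signs]).

    Since trajectories are maximal solutions, the explicit solutions have to be
    shown to be maximal. They end at infinity or at an equilibrium, and by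
    uniqueness no solution can go past such a point
    ([terminal_limit_not_crossed]).

    When [F] is negative at both ends, the level [- K0] is a connection from
    the saddle [p_minus] to the sink [p_plus]. Its robustness
    ([skew_connection_persists], [connection_robust]) is proved in three steps
    for a perturbed field, which is close to the given one, together with its
    first derivatives, on a large square. In a small square around the saddle
    the field is nearly linear. A solution of the reversed field that never
    leaves the square exists, because the starting points leaving it upwards and
    downwards form disjoint open sets; it converges to an equilibrium, because
    its time shifts approach it exponentially ([saddle_stable_solution]). From
    the boundary of this square to a neighbourhood of the sink, the time is
    bounded, and the first integral changes only by a multiple of the size of
    the perturbation, so that the solution stays close to the connection
    ([transit]). Around the sink there is a square that no solution leaves, and
    the solution converges by the same argument on time shifts ([sink_limit]).

    For [lambda < 0], time is reversed. The reversed field is the system of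
    [- lambda], [- Q1] and [- Q2], which turns around the origin in the opposite
    direction: the directions [tm] and [tp] are exchanged and [F] changes its
    sign. The cases (a) and (b) are preserved, (c) and (d) exchanged. *)

(** * Real induction, monotonicity and Gronwall estimates *)

(** A substitute for compactness arguments on an interval: a property that is
    open to the right and closed from the left propagates. *)
Lemma real_induction (P : R -> Prop) (a b : R) :
  a <= b -> P a ->
  (forall x, a <= x < b -> (forall u, a <= u <= x -> P u) ->
     at_right x P) ->
  (forall x, a < x <= b -> (forall u, a <= u < x -> P u) -> P x) ->
  forall x, a <= x <= b -> P x.
Proof.
  intros Hab Ha Hstep Hlim.
  set (E := fun x => a <= x <= b /\ forall u, a <= u <= x -> P u).
  assert (HEa : E a) by (split; [lra|]; intros u Hu; replace u with a by lra; exact Ha).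
  destruct (completeness E) as [m [Hub Hleast]].
  { exists b. intros x [Hx _]. lra. }
  { exists a. exact HEa. }
  assert (Ham : a <= m) by (apply Hub; exact HEa).
  assert (Hmb : m <= b) by (apply Hleast; intros x [Hx _]; lra).
  assert (Hbelow : forall u, a <= u < m -> P u).
  { intros u Hu. apply NNPP. intro Hn.
    assert (m <= u); [|lra]. apply Hleast. intros x [Hx HP].
    destruct (Rle_dec x u) as [|Hxu]; [assumption|].
    exfalso. apply Hn, HP. lra. }
  assert (HPm : P m).
  { destruct (Req_dec m a) as [->|Hne]; [exact Ha|]. apply Hlim; [lra|exact Hbelow]. }
  assert (HEm : forall u, a <= u <= m -> P u).
  { intros u Hu. destruct (Req_dec u m) as [->|]; [exact HPm|]. apply Hbelow; lra. }
  destruct (Req_dec m b) as [Heq|Hne].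
  { intros x Hx. apply HEm. lra. }
  exfalso.
  destruct (Hstep m) as [d Hd]; [lra|exact HEm|].
  set (y := Rmin (m + d / 2) b).
  assert (Hy : m < y <= b /\ y <= m + d / 2).
  { unfold y. destruct d as [d dpos]; simpl in *. unfold Rmin; destruct Rle_dec; lra. }
  assert (HEy : E y).
  { split; [lra|]. intros u Hu. destruct (Rle_dec u m) as [Hum|Hum]; [apply HEm; lra|].
    apply Hd; [|lra]. unfold ball; simpl. unfold AbsRing_ball, abs, minus, plus, opp; simpl.
    destruct d as [d dpos]; simpl in *. rewrite Rabs_right; lra. }
  generalize (Hub y HEy). lra.
Qed.

Lemma nonincreasing_of_derive (f f' : R -> R) (a b : R) :
  a <= b -> (forall t, a <= t <= b -> is_derive f t (f' t)) ->
  (forall t, a <= t <= b -> f' t <= 0) -> f b <= f a.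
Proof.
  intros Hab Hd Hs.
  destruct (MVT_gen f a b f') as [c [Hc Heq]].
  - intros x Hx. rewrite Rmin_left, Rmax_right in Hx by lra. apply Hd; lra.
  - intros x Hx. rewrite Rmin_left, Rmax_right in Hx by lra.
    apply continuity_pt_filterlim, (ex_derive_continuous (V := R_NormedModule)).
    exists (f' x). apply Hd; lra.
  - rewrite Rmin_left, Rmax_right in Hc by lra.
    assert (f' c <= 0) by (apply Hs; lra). nra.
Qed.

Lemma nondecreasing_of_derive (f f' : R -> R) (a b : R) :
  a <= b -> (forall t, a <= t <= b -> is_derive f t (f' t)) ->
  (forall t, a <= t <= b -> 0 <= f' t) -> f a <= f b.
Proof.
  intros Hab Hd Hs.
  assert (- f b <= - f a); [|lra].
  apply (nonincreasing_of_derive (fun t => - f t) (fun t => - f' t)); auto.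
  - intros t Ht. apply (is_derive_opp f). auto.
  - intros t Ht. specialize (Hs t Ht). lra.
Qed.

Lemma increasing_of_derive (f f' : R -> R) (a b : R) :
  a < b -> (forall t, a <= t <= b -> is_derive f t (f' t)) ->
  (forall t, a <= t <= b -> 0 < f' t) -> f a < f b.
Proof.
  intros Hab Hd Hs.
  destruct (MVT_gen f a b f') as [c [Hc Heq]].
  - intros x Hx. rewrite Rmin_left, Rmax_right in Hx by lra. apply Hd; lra.
  - intros x Hx. rewrite Rmin_left, Rmax_right in Hx by lra.
    apply continuity_pt_filterlim, (ex_derive_continuous (V := R_NormedModule)).
    exists (f' x). apply Hd; lra.
  - rewrite Rmin_left, Rmax_right in Hc by lra.
    assert (0 < f' c) by (apply Hs; lra). nra.
Qed.

(** The factor [exp (- k * t)] turns the differential inequality into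
    monotonicity. *)
Lemma gronwall_forward (u u' : R -> R) (k a b : R) :
  a <= b -> (forall t, a <= t <= b -> is_derive u t (u' t)) ->
  (forall t, a <= t <= b -> u' t <= k * u t) ->
  u b <= u a * exp (k * (b - a)).
Proof.
  intros Hab Hd Hk.
  assert (H : u b * exp (- k * b) <= u a * exp (- k * a)).
  { apply (nonincreasing_of_derive (fun t => u t * exp (- k * t))
             (fun t => (u' t - k * u t) * exp (- k * t))); auto.
    - intros t Ht. auto_derive.
      + exists (u' t). auto.
      + replace (Derive _ t) with (u' t) by (symmetry; apply is_derive_unique; auto). ring.
    - intros t Ht. specialize (Hk t Ht). generalize (exp_pos (- k * t)). nra. }
  replace (u b) with ((u b * exp (- k * b)) * exp (k * b)).
  2:{ rewrite Rmult_assoc, <- exp_plus. replace (- k * b + k * b) with 0 by ring.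
      rewrite exp_0; ring. }
  replace (u a * exp (k * (b - a))) with (u a * exp (- k * a) * exp (k * b)).
  2:{ rewrite Rmult_assoc, <- exp_plus. f_equal. f_equal. ring. }
  apply Rmult_le_compat_r; [left; apply exp_pos|exact H].
Qed.

Lemma gronwall_backward (u u' : R -> R) (k a b : R) :
  a <= b -> (forall t, a <= t <= b -> is_derive u t (u' t)) ->
  (forall t, a <= t <= b -> - k * u t <= u' t) ->
  u a <= u b * exp (k * (b - a)).
Proof.
  intros Hab Hd Hk.
  assert (H : u (- - a) <= u (- - b) * exp (k * (- a - - b))).
  { apply (gronwall_forward (fun t => u (- t)) (fun t => - u' (- t))); [lra| |].
    - intros t Ht. evar_last.
      + apply (is_derive_comp u (fun t => - t)).
        * apply Hd. lra.
        * auto_derive; [exact I|reflexivity].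
      + unfold scal; simpl; unfold mult; simpl; ring.
    - intros t Ht. specialize (Hk (- t)). lra. }
  rewrite !Ropp_involutive in H. replace (k * (b - a)) with (k * (- a - - b)) by ring.
  exact H.
Qed.

Lemma continuous_bounded_on (f : R -> R) (a b : R) :
  a <= b -> (forall t, a <= t <= b -> continuous f t) ->
  exists M, 0 <= M /\ forall t, a <= t <= b -> Rabs (f t) <= M.
Proof.
  intros Hab Hc.
  destruct (continuity_ab_maj (fun t => Rabs (f t)) a b Hab) as [m [Hm _]].
  - intros t Ht. apply continuity_pt_filterlim.
    apply (continuous_comp f Rabs); [apply Hc; exact Ht|].
    apply (continuous_Rabs (f t)).
  - exists (Rabs (f m)). split; [apply Rabs_pos|exact Hm].
Qed.

Lemma is_derive_continuous (f : R -> R) (t l : R) : is_derive f t l -> continuous f t.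
Proof.
  intros H. apply (ex_derive_continuous (V := R_NormedModule)). exists l. exact H.
Qed.

Lemma is_derive_plus_R (f g : R -> R) (t a b : R) :
  is_derive f t a -> is_derive g t b -> is_derive (fun s => f s + g s) t (a + b).
Proof. intros Hf Hg. apply (is_derive_plus f g t a b Hf Hg). Qed.

Lemma is_derive_minus_R (f g : R -> R) (t a b : R) :
  is_derive f t a -> is_derive g t b -> is_derive (fun s => f s - g s) t (a - b).
Proof. intros Hf Hg. apply (is_derive_minus f g t a b Hf Hg). Qed.

Lemma is_derive_mult_R (f g : R -> R) (t a b : R) :
  is_derive f t a -> is_derive g t b ->
  is_derive (fun s => f s * g s) t (a * g t + f t * b).
Proof. intros Hf Hg. apply (is_derive_mult f g t a b Hf Hg). intros; apply Rmult_comm. Qed.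

Lemma is_derive_comp_R (f g : R -> R) (t a b : R) :
  is_derive f (g t) a -> is_derive g t b -> is_derive (fun s => f (g s)) t (a * b).
Proof.
  intros Hf Hg. rewrite Rmult_comm. apply (is_derive_comp f g t a b Hf Hg).
Qed.

Lemma is_derive_square (f : R -> R) (t a : R) :
  is_derive f t a -> is_derive (fun s => f s ^ 2) t (2 * f t * a).
Proof.
  intros Hf. apply (is_derive_comp_R (fun x => x ^ 2) f); [|exact Hf].
  auto_derive; [exact I|ring].
Qed.

(** * Solutions of planar systems *)

(** The bounds are over the squares centred at the origin, which exhaust the
    plane. *)
Definition locally_lipschitz (h : plane -> R) : Prop :=
  forall M, exists K, 0 <= K /\ forall p q : plane,
    Rabs (fst p) <= M -> Rabs (snd p) <= M -> Rabs (fst q) <= M -> Rabs (snd q) <= M ->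
    Rabs (h p - h q) <= K * (Rabs (fst p - fst q) + Rabs (snd p - snd q)).

Definition locally_lipschitz_field (X : plane -> plane) : Prop :=
  locally_lipschitz (comp1 X) /\ locally_lipschitz (comp2 X).

Definition reverse_field (X : plane -> plane) (p : plane) : plane :=
  (- fst (X p), - snd (X p)).

Definition reverse_curve (c : curve) : curve :=
  Curve (Rbar_opp (hi c)) (Rbar_opp (lo c)) (fun t => c (- t)).

Lemma dom_open (c : curve) (t : R) : dom c t -> locally t (dom c).
Proof.
  intros [H1 H2]. apply filter_and.
  - apply (open_Rbar_gt' t (lo c) H1).
  - apply (open_Rbar_lt' t (hi c) H2).
Qed.

Lemma dom_between (c : curve) (a b t : R) : dom c a -> dom c b -> a <= t <= b -> dom c t.
Proof.
  intros [H1 H2] [H3 H4] Ht. split.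
  - apply Rbar_lt_le_trans with a; [exact H1|simpl; lra].
  - apply Rbar_le_lt_trans with b; [simpl; lra|exact H4].
Qed.

Lemma dom_reverse (c : curve) (t : R) : dom (reverse_curve c) t <-> dom c (- t).
Proof.
  unfold dom, reverse_curve; simpl. destruct (lo c), (hi c); simpl; split; intros [H1 H2]; split; lra.
Qed.

Lemma reverse_curve_involutive (c : curve) : reverse_curve (reverse_curve c) = c.
Proof.
  destruct c as [a b f]. unfold reverse_curve. simpl. rewrite !Rbar_opp_involutive. f_equal.
  apply functional_extensionality. intros t. rewrite Ropp_involutive. reflexivity.
Qed.

Lemma reverse_field_involutive (X : plane -> plane) : reverse_field (reverse_field X) = X.
Proof.
  apply functional_extensionality. intros p. unfold reverse_field. simpl.
  rewrite !Ropp_involutive. symmetry. apply surjective_pairing.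
Qed.

Lemma solution_reverse (X : plane -> plane) (c : curve) :
  solution X c -> solution (reverse_field X) (reverse_curve c).
Proof.
  intros [H1 H2]. split.
  - simpl. destruct (lo c), (hi c); simpl in *; lra.
  - intros t Ht. apply dom_reverse in Ht. destruct (H2 _ Ht) as [D1 D2]. simpl.
    assert (Hopp : is_derive (fun s => - s) t (-1)) by (auto_derive; [exact I|ring]).
    split.
    + replace (- fst (X (c (- t)))) with (fst (X (c (- t))) * -1) by ring.
      exact (is_derive_comp_R (fun s => fst (c s)) (fun s => - s) t _ _ D1 Hopp).
    + replace (- snd (X (c (- t)))) with (snd (X (c (- t))) * -1) by ring.
      exact (is_derive_comp_R (fun s => snd (c s)) (fun s => - s) t _ _ D2 Hopp).
Qed.

Lemma extends_reverse (c d : curve) : extends c d -> extends (reverse_curve c) (reverse_curve d).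
Proof.
  intros (H1 & H2 & H3). repeat split.
  - simpl. destruct (hi c), (hi d); simpl in *; try tauto; lra.
  - simpl. destruct (lo c), (lo d); simpl in *; try tauto; lra.
  - intros t Ht. apply dom_reverse in Ht. simpl. apply H3, Ht.
Qed.

Lemma trajectory_reverse (X : plane -> plane) (c : curve) :
  trajectory X c -> trajectory (reverse_field X) (reverse_curve c).
Proof.
  intros [Hs Hm]. split; [apply solution_reverse; exact Hs|].
  intros c' Hc' He. apply solution_reverse in Hc'. apply extends_reverse in He.
  rewrite reverse_field_involutive in Hc'. rewrite reverse_curve_involutive in He.
  destruct (Hm _ Hc' He) as [E1 E2]. simpl in *.
  rewrite <- E1, <- E2, !Rbar_opp_involutive. auto.
Qed.

Lemma trajectory_reverse_iff (X : plane -> plane) (c : curve) :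
  trajectory X (reverse_curve c) <-> trajectory (reverse_field X) c.
Proof.
  split; intros H; apply trajectory_reverse in H.
  - rewrite reverse_curve_involutive in H. exact H.
  - rewrite reverse_field_involutive in H. exact H.
Qed.

Lemma locally_lipschitz_reverse (X : plane -> plane) :
  locally_lipschitz_field X -> locally_lipschitz_field (reverse_field X).
Proof.
  intros [H1 H2]. split; intros M.
  - destruct (H1 M) as [K [HK H]]. exists K. split; [exact HK|]. intros p q A B C D.
    unfold comp1, reverse_field in *; simpl.
    replace (- fst (X p) - - fst (X q)) with (- (fst (X p) - fst (X q))) by ring.
    rewrite Rabs_Ropp. auto.
  - destruct (H2 M) as [K [HK H]]. exists K. split; [exact HK|]. intros p q A B C D.
    unfold comp2, reverse_field in *; simpl.
    replace (- snd (X p) - - snd (X q)) with (- (snd (X p) - snd (X q))) by ring.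
    rewrite Rabs_Ropp. auto.
Qed.

Lemma sum_squares_zero (x y : R) : x ^ 2 + y ^ 2 <= 0 -> x = 0 /\ y = 0.
Proof.
  intros H. generalize (pow2_ge_0 x) (pow2_ge_0 y). intros Hx Hy.
  split; apply Rsqr_0_uniq; unfold Rsqr; nra.
Qed.

(** The squared distance [u] satisfies [u' <= 4 (K1 + K2) u] for the
    Lipschitz constants on a square that contains both solutions, and starts
    from [0]. *)
Lemma solution_unique_forward (X : plane -> plane) (c d : curve) (t0 t : R) :
  locally_lipschitz_field X -> solution X c -> solution X d ->
  dom c t0 -> dom d t0 -> dom c t -> dom d t -> t0 <= t ->
  c t0 = d t0 -> c t = d t.
Proof.
  intros [L1 L2] [_ Hc] [_ Hd] Dc0 Dd0 Dc Dd Hle Heq.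
  assert (Ic : forall s, t0 <= s <= t -> dom c s) by (intros s Hs; apply (dom_between c t0 t); auto).
  assert (Id : forall s, t0 <= s <= t -> dom d s) by (intros s Hs; apply (dom_between d t0 t); auto).
  assert (B : forall f, (forall s, t0 <= s <= t -> continuous f s) ->
    exists M, 0 <= M /\ forall s, t0 <= s <= t -> Rabs (f s) <= M)
    by (intros f; apply continuous_bounded_on; auto).
  destruct (B (fun s => fst (c s))) as [M1 [P1 B1]].
  { intros s Hs. eapply is_derive_continuous. apply (Hc s); auto. }
  destruct (B (fun s => snd (c s))) as [M2 [P2 B2]].
  { intros s Hs. eapply is_derive_continuous. apply (Hc s); auto. }
  destruct (B (fun s => fst (d s))) as [M3 [P3 B3]].
  { intros s Hs. eapply is_derive_continuous. apply (Hd s); auto. }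
  destruct (B (fun s => snd (d s))) as [M4 [P4 B4]].
  { intros s Hs. eapply is_derive_continuous. apply (Hd s); auto. }
  set (M := M1 + M2 + M3 + M4).
  destruct (L1 M) as [K1 [PK1 HK1]]. destruct (L2 M) as [K2 [PK2 HK2]].
  set (u := fun s => (fst (c s) - fst (d s)) ^ 2 + (snd (c s) - snd (d s)) ^ 2).
  set (u' := fun s => 2 * (fst (c s) - fst (d s)) * (fst (X (c s)) - fst (X (d s)))
                    + 2 * (snd (c s) - snd (d s)) * (snd (X (c s)) - snd (X (d s)))).
  assert (Hu : u t <= u t0 * exp (4 * (K1 + K2) * (t - t0))).
  { apply (gronwall_forward u u'); [exact Hle| |].
    - intros s Hs. destruct (Hc s (Ic s Hs)) as [C1 C2]. destruct (Hd s (Id s Hs)) as [D1 D2].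
      unfold u, u'. apply is_derive_plus_R.
      + apply (is_derive_square (fun s => fst (c s) - fst (d s))).
        apply (is_derive_minus_R (fun s => fst (c s)) (fun s => fst (d s))); assumption.
      + apply (is_derive_square (fun s => snd (c s) - snd (d s))).
        apply (is_derive_minus_R (fun s => snd (c s)) (fun s => snd (d s))); assumption.
    - intros s Hs. unfold u, u'.
      specialize (B1 s Hs). specialize (B2 s Hs). specialize (B3 s Hs). specialize (B4 s Hs).
      simpl in *.
      assert (E1 := HK1 (c s) (d s)). assert (E2 := HK2 (c s) (d s)).
      specialize (E1 ltac:(unfold M; lra) ltac:(unfold M; lra) ltac:(unfold M; lra) ltac:(unfold M; lra)).
      specialize (E2 ltac:(unfold M; lra) ltac:(unfold M; lra) ltac:(unfold M; lra) ltac:(unfold M; lra)).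
      unfold comp1 in E1. unfold comp2 in E2.
      set (x := fst (c s) - fst (d s)) in *. set (y := snd (c s) - snd (d s)) in *.
      set (X1 := fst (X (c s)) - fst (X (d s))) in *.
      set (X2 := snd (X (c s)) - snd (X (d s))) in *.
      assert (F1 : x * X1 <= Rabs x * (K1 * (Rabs x + Rabs y))).
      { apply Rle_trans with (Rabs (x * X1)); [apply Rle_abs|]. rewrite Rabs_mult.
        apply Rmult_le_compat_l; [apply Rabs_pos|exact E1]. }
      assert (F2 : y * X2 <= Rabs y * (K2 * (Rabs x + Rabs y))).
      { apply Rle_trans with (Rabs (y * X2)); [apply Rle_abs|]. rewrite Rabs_mult.
        apply Rmult_le_compat_l; [apply Rabs_pos|exact E2]. }
      assert (S1 : x * x = Rabs x * Rabs x) by apply Rsqr_abs.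
      assert (S2 : y * y = Rabs y * Rabs y) by apply Rsqr_abs.
      generalize (Rabs_pos x) (Rabs_pos y). intros.
      replace (x * (x * 1) + y * (y * 1)) with (Rabs x * Rabs x + Rabs y * Rabs y) by (rewrite <- S1, <- S2; ring).
      set (ax := Rabs x) in *. set (ay := Rabs y) in *.
      assert (Q : 2 * (ax * ay) <= ax * ax + ay * ay)
        by (generalize (Rle_0_sqr (ax - ay)); unfold Rsqr; lra).
      assert (Q1 : 0 <= ay * (ax + ay)) by (apply Rmult_le_pos; lra).
      assert (Q2 : 0 <= ax * (ax + ay)) by (apply Rmult_le_pos; lra).
      assert (R1 : 0 <= K1 * (ay * (ax + ay))) by (apply Rmult_le_pos; lra).
      assert (R2 : 0 <= K2 * (ax * (ax + ay))) by (apply Rmult_le_pos; lra).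
      assert (R3 : (K1 + K2) * (2 * (ax * ay)) <= (K1 + K2) * (ax * ax + ay * ay))
        by (apply Rmult_le_compat_l; lra).
      lra. }
  assert (H0 : u t0 = 0) by (unfold u; rewrite Heq; ring).
  rewrite H0, Rmult_0_l in Hu.
  destruct (sum_squares_zero _ _ Hu) as [Hx Hy].
  destruct (c t), (d t); simpl in *. f_equal; lra.
Qed.

Lemma solution_unique (X : plane -> plane) (c d : curve) (t0 t : R) :
  locally_lipschitz_field X -> solution X c -> solution X d ->
  dom c t0 -> dom d t0 -> dom c t -> dom d t ->
  c t0 = d t0 -> c t = d t.
Proof.
  intros L Hc Hd Dc0 Dd0 Dc Dd Heq.
  destruct (Rle_dec t0 t) as [Hle|Hgt].
  - apply (solution_unique_forward X c d t0 t); auto.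
  - assert (E : reverse_curve c (- t) = reverse_curve d (- t)).
    { apply (solution_unique_forward (reverse_field X) _ _ (- t0) (- t));
        try apply locally_lipschitz_reverse; try apply solution_reverse;
        try apply dom_reverse; simpl; rewrite ?Ropp_involutive; auto. lra. }
    simpl in E. rewrite !Ropp_involutive in E. exact E.
Qed.

(** Otherwise the trajectory could be continued along the solution. *)
Lemma trajectory_outlasts_solution (X : plane -> plane) (c e : curve) (t0 : R) :
  locally_lipschitz_field X -> trajectory X c -> solution X e ->
  dom c t0 -> dom e t0 -> c t0 = e t0 -> Rbar_le (hi e) (hi c).
Proof.
  intros L [Hs Hm] He Dc De Heq.
  apply Rbar_not_lt_le. intros Hlt.
  set (c' := Curve (lo c) (hi e) (fun t => if Rle_dec t t0 then c t else e t)).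
  assert (Hsol : solution X c').
  { split.
    - simpl. apply Rbar_lt_trans with (hi c); [apply Hs|exact Hlt].
    - intros t [T1 T2]. simpl in T1, T2.
      assert (Hcase : (dom c t /\ locally t (fun s => c s = c' s)) \/
                      (dom e t /\ locally t (fun s => e s = c' s))).
      { destruct (Rlt_dec t t0) as [Hlt0|Hge].
        - left. split.
          + split; [exact T1|]. apply Rbar_lt_trans with t0; [exact Hlt0|apply Dc].
          + generalize (open_lt t0 t Hlt0). apply filter_imp. intros s Hs'. simpl.
            destruct (Rle_dec s t0); [reflexivity|lra].
        - destruct (Req_dec t t0) as [->|Hne].
          + right. split; [exact De|].
            generalize (filter_and _ _ (dom_open c t0 Dc) (dom_open e t0 De)).
            apply filter_imp. intros s [S1 S2]. simpl.
            destruct (Rle_dec s t0); [|reflexivity].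
            symmetry. apply (solution_unique X c e t0 s); auto.
          + right. assert (t0 < t) by lra. split.
            * split; [|exact T2]. apply Rbar_lt_trans with t0; [apply De|exact H].
            * generalize (open_gt t0 t H). apply filter_imp. intros s Hs'. simpl.
              destruct (Rle_dec s t0); [lra|reflexivity]. }
      destruct Hcase as [[D E]|[D E]].
      + rewrite <- (locally_singleton _ _ E). destruct (proj2 Hs t D) as [D1 D2].
        split; [eapply is_derive_ext_loc, D1|eapply is_derive_ext_loc, D2];
          revert E; apply filter_imp; intros s ->; reflexivity.
      + rewrite <- (locally_singleton _ _ E). destruct (proj2 He t D) as [D1 D2].
        split; [eapply is_derive_ext_loc, D1|eapply is_derive_ext_loc, D2];
          revert E; apply filter_imp; intros s ->; reflexivity. }
  destruct (Hm c' Hsol) as [_ E].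
  - split; [apply Rbar_le_refl|]. split; [apply Rbar_lt_le; exact Hlt|].
    intros t Ht. simpl. destruct (Rle_dec t t0) as [|Hn]; [reflexivity|].
    symmetry. apply (solution_unique X c e t0 t); auto.
    split.
    + apply Rbar_lt_trans with t0; [apply De|simpl; lra].
    + apply Rbar_lt_trans with (hi c); [apply Ht|exact Hlt].
  - simpl in E. rewrite E in Hlt. revert Hlt. apply Rbar_le_not_lt, Rbar_le_refl.
Qed.

(** * Limits of trajectories in the disk *)

(** Convergence at the upper end of the domain, finite or infinite; for a
    solution, this is stronger than the property of its limit set. *)
Definition tends_hi (c : curve) (z : plane) : Prop :=
  forall eps : posreal, exists t, dom c t /\ forall s, dom c s -> t <= s -> ball z eps (c s).

Definition tends_lo (c : curve) (z : plane) : Prop :=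
  forall eps : posreal, exists t, dom c t /\ forall s, dom c s -> s <= t -> ball z eps (c s).

Lemma ball_plane (z w : plane) (eps : R) :
  ball z eps w <-> Rabs (fst w - fst z) < eps /\ Rabs (snd w - snd z) < eps.
Proof. reflexivity. Qed.

Lemma plane_eq_of_close (z w : plane) :
  (forall eps : posreal, exists u, ball z eps u /\ ball w eps u) -> z = w.
Proof.
  intros H.
  assert (E : forall a b : R, (forall eps : posreal, Rabs (a - b) <= 2 * eps) -> a = b).
  { intros a b Hab. apply Rminus_diag_uniq. apply NNPP. intro Hn.
    assert (Hp : 0 < Rabs (a - b) / 4) by (generalize (Rabs_pos_lt _ Hn); lra).
    specialize (Hab (mkposreal _ Hp)). simpl in Hab. lra. }
  destruct z as [z1 z2], w as [w1 w2]. f_equal.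
  - apply E. intros eps. destruct (H eps) as [u [U1 U2]].
    apply (proj1 (ball_plane _ _ _)) in U1. apply (proj1 (ball_plane _ _ _)) in U2.
    destruct U1, U2, u as [u1 u2]. simpl fst in *. simpl snd in *.
    replace (z1 - w1) with ((u1 - w1) - (u1 - z1)) by ring.
    eapply Rle_trans; [apply Rabs_triang|]. rewrite Rabs_Ropp. lra.
  - apply E. intros eps. destruct (H eps) as [u [U1 U2]].
    apply (proj1 (ball_plane _ _ _)) in U1. apply (proj1 (ball_plane _ _ _)) in U2.
    destruct U1, U2, u as [u1 u2]. simpl fst in *. simpl snd in *.
    replace (z2 - w2) with ((u2 - w2) - (u2 - z2)) by ring.
    eapply Rle_trans; [apply Rabs_triang|]. rewrite Rabs_Ropp. lra.
Qed.

Lemma dom_right (c : curve) (t : R) : dom c t -> exists s, t < s /\ dom c s.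
Proof.
  intros H. destruct (dom_open c t H) as [d Hd].
  exists (t + d / 2). destruct d as [d dp]; simpl in *. split; [lra|].
  apply Hd. unfold ball; simpl. unfold AbsRing_ball, abs, minus, plus, opp; simpl.
  rewrite Rabs_right; lra.
Qed.

Lemma tends_hi_omega_limit (c : curve) (z : plane) : tends_hi c z -> omega_limit c z.
Proof.
  intros H q. split.
  - intros Hq. apply plane_eq_of_close. intros eps.
    destruct (H eps) as [t [Ht Hb]]. destruct (Hq eps t Ht) as [s [Hs [Hlt Hbs]]].
    exists (c s). split; [exact Hbs|]. apply Hb; [exact Hs|lra].
  - intros -> eps t Ht. destruct (H eps) as [t1 [Ht1 Hb]].
    destruct (Rle_dec t t1) as [Hle|Hgt].
    + destruct (dom_right c t1 Ht1) as [s [Hs1 Hs]]. exists s.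
      split; [exact Hs|]. split; [lra|]. apply Hb; [exact Hs|lra].
    + destruct (dom_right c t Ht) as [s [Hs1 Hs]]. exists s.
      split; [exact Hs|]. split; [lra|]. apply Hb; [exact Hs|lra].
Qed.

Lemma omega_limit_reverse (c : curve) (z : plane) :
  omega_limit (reverse_curve c) z <-> alpha_limit c z.
Proof.
  assert (E : forall q, omega_limit_set (reverse_curve c) q <-> alpha_limit_set c q).
  { intros q. split; intros H eps t Ht.
    - destruct (H eps (- t)) as [s [Hs [Hlt Hb]]].
      + apply dom_reverse. rewrite Ropp_involutive. exact Ht.
      + exists (- s). apply dom_reverse in Hs. split; [exact Hs|]. split; [lra|exact Hb].
    - apply dom_reverse in Ht. destruct (H eps (- t) Ht) as [s [Hs [Hlt Hb]]].
      exists (- s). split; [apply dom_reverse; rewrite Ropp_involutive; exact Hs|].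
      split; [lra|]. simpl. rewrite Ropp_involutive. exact Hb. }
  split; intros H q.
  - rewrite <- E. apply H.
  - rewrite E. apply H.
Qed.

Lemma tends_hi_reverse (c : curve) (z : plane) :
  tends_hi (reverse_curve c) z <-> tends_lo c z.
Proof.
  split; intros H eps; destruct (H eps) as [t [Ht Hb]]; exists (- t).
  - apply dom_reverse in Ht. split; [exact Ht|]. intros s Hs Hle.
    specialize (Hb (- s)). simpl in Hb. rewrite Ropp_involutive in Hb. apply Hb; [|lra].
    apply dom_reverse. rewrite Ropp_involutive. exact Hs.
  - split; [apply dom_reverse; rewrite Ropp_involutive; exact Ht|].
    intros s Hs Hle. apply dom_reverse in Hs. simpl. apply Hb; [exact Hs|lra].
Qed.

Lemma tends_lo_alpha_limit (c : curve) (z : plane) : tends_lo c z -> alpha_limit c z.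
Proof.
  intros H. apply omega_limit_reverse, tends_hi_omega_limit, tends_hi_reverse, H.
Qed.

Lemma alpha_limit_unique (c : curve) (z w : plane) :
  alpha_limit c z -> alpha_limit c w -> z = w.
Proof. intros Hz Hw. apply Hw, Hz. reflexivity. Qed.

Lemma disk_root_pos (x y : R) : 0 < sqrt (1 + x ^ 2 + y ^ 2).
Proof. apply sqrt_lt_R0. generalize (pow2_ge_0 x) (pow2_ge_0 y). lra. Qed.

Lemma to_disk_norm (p : plane) :
  fst (to_disk p) ^ 2 + snd (to_disk p) ^ 2 = 1 - / (1 + fst p ^ 2 + snd p ^ 2).
Proof.
  destruct p as [x y]. cbv [to_disk fst snd].
  assert (Hp := disk_root_pos x y).
  assert (Hs : sqrt (1 + x ^ 2 + y ^ 2) ^ 2 = 1 + x ^ 2 + y ^ 2).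
  { apply pow2_sqrt. generalize (pow2_ge_0 x) (pow2_ge_0 y). lra. }
  assert (H1 : 0 < 1 + x ^ 2 + y ^ 2) by (generalize (pow2_ge_0 x) (pow2_ge_0 y); lra).
  transitivity ((x ^ 2 + y ^ 2) / sqrt (1 + x ^ 2 + y ^ 2) ^ 2); [field; lra|].
  rewrite Hs. field. lra.
Qed.

Lemma to_disk_not_at_infinity (p : plane) (theta : R) : to_disk p <> at_infinity theta.
Proof.
  intros H. generalize (to_disk_norm p). rewrite H. simpl fst; simpl snd.
  generalize (sin2_cos2 theta). unfold Rsqr. intros E1 E2.
  assert (H1 : 0 < / (1 + fst p ^ 2 + snd p ^ 2)).
  { apply Rinv_0_lt_compat. generalize (pow2_ge_0 (fst p)) (pow2_ge_0 (snd p)). lra. }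
  simpl pow in *. lra.
Qed.

Lemma to_disk_injective (p q : plane) : to_disk p = to_disk q -> p = q.
Proof.
  intros H. assert (E := to_disk_norm p). rewrite H, to_disk_norm in E.
  assert (E1 : / (1 + fst p ^ 2 + snd p ^ 2) = / (1 + fst q ^ 2 + snd q ^ 2)) by lra.
  apply Rinv_eq_reg in E1.
  destruct p as [x y], q as [x' y']. cbv [to_disk fst snd] in *.
  rewrite E1 in H. assert (Hp := disk_root_pos x' y').
  injection H. intros H2 H1. f_equal.
  - apply Rmult_eq_reg_r with (/ sqrt (1 + x' ^ 2 + y' ^ 2)); [exact H1|].
    apply Rinv_neq_0_compat. lra.
  - apply Rmult_eq_reg_r with (/ sqrt (1 + x' ^ 2 + y' ^ 2)); [exact H2|].
    apply Rinv_neq_0_compat. lra.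
Qed.

Lemma to_disk_continuous (w : plane) (eps : posreal) :
  locally w (fun u => ball (to_disk w) eps (to_disk u)).
Proof.
  assert (Hsq : forall x : R, continuous (fun z => z ^ 2) x).
  { intros x. apply is_derive_continuous with (2 * x). auto_derive; [exact I|ring]. }
  assert (G : forall u : plane -> R, continuous u w ->
    continuous (fun p : plane => u p / sqrt (1 + fst p ^ 2 + snd p ^ 2)) w).
  { intros u Hu.
    apply (continuous_mult u (fun p : plane => / sqrt (1 + fst p ^ 2 + snd p ^ 2))); [exact Hu|].
    apply (continuous_comp (fun p : plane => 1 + fst p ^ 2 + snd p ^ 2) (fun z => / sqrt z)).
    - destruct w as [w1 w2].
      apply (continuous_plus (fun p : plane => 1 + fst p ^ 2) (fun p : plane => snd p ^ 2)).
      + apply (continuous_plus (fun p : plane => 1) (fun p : plane => fst p ^ 2));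
          [apply continuous_const|].
        apply (continuous_comp (fun p : plane => fst p) (fun z => z ^ 2)); [apply continuous_fst|apply Hsq].
      + apply (continuous_comp (fun p : plane => snd p) (fun z => z ^ 2)); [apply continuous_snd|apply Hsq].
    - apply (ex_derive_continuous (V := R_NormedModule)). auto_derive.
      generalize (disk_root_pos (fst w) (snd w)) (pow2_ge_0 (fst w)) (pow2_ge_0 (snd w)). intros.
      split; [lra|]. split; [lra|exact I]. }
  assert (C1 : continuous (fun p : plane => fst p) w) by (destruct w; apply continuous_fst).
  assert (C2 : continuous (fun p : plane => snd p) w) by (destruct w; apply continuous_snd).
  assert (B1 : locally w (fun u => ball (fst (to_disk w)) eps (fst (to_disk u))))
    by exact (G _ C1 _ (locally_ball _ eps)).
  assert (B2 : locally w (fun u => ball (snd (to_disk w)) eps (snd (to_disk u))))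
    by exact (G _ C2 _ (locally_ball _ eps)).
  generalize (filter_and _ _ B1 B2).
  apply filter_imp. intros u [U1 U2]. split; assumption.
Qed.

Lemma to_disk_curve_continuous (c : curve) (t : R) :
  continuous (fun s => fst (c s)) t -> continuous (fun s => snd (c s)) t ->
  forall eps : posreal, locally t (fun s => ball (to_disk (c t)) eps (to_disk (c s))).
Proof.
  intros H1 H2 eps. destruct (to_disk_continuous (c t) eps) as [d Hd].
  assert (B1 : locally t (fun s => ball (fst (c t)) d (fst (c s)))) by exact (H1 _ (locally_ball _ d)).
  assert (B2 : locally t (fun s => ball (snd (c t)) d (snd (c s)))) by exact (H2 _ (locally_ball _ d)).
  generalize (filter_and _ _ B1 B2).
  apply filter_imp. intros s [S1 S2]. apply Hd. split; assumption.
Qed.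

Lemma solution_continuous (X : plane -> plane) (c : curve) (t : R) :
  solution X c -> dom c t ->
  continuous (fun s => fst (c s)) t /\ continuous (fun s => snd (c s)) t.
Proof.
  intros [_ H] Ht. destruct (H t Ht) as [D1 D2].
  split; eapply is_derive_continuous; eassumption.
Qed.

Lemma tends_hi_to_disk (e : curve) (w : plane) :
  tends_hi e w -> tends_hi (in_disk e) (to_disk w).
Proof.
  intros H eps. destruct (to_disk_continuous w eps) as [d Hd]. destruct (H d) as [t [Ht Hb]].
  exists t. split; [exact Ht|]. intros s Hs Hle. apply Hd. apply Hb; assumption.
Qed.

Lemma tends_lo_to_disk (e : curve) (w : plane) :
  tends_lo e w -> tends_lo (in_disk e) (to_disk w).
Proof.
  intros H. apply (proj1 (tends_hi_reverse (in_disk e) (to_disk w))).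
  apply (tends_hi_to_disk (reverse_curve e)), tends_hi_reverse, H.
Qed.

(** The possible ends of a trajectory in the closed disk: the points at
    infinity, which are not of the form [to_disk w], and the equilibria. *)
Definition terminal (X : plane -> plane) (z : plane) : Prop :=
  forall w, to_disk w = z -> equilibrium X w.

Lemma terminal_at_infinity (X : plane -> plane) (theta : R) : terminal X (at_infinity theta).
Proof. intros w H. exfalso. exact (to_disk_not_at_infinity w theta H). Qed.

Lemma terminal_equilibrium (X : plane -> plane) (p : plane) :
  equilibrium X p -> terminal X (to_disk p).
Proof. intros H w E. rewrite (to_disk_injective _ _ E). exact H. Qed.

Lemma constant_solution (X : plane -> plane) (p : plane) :
  equilibrium X p -> solution X (Curve m_infty p_infty (fun _ => p)).
Proof.
  intros H. split; [exact I|]. intros t _. simpl. rewrite H. simpl.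
  split; apply (is_derive_const (V := R_NormedModule)).
Qed.

(** If [c] went on after the end [T] of [e], then [e] would tend to the point
    [c T] of the plane, an equilibrium since [z] is terminal; by uniqueness
    [c] would rest there, also at the time [t0]. *)
Lemma terminal_limit_not_crossed (X : plane -> plane) (c e : curve) (t0 : R) (z : plane) :
  locally_lipschitz_field X -> solution X c -> solution X e ->
  dom c t0 -> dom e t0 -> c t0 = e t0 ->
  tends_hi (in_disk e) z -> terminal X z -> ~ equilibrium X (e t0) ->
  Rbar_le (hi c) (hi e).
Proof.
  intros L Hc He Dc De Heq Hz Ht Hne. apply Rbar_not_lt_le. intros Hlt.
  assert (HT : exists T : R, hi e = T).
  { destruct De as [_ D]. destruct (hi e) as [T| |]; simpl in *.
    - exists T; reflexivity.
    - destruct (hi c); simpl in Hlt; tauto.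
    - tauto. }
  destruct HT as [T HT].
  assert (HT0 : t0 < T) by (destruct De as [_ D]; rewrite HT in D; exact D).
  assert (DT : dom c T).
  { split; [|rewrite HT in Hlt; exact Hlt].
    apply Rbar_lt_trans with t0; [apply Dc|exact HT0]. }
  destruct (solution_continuous X c T Hc DT) as [C1 C2].
  assert (Hzc : to_disk (c T) = z).
  { apply plane_eq_of_close. intros eps.
    destruct (to_disk_curve_continuous c T C1 C2 eps) as [d Hd].
    destruct (Hz eps) as [t1 [Ht1 Hb]].
    assert (Ht1T : t1 < T) by (destruct Ht1 as [_ D]; simpl in D; rewrite HT in D; exact D).
    set (s := Rmax (Rmax t0 t1) (T - d / 2)).
    assert (Hs : t0 <= s /\ t1 <= s /\ T - d / 2 <= s /\ s < T).
    { unfold s. destruct d as [d dp]; simpl.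
      generalize (Rmax_l (Rmax t0 t1) (T - d / 2)) (Rmax_r (Rmax t0 t1) (T - d / 2))
        (Rmax_l t0 t1) (Rmax_r t0 t1). intros.
      repeat split; try lra. apply Rmax_lub_lt; [apply Rmax_lub_lt; lra|lra]. }
    assert (De' : dom e s).
    { split; [|rewrite HT; simpl; lra]. apply Rbar_lt_le_trans with t0; [apply De|simpl; lra]. }
    assert (Dc' : dom c s) by (apply (dom_between c t0 T); auto; lra).
    exists (to_disk (c s)). split.
    - apply Hd. unfold ball; simpl. unfold AbsRing_ball, abs, minus, plus, opp; simpl.
      destruct d as [d dp]; simpl in *. apply Rabs_def1; lra.
    - rewrite (solution_unique X c e t0 s); auto. apply Hb; [exact De'|lra]. }
  assert (Heqm := Ht _ Hzc).
  assert (E : c t0 = c T).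
  { apply (solution_unique X c (Curve m_infty p_infty (fun _ => c T)) T t0); auto.
    - apply constant_solution, Heqm.
    - split; exact I.
    - split; exact I. }
  apply Hne. rewrite <- Heq, E. exact Heqm.
Qed.

(** This transfers limits of explicit solutions to arbitrary trajectories:
    neither of the two can outlive the other. *)
Lemma trajectory_agrees_to_terminal_limit (X : plane -> plane) (c e : curve) (t0 : R) (z : plane) :
  locally_lipschitz_field X -> trajectory X c -> solution X e ->
  dom c t0 -> dom e t0 -> c t0 = e t0 ->
  tends_hi (in_disk e) z -> terminal X z -> ~ equilibrium X (e t0) ->
  hi c = hi e /\ forall t, t0 <= t -> dom c t -> dom e t /\ c t = e t.
Proof.
  intros L Hc He Dc De Heq Hz Ht Hne.
  assert (E : hi c = hi e).
  { apply Rbar_le_antisym.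
    - apply (terminal_limit_not_crossed X c e t0 z); auto. apply Hc.
    - apply (trajectory_outlasts_solution X c e t0); auto. }
  split; [exact E|]. intros t Hle Dt.
  assert (De' : dom e t).
  { split; [apply Rbar_lt_le_trans with t0; [apply De|exact Hle]|rewrite <- E; apply Dt]. }
  split; [exact De'|]. apply (solution_unique X c e t0 t); auto. apply Hc.
Qed.

Lemma tends_hi_transfer (c e : curve) (t0 : R) (z : plane) :
  dom c t0 -> dom e t0 -> hi c = hi e ->
  (forall t, t0 <= t -> dom c t -> dom e t /\ c t = e t) ->
  tends_hi e z -> tends_hi c z.
Proof.
  intros Dc De E H Hz eps. destruct (Hz eps) as [t1 [Ht1 Hb]].
  exists (Rmax t0 t1). split.
  - split.
    + apply Rbar_lt_le_trans with t0; [apply Dc|apply Rmax_l].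
    + rewrite E. unfold Rmax. destruct Rle_dec; [apply Ht1|apply De].
  - intros s Ds Hs. destruct (H s) as [De' ->]; [|exact Ds|].
    + generalize (Rmax_l t0 t1). lra.
    + apply Hb; [exact De'|]. generalize (Rmax_r t0 t1). lra.
Qed.

Lemma omega_limit_in_disk_of_solution (X : plane -> plane) (c e : curve) (t0 : R) (z : plane) :
  locally_lipschitz_field X -> trajectory X c -> solution X e ->
  dom c t0 -> dom e t0 -> c t0 = e t0 ->
  tends_hi (in_disk e) z -> terminal X z -> ~ equilibrium X (e t0) ->
  omega_limit (in_disk c) z.
Proof.
  intros L Hc He Dc De Heq Hz Ht Hne.
  destruct (trajectory_agrees_to_terminal_limit X c e t0 z) as [E H]; auto.
  apply tends_hi_omega_limit. apply (tends_hi_transfer (in_disk c) (in_disk e) t0); auto.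
  intros t Hle Dt. destruct (H t Hle Dt) as [D1 D2]. split; [exact D1|]. simpl. rewrite D2. reflexivity.
Qed.

Lemma omega_limit_of_solution (X : plane -> plane) (c e : curve) (t0 : R) (w : plane) :
  locally_lipschitz_field X -> trajectory X c -> solution X e ->
  dom c t0 -> dom e t0 -> c t0 = e t0 ->
  tends_hi e w -> equilibrium X w -> ~ equilibrium X (e t0) ->
  omega_limit c w.
Proof.
  intros L Hc He Dc De Heq Hz Ht Hne.
  destruct (trajectory_agrees_to_terminal_limit X c e t0 (to_disk w)) as [E H]; auto.
  - apply tends_hi_to_disk, Hz.
  - apply terminal_equilibrium, Ht.
  - apply tends_hi_omega_limit. apply (tends_hi_transfer c e t0); auto.
Qed.

Lemma equilibrium_reverse (X : plane -> plane) (p : plane) :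
  equilibrium (reverse_field X) p <-> equilibrium X p.
Proof.
  unfold equilibrium, reverse_field. destruct (X p) as [a b]. simpl.
  split; intros H; injection H; intros; f_equal; lra.
Qed.

Lemma alpha_limit_in_disk_of_solution (X : plane -> plane) (c e : curve) (t0 : R) (z : plane) :
  locally_lipschitz_field X -> trajectory X c -> solution X e ->
  dom c t0 -> dom e t0 -> c t0 = e t0 ->
  tends_lo (in_disk e) z -> terminal X z -> ~ equilibrium X (e t0) ->
  alpha_limit (in_disk c) z.
Proof.
  intros L Hc He Dc De Heq Hz Ht Hne.
  apply omega_limit_reverse.
  apply (omega_limit_in_disk_of_solution (reverse_field X) (reverse_curve c) (reverse_curve e) (- t0)).
  - apply locally_lipschitz_reverse, L.
  - apply trajectory_reverse, Hc.
  - apply solution_reverse, He.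
  - apply dom_reverse. rewrite Ropp_involutive. exact Dc.
  - apply dom_reverse. rewrite Ropp_involutive. exact De.
  - simpl. rewrite Ropp_involutive. exact Heq.
  - apply (tends_hi_reverse (in_disk e)), Hz.
  - intros w Hw. apply equilibrium_reverse, Ht, Hw.
  - simpl. rewrite Ropp_involutive. intros K. apply (proj1 (equilibrium_reverse _ _)) in K. exact (Hne K).
Qed.

Lemma alpha_limit_of_solution (X : plane -> plane) (c e : curve) (t0 : R) (w : plane) :
  locally_lipschitz_field X -> trajectory X c -> solution X e ->
  dom c t0 -> dom e t0 -> c t0 = e t0 ->
  tends_lo e w -> equilibrium X w -> ~ equilibrium X (e t0) ->
  alpha_limit c w.
Proof.
  intros L Hc He Dc De Heq Hz Ht Hne.
  apply omega_limit_reverse.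
  apply (omega_limit_of_solution (reverse_field X) (reverse_curve c) (reverse_curve e) (- t0)).
  - apply locally_lipschitz_reverse, L.
  - apply trajectory_reverse, Hc.
  - apply solution_reverse, He.
  - apply dom_reverse. rewrite Ropp_involutive. exact Dc.
  - apply dom_reverse. rewrite Ropp_involutive. exact De.
  - simpl. rewrite Ropp_involutive. exact Heq.
  - apply tends_hi_reverse, Hz.
  - apply equilibrium_reverse, Ht.
  - simpl. rewrite Ropp_involutive. intros K. apply (proj1 (equilibrium_reverse _ _)) in K. exact (Hne K).
Qed.

Lemma trajectory_of_terminal_limits (X : plane -> plane) (e : curve) (t0 : R) (z1 z2 : plane) :
  locally_lipschitz_field X -> solution X e -> dom e t0 -> ~ equilibrium X (e t0) ->
  tends_lo (in_disk e) z1 -> terminal X z1 ->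
  tends_hi (in_disk e) z2 -> terminal X z2 ->
  trajectory X e.
Proof.
  intros L He De Hne H1 T1 H2 T2. split; [exact He|].
  intros c' Hc' (E1 & E2 & E3).
  assert (Dc : dom c' t0).
  { split; [apply Rbar_le_lt_trans with (lo e)|apply Rbar_lt_le_trans with (hi e)]; auto; apply De. }
  split; apply Rbar_le_antisym; auto.
  - assert (K : Rbar_le (hi (reverse_curve c')) (hi (reverse_curve e))).
    { apply (terminal_limit_not_crossed (reverse_field X) _ _ (- t0) z1).
      - apply locally_lipschitz_reverse, L.
      - apply solution_reverse, Hc'.
      - apply solution_reverse, He.
      - apply dom_reverse. rewrite Ropp_involutive. exact Dc.
      - apply dom_reverse. rewrite Ropp_involutive. exact De.
      - simpl. rewrite Ropp_involutive. apply E3, De.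
      - apply (tends_hi_reverse (in_disk e)), H1.
      - intros w Hw. apply equilibrium_reverse, T1, Hw.
      - simpl. rewrite Ropp_involutive. intros K. apply (proj1 (equilibrium_reverse _ _)) in K. exact (Hne K). }
    simpl in K. rewrite Rbar_opp_le in K. exact K.
  - apply (terminal_limit_not_crossed X c' e t0 z2); auto.
Qed.

(** * Scalar autonomous equations *)

Definition between (a b : Rbar) (s : R) : Prop := Rbar_lt a s /\ Rbar_lt s b.

Lemma between_open (a b : Rbar) (s : R) : between a b s -> locally s (between a b).
Proof. intros H. exact (dom_open (Curve a b (fun _ => (0, 0))) s H). Qed.

Lemma between_convex (a b : Rbar) (x y s : R) :
  between a b x -> between a b y -> x <= s <= y -> between a b s.
Proof. intros Hx Hy. exact (dom_between (Curve a b (fun _ => (0, 0))) x y s Hx Hy). Qed.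

Lemma Rbar_lt_lo_hi_point (a b : Rbar) : Rbar_lt a b -> exists s, between a b s.
Proof.
  intros H. destruct a as [a| |], b as [b| |]; simpl in H; try tauto.
  - exists ((a + b) / 2). split; simpl; lra.
  - exists (a + 1). split; simpl; [lra|exact I].
  - exists (b - 1). split; simpl; [exact I|lra].
  - exists 0. split; exact I.
Qed.

Lemma between_room (a b : Rbar) (s : R) :
  between a b s -> exists d, 0 < d /\ forall u, Rabs (u - s) <= d -> between a b u.
Proof.
  intros H. destruct (between_open a b s H) as [d Hd].
  exists (d / 2). destruct d as [d dp]; simpl in *. split; [lra|].
  intros u Hu. apply Hd. unfold ball; simpl. unfold AbsRing_ball, abs, minus, plus, opp; simpl.
  unfold Rminus in Hu. lra.
Qed.

Lemma primitive_exists (a b : Rbar) (f : R -> R) (s0 : R) :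
  between a b s0 -> (forall s, between a b s -> continuous f s) ->
  exists T : R -> R, T s0 = 0 /\ forall s, between a b s -> is_derive T s (f s).
Proof.
  intros H0 Hf. exists (RInt f s0). split; [exact (RInt_point s0 f)|].
  intros s Hs. apply is_derive_RInt with s0; [|apply Hf, Hs].
  generalize (between_open a b s Hs). apply filter_imp. intros u Hu.
  apply (RInt_correct (V := R_CompleteNormedModule)), (ex_RInt_continuous (V := R_CompleteNormedModule)).
  intros z Hz. apply Hf.
  unfold Rmin, Rmax in Hz. destruct (Rle_dec s0 u).
  - apply (between_convex a b s0 u); auto.
  - apply (between_convex a b u s0); auto.
Qed.

Lemma intermediate_value (f : R -> R) (x y v : R) :
  x <= y -> (forall s, x <= s <= y -> continuous f s) -> f x <= v <= f y ->
  exists s, x <= s <= y /\ f s = v.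
Proof.
  intros Hxy Hc Hv.
  destruct (Req_dec (f x) v) as [E|N1]; [exists x; split; [lra|exact E]|].
  destruct (Req_dec (f y) v) as [E|N2]; [exists y; split; [lra|exact E]|].
  assert (x < y) by (destruct (Req_dec x y) as [->|]; lra).
  destruct (Ranalysis5.IVT_interv (fun s => f s - v) x y) as [z [Hz E]]; [|lra|lra|lra|].
  - intros s Hs. apply continuity_pt_filterlim.
    apply (continuous_minus f (fun _ => v)); [apply Hc, Hs|apply continuous_const].
  - exists z. split; [exact Hz|lra].
Qed.

(** A difference quotient of [phi] is the inverse of one of [T], over an
    increment that tends to [0] by continuity. *)
Lemma derivative_of_inverse (T phi : R -> R) (t d : R) :
  is_derive T (phi t) d -> 0 < d -> continuous phi t ->
  locally t (fun u => T (phi u) = u) -> is_derive phi t (/ d).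
Proof.
  intros HT Hd Hc HTphi. apply is_derive_Reals. apply is_derive_Reals in HT.
  intros eps Heps.
  set (e1 := Rmin (d / 2) (eps * d * d / 2)).
  assert (He1 : 0 < e1).
  { unfold e1. apply Rmin_pos; [lra|]. assert (0 < eps * d * d) by (repeat apply Rmult_lt_0_compat; auto). lra. }
  destruct (HT e1 He1) as [dl Hdl].
  assert (HL : locally t (fun u => ball (phi t) dl (phi u))) by exact (Hc _ (locally_ball _ dl)).
  destruct (filter_and _ _ HL HTphi) as [d2 Hd2].
  exists d2. intros k Hk Hkd.
  destruct (Hd2 (t + k)) as [B E].
  { unfold ball; simpl. unfold AbsRing_ball, abs, minus, plus, opp; simpl.
    replace (t + k + - t) with k by ring. exact Hkd. }
  assert (E0 : T (phi t) = t) by exact (locally_singleton _ _ HTphi).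
  set (j := phi (t + k) - phi t).
  assert (Hj : j <> 0).
  { unfold j. intros Hj. assert (Ep : phi (t + k) = phi t) by lra. rewrite Ep, E0 in E. lra. }
  specialize (Hdl j Hj).
  replace (phi t + j) with (phi (t + k)) in Hdl by (unfold j; ring).
  rewrite E, E0 in Hdl. replace (t + k - t) with k in Hdl by ring.
  assert (Hj2 : Rabs j < dl) by exact B. specialize (Hdl Hj2).
  fold j. set (r := k / j) in *.
  assert (Hr : d / 2 < r).
  { apply Rabs_def2 in Hdl. assert (e1 <= d / 2) by apply Rmin_l. lra. }
  replace (j / k - / d) with ((d - r) / (r * d)) by (unfold r; field; repeat split; auto; lra).
  unfold Rdiv. rewrite Rabs_mult, (Rabs_minus_sym d r), Rabs_inv, (Rabs_right (r * d)) by nra.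
  assert (Hrd : 0 < r * d) by nra.
  apply Rmult_lt_reg_r with (r * d); [exact Hrd|].
  rewrite Rmult_assoc, Rinv_l, Rmult_1_r by lra.
  apply Rlt_le_trans with e1; [exact Hdl|].
  apply Rle_trans with (eps * d * d / 2); [apply Rmin_r|].
  assert (d / 2 * d <= r * d) by nra.
  assert (eps * (d / 2 * d) <= eps * (r * d)) by (apply Rmult_le_compat_l; lra). lra.
Qed.

(** Time is the primitive of [1 / h]. It increases, and its inverse is the
    solution; it runs through the whole interval, in a time which may be finite. *)
Lemma scalar_flow (a b : Rbar) (h : R -> R) (s0 t0 : R) :
  between a b s0 -> (forall s, between a b s -> continuous h s) ->
  (forall s, between a b s -> 0 < h s) ->
  exists (l r : Rbar) (phi : R -> R),
    between l r t0 /\ phi t0 = s0 /\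
    (forall t, between l r t -> between a b (phi t) /\ is_derive phi t (h (phi t))) /\
    (forall t u, between l r t -> between l r u -> t < u -> phi t < phi u) /\
    (forall s, between a b s -> exists t, between l r t /\ phi t = s).
Proof.
  intros H0 Hc Hp.
  destruct (primitive_exists a b (fun s => / h s) s0 H0) as [T0 [T00 HT0]].
  { intros s Hs. apply (continuous_comp h Rinv); [apply Hc, Hs|].
    apply (ex_derive_continuous (V := R_NormedModule)). auto_derive.
    generalize (Hp s Hs). lra. }
  set (T := fun s => T0 s + t0).
  assert (HT : forall s, between a b s -> is_derive T s (/ h s)).
  { intros s Hs. replace (/ h s) with (/ h s + 0) by ring.
    apply is_derive_plus_R; [apply HT0, Hs|apply (is_derive_const (V := R_NormedModule))]. }
  assert (Hinc : forall x y, between a b x -> between a b y -> x < y -> T x < T y).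
  { intros x y Hx Hy Hxy. apply (increasing_of_derive T (fun s => / h s)); [exact Hxy| |].
    - intros s Hs. apply HT, (between_convex a b x y); auto.
    - intros s Hs. apply Rinv_0_lt_compat, Hp, (between_convex a b x y); auto. }
  set (E := fun t => exists s, between a b s /\ T s = t).
  destruct (Lub_Rbar_correct E) as [Ub1 Ub2]. destruct (Glb_Rbar_correct E) as [Lb1 Lb2].
  set (l := Glb_Rbar E) in *. set (r := Lub_Rbar E) in *.
  assert (Hrange : forall s, between a b s -> between l r (T s)).
  { intros s Hs. destruct (between_room a b s Hs) as [d [Hd Hroom]].
    assert (H1 : between a b (s + d)) by (apply Hroom; replace (s + d - s) with d by ring; rewrite Rabs_right; lra).
    assert (H2 : between a b (s - d)).
    { apply Hroom. replace (s - d - s) with (- d) by ring. rewrite Rabs_Ropp, Rabs_right; lra. }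
    split.
    - apply Rbar_le_lt_trans with (T (s - d)); [|apply Hinc; auto; lra].
      apply Lb1. exists (s - d). auto.
    - apply Rbar_lt_le_trans with (T (s + d)); [apply Hinc; auto; lra|].
      apply Ub1. exists (s + d). auto. }
  assert (Hsurj : forall t, between l r t -> E t).
  { intros t [Ht1 Ht2].
    assert (Hs2 : exists s, between a b s /\ t < T s).
    { apply NNPP. intros Hn. apply (Rbar_lt_not_le _ _ Ht2). apply Ub2.
      intros u [s [Hs <-]]. apply Rnot_lt_le. intros Hlt. apply Hn. exists s. auto. }
    assert (Hs1 : exists s, between a b s /\ T s < t).
    { apply NNPP. intros Hn. apply (Rbar_lt_not_le _ _ Ht1). apply Lb2.
      intros u [s [Hs <-]]. apply Rnot_lt_le. intros Hlt. apply Hn. exists s. auto. }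
    destruct Hs1 as [x [Hx Hxt]]. destruct Hs2 as [y [Hy Hyt]].
    assert (Hxy : x < y).
    { apply Rnot_le_lt. intros Hle. destruct (Req_dec x y) as [->|]; [lra|].
      assert (T y < T x) by (apply Hinc; auto; lra). lra. }
    destruct (intermediate_value T x y t) as [s [Hs Es]]; [lra| |lra|].
    - intros s Hs. eapply is_derive_continuous. apply HT, (between_convex a b x y); auto.
    - exists s. split; [apply (between_convex a b x y); auto|exact Es]. }
  set (phi := fun t => epsilon (inhabits 0) (fun s => between a b s /\ T s = t)).
  assert (Hphi : forall t, between l r t -> between a b (phi t) /\ T (phi t) = t).
  { intros t Ht. apply (epsilon_spec (inhabits 0) (fun s => between a b s /\ T s = t)), Hsurj, Ht. }
  assert (Hmono : forall t u, between l r t -> between l r u -> t < u -> phi t < phi u).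
  { intros t u Ht Hu Htu. destruct (Hphi t Ht) as [B1 E1]. destruct (Hphi u Hu) as [B2 E2].
    apply Rnot_le_lt. intros Hle. destruct (Req_dec (phi t) (phi u)) as [Eq|Ne].
    - rewrite Eq in E1. lra.
    - assert (T (phi u) < T (phi t)) by (apply Hinc; auto; lra). lra. }
  assert (HphiT : forall s, between a b s -> phi (T s) = s).
  { intros s Hs. destruct (Hphi (T s) (Hrange s Hs)) as [B1 E1].
    destruct (Rtotal_order (phi (T s)) s) as [Lt|[Eq|Gt]]; [|exact Eq|].
    - assert (T (phi (T s)) < T s) by (apply Hinc; auto). lra.
    - assert (T s < T (phi (T s))) by (apply Hinc; auto; lra). lra. }
  assert (Ht0 : T s0 = t0) by (unfold T; rewrite T00; ring).
  exists l, r, phi. split; [rewrite <- Ht0; apply Hrange, H0|].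
  split; [rewrite <- Ht0; apply HphiT, H0|].
  split; [|split; [exact Hmono|intros s Hs; exists (T s); auto]].
  intros t Ht. destruct (Hphi t Ht) as [B1 E1]. split; [exact B1|].
  rewrite <- (Rinv_inv (h (phi t))).
  apply (derivative_of_inverse T).
  - apply HT, B1.
  - apply Rinv_0_lt_compat, Hp, B1.
  - intros P [eps HP]. destruct (between_room a b (phi t) B1) as [d [Hd Hroom]].
    set (e := Rmin d (eps / 2)).
    assert (He : 0 < e /\ e <= d /\ e <= eps / 2).
    { unfold e. destruct eps as [eps ep]; simpl. split; [apply Rmin_pos; lra|].
      split; [apply Rmin_l|apply Rmin_r]. }
    assert (H1 : between a b (phi t + e)) by (apply Hroom; replace (phi t + e - phi t) with e by ring; rewrite Rabs_right; lra).
    assert (H2 : between a b (phi t - e)).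
    { apply Hroom. replace (phi t - e - phi t) with (- e) by ring. rewrite Rabs_Ropp, Rabs_right; lra. }
    assert (I1 : T (phi t - e) < t) by (rewrite <- E1 at 2; apply Hinc; auto; lra).
    assert (I2 : t < T (phi t + e)) by (rewrite <- E1 at 1; apply Hinc; auto; lra).
    change (locally t (fun u => P (phi u))).
    generalize (filter_and _ _ (open_gt _ _ I1) (open_lt _ _ I2)).
    apply filter_imp. intros u [U1 U2]. apply HP.
    assert (Hu : between l r u) by (apply (between_convex l r (T (phi t - e)) (T (phi t + e))); auto; lra).
    assert (V1 := Hmono _ _ (Hrange _ H2) Hu U1). assert (V2 := Hmono _ _ Hu (Hrange _ H1) U2).
    rewrite HphiT in V1, V2 by assumption.
    unfold ball; simpl. unfold AbsRing_ball, abs, minus, plus, opp; simpl.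
    destruct eps as [eps ep]; simpl in *. apply Rabs_def1; lra.
  - generalize (between_open l r t Ht). apply filter_imp. intros u Hu. apply Hphi, Hu.
Qed.

(** * One-sided neighbourhoods *)

Lemma at_right_iff (a : R) (P : R -> Prop) :
  at_right a P <-> exists d, 0 < d /\ forall s, a < s < a + d -> P s.
Proof.
  split.
  - intros [d Hd]. exists d. split; [apply d|]. intros s Hs. apply Hd; [|lra].
    unfold ball; simpl. unfold AbsRing_ball, abs, minus, plus, opp; simpl.
    rewrite Rabs_right; lra.
  - intros [d [Hd H]]. exists (mkposreal d Hd). intros s Hb Hs. apply H.
    unfold ball in Hb; simpl in Hb. unfold AbsRing_ball, abs, minus, plus, opp in Hb; simpl in Hb.
    apply Rabs_def2 in Hb. lra.
Qed.

Lemma at_left_iff (b : R) (P : R -> Prop) :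
  at_left b P <-> exists d, 0 < d /\ forall s, b - d < s < b -> P s.
Proof.
  split.
  - intros [d Hd]. exists d. split; [apply d|]. intros s Hs. apply Hd; [|lra].
    unfold ball; simpl. unfold AbsRing_ball, abs, minus, plus, opp; simpl.
    rewrite Rabs_left; lra.
  - intros [d [Hd H]]. exists (mkposreal d Hd). intros s Hb Hs. apply H.
    unfold ball in Hb; simpl in Hb. unfold AbsRing_ball, abs, minus, plus, opp in Hb; simpl in Hb.
    apply Rabs_def2 in Hb. lra.
Qed.

Lemma at_left_reflect (b : R) (P : R -> Prop) :
  at_right 0 (fun x => P (b - x)) -> at_left b P.
Proof.
  intros H. apply at_right_iff in H. destruct H as [d [Hd H]].
  apply at_left_iff. exists d. split; [exact Hd|]. intros s Hs.
  replace s with (b - (b - s)) by ring. apply H. lra.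
Qed.

Lemma at_right_continuous (f : R -> R) (a : R) :
  continuous f a -> filterlim f (at_right a) (locally (f a)).
Proof. intros H. eapply filterlim_filter_le_1; [apply filter_le_within|exact H]. Qed.

Lemma at_left_continuous (f : R -> R) (a : R) :
  continuous f a -> filterlim f (at_left a) (locally (f a)).
Proof. intros H. eapply filterlim_filter_le_1; [apply filter_le_within|exact H]. Qed.

(** * Regularity of the vector fields *)

Definition continuously_differentiable (h : R -> R) : Prop :=
  exists h', (forall x, is_derive h x (h' x)) /\ (forall x, continuous h' x).

Lemma continuously_differentiable_continuous (h : R -> R) (x : R) :
  continuously_differentiable h -> continuous h x.
Proof. intros [h' [H _]]. exact (is_derive_continuous _ _ _ (H x)). Qed.

Lemma continuously_differentiable_const (a : R) : continuously_differentiable (fun _ => a).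
Proof.
  exists (fun _ => 0). split; intros x; [apply (is_derive_const (V := R_NormedModule))|apply continuous_const].
Qed.

Lemma continuously_differentiable_plus (h k : R -> R) :
  continuously_differentiable h -> continuously_differentiable k ->
  continuously_differentiable (fun x => h x + k x).
Proof.
  intros [h' [H1 H2]] [k' [K1 K2]]. exists (fun x => h' x + k' x). split; intros x.
  - apply is_derive_plus_R; auto.
  - apply (continuous_plus h' k'); auto.
Qed.

Lemma continuously_differentiable_mult (h k : R -> R) :
  continuously_differentiable h -> continuously_differentiable k ->
  continuously_differentiable (fun x => h x * k x).
Proof.
  intros Ch Ck.
  assert (Hc := fun x => continuously_differentiable_continuous h x Ch).
  assert (Kc := fun x => continuously_differentiable_continuous k x Ck).
  destruct Ch as [h' [H1 H2]], Ck as [k' [K1 K2]].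
  exists (fun x => h' x * k x + h x * k' x). split; intros x.
  - apply is_derive_mult_R; auto.
  - apply (continuous_plus (fun x => h' x * k x) (fun x => h x * k' x)).
    + apply (continuous_mult h' k); auto.
    + apply (continuous_mult h k'); auto.
Qed.

Lemma continuously_differentiable_pow (h : R -> R) (i : nat) :
  continuously_differentiable h -> continuously_differentiable (fun x => h x ^ i).
Proof.
  intros H. induction i as [|i IH]; simpl.
  - apply continuously_differentiable_const.
  - apply continuously_differentiable_mult; assumption.
Qed.

Lemma continuously_differentiable_ext (h k : R -> R) :
  (forall x, h x = k x) -> continuously_differentiable h -> continuously_differentiable k.
Proof.
  intros E [h' [H1 H2]]. exists h'. split; [|exact H2].
  intros x. apply (is_derive_ext h); auto.
Qed.

Lemma continuously_differentiable_cos : continuously_differentiable cos.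
Proof.
  exists (fun x => - sin x). split; intros x.
  - auto_derive; [exact I|ring].
  - apply is_derive_continuous with (- cos x). auto_derive; [exact I|ring].
Qed.

Lemma continuously_differentiable_sin : continuously_differentiable sin.
Proof.
  exists cos. split; intros x.
  - auto_derive; [exact I|ring].
  - apply is_derive_continuous with (- sin x). auto_derive; [exact I|ring].
Qed.

Lemma continuously_differentiable_sum (t : nat -> R -> R) (n : nat) :
  (forall i, continuously_differentiable (t i)) ->
  continuously_differentiable (fun x => sum_f_R0 (fun i => t i x) n).
Proof.
  intros T. induction n as [|n IH]; simpl; [apply T|].
  apply (continuously_differentiable_plus (fun x => sum_f_R0 (fun i => t i x) n)); auto.
Qed.

Lemma continuously_differentiable_polynomial (n : nat) (Q : R -> R -> R) (u v : R -> R) :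
  homogeneous_polynomial n Q ->
  continuously_differentiable u -> continuously_differentiable v ->
  continuously_differentiable (fun x => Q (u x) (v x)).
Proof.
  intros [a Ha] Hu Hv.
  apply (continuously_differentiable_ext
           (fun x => sum_f_R0 (fun i => a i * u x ^ (n - i) * v x ^ i) n)).
  { intros x. symmetry. apply Ha. }
  assert (T : forall i, continuously_differentiable (fun x => a i * u x ^ (n - i) * v x ^ i)).
  { intros i. apply (continuously_differentiable_mult (fun x => a i * u x ^ (n - i))).
    - apply (continuously_differentiable_mult (fun _ => a i)).
      + apply continuously_differentiable_const.
      + apply continuously_differentiable_pow, Hu.
    - apply continuously_differentiable_pow, Hv. }
  apply (continuously_differentiable_sum (fun i x => a i * u x ^ (n - i) * v x ^ i)), T.
Qed.

Lemma polar_f_continuously_differentiable (n : nat) (Q1 Q2 : R -> R -> R) :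
  homogeneous_polynomial n Q1 -> homogeneous_polynomial n Q2 ->
  continuously_differentiable (polar_f Q1 Q2).
Proof.
  intros H1 H2.
  assert (C := continuously_differentiable_cos). assert (S := continuously_differentiable_sin).
  apply (continuously_differentiable_plus (fun x => cos x * Q1 (cos x) (sin x))
           (fun x => sin x * Q2 (cos x) (sin x))).
  - apply (continuously_differentiable_mult cos); [exact C|].
    apply (continuously_differentiable_polynomial n Q1 cos sin); assumption.
  - apply (continuously_differentiable_mult sin); [exact S|].
    apply (continuously_differentiable_polynomial n Q2 cos sin); assumption.
Qed.

Lemma polar_g_continuously_differentiable (n : nat) (Q1 Q2 : R -> R -> R) :
  homogeneous_polynomial n Q1 -> homogeneous_polynomial n Q2 ->
  continuously_differentiable (polar_g Q1 Q2).
Proof.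
  intros H1 H2.
  assert (C := continuously_differentiable_cos). assert (S := continuously_differentiable_sin).
  apply (continuously_differentiable_ext
           (fun x => cos x * Q2 (cos x) (sin x) + (-1) * (sin x * Q1 (cos x) (sin x)))).
  { intros x. unfold polar_g. ring. }
  apply (continuously_differentiable_plus (fun x => cos x * Q2 (cos x) (sin x))
           (fun x => (-1) * (sin x * Q1 (cos x) (sin x)))).
  - apply (continuously_differentiable_mult cos); [exact C|].
    apply (continuously_differentiable_polynomial n Q2 cos sin); assumption.
  - apply (continuously_differentiable_mult (fun _ => -1));
      [apply continuously_differentiable_const|].
    apply (continuously_differentiable_mult sin); [exact S|].
    apply (continuously_differentiable_polynomial n Q1 cos sin); assumption.
Qed.

Lemma locally_lipschitz_const (a : R) : locally_lipschitz (fun _ => a).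
Proof.
  intros M. exists 0. split; [lra|]. intros p q _ _ _ _.
  rewrite Rminus_diag, Rabs_R0. lra.
Qed.

Lemma locally_lipschitz_fst : locally_lipschitz (fun p => fst p).
Proof.
  intros M. exists 1. split; [lra|]. intros p q _ _ _ _.
  generalize (Rabs_pos (snd p - snd q)). lra.
Qed.

Lemma locally_lipschitz_snd : locally_lipschitz (fun p => snd p).
Proof.
  intros M. exists 1. split; [lra|]. intros p q _ _ _ _.
  generalize (Rabs_pos (fst p - fst q)). lra.
Qed.

Lemma locally_lipschitz_plus (h k : plane -> R) :
  locally_lipschitz h -> locally_lipschitz k -> locally_lipschitz (fun p => h p + k p).
Proof.
  intros Hh Hk M. destruct (Hh M) as [A [PA HA]]. destruct (Hk M) as [B [PB HB]].
  exists (A + B). split; [lra|]. intros p q H1 H2 H3 H4.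
  replace (h p + k p - (h q + k q)) with ((h p - h q) + (k p - k q)) by ring.
  eapply Rle_trans; [apply Rabs_triang|].
  specialize (HA p q H1 H2 H3 H4). specialize (HB p q H1 H2 H3 H4). lra.
Qed.

Lemma locally_lipschitz_bounded (h : plane -> R) (M : R) :
  locally_lipschitz h -> exists B, 0 <= B /\ forall p : plane,
    Rabs (fst p) <= M -> Rabs (snd p) <= M -> Rabs (h p) <= B.
Proof.
  intros Hh. destruct (Hh M) as [K [PK HK]].
  exists (Rabs (h (0, 0)) + K * (Rabs M + Rabs M)).
  assert (PM := Rabs_pos M). split.
  { generalize (Rabs_pos (h (0, 0))). assert (0 <= K * (Rabs M + Rabs M)) by (apply Rmult_le_pos; lra). lra. }
  intros p H1 H2.
  assert (M <= Rabs M) by apply Rle_abs.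
  assert (P1 := Rabs_pos (fst p)). assert (P2 := Rabs_pos (snd p)).
  assert (E := HK p (0, 0) H1 H2). simpl fst in E. simpl snd in E.
  rewrite Rabs_R0, !Rminus_0_r in E. specialize (E ltac:(lra) ltac:(lra)).
  replace (h p) with (h (0, 0) + (h p - h (0, 0))) by ring.
  eapply Rle_trans; [apply Rabs_triang|]. apply Rplus_le_compat_l.
  eapply Rle_trans; [exact E|]. apply Rmult_le_compat_l; lra.
Qed.

Lemma locally_lipschitz_mult (h k : plane -> R) :
  locally_lipschitz h -> locally_lipschitz k -> locally_lipschitz (fun p => h p * k p).
Proof.
  intros Hh Hk M.
  destruct (locally_lipschitz_bounded h M Hh) as [Bh [PBh HBh]].
  destruct (locally_lipschitz_bounded k M Hk) as [Bk [PBk HBk]].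
  destruct (Hh M) as [A [PA HA]]. destruct (Hk M) as [B [PB HB]].
  exists (Bh * B + Bk * A). split; [apply Rplus_le_le_0_compat; apply Rmult_le_pos; assumption|].
  intros p q H1 H2 H3 H4.
  replace (h p * k p - h q * k q) with (h p * (k p - k q) + k q * (h p - h q)) by ring.
  eapply Rle_trans; [apply Rabs_triang|]. rewrite !Rabs_mult.
  rewrite Rmult_plus_distr_r, !Rmult_assoc.
  apply Rplus_le_compat; apply Rmult_le_compat; auto using Rabs_pos.
Qed.

Lemma locally_lipschitz_pow (h : plane -> R) (i : nat) :
  locally_lipschitz h -> locally_lipschitz (fun p => h p ^ i).
Proof.
  intros H. induction i as [|i IH]; simpl.
  - apply locally_lipschitz_const.
  - apply locally_lipschitz_mult; assumption.
Qed.

Lemma locally_lipschitz_ext (h k : plane -> R) :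
  (forall p, h p = k p) -> locally_lipschitz h -> locally_lipschitz k.
Proof.
  intros E H M. destruct (H M) as [K [PK HK]]. exists K. split; [exact PK|].
  intros p q. rewrite <- !E. apply HK.
Qed.

Lemma lipschitz_of_derivative_bound (f f' : R -> R) (K a b : R) :
  (forall x, is_derive f x (f' x)) -> (forall x, Rabs (f' x) <= K) ->
  Rabs (f a - f b) <= K * Rabs (a - b).
Proof.
  intros Hd Hb. destruct (MVT_gen f b a f') as [c [_ E]].
  - intros x _. apply Hd.
  - intros x _. apply continuity_pt_filterlim. exact (is_derive_continuous _ _ _ (Hd x)).
  - rewrite E, Rabs_mult. apply Rmult_le_compat_r; [apply Rabs_pos|apply Hb].
Qed.

Lemma cos_lipschitz (a b : R) : Rabs (cos a - cos b) <= Rabs (a - b).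
Proof.
  rewrite <- (Rmult_1_l (Rabs (a - b))).
  apply (lipschitz_of_derivative_bound cos (fun x => - sin x)).
  - intros x. auto_derive; [exact I|ring].
  - intros x. apply Rabs_le. generalize (SIN_bound x). lra.
Qed.

Lemma sin_lipschitz (a b : R) : Rabs (sin a - sin b) <= Rabs (a - b).
Proof.
  rewrite <- (Rmult_1_l (Rabs (a - b))).
  apply (lipschitz_of_derivative_bound sin cos).
  - intros x. auto_derive; [exact I|ring].
  - intros x. apply Rabs_le. generalize (COS_bound x). lra.
Qed.

Lemma locally_lipschitz_cos_snd : locally_lipschitz (fun p => cos (snd p)).
Proof.
  intros M. exists 1. split; [lra|]. intros p q _ _ _ _.
  generalize (Rabs_pos (fst p - fst q)) (cos_lipschitz (snd p) (snd q)). lra.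
Qed.

Lemma locally_lipschitz_sin_snd : locally_lipschitz (fun p => sin (snd p)).
Proof.
  intros M. exists 1. split; [lra|]. intros p q _ _ _ _.
  generalize (Rabs_pos (fst p - fst q)) (sin_lipschitz (snd p) (snd q)). lra.
Qed.

Lemma locally_lipschitz_sum (t : nat -> plane -> R) (n : nat) :
  (forall i, locally_lipschitz (t i)) ->
  locally_lipschitz (fun p => sum_f_R0 (fun i => t i p) n).
Proof.
  intros T. induction n as [|n IH]; simpl; [apply T|].
  apply (locally_lipschitz_plus (fun p => sum_f_R0 (fun i => t i p) n)); auto.
Qed.

Lemma locally_lipschitz_polynomial (n : nat) (Q : R -> R -> R) (u v : plane -> R) :
  homogeneous_polynomial n Q -> locally_lipschitz u -> locally_lipschitz v ->
  locally_lipschitz (fun p => Q (u p) (v p)).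
Proof.
  intros [a Ha] Hu Hv.
  apply (locally_lipschitz_ext (fun p => sum_f_R0 (fun i => a i * u p ^ (n - i) * v p ^ i) n)).
  { intros x. symmetry. apply Ha. }
  assert (T : forall i, locally_lipschitz (fun p => a i * u p ^ (n - i) * v p ^ i)).
  { intros i. apply (locally_lipschitz_mult (fun p => a i * u p ^ (n - i))).
    - apply (locally_lipschitz_mult (fun _ => a i)).
      + apply locally_lipschitz_const.
      + apply locally_lipschitz_pow, Hu.
    - apply locally_lipschitz_pow, Hv. }
  apply (locally_lipschitz_sum (fun i p => a i * u p ^ (n - i) * v p ^ i)), T.
Qed.

Lemma system_locally_lipschitz (lambda : R) (n : nat) (Q1 Q2 : R -> R -> R) :
  homogeneous_polynomial n Q1 -> homogeneous_polynomial n Q2 ->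
  locally_lipschitz_field (system lambda Q1 Q2).
Proof.
  intros H1 H2.
  assert (F := locally_lipschitz_fst). assert (S := locally_lipschitz_snd). split.
  - apply (locally_lipschitz_plus (fun p => lambda * fst p) (fun p => Q1 (fst p) (snd p))).
    + apply (locally_lipschitz_mult (fun _ => lambda)); [apply locally_lipschitz_const|exact F].
    + apply (locally_lipschitz_polynomial n); assumption.
  - apply (locally_lipschitz_plus (fun p => lambda * snd p) (fun p => Q2 (fst p) (snd p))).
    + apply (locally_lipschitz_mult (fun _ => lambda)); [apply locally_lipschitz_const|exact S].
    + apply (locally_lipschitz_polynomial n); assumption.
Qed.

Lemma system_at_infinity_locally_lipschitz (lambda : R) (n : nat) (Q1 Q2 : R -> R -> R) :
  homogeneous_polynomial n Q1 -> homogeneous_polynomial n Q2 ->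
  locally_lipschitz_field (system_at_infinity lambda n Q1 Q2).
Proof.
  intros H1 H2.
  assert (F := locally_lipschitz_fst).
  assert (C := locally_lipschitz_cos_snd). assert (S := locally_lipschitz_sin_snd).
  assert (G1 := locally_lipschitz_polynomial n Q1 _ _ H1 C S).
  assert (G2 := locally_lipschitz_polynomial n Q2 _ _ H2 C S).
  split.
  - apply (locally_lipschitz_ext (fun w => (- lambda) * fst w ^ n +
      (-1) * (fst w * (cos (snd w) * Q1 (cos (snd w)) (sin (snd w)) +
                       sin (snd w) * Q2 (cos (snd w)) (sin (snd w)))))).
    { intros w. unfold comp1, system_at_infinity, polar_f. simpl. ring. }
    apply (locally_lipschitz_plus (fun w => (- lambda) * fst w ^ n)).
    + apply (locally_lipschitz_mult (fun _ => - lambda)); [apply locally_lipschitz_const|].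
      apply locally_lipschitz_pow, F.
    + apply (locally_lipschitz_mult (fun _ => -1)); [apply locally_lipschitz_const|].
      apply locally_lipschitz_mult; [exact F|].
      apply (locally_lipschitz_plus (fun w => cos (snd w) * Q1 (cos (snd w)) (sin (snd w))));
        apply locally_lipschitz_mult; assumption.
  - apply (locally_lipschitz_ext (fun w => cos (snd w) * Q2 (cos (snd w)) (sin (snd w)) +
      (-1) * (sin (snd w) * Q1 (cos (snd w)) (sin (snd w))))).
    { intros w. unfold comp2, system_at_infinity, polar_g. simpl. ring. }
    apply (locally_lipschitz_plus (fun w => cos (snd w) * Q2 (cos (snd w)) (sin (snd w)))).
    + apply locally_lipschitz_mult; assumption.
    + apply (locally_lipschitz_mult (fun _ => -1)); [apply locally_lipschitz_const|].
      apply locally_lipschitz_mult; assumption.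
Qed.

Lemma homogeneous_polynomial_scale (n : nat) (Q : R -> R -> R) (c x y : R) :
  homogeneous_polynomial n Q -> Q (c * x) (c * y) = c ^ n * Q x y.
Proof.
  intros [a Ha]. rewrite !Ha, scal_sum. apply sum_eq. intros i Hi.
  rewrite !Rpow_mult_distr.
  replace (c ^ n) with (c ^ (n - i) * c ^ i) by (rewrite <- pow_add; f_equal; lia).
  ring.
Qed.

(** * Log-polar coordinates on a sector *)

(** The angle [s] is counted from the direction [tm] in the direction of the
    sign [sg], so that the sectors [tm < tp] and [tp < tm] are treated at once.
    The logarithm [q] of the radius removes the singularity at the origin. *)
Definition chart (tm sg : R) (w : plane) : plane :=
  (exp (snd w) * cos (tm + sg * fst w), exp (snd w) * sin (tm + sg * fst w)).

(** The field in the coordinates of [chart], that is, the pull back of [Y] by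
    the inverse of the differential of [chart]. *)
Definition lift (tm sg : R) (Y : plane -> plane) (w : plane) : plane :=
  let th := tm + sg * fst w in
  let y := Y (chart tm sg w) in
  (sg * (exp (- snd w) * (cos th * snd y - sin th * fst y)),
   exp (- snd w) * (cos th * fst y + sin th * snd y)).

Lemma exp_opp_mult (q : R) : exp q * exp (- q) = 1.
Proof. rewrite <- exp_plus, Rplus_opp_r. apply exp_0. Qed.

Lemma cos_sin_square (x : R) : cos x * cos x + sin x * sin x = 1.
Proof. generalize (sin2_cos2 x). unfold Rsqr. lra. Qed.

Lemma chart_pushforward (tm sg : R) (Y : plane -> plane) (w : plane) :
  sg * sg = 1 ->
  let th := tm + sg * fst w in
  fst (Y (chart tm sg w)) =
    exp (snd w) * (snd (lift tm sg Y w) * cos th - sg * fst (lift tm sg Y w) * sin th) /\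
  snd (Y (chart tm sg w)) =
    exp (snd w) * (snd (lift tm sg Y w) * sin th + sg * fst (lift tm sg Y w) * cos th).
Proof.
  intros Hsg th. unfold lift. simpl. fold th.
  set (y := Y (chart tm sg w)).
  assert (E := exp_opp_mult (snd w)). assert (C := cos_sin_square th).
  set (a := exp (snd w)) in *. set (b := exp (- snd w)) in *.
  set (c := cos th) in *. set (s := sin th) in *. split.
  - transitivity ((a * b) * (c * (c * fst y + s * snd y) - (sg * sg) * s * (c * snd y - s * fst y)));
      [rewrite E, Hsg|ring].
    transitivity ((c * c + s * s) * fst y); [rewrite C|]; ring.
  - transitivity ((a * b) * (s * (c * fst y + s * snd y) + (sg * sg) * c * (c * snd y - s * fst y)));
      [rewrite E, Hsg|ring].
    transitivity ((c * c + s * s) * snd y); [rewrite C|]; ring.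
Qed.

Lemma chart_curve_solution (tm sg : R) (Y : plane -> plane) (l r : Rbar) (s q : R -> R) :
  sg * sg = 1 -> Rbar_lt l r ->
  (forall t, between l r t ->
     is_derive s t (fst (lift tm sg Y (s t, q t))) /\
     is_derive q t (snd (lift tm sg Y (s t, q t)))) ->
  solution Y (Curve l r (fun t => chart tm sg (s t, q t))).
Proof.
  intros Hsg Hlr H. split; [exact Hlr|]. intros t Ht. destruct (H t Ht) as [Ds Dq].
  destruct (chart_pushforward tm sg Y (s t, q t) Hsg) as [E1 E2].
  assert (Da : is_derive (fun u => tm + sg * s u) t (sg * fst (lift tm sg Y (s t, q t)))).
  { replace (sg * fst (lift tm sg Y (s t, q t)))
      with (0 + (0 * s t + sg * fst (lift tm sg Y (s t, q t)))) by ring.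
    apply (is_derive_plus_R (fun _ => tm)); [apply (is_derive_const (V := R_NormedModule))|].
    apply (is_derive_mult_R (fun _ => sg)); [apply (is_derive_const (V := R_NormedModule))|exact Ds]. }
  assert (De : is_derive (fun u => exp (q u)) t (exp (q t) * snd (lift tm sg Y (s t, q t)))).
  { apply is_derive_comp_R; [auto_derive; [exact I|ring]|exact Dq]. }
  change (is_derive (fun u => exp (q u) * cos (tm + sg * s u)) t (fst (Y (chart tm sg (s t, q t)))) /\
          is_derive (fun u => exp (q u) * sin (tm + sg * s u)) t (snd (Y (chart tm sg (s t, q t))))).
  rewrite E1, E2. cbv [fst snd] in *. split.
  - evar_last.
    + apply (is_derive_mult_R (fun u => exp (q u)) (fun u => cos (tm + sg * s u)));
        [exact De|].
      apply (is_derive_comp_R cos); [|exact Da]. auto_derive; [exact I|reflexivity].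
    + simpl. ring.
  - evar_last.
    + apply (is_derive_mult_R (fun u => exp (q u)) (fun u => sin (tm + sg * s u)));
        [exact De|].
      apply (is_derive_comp_R sin); [|exact Da]. auto_derive; [exact I|reflexivity].
    + simpl. ring.
Qed.

Lemma equilibrium_chart (tm sg : R) (Y : plane -> plane) (w : plane) :
  sg * sg = 1 -> equilibrium Y (chart tm sg w) <-> lift tm sg Y w = (0, 0).
Proof.
  intros Hsg. split; intros H.
  - unfold lift. rewrite H. simpl. f_equal; ring.
  - destruct (chart_pushforward tm sg Y w Hsg) as [E1 E2]. rewrite H in E1, E2. simpl in E1, E2.
    unfold equilibrium. destruct (Y (chart tm sg w)) as [a b]. simpl in E1, E2.
    rewrite E1, E2. f_equal; ring.
Qed.

Lemma exp_INR_mult (m : nat) (q : R) : exp (INR m * q) = exp q ^ m.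
Proof.
  induction m as [|m IH]; [simpl; rewrite Rmult_0_l; apply exp_0|].
  rewrite S_INR, Rmult_plus_distr_r, exp_plus, IH, Rmult_1_l. simpl. ring.
Qed.

(** By homogeneity the nonlinear terms contribute the same factor [r ^ m] to
    both components, beside functions of the angle alone. *)
Lemma lift_system (tm sg lambda : R) (m : nat) (Q1 Q2 : R -> R -> R) (w : plane) :
  homogeneous_polynomial (S m) Q1 -> homogeneous_polynomial (S m) Q2 ->
  lift tm sg (system lambda Q1 Q2) w =
    (sg * polar_g Q1 Q2 (tm + sg * fst w) * exp (INR m * snd w),
     lambda + polar_f Q1 Q2 (tm + sg * fst w) * exp (INR m * snd w)).
Proof.
  intros H1 H2. unfold lift, system, chart, polar_f, polar_g. simpl fst. simpl snd.
  set (th := tm + sg * fst w).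
  rewrite (homogeneous_polynomial_scale (S m) Q1) by assumption.
  rewrite (homogeneous_polynomial_scale (S m) Q2) by assumption.
  rewrite exp_INR_mult. simpl pow.
  assert (E := exp_opp_mult (snd w)). assert (C := cos_sin_square th).
  set (a := exp (snd w)) in *. set (b := exp (- snd w)) in *.
  set (c := cos th) in *. set (s := sin th) in *. set (A := a ^ m).
  f_equal.
  - transitivity (sg * ((a * b) * (c * Q2 c s - s * Q1 c s) * A)); [ring|rewrite E; ring].
  - transitivity ((a * b) * (lambda * (c * c + s * s) + (c * Q1 c s + s * Q2 c s) * A));
      [ring|rewrite E, C; ring].
Qed.

(** * The half-cone *)

Lemma cos_sign_mult (sg x : R) : sg = 1 \/ sg = -1 -> cos (sg * x) = cos x.
Proof.
  intros [->| ->]; [f_equal; ring|]. replace (-1 * x) with (- x) by ring. apply cos_neg.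
Qed.

Lemma sin_sign_mult (sg x : R) : sg = 1 \/ sg = -1 -> sin (sg * x) = sg * sin x.
Proof.
  intros [->| ->]; [rewrite !Rmult_1_l; reflexivity|].
  replace (-1 * x) with (- x) by ring. rewrite sin_neg. ring.
Qed.

Lemma sin_angle_difference (a b c : R) :
  c = a - b -> sin c = sin a * cos b - cos a * sin b.
Proof. intros ->. apply sin_minus. Qed.

Lemma continuous_square (x : R) : continuous (fun z => z ^ 2) x.
Proof. apply is_derive_continuous with (2 * x). auto_derive; [exact I|ring]. Qed.

Section HalfCone.

Variables tm sg L : R.
Hypothesis sign_sg : sg = 1 \/ sg = -1.
Hypothesis L_pos : 0 < L.
Hypothesis L_le_PI : L <= PI.

Definition bisector : R := tm + sg * (L / 2).

(** Coordinates along and across the bisector. As the opening is at most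
    [PI], the open half-cone lies in the half-plane where [along] is positive, on
    which the angle is a continuous function. *)
Definition along (p : plane) : R := fst p * cos bisector + snd p * sin bisector.
Definition across (p : plane) : R := sg * (snd p * cos bisector - fst p * sin bisector).

Definition sector_angle (p : plane) : R := L / 2 + atan (across p / along p).
Definition log_radius (p : plane) : R := ln (fst p ^ 2 + snd p ^ 2) / 2.

Lemma sign_square : sg * sg = 1.
Proof. destruct sign_sg as [->| ->]; ring. Qed.

Lemma along_chart (w : plane) : along (chart tm sg w) = exp (snd w) * cos (fst w - L / 2).
Proof.
  unfold along, chart. simpl fst. simpl snd.
  rewrite <- (cos_sign_mult sg (fst w - L / 2) sign_sg).
  replace (sg * (fst w - L / 2)) with ((tm + sg * fst w) - bisector) by (unfold bisector; ring).
  rewrite cos_minus. ring.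
Qed.

Lemma across_chart (w : plane) : across (chart tm sg w) = exp (snd w) * sin (fst w - L / 2).
Proof.
  unfold across, chart. simpl fst. simpl snd.
  transitivity (exp (snd w) * (sg * sin (sg * (fst w - L / 2)))).
  - replace (sg * (fst w - L / 2)) with ((tm + sg * fst w) - bisector) by (unfold bisector; ring).
    rewrite sin_minus. ring.
  - rewrite sin_sign_mult by assumption. rewrite <- (Rmult_assoc sg), sign_square. ring.
Qed.

Lemma along_chart_pos (w : plane) : 0 < fst w < L -> 0 < along (chart tm sg w).
Proof.
  intros H. rewrite along_chart. apply Rmult_lt_0_compat; [apply exp_pos|].
  apply cos_gt_0; lra.
Qed.

Lemma sector_angle_chart (w : plane) : 0 < fst w < L -> sector_angle (chart tm sg w) = fst w.
Proof.
  intros H. unfold sector_angle. rewrite along_chart, across_chart.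
  assert (0 < cos (fst w - L / 2)) by (apply cos_gt_0; lra).
  assert (0 < exp (snd w)) by apply exp_pos.
  replace (exp (snd w) * sin (fst w - L / 2) / (exp (snd w) * cos (fst w - L / 2)))
    with (tan (fst w - L / 2)) by (unfold tan; field; lra).
  rewrite atan_tan; lra.
Qed.

Lemma chart_square (w : plane) :
  fst (chart tm sg w) ^ 2 + snd (chart tm sg w) ^ 2 = exp (snd w) * exp (snd w).
Proof.
  unfold chart. cbv [fst snd].
  generalize (cos_sin_square (tm + sg * (let (x, _) := w in x))). intros E.
  transitivity (exp (let (_, y) := w in y) * exp (let (_, y) := w in y) *
    (cos (tm + sg * (let (x, _) := w in x)) * cos (tm + sg * (let (x, _) := w in x)) +
     sin (tm + sg * (let (x, _) := w in x)) * sin (tm + sg * (let (x, _) := w in x)))); [ring|].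
  rewrite E. ring.
Qed.

Lemma log_radius_chart (w : plane) : log_radius (chart tm sg w) = snd w.
Proof.
  unfold log_radius. rewrite chart_square, <- exp_plus, ln_exp. field.
Qed.

Lemma along_across_square (p : plane) :
  along p ^ 2 + across p ^ 2 = fst p ^ 2 + snd p ^ 2.
Proof.
  unfold along, across. assert (C := cos_sin_square bisector). assert (E := sign_square).
  set (c := cos bisector) in *. set (s := sin bisector) in *.
  transitivity ((fst p * c + snd p * s) ^ 2 + (sg * sg) * (snd p * c - fst p * s) ^ 2); [ring|].
  rewrite E. transitivity ((c * c + s * s) * (fst p ^ 2 + snd p ^ 2)); [ring|rewrite C; ring].
Qed.

Lemma chart_sector_coordinates (p : plane) :
  0 < along p -> chart tm sg (sector_angle p, log_radius p) = p.
Proof.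
  intros Ha. set (rho := sqrt (fst p ^ 2 + snd p ^ 2)).
  assert (Hsq : 0 < fst p ^ 2 + snd p ^ 2).
  { rewrite <- along_across_square. generalize (pow2_ge_0 (across p)). nra. }
  assert (Hrho : 0 < rho) by (apply sqrt_lt_R0, Hsq).
  assert (Hrr : rho * rho = fst p ^ 2 + snd p ^ 2) by (apply sqrt_sqrt; lra).
  assert (Hexp : exp (log_radius p) = rho).
  { unfold log_radius. rewrite <- (exp_ln rho Hrho). f_equal.
    rewrite <- Hrr, ln_mult by assumption. field. }
  assert (Hroot : sqrt (1 + (across p / along p)²) = rho / along p).
  { apply Rsqr_inj; [apply sqrt_pos|apply Rlt_le, Rdiv_lt_0_compat; assumption|].
    rewrite Rsqr_sqrt by (generalize (Rle_0_sqr (across p / along p)); lra).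
    unfold Rsqr. transitivity ((along p ^ 2 + across p ^ 2) / (along p * along p)); [field; lra|].
    rewrite along_across_square, <- Hrr. field. lra. }
  assert (Hc : rho * cos (atan (across p / along p)) = along p).
  { rewrite cos_atan, Hroot. field. lra. }
  assert (Hs : rho * sin (atan (across p / along p)) = across p).
  { rewrite sin_atan, Hroot. field. lra. }
  unfold chart. cbv [fst snd]. fold (fst p) (snd p). rewrite Hexp. unfold sector_angle.
  replace (tm + sg * (L / 2 + atan (across p / along p)))
    with (bisector + sg * atan (across p / along p)) by (unfold bisector; ring).
  rewrite cos_plus, sin_plus, cos_sign_mult, sin_sign_mult by assumption.
  set (a := atan (across p / along p)) in *.
  assert (C := cos_sin_square bisector). assert (E := sign_square).
  apply injective_projections; simpl.
  - transitivity (cos bisector * (rho * cos a) - sin bisector * sg * (rho * sin a)); [ring|].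
    rewrite Hc, Hs. unfold along, across.
    set (c := cos bisector) in *. set (s := sin bisector) in *.
    transitivity (fst p * (c * c + (sg * sg) * (s * s)) + snd p * (c * s) * (1 - sg * sg)); [ring|].
    rewrite E. transitivity (fst p * (c * c + s * s)); [ring|rewrite C; ring].
  - transitivity (sin bisector * (rho * cos a) + cos bisector * sg * (rho * sin a)); [ring|].
    rewrite Hc, Hs. unfold along, across.
    set (c := cos bisector) in *. set (s := sin bisector) in *.
    transitivity (snd p * (s * s + (sg * sg) * (c * c)) + fst p * (c * s) * (1 - sg * sg)); [ring|].
    rewrite E. transitivity (snd p * (c * c + s * s)); [ring|rewrite C; ring].
Qed.

Lemma continuous_linear_form (a b : R) (p : plane) :
  continuous (fun p : plane => fst p * a + snd p * b) p.
Proof.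
  destruct p as [x y].
  apply (continuous_plus (fun p : plane => fst p * a) (fun p : plane => snd p * b)).
  - apply (continuous_mult (fun p : plane => fst p) (fun _ => a)); [apply continuous_fst|apply continuous_const].
  - apply (continuous_mult (fun p : plane => snd p) (fun _ => b)); [apply continuous_snd|apply continuous_const].
Qed.

Lemma continuous_along (p : plane) : continuous along p.
Proof. apply continuous_linear_form. Qed.

Lemma continuous_across (p : plane) : continuous across p.
Proof.
  apply (continuous_ext (fun p : plane => fst p * (sg * - sin bisector) + snd p * (sg * cos bisector))).
  - intros q. change (fst q * (sg * - sin bisector) + snd q * (sg * cos bisector) =
      sg * (snd q * cos bisector - fst q * sin bisector)). ring.
  - apply continuous_linear_form.
Qed.

Lemma continuous_sector_angle (p : plane) : 0 < along p -> continuous sector_angle p.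
Proof.
  intros H. apply (continuous_plus (fun _ => L / 2) (fun p => atan (across p / along p)));
    [apply continuous_const|].
  apply (continuous_comp (fun p => across p / along p) atan).
  - apply (continuous_mult across (fun p => / along p)); [apply continuous_across|].
    apply (continuous_comp along Rinv); [apply continuous_along|].
    apply (ex_derive_continuous (V := R_NormedModule)). auto_derive. lra.
  - apply (ex_derive_continuous (V := R_NormedModule)). auto_derive. exact I.
Qed.

Lemma continuous_log_radius (p : plane) : 0 < along p -> continuous log_radius p.
Proof.
  intros H.
  assert (Hsq : 0 < fst p ^ 2 + snd p ^ 2).
  { rewrite <- along_across_square. generalize (pow2_ge_0 (across p)). nra. }
  apply (continuous_comp (fun p : plane => fst p ^ 2 + snd p ^ 2) (fun z => ln z / 2)).
  - destruct p as [x y].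
    apply (continuous_plus (fun p : plane => fst p ^ 2) (fun p : plane => snd p ^ 2)).
    + apply (continuous_comp (fun p : plane => fst p) (fun z => z ^ 2)); [apply continuous_fst|].
      apply continuous_square.
    + apply (continuous_comp (fun p : plane => snd p) (fun z => z ^ 2)); [apply continuous_snd|].
      apply continuous_square.
  - apply (ex_derive_continuous (V := R_NormedModule)). auto_derive. exact Hsq.
Qed.

Lemma half_cone_sector (p : plane) :
  half_cone tm (tm + sg * L) p <->
  exists r s, 0 <= r /\ 0 <= s <= L /\
    p = (r * cos (tm + sg * s), r * sin (tm + sg * s)).
Proof.
  assert (HM : Rmin tm (tm + sg * L) = tm + (sg - 1) / 2 * L /\
               Rmax tm (tm + sg * L) = tm + (sg + 1) / 2 * L).
  { destruct sign_sg as [->| ->]; split; unfold Rmin, Rmax; destruct Rle_dec; lra. }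
  destruct HM as [Hm HM]. unfold half_cone. rewrite Hm, HM. split.
  - intros (r & th & Hr & Hth & ->). exists r, (sg * (th - tm)). split; [exact Hr|].
    split; [destruct sign_sg as [E|E]; rewrite E in *; lra|].
    rewrite <- Rmult_assoc, sign_square, Rmult_1_l.
    replace (tm + (th - tm)) with th by ring. reflexivity.
  - intros (r & s & Hr & Hs & ->). exists r, (tm + sg * s). split; [exact Hr|].
    split; [destruct sign_sg as [E|E]; rewrite E in *; lra|reflexivity].
Qed.

(** The interior is given by strict inequalities for the angle. A point of the
    interior is on neither of the two bounding rays nor at the origin, since the
    linear forms that vanish on the rays are positive there. *)
Lemma half_cone_interior_sector (p : plane) :
  half_cone_interior tm (tm + sg * L) p <->
  0 < along p /\ 0 < sector_angle p < L.
Proof.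
  split.
  - intros Hint.
    (* The linear forms vanishing on the two bounding rays are nonnegative on
       the half-cone, hence positive in its interior. *)
    assert (Hform : forall a b : R, (a <> 0 \/ b <> 0) ->
      (forall q, half_cone tm (tm + sg * L) q -> 0 <= a * fst q + b * snd q) ->
      0 < a * fst p + b * snd p).
    { intros a b Hab Hpos.
      destruct Hint as [d Hd].
      set (e := d / (2 * (1 + Rabs a + Rabs b))).
      assert (Pa := Rabs_pos a). assert (Pb := Rabs_pos b).
      assert (He : 0 < e).
      { unfold e. apply Rdiv_lt_0_compat; [apply d|lra]. }
      assert (Heab : e * (1 + Rabs a + Rabs b) = d / 2).
      { unfold e. field. lra. }
      assert (Hq : half_cone tm (tm + sg * L) (fst p - e * a, snd p - e * b)).
      { apply Hd. apply (proj2 (ball_plane _ _ _)). simpl.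
        assert (Hdp : 0 < d) by apply d.
        replace (fst p - e * a - fst p) with (- (e * a)) by ring.
        replace (snd p - e * b - snd p) with (- (e * b)) by ring.
        rewrite !Rabs_Ropp, !Rabs_mult, (Rabs_right e) by lra.
        assert (0 <= e * Rabs a) by (apply Rmult_le_pos; lra).
        assert (0 <= e * Rabs b) by (apply Rmult_le_pos; lra). split; lra. }
      specialize (Hpos _ Hq). simpl in Hpos.
      assert (0 < a * a + b * b) by (destruct Hab; nra).
      assert (0 < e * (a * a + b * b)) by (apply Rmult_lt_0_compat; assumption). nra. }
    assert (Hself : half_cone tm (tm + sg * L) p) by exact (locally_singleton _ _ Hint).
    apply half_cone_sector in Hself. destruct Hself as (r & s & Hr & Hs & Hp).
    assert (Hray : forall x, cos x <> 0 \/ sin x <> 0).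
    { intros x. generalize (cos_sin_square x). intros E.
      destruct (Req_dec (cos x) 0) as [Z|Z]; [right|left; exact Z].
      intros Z'. rewrite Z, Z' in E. lra. }
    assert (Hsg : sg <> 0) by (destruct sign_sg; lra).
    assert (A1 : 0 < (- sg * sin tm) * fst p + (sg * cos tm) * snd p).
    { apply Hform.
      - destruct (Hray tm) as [Z|Z]; [right|left]; apply Rmult_integral_contrapositive; split; auto; lra.
      - intros q Hq. apply half_cone_sector in Hq. destruct Hq as (r' & s' & Hr' & Hs' & ->).
        simpl. replace (- sg * sin tm * (r' * cos (tm + sg * s')) + sg * cos tm * (r' * sin (tm + sg * s')))
          with (r' * (sg * sin (sg * s'))).
        2:{ rewrite (sin_angle_difference (tm + sg * s') tm (sg * s')) by ring. ring. }
        rewrite sin_sign_mult, <- (Rmult_assoc sg), sign_square by assumption.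
        apply Rmult_le_pos; [lra|]. rewrite Rmult_1_l. apply sin_ge_0; lra. }
    assert (A2 : 0 < (sg * sin (tm + sg * L)) * fst p + (- sg * cos (tm + sg * L)) * snd p).
    { apply Hform.
      - destruct (Hray (tm + sg * L)) as [Z|Z]; [right|left];
          apply Rmult_integral_contrapositive; split; auto; lra.
      - intros q Hq. apply half_cone_sector in Hq. destruct Hq as (r' & s' & Hr' & Hs' & ->).
        simpl. replace (sg * sin (tm + sg * L) * (r' * cos (tm + sg * s')) +
          - sg * cos (tm + sg * L) * (r' * sin (tm + sg * s')))
          with (r' * (sg * sin (sg * (L - s')))).
        2:{ rewrite (sin_angle_difference (tm + sg * L) (tm + sg * s') (sg * (L - s'))) by ring. ring. }
        rewrite sin_sign_mult, <- (Rmult_assoc sg), sign_square by assumption.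
        apply Rmult_le_pos; [lra|]. rewrite Rmult_1_l. apply sin_ge_0; lra. }
    assert (B1 : (- sg * sin tm) * fst p + (sg * cos tm) * snd p = r * sin s).
    { rewrite Hp. simpl. transitivity (r * (sg * sin (sg * s))).
      - rewrite (sin_angle_difference (tm + sg * s) tm (sg * s)) by ring. ring.
      - rewrite sin_sign_mult, <- (Rmult_assoc sg), sign_square by assumption. ring. }
    assert (B2 : (sg * sin (tm + sg * L)) * fst p + (- sg * cos (tm + sg * L)) * snd p = r * sin (L - s)).
    { rewrite Hp. simpl. transitivity (r * (sg * sin (sg * (L - s)))).
      - rewrite (sin_angle_difference (tm + sg * L) (tm + sg * s) (sg * (L - s))) by ring. ring.
      - rewrite sin_sign_mult, <- (Rmult_assoc sg), sign_square by assumption. ring. }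
    rewrite B1 in A1. rewrite B2 in A2.
    assert (Hr0 : 0 < r) by (destruct (Req_dec r 0) as [Z|]; [rewrite Z in A1; lra|lra]).
    assert (Hs0 : s <> 0) by (intros Z; rewrite Z, sin_0 in A1; lra).
    assert (HsL : s <> L) by (intros Z; rewrite Z, Rminus_diag, sin_0 in A2; lra).
    assert (Hc : p = chart tm sg (s, ln r)).
    { rewrite Hp. unfold chart. simpl. rewrite exp_ln by assumption. reflexivity. }
    rewrite Hc, sector_angle_chart by (simpl; lra).
    split; [apply along_chart_pos; simpl; lra|simpl; lra].
  - intros [Ha Hs].
    assert (L1 : locally p (fun q => 0 < along q))
      by exact (continuous_along p _ (open_gt 0 (along p) Ha)).
    assert (Cs := continuous_sector_angle p Ha).
    assert (L2 : locally p (fun q => 0 < sector_angle q))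
      by exact (Cs _ (open_gt 0 (sector_angle p) (proj1 Hs))).
    assert (L3 : locally p (fun q => sector_angle q < L))
      by exact (Cs _ (open_lt L (sector_angle p) (proj2 Hs))).
    unfold half_cone_interior. generalize (filter_and _ _ L1 (filter_and _ _ L2 L3)).
    apply filter_imp. intros q (Q1 & Q2 & Q3).
    apply half_cone_sector. exists (exp (log_radius q)), (sector_angle q).
    split; [left; apply exp_pos|]. split; [lra|].
    exact (eq_sym (chart_sector_coordinates q Q1)).
Qed.

Lemma half_cone_interior_chart (p : plane) :
  half_cone_interior tm (tm + sg * L) p <-> exists w, 0 < fst w < L /\ p = chart tm sg w.
Proof.
  rewrite half_cone_interior_sector. split.
  - intros [Ha Hs]. exists (sector_angle p, log_radius p). split; [exact Hs|].
    symmetry. apply chart_sector_coordinates, Ha.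
  - intros (w & Hw & ->). rewrite sector_angle_chart by exact Hw.
    split; [apply along_chart_pos, Hw|exact Hw].
Qed.

End HalfCone.

Lemma half_cone_interior_comm (ta tb : R) (p : plane) :
  half_cone_interior ta tb p <-> half_cone_interior tb ta p.
Proof.
  unfold half_cone_interior, half_cone.
  split; apply filter_imp; intros q Hq; rewrite (Rmin_comm _ _), (Rmax_comm _ _); exact Hq.
Qed.

Lemma half_cone_interior_open (ta tb : R) : open (half_cone_interior ta tb).
Proof. intros p Hp. apply locally_locally, Hp. Qed.

(** * The first integral near the ends of the sector *)

(** Since [p / G >= c / (gam * s)] near [0], the function [ln u] grows at
    least like [- (c / gam) * ln s]. *)
Lemma blow_up_at_simple_zero (u p G : R -> R) (d c gam : R) :
  0 < d -> 0 < c -> 0 < gam ->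
  (forall s, 0 < s <= d -> 0 < u s /\ is_derive u s (- (p s / G s) * u s) /\
     c <= p s /\ 0 < G s <= gam * s) ->
  forall A, at_right 0 (fun s => A <= u s).
Proof.
  intros Hd Hc Hg H A.
  set (k := c / gam).
  assert (Hk : 0 < k) by (apply Rdiv_lt_0_compat; assumption).
  set (z := fun s => ln (u s) + k * ln s).
  assert (Hz : forall s, 0 < s <= d -> z d <= z s).
  { intros s Hs.
    apply (nonincreasing_of_derive z (fun x => - (p x / G x) + k * / x) s d); [lra| |].
    - intros x Hx. destruct (H x) as (U1 & U2 & U3 & U4); [lra|].
      unfold z. apply (is_derive_plus_R (fun s => ln (u s)) (fun s => k * ln s)).
      + replace (- (p x / G x)) with (/ u x * (- (p x / G x) * u x)) by (field; lra).
        apply (is_derive_comp_R ln u); [apply is_derive_ln; exact U1|exact U2].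
      + auto_derive; [lra|ring].
    - intros x Hx. destruct (H x) as (U1 & U2 & U3 & U4); [lra|].
      assert (E : k * / x <= p x / G x); [|lra].
      apply Rmult_le_reg_r with (G x * x); [apply Rmult_lt_0_compat; lra|].
      replace (k * / x * (G x * x)) with (k * G x) by (field; lra).
      replace (p x / G x * (G x * x)) with (p x * x) by (field; lra).
      apply Rle_trans with (k * (gam * x)); [apply Rmult_le_compat_l; lra|].
      replace (k * (gam * x)) with (c * x) by (unfold k; field; lra).
      apply Rmult_le_compat_r; lra. }
  set (B := Rmax A 1).
  assert (HB : 1 <= B /\ A <= B) by (unfold B; split; [apply Rmax_r|apply Rmax_l]).
  set (d1 := exp ((z d - ln B) / k)).
  assert (Hd1 : 0 < d1) by apply exp_pos.
  apply at_right_iff. exists (Rmin d d1). split; [apply Rmin_pos; assumption|].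
  intros s Hs. rewrite Rplus_0_l in Hs.
  assert (Hsd : s < d) by (eapply Rlt_le_trans; [apply Hs|apply Rmin_l]).
  assert (Hsd1 : s < d1) by (eapply Rlt_le_trans; [apply Hs|apply Rmin_r]).
  specialize (Hz s ltac:(lra)). destruct (H s) as (U1 & _); [lra|].
  assert (Hln : ln s <= (z d - ln B) / k).
  { rewrite <- (ln_exp ((z d - ln B) / k)). left. apply ln_increasing; [lra|exact Hsd1]. }
  assert (HlnB : ln B <= ln (u s)).
  { assert (k * ln s <= z d - ln B).
    { apply Rmult_le_compat_l with (r := k) in Hln; [|lra].
      replace (k * ((z d - ln B) / k)) with (z d - ln B) in Hln by (field; lra). exact Hln. }
    unfold z in *. lra. }
  apply Rle_trans with B; [lra|]. apply Rnot_lt_le. intros Hlt.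
  assert (ln (u s) < ln B) by (apply ln_increasing; lra). lra.
Qed.

Lemma linear_bound_right (G G' : R -> R) :
  is_derive G 0 (G' 0) -> G 0 = 0 ->
  exists gam, 0 < gam /\ at_right 0 (fun s => G s <= gam * s).
Proof.
  intros HG G0. apply is_derive_Reals in HG.
  destruct (HG 1 Rlt_0_1) as [d Hd].
  exists (Rabs (G' 0) + 1). split; [generalize (Rabs_pos (G' 0)); lra|].
  apply at_right_iff. exists d. split; [apply d|]. intros s Hs.
  specialize (Hd s ltac:(lra) ltac:(rewrite Rabs_right; lra)).
  rewrite Rplus_0_l, G0, Rminus_0_r in Hd. apply Rabs_def2 in Hd.
  assert (Hq : G s / s <= Rabs (G' 0) + 1) by (generalize (Rle_abs (G' 0)); lra).
  replace (G s) with (G s / s * s) by (field; lra). apply Rmult_le_compat_r; lra.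
Qed.

Lemma neg_quotient_pos (a f : R) : 0 < a -> f < 0 -> 0 < - (a / f).
Proof.
  intros Ha Hf. unfold Rdiv. rewrite <- Ropp_mult_distr_r_reverse, <- Rinv_opp.
  apply Rmult_lt_0_compat; [exact Ha|apply Rinv_0_lt_compat; lra].
Qed.

Section FirstIntegral.

Variables m lam L : R.
Variables F G G' H K : R -> R.
Hypothesis m_pos : 0 < m.
Hypothesis lam_pos : 0 < lam.
Hypothesis L_pos : 0 < L.
Hypothesis F_continuous : forall s, continuous F s.
Hypothesis G_derive : forall s, is_derive G s (G' s).
Hypothesis G_0 : G 0 = 0.
Hypothesis G_L : G L = 0.
Hypothesis G_pos : forall s, 0 < s < L -> 0 < G s.
Hypothesis H_pos : forall s, 0 < s < L -> 0 < H s.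
Hypothesis H_derive : forall s, 0 < s < L -> is_derive H s (- (m * F s / G s) * H s).
Hypothesis K_derive : forall s, 0 < s < L -> is_derive K s (m * lam * H s / G s).

Lemma at_right_0_interior : at_right 0 (fun s => 0 < s < L).
Proof. apply at_right_iff. exists L. split; [exact L_pos|]. intros s Hs. lra. Qed.

Lemma at_left_L_interior : at_left L (fun s => 0 < s < L).
Proof. apply at_left_iff. exists L. split; [exact L_pos|]. intros s Hs. lra. Qed.

Lemma inv_H_derive (s : R) :
  0 < s < L -> is_derive (fun x => / H x) s (- (- (m * F s) / G s) * / H s).
Proof.
  intros Hs. assert (P := H_pos s Hs). assert (PG := G_pos s Hs).
  replace (- (- (m * F s) / G s) * / H s) with (- (- (m * F s / G s) * H s) / H s ^ 2) by (field; lra).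
  apply (is_derive_inv H); [apply H_derive, Hs|lra].
Qed.

Lemma F_near_right (P : R -> Prop) : locally (F 0) P -> at_right 0 (fun s => P (F s)).
Proof. intros HP. exact (at_right_continuous F 0 (F_continuous 0) P HP). Qed.

Lemma F_near_left (P : R -> Prop) : locally (F L) P -> at_left L (fun s => P (F s)).
Proof. intros HP. exact (at_left_continuous F L (F_continuous L) P HP). Qed.

Lemma H_unbounded_at_0 : 0 < F 0 -> forall A, at_right 0 (fun s => A <= H s).
Proof.
  intros HF.
  assert (N1 : at_right 0 (fun s => F 0 / 2 <= F s)).
  { apply (F_near_right (fun y => F 0 / 2 <= y)).
    assert (Hl : F 0 / 2 < F 0) by lra. generalize (open_gt _ _ Hl).
    apply filter_imp. intros y Hy. lra. }
  destruct (linear_bound_right G G') as [gam [Hgam N2]]; auto.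
  generalize (filter_and _ _ N1 (filter_and _ _ N2 at_right_0_interior)). intros N.
  apply at_right_iff in N. destruct N as [d [Hd N]].
  apply (blow_up_at_simple_zero H (fun s => m * F s) G (d / 2) (m * (F 0 / 2)) gam).
  - lra.
  - apply Rmult_lt_0_compat; lra.
  - exact Hgam.
  - intros s Hs. destruct (N s) as (A1 & A2 & A3); [lra|].
    split; [apply H_pos, A3|]. split; [apply H_derive, A3|].
    split; [apply Rmult_le_compat_l; lra|]. split; [apply G_pos, A3|exact A2].
Qed.

Lemma H_vanishes_at_0 : F 0 < 0 -> forall A, at_right 0 (fun s => A <= / H s).
Proof.
  intros HF.
  assert (N1 : at_right 0 (fun s => F s <= F 0 / 2)).
  { apply (F_near_right (fun y => y <= F 0 / 2)).
    assert (Hl : F 0 < F 0 / 2) by lra. generalize (open_lt _ _ Hl).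
    apply filter_imp. intros y Hy. lra. }
  destruct (linear_bound_right G G') as [gam [Hgam N2]]; auto.
  generalize (filter_and _ _ N1 (filter_and _ _ N2 at_right_0_interior)). intros N.
  apply at_right_iff in N. destruct N as [d [Hd N]].
  apply (blow_up_at_simple_zero (fun s => / H s) (fun s => - (m * F s)) G (d / 2) (m * - (F 0 / 2)) gam).
  - lra.
  - apply Rmult_lt_0_compat; lra.
  - exact Hgam.
  - intros s Hs. destruct (N s) as (A1 & A2 & A3); [lra|].
    split; [apply Rinv_0_lt_compat, H_pos, A3|]. split; [apply inv_H_derive, A3|].
    split; [|split; [apply G_pos, A3|exact A2]].
    rewrite Ropp_mult_distr_r. apply Rmult_le_compat_l; lra.
Qed.

Lemma is_derive_reflect (u : R -> R) (b s a : R) :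
  is_derive u (b - s) a -> is_derive (fun x => u (b - x)) s (- a).
Proof.
  intros Hu. replace (- a) with (a * (0 - 1)) by ring.
  apply (is_derive_comp_R u (fun x => b - x)); [exact Hu|].
  apply (is_derive_minus_R (fun _ => b) (fun x => x)).
  - apply (is_derive_const (V := R_NormedModule)).
  - apply (is_derive_id (K := R_AbsRing)).
Qed.

Lemma G_reflect_bound : exists gam, 0 < gam /\ at_right 0 (fun x => G (L - x) <= gam * x).
Proof.
  apply (linear_bound_right (fun x => G (L - x)) (fun _ => - G' L)).
  - apply is_derive_reflect. rewrite Rminus_0_r. apply G_derive.
  - rewrite Rminus_0_r. exact G_L.
Qed.

Lemma H_unbounded_at_L : F L < 0 -> forall A, at_left L (fun s => A <= H s).
Proof.
  intros HF A.
  assert (N1 : at_left L (fun s => F s <= F L / 2)).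
  { apply (F_near_left (fun y => y <= F L / 2)).
    assert (Hl : F L < F L / 2) by lra. generalize (open_lt _ _ Hl).
    apply filter_imp. intros y Hy. lra. }
  destruct G_reflect_bound as [gam [Hgam N2]].
  generalize (filter_and _ _ N1 at_left_L_interior). intros N.
  apply at_left_iff in N. destruct N as [d [Hd N]].
  apply at_right_iff in N2. destruct N2 as [d2 [Hd2 N2]].
  apply at_left_reflect. revert A.
  assert (Hmin : 0 < Rmin d d2) by (apply Rmin_pos; assumption).
  assert (Hl := Rmin_l d d2). assert (Hr := Rmin_r d d2).
  apply (blow_up_at_simple_zero (fun x => H (L - x)) (fun x => - (m * F (L - x)))
           (fun x => G (L - x)) (Rmin d d2 / 2) (m * - (F L / 2)) gam); [lra|apply Rmult_lt_0_compat; lra|exact Hgam|].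
  intros s Hs. destruct (N (L - s)) as (A1 & A3); [lra|].
  split; [apply H_pos, A3|]. split.
  - replace (- (- (m * F (L - s)) / G (L - s)) * H (L - s))
      with (- (- (m * F (L - s) / G (L - s)) * H (L - s))) by (unfold Rdiv; ring).
    apply is_derive_reflect, H_derive, A3.
  - split; [rewrite Ropp_mult_distr_r; apply Rmult_le_compat_l; lra|].
    split; [apply G_pos, A3|apply N2; lra].
Qed.

Lemma H_vanishes_at_L : 0 < F L -> forall A, at_left L (fun s => A <= / H s).
Proof.
  intros HF A.
  assert (N1 : at_left L (fun s => F L / 2 <= F s)).
  { apply (F_near_left (fun y => F L / 2 <= y)).
    assert (Hl : F L / 2 < F L) by lra. generalize (open_gt _ _ Hl).
    apply filter_imp. intros y Hy. lra. }
  destruct G_reflect_bound as [gam [Hgam N2]].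
  generalize (filter_and _ _ N1 at_left_L_interior). intros N.
  apply at_left_iff in N. destruct N as [d [Hd N]].
  apply at_right_iff in N2. destruct N2 as [d2 [Hd2 N2]].
  apply (at_left_reflect L (fun s => A <= / H s)). revert A.
  assert (Hmin : 0 < Rmin d d2) by (apply Rmin_pos; assumption).
  assert (Hl := Rmin_l d d2). assert (Hr := Rmin_r d d2).
  apply (blow_up_at_simple_zero (fun x => / H (L - x)) (fun x => m * F (L - x))
           (fun x => G (L - x)) (Rmin d d2 / 2) (m * (F L / 2)) gam); [lra|apply Rmult_lt_0_compat; lra|exact Hgam|].
  intros s Hs. destruct (N (L - s)) as (A1 & A3); [lra|].
  split; [apply Rinv_0_lt_compat, H_pos, A3|]. split.
  - replace (- (m * F (L - s) / G (L - s)) * / H (L - s))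
      with (- (- (- (m * F (L - s)) / G (L - s)) * / H (L - s))) by (unfold Rdiv; ring).
    apply (is_derive_reflect (fun x => / H x)), inv_H_derive, A3.
  - split; [apply Rmult_le_compat_l; lra|].
    split; [apply G_pos, A3|apply N2; lra].
Qed.

Lemma K_increasing (x y : R) : 0 < x -> x < y -> y < L -> K x < K y.
Proof.
  intros Hx Hxy Hy. apply (increasing_of_derive K (fun s => m * lam * H s / G s)); [exact Hxy| |].
  - intros s Hs. apply K_derive. lra.
  - intros s Hs. apply Rdiv_lt_0_compat; [|apply G_pos; lra].
    repeat apply Rmult_lt_0_compat; auto. apply H_pos; lra.
Qed.

(** Since [dK / dH = - lam / F], this difference is monotone where [F] stays on
    one side of [- lam / k], which gives comparisons of [K] with [H] as in the
    rule of de l'Hospital. *)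
Lemma K_minus_multiple_of_H (k : R) (s : R) :
  0 < s < L -> F s <> 0 ->
  is_derive (fun x => K x - k * H x) s ((lam + k * F s) * (m * H s / G s)).
Proof.
  intros Hs HF. assert (PG := G_pos s Hs).
  replace ((lam + k * F s) * (m * H s / G s))
    with (m * lam * H s / G s - (0 * H s + k * (- (m * F s / G s) * H s))) by (field; lra).
  apply (is_derive_minus_R K (fun x => k * H x)); [apply K_derive, Hs|].
  apply (is_derive_mult_R (fun _ => k)); [apply (is_derive_const (V := R_NormedModule))|apply H_derive, Hs].
Qed.

Lemma mH_over_G_pos (s : R) : 0 < s < L -> 0 < m * H s / G s.
Proof.
  intros Hs. apply Rdiv_lt_0_compat; [apply Rmult_lt_0_compat; auto|auto].
Qed.

Lemma K_unbounded_at_0 : 0 < F 0 -> forall A, at_right 0 (fun s => K s <= A).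
Proof.
  intros HF A.
  assert (N1 : at_right 0 (fun s => 0 < F s < 2 * F 0)).
  { apply (F_near_right (fun y => 0 < y < 2 * F 0)).
    assert (Hl : F 0 < 2 * F 0) by lra.
    generalize (filter_and _ _ (open_lt _ _ Hl) (open_gt _ _ HF)).
    apply filter_imp. intros y Hy. lra. }
  generalize (filter_and _ _ N1 at_right_0_interior). intros N.
  apply at_right_iff in N. destruct N as [d [Hd N]].
  set (k := - (lam / (2 * F 0))).
  assert (Hk : 0 < - k).
  { unfold k. rewrite Ropp_involutive. apply Rdiv_lt_0_compat; lra. }
  set (B := K (d / 2) - k * H (d / 2)).
  generalize (filter_and _ _ (H_unbounded_at_0 HF ((B - A) / - k)) (proj2 (at_right_iff 0 (fun s => 0 < s < d / 2))
    ltac:(exists (d / 2); split; [lra|intros s Hs; lra]))).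
  apply filter_imp. intros s [S1 S2].
  assert (E : K s - k * H s <= B).
  { apply (nondecreasing_of_derive (fun x => K x - k * H x)
             (fun x => (lam + k * F x) * (m * H x / G x)) s (d / 2)); [lra| |].
    - intros x Hx. destruct (N x) as [N2 N3]; [lra|]. apply K_minus_multiple_of_H; [exact N3|lra].
    - intros x Hx. destruct (N x) as [N2 N3]; [lra|].
      apply Rmult_le_pos; [|left; apply mH_over_G_pos, N3].
      assert (- k * F x <= - k * (2 * F 0)) by (apply Rmult_le_compat_l; lra).
      replace (- k * (2 * F 0)) with lam in H0 by (unfold k; field; lra). lra. }
  assert (E2 : B - A <= - k * H s).
  { apply Rmult_le_compat_l with (r := - k) in S1; [|lra].
    replace (- k * ((B - A) / - k)) with (B - A) in S1 by (field; lra). exact S1. }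
  lra.
Qed.

Section NegativeLeft.

Hypothesis F_0_neg : F 0 < 0.

(** By [K_minus_multiple_of_H] with [k = - lam / (F 0 / 2)], the function
    [K - k * H] decreases near [0], and [k * H] is positive. *)
Lemma K_bounded_below : exists B, forall s, 0 < s < L -> B <= K s.
Proof.
  assert (N1 : at_right 0 (fun s => F s < F 0 / 2)).
  { apply (F_near_right (fun y => y < F 0 / 2)).
    assert (Hl : F 0 < F 0 / 2) by lra. exact (open_lt _ _ Hl). }
  generalize (filter_and _ _ N1 at_right_0_interior). intros N.
  apply at_right_iff in N. destruct N as [d [Hd N]].
  set (k := - (lam / (F 0 / 2))).
  assert (Hk : 0 < k) by (apply neg_quotient_pos; lra).
  exists (K (d / 2) - k * H (d / 2)).
  assert (Hpos := H_pos (d / 2) ltac:(apply N; lra)).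
  assert (Hcore : forall s, 0 < s <= d / 2 -> K (d / 2) - k * H (d / 2) <= K s).
  { intros s Hs.
    assert (E : K (d / 2) - k * H (d / 2) <= K s - k * H s).
    { apply (nonincreasing_of_derive (fun x => K x - k * H x)
             (fun x => (lam + k * F x) * (m * H x / G x)) s (d / 2)); [lra| |].
      - intros x Hx. destruct (N x) as [N2 N3]; [lra|]. apply K_minus_multiple_of_H; [exact N3|lra].
      - intros x Hx. destruct (N x) as [N2 N3]; [lra|].
        assert (P := mH_over_G_pos x N3).
        assert (k * F x <= k * (F 0 / 2)) by (apply Rmult_le_compat_l; lra).
        replace (k * (F 0 / 2)) with (- lam) in H0 by (unfold k; field; lra). nra. }
    assert (0 < k * H s); [|lra]. apply Rmult_lt_0_compat; [exact Hk|].
    apply H_pos, N. lra. }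
  intros s Hs. destruct (Rle_dec s (d / 2)) as [Hle|Hgt]; [apply Hcore; lra|].
  apply Rle_trans with (K (d / 2)).
  - assert (0 < k * H (d / 2)) by (apply Rmult_lt_0_compat; assumption). lra.
  - left. apply K_increasing; lra.
Qed.

(** Since [K] increases, its infimum is its limit at [0]. *)
Lemma K_infimum_exists :
  exists K0, (forall s, 0 < s < L -> K0 < K s) /\
    forall e, 0 < e -> at_right 0 (fun s => K s < K0 + e).
Proof.
  destruct K_bounded_below as [B HB].
  destruct (completeness (fun y => exists s, 0 < s < L /\ y = - K s)) as [M [HM1 HM2]].
  - exists (- B). intros y (s & Hs & ->). specialize (HB s Hs). lra.
  - exists (- K (L / 2)), (L / 2). split; [lra|reflexivity].
  - exists (- M).
    assert (Hle : forall s, 0 < s < L -> - M <= K s).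
    { intros s Hs. assert (- K s <= M); [|lra]. apply HM1. exists s. auto. }
    split.
    + intros s Hs. apply Rle_lt_trans with (K (s / 2)); [apply Hle; lra|].
      apply K_increasing; lra.
    + intros e He.
      assert (Hex : exists s, 0 < s < L /\ K s < - M + e).
      { apply NNPP. intros Hn. assert (M <= M - e); [|lra].
        apply HM2. intros y (s & Hs & ->). apply Rnot_lt_le. intros Hlt.
        apply Hn. exists s. split; [exact Hs|lra]. }
      destruct Hex as (s & Hs & Hlt). apply at_right_iff. exists s. split; [lra|].
      intros x Hx. apply Rlt_trans with (K s); [apply K_increasing; lra|exact Hlt].
Qed.

Variable K0 : R.
Hypothesis K0_below : forall s, 0 < s < L -> K0 < K s.
Hypothesis K0_limit : forall e, 0 < e -> at_right 0 (fun s => K s < K0 + e).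

Lemma H_small_at_0 (e : R) : 0 < e -> at_right 0 (fun s => H s < e).
Proof.
  intros He. generalize (filter_and _ _ (H_vanishes_at_0 F_0_neg (2 / e)) at_right_0_interior).
  apply filter_imp. intros s [S1 S2]. assert (P := H_pos s S2).
  apply Rmult_le_compat_l with (r := H s) in S1; [|lra].
  rewrite Rinv_r in S1 by lra.
  apply Rmult_lt_reg_r with (2 / e); [apply Rdiv_lt_0_compat; lra|].
  replace (e * (2 / e)) with 2 by (field; lra). lra.
Qed.

(** For [k] slightly above or below [kap], the monotone function
    [K - k * H] has the limit [K0] at [0], so that [K - K0] is squeezed between
    multiples of [H]. *)
Lemma separatrix_limit_at_0 :
  filterlim (fun s => (K s - K0) / H s) (at_right 0) (locally (- (lam / F 0))).
Proof.
  set (kap := - (lam / F 0)).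
  intros P [eps HP].
  assert (Heps : 0 < eps / 2) by (destruct eps as [e pe]; simpl; lra).
  assert (Hkap : kap * F 0 = - lam) by (unfold kap; field; lra).
  assert (N1 : at_right 0 (fun s => F s < 0 /\ lam + (kap + eps / 2) * F s < 0 /\
                                    0 < lam + (kap - eps / 2) * F s)).
  { apply (F_near_right (fun y => y < 0 /\ lam + (kap + eps / 2) * y < 0 /\
                                    0 < lam + (kap - eps / 2) * y)).
    assert (C : forall k, continuous (fun y => lam + k * y) (F 0)).
    { intros k. apply is_derive_continuous with k. auto_derive; [exact I|ring]. }
    apply filter_and; [exact (open_lt _ _ F_0_neg)|]. apply filter_and.
    - apply (C (kap + eps / 2) (fun z => z < 0)). apply open_lt. nra.
    - apply (C (kap - eps / 2) (fun z => 0 < z)). apply open_gt. nra. }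
  generalize (filter_and _ _ N1 at_right_0_interior). intros N.
  apply at_right_iff in N. destruct N as [d [Hd N]].
  apply at_right_iff. exists d. split; [exact Hd|]. intros s Hs. apply HP.
  assert (Hs2 : 0 < s < L) by (apply N; lra).
  assert (PH := H_pos s Hs2).
  assert (Up : K s - (kap + eps / 2) * H s <= K0).
  { apply Rnot_lt_le. intros Hlt.
    set (e := K s - (kap + eps / 2) * H s - K0).
    assert (He : 0 < e / 2 / (Rabs (kap + eps / 2) + 1)).
    { apply Rdiv_lt_0_compat; [unfold e; lra|generalize (Rabs_pos (kap + eps / 2)); lra]. }
    assert (He2 : 0 < e / 2) by (unfold e; lra).
    generalize (filter_and _ _ (K0_limit (e / 2) He2) (H_small_at_0 _ He)). intros M.
    apply at_right_iff in M. destruct M as [d2 [Hd2 M]].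
    set (x := Rmin s d2 / 2).
    assert (Hx : 0 < x < d2 /\ x <= s).
    { unfold x. assert (0 < Rmin s d2) by (apply Rmin_pos; lra).
      generalize (Rmin_l s d2) (Rmin_r s d2). lra. }
    destruct (M x) as [M1 M2]; [lra|].
    assert (Hx2 : 0 < x < L) by lra. assert (PHx := H_pos x Hx2).
    assert (E : K s - (kap + eps / 2) * H s <= K x - (kap + eps / 2) * H x).
    { apply (nonincreasing_of_derive (fun x => K x - (kap + eps / 2) * H x)
             (fun x => (lam + (kap + eps / 2) * F x) * (m * H x / G x)) x s); [lra| |].
      - intros y Hy. destruct (N y) as [N2 N3]; [lra|]. apply K_minus_multiple_of_H; [exact N3|lra].
      - intros y Hy. destruct (N y) as [N2 N3]; [lra|].
        assert (Q := mH_over_G_pos y N3). nra. }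
    assert (E2 : - (kap + eps / 2) * H x <= Rabs (kap + eps / 2) * H x).
    { apply Rmult_le_compat_r; [lra|]. rewrite <- Rabs_Ropp. apply Rle_abs. }
    assert (E3 : (Rabs (kap + eps / 2) + 1) * H x <= e / 2).
    { left. apply Rmult_lt_compat_l with (r := Rabs (kap + eps / 2) + 1) in M2;
        [|generalize (Rabs_pos (kap + eps / 2)); lra].
      replace ((Rabs (kap + eps / 2) + 1) * (e / 2 / (Rabs (kap + eps / 2) + 1))) with (e / 2) in M2
        by (field; generalize (Rabs_pos (kap + eps / 2)); lra). exact M2. }
    unfold e in *. lra. }
  assert (Low : K0 <= K s - (kap - eps / 2) * H s).
  { apply Rnot_lt_le. intros Hlt.
    set (e := K0 - (K s - (kap - eps / 2) * H s)).
    assert (He : 0 < e / 2 / (Rabs (kap - eps / 2) + 1)).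
    { apply Rdiv_lt_0_compat; [unfold e; lra|generalize (Rabs_pos (kap - eps / 2)); lra]. }
    generalize (H_small_at_0 _ He). intros M.
    apply at_right_iff in M. destruct M as [d2 [Hd2 M]].
    set (x := Rmin s d2 / 2).
    assert (Hx : 0 < x < d2 /\ x <= s).
    { unfold x. assert (0 < Rmin s d2) by (apply Rmin_pos; lra).
      generalize (Rmin_l s d2) (Rmin_r s d2). lra. }
    specialize (M x ltac:(lra)).
    assert (Hx2 : 0 < x < L) by lra. assert (PHx := H_pos x Hx2).
    assert (M1 := K0_below x Hx2).
    assert (E : K x - (kap - eps / 2) * H x <= K s - (kap - eps / 2) * H s).
    { apply (nondecreasing_of_derive (fun x => K x - (kap - eps / 2) * H x)
             (fun x => (lam + (kap - eps / 2) * F x) * (m * H x / G x)) x s); [lra| |].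
      - intros y Hy. destruct (N y) as [N2 N3]; [lra|]. apply K_minus_multiple_of_H; [exact N3|lra].
      - intros y Hy. destruct (N y) as [N2 N3]; [lra|].
        assert (Q := mH_over_G_pos y N3). apply Rmult_le_pos; lra. }
    assert (E2 : (kap - eps / 2) * H x <= Rabs (kap - eps / 2) * H x).
    { apply Rmult_le_compat_r; [lra|apply Rle_abs]. }
    assert (E3 : (Rabs (kap - eps / 2) + 1) * H x <= e / 2).
    { left. apply Rmult_lt_compat_l with (r := Rabs (kap - eps / 2) + 1) in M;
        [|generalize (Rabs_pos (kap - eps / 2)); lra].
      replace ((Rabs (kap - eps / 2) + 1) * (e / 2 / (Rabs (kap - eps / 2) + 1))) with (e / 2) in M
        by (field; generalize (Rabs_pos (kap - eps / 2)); lra). exact M. }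
    unfold e in *. lra. }
  unfold ball; simpl. unfold AbsRing_ball, abs, minus, plus, opp; simpl.
  assert (E1 : (K s - K0) / H s <= kap + eps / 2).
  { apply Rmult_le_reg_r with (H s); [exact PH|]. unfold Rdiv.
    rewrite Rmult_assoc, Rinv_l, Rmult_1_r by lra. lra. }
  assert (E2 : kap - eps / 2 <= (K s - K0) / H s).
  { apply Rmult_le_reg_r with (H s); [exact PH|]. unfold Rdiv.
    rewrite (Rmult_assoc (K s - K0)), Rinv_l, Rmult_1_r by lra. lra. }
  apply Rabs_def1; lra.
Qed.

End NegativeLeft.

(** As at [0], but now [H] is unbounded, so that constants do not
    matter in the limit. *)
Lemma level_limit_at_L_negative (C : R) :
  F L < 0 -> filterlim (fun s => (K s + C) / H s) (at_left L) (locally (- (lam / F L))).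
Proof.
  intros HF. set (kap := - (lam / F L)).
  intros P [eps HP].
  assert (Heps : 0 < eps / 4) by (destruct eps as [e pe]; simpl; lra).
  assert (Hkap : kap * F L = - lam) by (unfold kap; field; lra).
  assert (N1 : at_left L (fun s => F s < 0 /\ lam + (kap + eps / 4) * F s < 0 /\
                                    0 < lam + (kap - eps / 4) * F s)).
  { apply (F_near_left (fun y => y < 0 /\ lam + (kap + eps / 4) * y < 0 /\
                                    0 < lam + (kap - eps / 4) * y)).
    assert (Cc : forall k, continuous (fun y => lam + k * y) (F L)).
    { intros k. apply is_derive_continuous with k. auto_derive; [exact I|ring]. }
    apply filter_and; [exact (open_lt _ _ HF)|]. apply filter_and.
    - apply (Cc (kap + eps / 4) (fun z => z < 0)). apply open_lt. nra.
    - apply (Cc (kap - eps / 4) (fun z => 0 < z)). apply open_gt. nra. }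
  generalize (filter_and _ _ N1 at_left_L_interior). intros N.
  apply at_left_iff in N. destruct N as [d [Hd N]].
  set (a := L - d / 2).
  set (B1 := K a - (kap + eps / 4) * H a). set (B2 := K a - (kap - eps / 4) * H a).
  set (B := Rabs (B1 + C) + Rabs (B2 + C)).
  assert (HB : 0 <= B) by (unfold B; generalize (Rabs_pos (B1 + C)) (Rabs_pos (B2 + C)); lra).
  change (at_left L (fun s => P ((K s + C) / H s))).
  generalize (filter_and _ _ (H_unbounded_at_L HF (B / (eps / 4)))
    (proj2 (at_left_iff L (fun s => a < s < L)) ltac:(exists (d / 2); split; [lra|intros s Hs; unfold a; lra]))).
  apply filter_imp. intros s [S1 S2]. apply HP.
  assert (Hs2 : 0 < s < L) by (apply N; unfold a in S2; lra).
  assert (PH := H_pos s Hs2).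
  assert (SB : B <= eps / 4 * H s).
  { apply Rmult_le_compat_l with (r := eps / 4) in S1; [|lra].
    replace (eps / 4 * (B / (eps / 4))) with B in S1 by (field; lra). exact S1. }
  assert (Up : K s - (kap + eps / 4) * H s <= B1).
  { apply (nonincreasing_of_derive (fun x => K x - (kap + eps / 4) * H x)
             (fun x => (lam + (kap + eps / 4) * F x) * (m * H x / G x)) a s); [lra| |].
    - intros y Hy. destruct (N y) as [N2 N3]; [unfold a in *; lra|]. apply K_minus_multiple_of_H; [exact N3|lra].
    - intros y Hy. destruct (N y) as [N2 N3]; [unfold a in *; lra|].
      assert (Q := mH_over_G_pos y N3). nra. }
  assert (Low : B2 <= K s - (kap - eps / 4) * H s).
  { apply (nondecreasing_of_derive (fun x => K x - (kap - eps / 4) * H x)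
             (fun x => (lam + (kap - eps / 4) * F x) * (m * H x / G x)) a s); [lra| |].
    - intros y Hy. destruct (N y) as [N2 N3]; [unfold a in *; lra|]. apply K_minus_multiple_of_H; [exact N3|lra].
    - intros y Hy. destruct (N y) as [N2 N3]; [unfold a in *; lra|].
      assert (Q := mH_over_G_pos y N3). apply Rmult_le_pos; lra. }
  assert (E1 : (K s + C) / H s <= kap + eps / 2).
  { apply Rmult_le_reg_r with (H s); [exact PH|]. unfold Rdiv.
    rewrite Rmult_assoc, Rinv_l, Rmult_1_r by lra.
    assert (B1 + C <= B).
    { unfold B. generalize (Rle_abs (B1 + C)) (Rabs_pos (B2 + C)). lra. } lra. }
  assert (E2 : kap - eps / 2 <= (K s + C) / H s).
  { apply Rmult_le_reg_r with (H s); [exact PH|]. unfold Rdiv.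
    rewrite (Rmult_assoc (K s + C)), Rinv_l, Rmult_1_r by lra.
    assert (- B <= B2 + C).
    { unfold B. generalize (Rle_abs (- (B2 + C))) (Rabs_pos (B1 + C)). rewrite Rabs_Ropp. lra. } lra. }
  unfold ball; simpl. unfold AbsRing_ball, abs, minus, plus, opp; simpl.
  apply Rabs_def1; lra.
Qed.

Lemma level_limit_at_L_positive (C a : R) :
  0 < F L -> 0 <= a < L -> (forall s, a < s < L -> 0 < K s + C) ->
  filterlim (fun s => (K s + C) / H s) (at_left L) (Rbar_locally p_infty).
Proof.
  intros HF Ha Hpos P [A HP].
  set (b := (a + L) / 2). set (B := K b + C).
  assert (HB : 0 < B) by (apply Hpos; unfold b; lra).
  change (at_left L (fun s => P ((K s + C) / H s))).
  generalize (filter_and _ _ (H_vanishes_at_L HF ((Rabs A + 1) / B))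
    (proj2 (at_left_iff L (fun s => b < s < L)) ltac:(exists (L - b); split; [unfold b; lra|intros s Hs; lra]))).
  apply filter_imp. intros s [S1 S2]. apply HP.
  assert (Hb : a < b) by (unfold b; lra).
  assert (E : B <= K s + C).
  { unfold B. apply Rplus_le_compat_r. left. apply K_increasing; lra. }
  assert (PH := H_pos s ltac:(lra)).
  apply Rlt_le_trans with (Rabs A + 1); [generalize (Rle_abs A); lra|].
  replace (Rabs A + 1) with (B * ((Rabs A + 1) / B)) by (field; lra).
  apply Rmult_le_compat; try lra.
  apply Rlt_le, Rdiv_lt_0_compat; [generalize (Rabs_pos A); lra|exact HB].
Qed.

Lemma level_limit_at_0_above (C K0 : R) :
  F 0 < 0 -> (forall s, 0 < s < L -> K0 < K s) -> 0 < K0 + C ->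
  filterlim (fun s => (K s + C) / H s) (at_right 0) (Rbar_locally p_infty).
Proof.
  intros HF HK0 HC P [A HP].
  change (at_right 0 (fun s => P ((K s + C) / H s))).
  generalize (filter_and _ _ (H_vanishes_at_0 HF ((Rabs A + 1) / (K0 + C))) at_right_0_interior).
  apply filter_imp. intros s [S1 S2]. apply HP.
  assert (E := HK0 s S2). assert (PH := H_pos s S2).
  apply Rlt_le_trans with (Rabs A + 1); [generalize (Rle_abs A); lra|].
  replace (Rabs A + 1) with ((K0 + C) * ((Rabs A + 1) / (K0 + C))) by (field; lra).
  apply Rmult_le_compat; try lra.
  apply Rlt_le, Rdiv_lt_0_compat; [generalize (Rabs_pos A); lra|exact HC].
Qed.

Lemma level_limit_at_zero (C a : R) :
  0 < a < L -> K a + C = 0 ->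
  filterlim (fun s => (K s + C) / H s) (at_right a) (locally 0).
Proof.
  intros Ha E.
  replace 0 with ((K a + C) / H a) by (rewrite E; unfold Rdiv; ring).
  apply (at_right_continuous (fun s => (K s + C) / H s)).
  apply (continuous_mult (fun s => K s + C) (fun s => / H s)).
  - apply (continuous_plus K (fun _ => C)); [|apply continuous_const].
    exact (is_derive_continuous _ _ _ (K_derive a Ha)).
  - exact (is_derive_continuous _ _ _ (inv_H_derive a Ha)).
Qed.

(** On the level [C] of the first integral [H * v - K] one has
    [v = (K + C) / H]. *)
Lemma level_derive (C s : R) :
  0 < s < L ->
  is_derive (fun x => (K x + C) / H x) s (m * (lam + F s * ((K s + C) / H s)) / G s).
Proof.
  intros Hs. assert (PH := H_pos s Hs). assert (PG := G_pos s Hs).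
  replace (m * (lam + F s * ((K s + C) / H s)) / G s)
    with ((m * lam * H s / G s + 0) * / H s + (K s + C) * (- (- (m * F s) / G s) * / H s)) by (field; lra).
  apply (is_derive_mult_R (fun x => K x + C) (fun x => / H x)); [|apply inv_H_derive, Hs].
  apply (is_derive_plus_R K (fun _ => C)); [apply K_derive, Hs|].
  apply (is_derive_const (V := R_NormedModule)).
Qed.

(** The curve is given as a graph over the angle; its parametrization by time
    solves [s' = G s * v s]. *)
Lemma level_solution (C a s1 t1 : R) :
  0 <= a -> a < s1 < L -> (forall s, a < s < L -> 0 < K s + C) ->
  exists (l r : Rbar) (phi : R -> R),
    let v := fun s => (K s + C) / H s in
    let q := fun s => ln (v s) / m in
    between l r t1 /\ phi t1 = s1 /\
    (forall t, between l r t -> a < phi t < L) /\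
    (forall t, between l r t ->
       is_derive phi t (G (phi t) * exp (m * q (phi t))) /\
       is_derive (fun t => q (phi t)) t (lam + F (phi t) * exp (m * q (phi t)))) /\
    (forall t u, between l r t -> between l r u -> t < u -> phi t < phi u) /\
    (forall s, a < s < L -> exists t, between l r t /\ phi t = s).
Proof.
  intros Ha Hs1 Hpos.
  set (v := fun s => (K s + C) / H s).
  assert (Hv : forall s, a < s < L -> 0 < v s).
  { intros s Hs. apply Rdiv_lt_0_compat; [apply Hpos, Hs|apply H_pos; lra]. }
  destruct (scalar_flow a L (fun s => G s * v s) s1 t1) as (l & r & phi & P1 & P2 & P3 & P4 & P5).
  - exact Hs1.
  - intros s Hs. simpl in Hs.
    apply (continuous_mult G v); [exact (is_derive_continuous _ _ _ (G_derive s))|].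
    eapply is_derive_continuous. apply level_derive. destruct Hs; simpl in *; lra.
  - intros s [A1 A2]. simpl in *. apply Rmult_lt_0_compat; [apply G_pos; lra|apply Hv; lra].
  - exists l, r, phi. cbv zeta. fold v. split; [exact P1|]. split; [exact P2|].
    split; [intros t Ht; apply P3, Ht|].
    split; [|split; [exact P4|exact P5]].
    intros t Ht. destruct (P3 t Ht) as [[A1 A2] D]. simpl in A1, A2.
    assert (Hvt := Hv (phi t) ltac:(lra)).
    replace (m * (ln (v (phi t)) / m)) with (ln (v (phi t))) by (field; lra).
    rewrite exp_ln by assumption.
    split; [exact D|].
    evar_last.
    + apply (is_derive_comp_R (fun s => ln (v s) / m) phi); [|exact D].
      apply (is_derive_comp_R (fun y => ln y / m) v).
      * auto_derive; [exact Hvt|reflexivity].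
      * apply level_derive. lra.
    + fold (v (phi t)). assert (PG := G_pos (phi t) ltac:(lra)). field. lra.
Qed.

End FirstIntegral.

Lemma first_integral_exists (m lam L : R) (F G : R -> R) :
  0 < L -> (forall s, continuous F s) -> (forall s, continuous G s) ->
  (forall s, 0 < s < L -> 0 < G s) ->
  exists H K : R -> R, (forall s, 0 < s < L -> 0 < H s) /\
    (forall s, 0 < s < L -> is_derive H s (- (m * F s / G s) * H s)) /\
    (forall s, 0 < s < L -> is_derive K s (m * lam * H s / G s)).
Proof.
  intros HL HF HG Hpos.
  assert (Cinv : forall s, between 0 L s -> continuous (fun x => / G x) s).
  { intros s Hs. apply (continuous_comp G Rinv); [apply HG|].
    apply (ex_derive_continuous (V := R_NormedModule)). auto_derive.
    generalize (Hpos s Hs). lra. }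
  assert (Hmid : between 0 L (L / 2)) by (split; simpl; lra).
  destruct (primitive_exists 0 L (fun s => m * F s * / G s) (L / 2) Hmid) as [U [_ HU]].
  { intros s Hs. apply (continuous_mult (fun s => m * F s) (fun s => / G s)); [|apply Cinv, Hs].
    apply (continuous_mult (fun _ => m) F); [apply continuous_const|apply HF]. }
  set (H := fun s => exp (- U s)).
  assert (DH : forall s, 0 < s < L -> is_derive H s (- (m * F s / G s) * H s)).
  { intros s Hs. unfold H. rewrite Rmult_comm. apply (is_derive_comp_R exp (fun s => - U s)).
    - auto_derive; [exact I|ring].
    - apply (is_derive_opp U). apply (HU s). exact Hs. }
  destruct (primitive_exists 0 L (fun s => m * lam * H s * / G s) (L / 2) Hmid) as [K [_ HK]].
  { intros s Hs. apply (continuous_mult (fun s => m * lam * H s) (fun s => / G s)); [|apply Cinv, Hs].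
    apply (continuous_mult (fun _ => m * lam) H); [apply continuous_const|].
    exact (is_derive_continuous _ _ _ (DH s Hs)). }
  exists H, K. split; [intros s _; apply exp_pos|]. split; [exact DH|exact HK].
Qed.

(** * Connected sets *)

(** Along a path from [U] to [V], real induction shows that the path stays
    in [U] as long as it does not meet both sets. *)
Lemma connected_of_paths (A : plane -> Prop) :
  (forall p q, A p -> A q -> exists gam : R -> plane, gam 0 = p /\ gam 1 = q /\
     forall t, 0 <= t <= 1 -> A (gam t) /\ continuous gam t) ->
  connected A.
Proof.
  intros Hpath U V HU HV Hcov (p & Ap & Up) (q & Aq & Vq).
  destruct (Hpath p q Ap Aq) as (gam & G0 & G1 & G).
  apply NNPP. intros Hn.
  assert (HUall : forall t, 0 <= t <= 1 -> U (gam t)).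
  { apply real_induction; [lra|rewrite G0; exact Up| |].
    - intros x Hx Hb. destruct (G x ltac:(lra)) as [_ Cx].
      assert (Hl : locally x (fun t => U (gam t))) by exact (Cx U (HU _ (Hb x ltac:(lra)))).
      revert Hl. apply filter_le_within.
    - intros x Hx Hb. destruct (G x ltac:(lra)) as [Ax Cx].
      destruct (Hcov _ Ax) as [Ux|Vx]; [exact Ux|exfalso].
      assert (Hl : locally x (fun t => V (gam t))) by exact (Cx V (HV _ Vx)).
      destruct Hl as [d Hd].
      set (y := Rmax 0 (x - d / 2)).
      assert (Hdp : 0 < d) by apply d.
      assert (Hy : 0 <= y < x /\ x - d / 2 <= y).
      { unfold y. split; [split; [apply Rmax_l|apply Rmax_lub_lt; lra]|apply Rmax_r]. }
      apply Hn. exists (gam y). split; [apply G; lra|]. split; [apply Hb; lra|].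
      apply Hd. unfold ball; simpl. unfold AbsRing_ball, abs, minus, plus, opp; simpl.
      rewrite Rabs_left; lra. }
  apply Hn. exists q. split; [exact Aq|]. split; [|exact Vq].
  rewrite <- G1. apply HUall. lra.
Qed.

Lemma continuous_pair (x y : R -> R) (t : R) :
  continuous x t -> continuous y t -> continuous (fun t => (x t, y t) : plane) t.
Proof.
  intros Hx Hy P [eps HP].
  assert (B1 : locally t (fun s => ball (x t) eps (x s))) by exact (Hx _ (locally_ball _ eps)).
  assert (B2 : locally t (fun s => ball (y t) eps (y s))) by exact (Hy _ (locally_ball _ eps)).
  change (locally t (fun s => P (x s, y s))).
  generalize (filter_and _ _ B1 B2). apply filter_imp. intros s [S1 S2].
  apply HP. split; assumption.
Qed.

Lemma continuous_chart (tm sg : R) (s q : R -> R) (t : R) :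
  continuous s t -> continuous q t -> continuous (fun t => chart tm sg (s t, q t)) t.
Proof.
  intros Hs Hq.
  assert (Ha : continuous (fun t => tm + sg * s t) t).
  { apply (continuous_plus (fun _ => tm) (fun t => sg * s t)); [apply continuous_const|].
    apply (continuous_mult (fun _ => sg) s); [apply continuous_const|exact Hs]. }
  assert (He : continuous (fun t => exp (q t)) t).
  { apply (continuous_comp q exp); [exact Hq|]. apply is_derive_continuous with (exp (q t)).
    apply is_derive_exp. }
  apply (continuous_pair (fun t => exp (q t) * cos (tm + sg * s t))
           (fun t => exp (q t) * sin (tm + sg * s t))).
  - apply (continuous_mult (fun t => exp (q t)) (fun t => cos (tm + sg * s t))); [exact He|].
    apply (continuous_comp (fun t => tm + sg * s t) cos); [exact Ha|apply continuous_cos].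
  - apply (continuous_mult (fun t => exp (q t)) (fun t => sin (tm + sg * s t))); [exact He|].
    apply (continuous_comp (fun t => tm + sg * s t) sin); [exact Ha|apply continuous_sin].
Qed.

Lemma convex_combination_bounds (x y t : R) :
  0 <= t <= 1 -> Rmin x y <= x + t * (y - x) <= Rmax x y.
Proof.
  intros Ht. unfold Rmin, Rmax. destruct (Rle_dec x y) as [H|H].
  - assert (0 <= t * (y - x)) by (apply Rmult_le_pos; lra).
    assert (0 <= (1 - t) * (y - x)) by (apply Rmult_le_pos; lra). lra.
  - assert (0 <= t * (x - y)) by (apply Rmult_le_pos; lra).
    assert (0 <= (1 - t) * (x - y)) by (apply Rmult_le_pos; lra). lra.
Qed.

(** The coordinates [s] and [d], the angle and the height above the graph,
    identify the side with a convex set. *)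
Lemma graph_side_connected (tm sg L e : R) (f : R -> R) (A : plane -> Prop) :
  (forall s, 0 < s < L -> continuous f s) ->
  (forall p, A p <-> exists s d, 0 < s < L /\ 0 < d /\ p = chart tm sg (s, f s + e * d)) ->
  connected A.
Proof.
  intros Hf HA. apply connected_of_paths. intros p q Hp Hq.
  apply HA in Hp. apply HA in Hq.
  destruct Hp as (s1 & d1 & Hs1 & Hd1 & ->). destruct Hq as (s2 & d2 & Hs2 & Hd2 & ->).
  set (s := fun t => s1 + t * (s2 - s1)). set (d := fun t => d1 + t * (d2 - d1)).
  assert (Hs : forall t, 0 <= t <= 1 -> 0 < s t < L) 
    by (intros t Ht; generalize (convex_combination_bounds s1 s2 t Ht); unfold s, Rmin, Rmax; destruct Rle_dec; lra).
  assert (Hd : forall t, 0 <= t <= 1 -> 0 < d t) 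
    by (intros t Ht; generalize (convex_combination_bounds d1 d2 t Ht); unfold d, Rmin, Rmax; destruct Rle_dec; lra).
  assert (Cs : forall t, continuous s t).
  { intros t. apply is_derive_continuous with (s2 - s1). unfold s. auto_derive; [exact I|ring]. }
  assert (Cd : forall t, continuous (fun t => e * d t) t).
  { intros t. apply is_derive_continuous with (e * (d2 - d1)). unfold d. auto_derive; [exact I|ring]. }
  exists (fun t => chart tm sg (s t, f (s t) + e * d t)).
  assert (E0 : s 0 = s1 /\ d 0 = d1) by (unfold s, d; split; ring).
  assert (E1 : s 1 = s2 /\ d 1 = d2) by (unfold s, d; split; ring).
  destruct E0 as [-> ->], E1 as [-> ->].
  split; [reflexivity|]. split; [reflexivity|].
  intros t Ht. split.
  - apply HA. exists (s t), (d t). auto.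
  - apply (continuous_chart tm sg s (fun t => f (s t) + e * d t)); [apply Cs|].
    apply (continuous_plus (fun t => f (s t)) (fun t => e * d t)); [|apply Cd].
    apply (continuous_comp s f); [apply Cs|apply Hf, Hs, Ht].
Qed.

(** * Limits in the disk in polar coordinates *)

Lemma polar_ball_limit (Fl : (R -> Prop) -> Prop) {FFl : Filter Fl} (rho th : R -> R) (rho0 th0 : R) :
  filterlim rho Fl (locally rho0) -> filterlim th Fl (locally th0) ->
  forall eps : posreal,
    Fl (fun s => ball ((rho0 * cos th0, rho0 * sin th0) : plane) eps
                   ((rho s * cos (th s), rho s * sin (th s)) : plane)).
Proof.
  intros Hr Ht eps.
  assert (Hc : filterlim (fun s => rho s * cos (th s)) Fl (locally (rho0 * cos th0))).
  { eapply filterlim_comp_2; [exact Hr|eapply filterlim_comp; [exact Ht|apply continuous_cos]|].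
    apply (filterlim_mult rho0 (cos th0)). }
  assert (Hs : filterlim (fun s => rho s * sin (th s)) Fl (locally (rho0 * sin th0))).
  { eapply filterlim_comp_2; [exact Hr|eapply filterlim_comp; [exact Ht|apply continuous_sin]|].
    apply (filterlim_mult rho0 (sin th0)). }
  assert (B1 : Fl (fun s => ball (rho0 * cos th0) eps (rho s * cos (th s))))
    by exact (Hc _ (locally_ball _ eps)).
  assert (B2 : Fl (fun s => ball (rho0 * sin th0) eps (rho s * sin (th s))))
    by exact (Hs _ (locally_ball _ eps)).
  generalize (filter_and _ _ B1 B2). apply filter_imp. intros s [S1 S2]. split; assumption.
Qed.

(** The disk model keeps the directions and maps the radius [r] to this
    number. *)
Definition disk_radius (r : R) : R := r / sqrt (1 + r ^ 2).

Lemma to_disk_polar (r th : R) :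
  to_disk (r * cos th, r * sin th) = (disk_radius r * cos th, disk_radius r * sin th).
Proof.
  unfold to_disk, disk_radius. cbv [fst snd].
  replace (1 + (r * cos th) ^ 2 + (r * sin th) ^ 2) with (1 + r ^ 2).
  - f_equal; unfold Rdiv; ring.
  - transitivity (1 + r ^ 2 * (cos th * cos th + sin th * sin th)); [|ring].
    rewrite cos_sin_square. ring.
Qed.

Lemma continuous_disk_radius (r : R) : continuous disk_radius r.
Proof.
  apply (ex_derive_continuous (V := R_NormedModule)). unfold disk_radius. auto_derive.
  assert (0 < 1 + r ^ 2) by (generalize (pow2_ge_0 r); lra).
  assert (0 < sqrt (1 + r ^ 2)) by (apply sqrt_lt_R0; assumption).
  simpl in *. repeat split; lra.
Qed.

Lemma disk_radius_at_infinity : filterlim disk_radius (Rbar_locally p_infty) (locally 1).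
Proof.
  intros P [eps HP]. exists (1 + / eps). intros r Hr. apply HP.
  assert (Hep : 0 < eps) by apply eps.
  assert (Hi : 0 < / eps) by (apply Rinv_0_lt_compat; exact Hep).
  assert (H1 : 0 < 1 + r ^ 2) by (generalize (pow2_ge_0 r); lra).
  set (w := sqrt (1 + r ^ 2)).
  assert (Hw : 0 < w) by (apply sqrt_lt_R0; exact H1).
  assert (Hww : w * w = 1 + r ^ 2) by (apply sqrt_sqrt; lra).
  assert (Hwr : r < w) by nra.
  unfold ball; simpl. unfold AbsRing_ball, abs, minus, plus, opp; simpl.
  unfold disk_radius. fold w.
  assert (E : r / w = 1 - (w - r) / w) by (field; lra). rewrite E.
  assert (P1 : 0 < (w - r) / w) by (apply Rdiv_lt_0_compat; lra).
  assert (P2 : (w - r) / w < eps).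
  { apply Rmult_lt_reg_r with w; [exact Hw|]. unfold Rdiv. rewrite Rmult_assoc, Rinv_l, Rmult_1_r by lra.
    assert ((w - r) * (w + r) = 1) by (ring_simplify; nra).
    assert (w - r < 1) by nra.
    assert (1 < eps * r) by (apply Rmult_lt_reg_l with (/ eps); [exact Hi|]; rewrite <- Rmult_assoc, Rinv_l by lra; lra).
    nra. }
  rewrite Rabs_left; lra.
Qed.

(** It is the radius in the disk that converges, so that limits at infinity
    are included, with [rho0 = 1]. *)
Lemma polar_disk_limit (Fl : (R -> Prop) -> Prop) {FFl : Filter Fl} (rho th : R -> R) (rho0 th0 : R) :
  filterlim (fun s => disk_radius (rho s)) Fl (locally rho0) -> filterlim th Fl (locally th0) ->
  forall eps : posreal,
    Fl (fun s => ball ((rho0 * cos th0, rho0 * sin th0) : plane) eps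
                   (to_disk (rho s * cos (th s), rho s * sin (th s)))).
Proof.
  intros Hr Ht eps.
  generalize (polar_ball_limit Fl _ th rho0 th0 Hr Ht eps). apply filter_imp.
  intros s. rewrite to_disk_polar. trivial.
Qed.

(** An increasing bijection from the interval [(l, r)] onto [(a, b)], for a
    change of parameter that preserves the limits at both ends. *)
Definition runs_through (l r : Rbar) (phi : R -> R) (a b : R) : Prop :=
  (forall t, between l r t -> a < phi t < b) /\
  (forall t u, between l r t -> between l r u -> t < u -> phi t < phi u) /\
  (forall s, a < s < b -> exists t, between l r t /\ phi t = s).

Lemma runs_through_tends_hi (l r : Rbar) (phi : R -> R) (a b : R) (Gam : R -> plane) (z : plane) :
  a < b -> runs_through l r phi a b ->
  (forall eps : posreal, at_left b (fun s => ball z eps (Gam s))) ->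
  tends_hi (Curve l r (fun t => Gam (phi t))) z.
Proof.
  intros Hab (R1 & R2 & R3) H eps.
  destruct (proj1 (at_left_iff b _) (H eps)) as [d [Hd Hb]].
  assert (Hmin : 0 < Rmin (b - a) d) by (apply Rmin_pos; lra).
  assert (M1 := Rmin_l (b - a) d). assert (M2 := Rmin_r (b - a) d).
  destruct (R3 (b - Rmin (b - a) d / 2)) as [t [Ht E]]; [lra|].
  exists t. split; [exact Ht|]. intros s Hs Hle. apply Hb.
  assert (Hsb := R1 s Hs).
  destruct (Req_dec t s) as [<-|Hne]; [lra|].
  assert (phi t < phi s) by (apply R2; auto; lra). lra.
Qed.

Lemma runs_through_tends_lo (l r : Rbar) (phi : R -> R) (a b : R) (Gam : R -> plane) (z : plane) :
  a < b -> runs_through l r phi a b ->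
  (forall eps : posreal, at_right a (fun s => ball z eps (Gam s))) ->
  tends_lo (Curve l r (fun t => Gam (phi t))) z.
Proof.
  intros Hab (R1 & R2 & R3) H eps.
  destruct (proj1 (at_right_iff a _) (H eps)) as [d [Hd Hb]].
  assert (Hmin : 0 < Rmin (b - a) d) by (apply Rmin_pos; lra).
  assert (M1 := Rmin_l (b - a) d). assert (M2 := Rmin_r (b - a) d).
  destruct (R3 (a + Rmin (b - a) d / 2)) as [t [Ht E]]; [lra|].
  exists t. split; [exact Ht|]. intros s Hs Hle. apply Hb.
  assert (Hsb := R1 s Hs).
  destruct (Req_dec t s) as [<-|Hne]; [lra|].
  assert (phi s < phi t) by (apply R2; auto; lra). lra.
Qed.

Lemma filterlim_root_0 (M : R) : 0 < M -> filterlim (fun v => exp (ln v / M)) (at_right 0) (locally 0).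
Proof.
  intros HM P HP. destruct HP as [eps HP].
  assert (Hep : 0 < eps) by apply eps.
  apply (proj2 (at_right_iff 0 (fun v => P (exp (ln v / M))))).
  exists (exp (M * ln eps)). split; [apply exp_pos|].
  intros v Hv. apply HP. rewrite Rplus_0_l in Hv.
  assert (ln v < M * ln eps).
  { rewrite <- (ln_exp (M * ln eps)). apply ln_increasing; lra. }
  unfold ball; simpl. unfold AbsRing_ball, abs, minus, plus, opp; simpl.
  rewrite Ropp_0, Rplus_0_r, Rabs_right by (left; apply exp_pos).
  rewrite <- (exp_ln eps Hep). apply exp_increasing.
  apply Rmult_lt_reg_l with M; [exact HM|].
  replace (M * (ln v / M)) with (ln v) by (field; lra). exact H.
Qed.

Lemma filterlim_root_infty (M : R) :
  0 < M -> filterlim (fun v => exp (ln v / M)) (Rbar_locally p_infty) (Rbar_locally p_infty).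
Proof.
  intros HM P [A HP]. exists (exp (M * ln (Rabs A + 1))). intros v Hv. apply HP.
  assert (HA := Rabs_pos A).
  apply Rlt_le_trans with (Rabs A + 1); [generalize (Rle_abs A); lra|].
  assert (M * ln (Rabs A + 1) < ln v).
  { rewrite <- (ln_exp (M * ln (Rabs A + 1))). apply ln_increasing; [apply exp_pos|exact Hv]. }
  left. rewrite <- (exp_ln (Rabs A + 1)) at 1 by lra. apply exp_increasing.
  apply Rmult_lt_reg_l with M; [exact HM|].
  replace (M * (ln v / M)) with (ln v) by (field; lra). exact H.
Qed.

Lemma continuous_root (M kap : R) : 0 < kap -> M <> 0 -> continuous (fun v => exp (ln v / M)) kap.
Proof.
  intros Hk HM. apply (ex_derive_continuous (V := R_NormedModule)). auto_derive.
  repeat split; auto.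
Qed.

(** * Equilibria on a radius *)

Definition root (M v : R) : R := exp (ln v / M).

Definition polar_point (r th : R) : plane := (r * cos th, r * sin th).

Lemma polar_point_chart (th r : R) : 0 < r -> polar_point r th = chart th 1 (0, ln r).
Proof.
  intros Hr. unfold polar_point, chart. simpl. rewrite exp_ln by assumption.
  rewrite Rmult_0_r, Rplus_0_r. reflexivity.
Qed.

Lemma polar_point_equilibrium (lam : R) (m : nat) (Q1 Q2 : R -> R -> R) (th r : R) :
  homogeneous_polynomial (S m) Q1 -> homogeneous_polynomial (S m) Q2 ->
  polar_g Q1 Q2 th = 0 -> 0 < r ->
  equilibrium (system lam Q1 Q2) (polar_point r th) <-> lam + polar_f Q1 Q2 th * r ^ m = 0.
Proof.
  intros H1 H2 Hg Hr. rewrite polar_point_chart by assumption.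
  rewrite equilibrium_chart by ring. rewrite (lift_system th 1 lam m) by assumption.
  simpl fst. simpl snd. rewrite Rmult_0_r, Rplus_0_r, Hg, exp_INR_mult, exp_ln by assumption.
  split; intros H.
  - injection H. auto.
  - rewrite H. f_equal. ring.
Qed.

Lemma no_radius_equilibrium_of_sign (lam : R) (m : nat) (Q1 Q2 : R -> R -> R) (th : R) :
  homogeneous_polynomial (S m) Q1 -> homogeneous_polynomial (S m) Q2 ->
  polar_g Q1 Q2 th = 0 -> 0 < lam -> 0 < polar_f Q1 Q2 th ->
  no_radius_equilibrium (system lam Q1 Q2) th.
Proof.
  intros H1 H2 Hg Hl Hf p [(r & Hr & ->) Heq].
  apply (polar_point_equilibrium lam m Q1 Q2 th r H1 H2 Hg Hr) in Heq.
  assert (0 < r ^ m) by (apply pow_lt; exact Hr).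
  assert (0 < polar_f Q1 Q2 th * r ^ m) by (apply Rmult_lt_0_compat; assumption). lra.
Qed.

Lemma root_pow (m : nat) (v : R) : m <> O -> 0 < v -> root (INR m) v ^ m = v.
Proof.
  intros Hm Hv. unfold root. rewrite <- exp_INR_mult.
  replace (INR m * (ln v / INR m)) with (ln v) by (field; apply not_0_INR; exact Hm).
  apply exp_ln, Hv.
Qed.

Lemma unique_radius_equilibrium (lam : R) (m : nat) (Q1 Q2 : R -> R -> R) (th : R) :
  homogeneous_polynomial (S m) Q1 -> homogeneous_polynomial (S m) Q2 -> m <> O ->
  polar_g Q1 Q2 th = 0 -> 0 < lam -> polar_f Q1 Q2 th < 0 ->
  unique (radius_equilibrium (system lam Q1 Q2) th)
    (polar_point (root (INR m) (- (lam / polar_f Q1 Q2 th))) th).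
Proof.
  intros H1 H2 Hm Hg Hl Hf. set (f := polar_f Q1 Q2 th) in *.
  set (kap := - (lam / f)).
  assert (Hkap : 0 < kap) by (apply neg_quotient_pos; assumption).
  assert (Hr : 0 < root (INR m) kap) by apply exp_pos.
  split.
  - split; [exists (root (INR m) kap); auto|].
    apply (polar_point_equilibrium lam m); auto. rewrite root_pow by assumption.
    fold f. unfold kap. field. lra.
  - intros p [(r & Hr' & ->) Heq].
    apply (polar_point_equilibrium lam m Q1 Q2 th r H1 H2 Hg Hr') in Heq. fold f in Heq.
    assert (E : r ^ m = kap) by (unfold kap; apply Rmult_eq_reg_l with f; [field_simplify; lra|lra]).
    assert (Er : root (INR m) kap = r); [|rewrite Er; reflexivity].
    unfold root. rewrite <- E, ln_pow by assumption.
    replace (INR m * ln r / INR m) with (ln r) by (field; apply not_0_INR; exact Hm).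
    apply exp_ln, Hr'.
Qed.

(** * Trajectories in the half-cone for positive [lambda] *)

Definition sector_f (Q1 Q2 : R -> R -> R) (tm sg s : R) : R := polar_f Q1 Q2 (tm + sg * s).

(** The sign makes [sector_g] the velocity of the angle counted as in [chart],
    up to the power of the radius. *)
Definition sector_g (Q1 Q2 : R -> R -> R) (tm sg s : R) : R := sg * polar_g Q1 Q2 (tm + sg * s).

Section Sector.

Variables (lam : R) (m : nat) (Q1 Q2 : R -> R -> R) (tm sg L : R).
Hypothesis Q1_homogeneous : homogeneous_polynomial (S m) Q1.
Hypothesis Q2_homogeneous : homogeneous_polynomial (S m) Q2.
Hypothesis m_nonzero : m <> O.
Hypothesis lam_pos : 0 < lam.
Hypothesis sign_sg : sg = 1 \/ sg = -1.
Hypothesis L_pos : 0 < L.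
Hypothesis L_le_PI : L <= PI.

Local Notation X := (system lam Q1 Q2).
Local Notation M := (INR m).
Local Notation F := (sector_f Q1 Q2 tm sg).
Local Notation G := (sector_g Q1 Q2 tm sg).
Local Notation intC := (half_cone_interior tm (tm + sg * L)).

Hypothesis G_0 : G 0 = 0.
Hypothesis G_L : G L = 0.
Hypothesis G_pos : forall s, 0 < s < L -> 0 < G s.

Variables H K : R -> R.
Hypothesis H_pos : forall s, 0 < s < L -> 0 < H s.
Hypothesis H_derive : forall s, 0 < s < L -> is_derive H s (- (M * F s / G s) * H s).
Hypothesis K_derive : forall s, 0 < s < L -> is_derive K s (M * lam * H s / G s).

Variable K0 : R.
Hypothesis K0_below : F 0 < 0 -> forall s, 0 < s < L -> K0 < K s.
Hypothesis K0_limit : F 0 < 0 -> forall e, 0 < e -> at_right 0 (fun s => K s < K0 + e).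

Let M_pos : 0 < M.
Proof. apply lt_0_INR. lia. Qed.

Let sg_square : sg * sg = 1.
Proof. exact (sign_square sg sign_sg). Qed.

Lemma sector_F_continuous (s : R) : continuous F s.
Proof.
  apply (continuous_comp (fun s => tm + sg * s) (polar_f Q1 Q2)).
  - apply is_derive_continuous with sg. auto_derive; [exact I|ring].
  - apply continuously_differentiable_continuous, (polar_f_continuously_differentiable (S m)); assumption.
Qed.

Lemma sector_G_derive : exists G', forall s, is_derive G s (G' s).
Proof.
  destruct (polar_g_continuously_differentiable (S m) Q1 Q2) as [g' [Hg _]]; auto.
  exists (fun s => g' (tm + sg * s)). intros s. unfold sector_g.
  replace (g' (tm + sg * s))
    with (0 * polar_g Q1 Q2 (tm + sg * s) + sg * (g' (tm + sg * s) * sg))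
    by (transitivity ((sg * sg) * g' (tm + sg * s)); [ring|rewrite sg_square; ring]).
  apply (is_derive_mult_R (fun _ => sg) (fun s => polar_g Q1 Q2 (tm + sg * s)));
    [apply (is_derive_const (V := R_NormedModule))|].
  apply (is_derive_comp_R (polar_g Q1 Q2) (fun s => tm + sg * s)); [exact (Hg (tm + sg * s))|]. auto_derive; [exact I|ring].
Qed.

Lemma sector_lift (w : plane) :
  lift tm sg X w = (G (fst w) * exp (M * snd w), lam + F (fst w) * exp (M * snd w)).
Proof. apply (lift_system tm sg lam m); assumption. Qed.

Lemma sector_no_equilibrium (w : plane) : 0 < fst w < L -> ~ equilibrium X (chart tm sg w).
Proof.
  intros Hw Heq. apply (equilibrium_chart tm sg X w sg_square) in Heq.
  rewrite sector_lift in Heq. injection Heq. intros _ E.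
  assert (0 < G (fst w) * exp (M * snd w)); [|lra].
  apply Rmult_lt_0_compat; [apply G_pos, Hw|apply exp_pos].
Qed.

(** The first integral [H * r ^ (n - 1) - K] of the system. *)
Definition level (w : plane) : R := H (fst w) * exp (M * snd w) - K (fst w).

(** The level [C] as a graph over the angle. *)
Definition level_log_radius (C s : R) : R := ln ((K s + C) / H s) / M.

Lemma level_graph (w : plane) :
  0 < fst w < L -> 0 < K (fst w) + level w /\
  snd w = level_log_radius (level w) (fst w).
Proof.
  intros Hw. assert (PH := H_pos (fst w) Hw). unfold level_log_radius, level.
  replace (K (fst w) + (H (fst w) * exp (M * snd w) - K (fst w)))
    with (H (fst w) * exp (M * snd w)) by ring.
  split; [apply Rmult_lt_0_compat; [exact PH|apply exp_pos]|].
  replace (H (fst w) * exp (M * snd w) / H (fst w)) with (exp (M * snd w)) by (field; lra).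
  rewrite ln_exp. field. lra.
Qed.

Lemma level_of_level_log_radius (C s : R) :
  0 < s < L -> 0 < K s + C -> level (s, level_log_radius C s) = C.
Proof.
  intros Hs HC. assert (PH := H_pos s Hs). unfold level, level_log_radius. simpl.
  replace (M * (ln ((K s + C) / H s) / M)) with (ln ((K s + C) / H s)) by (field; lra).
  rewrite exp_ln by (apply Rdiv_lt_0_compat; assumption). field. lra.
Qed.

Lemma sector_K_increasing (x y : R) : 0 < x -> x < y -> y < L -> K x < K y.
Proof. apply (K_increasing M lam L G H K); auto. Qed.

(** The solution runs through the whole part of its level beyond the angle
    [a]. Its limits in the disk are therefore those of the graph, and they are left
    as hypotheses because they depend on the signs at the ends of the sector. *)
Lemma sector_solution_exists (w1 : plane) (a t1 : R) :
  0 <= a -> a < fst w1 < L -> (forall s, a < s < L -> 0 < K s + level w1) ->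
  exists e, solution X e /\ dom e t1 /\ e t1 = chart tm sg w1 /\
    (forall t, dom e t -> exists w, 0 < fst w < L /\ level w = level w1 /\ e t = chart tm sg w) /\
    (forall w, a < fst w < L -> level w = level w1 -> image e (chart tm sg w)) /\
    (forall z, (forall eps : posreal, at_right a (fun s =>
         ball z eps (to_disk (chart tm sg (s, level_log_radius (level w1) s))))) ->
       tends_lo (in_disk e) z) /\
    (forall z, (forall eps : posreal, at_left L (fun s =>
         ball z eps (to_disk (chart tm sg (s, level_log_radius (level w1) s))))) ->
       tends_hi (in_disk e) z).
Proof.
  intros Ha Hw1 Hpos. set (C := level w1) in *.
  destruct sector_G_derive as [G' HG'].
  destruct (level_solution M lam L F G G' H K M_pos HG' G_pos H_pos H_derive K_derive
              C a (fst w1) t1 Ha Hw1 Hpos) as (l & r & phi & P1 & P2 & P3 & P4 & P5 & P6).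
  set (q := level_log_radius C).
  change (forall t, between l r t ->
    is_derive phi t (G (phi t) * exp (M * q (phi t))) /\
    is_derive (fun t => q (phi t)) t (lam + F (phi t) * exp (M * q (phi t)))) in P4.
  assert (HR : runs_through l r phi a L) by (split; [exact P3|split; [exact P5|exact P6]]).
  exists (Curve l r (fun t => chart tm sg (phi t, q (phi t)))).
  split.
  { apply (chart_curve_solution tm sg X l r phi (fun t => q (phi t)) sg_square).
    - apply Rbar_lt_trans with t1; apply P1.
    - intros t Ht. rewrite sector_lift. exact (P4 t Ht). }
  split; [exact P1|].
  split.
  { simpl. rewrite P2. unfold q. destruct (level_graph w1) as [_ E]; [lra|].
    fold C in E. rewrite <- E. destruct w1; reflexivity. }
  split.
  { intros t Ht. exists (phi t, q (phi t)). assert (B := P3 t Ht). simpl.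
    split; [lra|]. split; [|reflexivity].
    apply level_of_level_log_radius; [lra|]. apply Hpos, B. }
  split.
  { intros w Hw E. destruct (P6 (fst w) Hw) as [t [Ht Et]]. exists t. split; [exact Ht|].
    simpl. rewrite Et. destruct (level_graph w) as [_ E2]; [lra|].
    rewrite E in E2. fold q in E2. rewrite <- E2. destruct w; reflexivity. }
  split; intros z Hz.
  - apply (runs_through_tends_lo l r phi a L (fun s => to_disk (chart tm sg (s, q s))) z); [lra|exact HR|exact Hz].
  - apply (runs_through_tends_hi l r phi a L (fun s => to_disk (chart tm sg (s, q s))) z); [lra|exact HR|exact Hz].
Qed.

Definition p_minus : plane := polar_point (root M (- (lam / F 0))) tm.
Definition p_plus : plane := polar_point (root M (- (lam / F L))) (tm + sg * L).

Lemma angle_limit (Fl : (R -> Prop) -> Prop) (s0 : R) :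
  filterlim (fun s => s) Fl (locally s0) ->
  filterlim (fun s => tm + sg * s) Fl (locally (tm + sg * s0)).
Proof.
  intros Hid. apply (filterlim_comp _ _ _ (fun s => s) (fun s => tm + sg * s) _ (locally s0)); [exact Hid|].
  change (continuous (fun s => tm + sg * s) s0).
  apply is_derive_continuous with sg. auto_derive; [exact I|ring].
Qed.

Lemma level_disk_limit_finite (Fl : (R -> Prop) -> Prop) {FFl : Filter Fl} (C s0 kap : R) :
  filterlim (fun s => s) Fl (locally s0) -> 0 < kap ->
  filterlim (fun s => (K s + C) / H s) Fl (locally kap) ->
  forall eps : posreal, Fl (fun s =>
    ball (to_disk (polar_point (root M kap) (tm + sg * s0))) eps
      (to_disk (chart tm sg (s, level_log_radius C s)))).
Proof.
  intros Hid Hk Hv. unfold polar_point. rewrite to_disk_polar.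
  apply (polar_disk_limit Fl (fun s => root M ((K s + C) / H s)) (fun s => tm + sg * s)).
  - apply (filterlim_comp _ _ _ (fun s => (K s + C) / H s) (fun v => disk_radius (root M v)) _ (locally kap)); [exact Hv|].
    apply (continuous_comp (root M) disk_radius); [|apply continuous_disk_radius].
    apply continuous_root; lra.
  - exact (angle_limit Fl s0 Hid).
Qed.

Lemma level_disk_limit_infinite (Fl : (R -> Prop) -> Prop) {FFl : Filter Fl} (C s0 : R) :
  filterlim (fun s => s) Fl (locally s0) ->
  filterlim (fun s => (K s + C) / H s) Fl (Rbar_locally p_infty) ->
  forall eps : posreal, Fl (fun s =>
    ball (at_infinity (tm + sg * s0)) eps (to_disk (chart tm sg (s, level_log_radius C s)))).
Proof.
  intros Hid Hv. replace (at_infinity (tm + sg * s0))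
    with ((1 * cos (tm + sg * s0), 1 * sin (tm + sg * s0)) : plane)
    by (unfold at_infinity; rewrite !Rmult_1_l; reflexivity).
  apply (polar_disk_limit Fl (fun s => root M ((K s + C) / H s)) (fun s => tm + sg * s)).
  - apply (filterlim_comp _ _ _ (fun s => (K s + C) / H s) (fun v => disk_radius (root M v)) _ (Rbar_locally p_infty)); [exact Hv|].
    apply (filterlim_comp _ _ _ (root M) disk_radius _ (Rbar_locally p_infty));
      [apply filterlim_root_infty, M_pos|apply disk_radius_at_infinity].
  - exact (angle_limit Fl s0 Hid).
Qed.

(** Where [K + C] vanishes, the radius tends to [0] and the direction does
    not matter. *)
Lemma level_disk_limit_zero (C a : R) :
  0 < a < L -> K a + C = 0 ->
  forall eps : posreal, at_right a (fun s =>
    ball (to_disk origin) eps (to_disk (chart tm sg (s, level_log_radius C s)))).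
Proof.
  intros Ha E. replace (to_disk origin)
    with ((disk_radius 0 * cos (tm + sg * a), disk_radius 0 * sin (tm + sg * a)) : plane).
  2:{ rewrite <- to_disk_polar. unfold origin. rewrite !Rmult_0_l. reflexivity. }
  apply (polar_disk_limit (at_right a) (fun s => root M ((K s + C) / H s)) (fun s => tm + sg * s)).
  - apply (filterlim_comp _ _ _ (fun s => (K s + C) / H s) (fun v => disk_radius (root M v)) _ (at_right 0)).
    + intros P HP. apply (proj1 (at_right_iff 0 P)) in HP. destruct HP as [d [Hd HP]].
      assert (Hlim := level_limit_at_zero M lam L F G H K G_pos H_pos H_derive K_derive C a Ha E).
      assert (Hball : at_right a (fun s => Rabs ((K s + C) / H s - 0) < d)).
      { apply (Hlim (fun v => Rabs (v - 0) < d)). exists (mkposreal d Hd). intros v Hv. exact Hv. }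
      assert (Hint : at_right a (fun s => a < s < L)).
      { apply at_right_iff. exists (L - a). split; [lra|intros s Hs; lra]. }
      change (at_right a (fun s => P ((K s + C) / H s))).
      generalize (filter_and _ _ Hball Hint). apply filter_imp. intros s [S1 S2].
      apply HP. assert (K a < K s) by (apply sector_K_increasing; lra).
      assert (0 < (K s + C) / H s) by (apply Rdiv_lt_0_compat; [lra|apply H_pos; lra]).
      rewrite Rminus_0_r in S1. apply Rabs_def2 in S1. lra.
    + apply (filterlim_comp _ _ _ (root M) disk_radius _ (locally 0));
        [apply filterlim_root_0, M_pos|apply continuous_disk_radius].
  - apply (angle_limit (at_right a) a). apply (at_right_continuous (fun s => s)), continuous_id.
Qed.

(** The alpha-limits in the closed disk. The trajectories of the levels
    [C < - K0], like all of them for [0 < F 0], start at an angle inside the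
    sector, where [K + C] vanishes. *)
Definition backward_end (C : R) (z : plane) : Prop :=
  (0 < F 0 /\ z = to_disk origin) \/
  (F 0 < 0 /\ ((C < - K0 /\ z = to_disk origin) \/
               (C = - K0 /\ z = to_disk p_minus) \/
               (- K0 < C /\ z = at_infinity tm))).

(** The omega-limit is the same for all levels. *)
Definition forward_end (z : plane) : Prop :=
  (0 < F L /\ z = at_infinity (tm + sg * L)) \/ (F L < 0 /\ z = to_disk p_plus).

Lemma polar_g_tm : polar_g Q1 Q2 tm = 0.
Proof.
  assert (E := G_0). unfold sector_g in E. rewrite Rmult_0_r, Rplus_0_r in E.
  apply Rmult_integral in E. destruct E; [destruct sign_sg; lra|assumption].
Qed.

Lemma polar_g_tp : polar_g Q1 Q2 (tm + sg * L) = 0.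
Proof.
  assert (E := G_L). unfold sector_g in E.
  apply Rmult_integral in E. destruct E; [destruct sign_sg; lra|assumption].
Qed.

Lemma F_0_tm : F 0 = polar_f Q1 Q2 tm.
Proof. unfold sector_f. rewrite Rmult_0_r, Rplus_0_r. reflexivity. Qed.

Lemma p_minus_unique : F 0 < 0 -> unique (radius_equilibrium X tm) p_minus.
Proof.
  intros HF. unfold p_minus. rewrite F_0_tm in *.
  apply unique_radius_equilibrium; auto. apply polar_g_tm.
Qed.

Lemma p_plus_unique : F L < 0 -> unique (radius_equilibrium X (tm + sg * L)) p_plus.
Proof.
  intros HF. unfold p_plus. apply unique_radius_equilibrium; auto. apply polar_g_tp.
Qed.

Lemma origin_equilibrium : equilibrium X origin.
Proof.
  unfold equilibrium, system, origin. simpl.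
  assert (Z : forall Q, homogeneous_polynomial (S m) Q -> Q 0 0 = 0).
  { intros Q HQ. generalize (homogeneous_polynomial_scale (S m) Q 0 0 0 HQ).
    rewrite Rmult_0_l, pow_i by lia. rewrite Rmult_0_l. trivial. }
  rewrite !Z by assumption. f_equal; ring.
Qed.

Lemma backward_end_terminal (C : R) (z : plane) : backward_end C z -> terminal X z.
Proof.
  intros [[_ ->]|[HF [[_ ->]|[[_ ->]|[_ ->]]]]].
  - apply terminal_equilibrium, origin_equilibrium.
  - apply terminal_equilibrium, origin_equilibrium.
  - apply terminal_equilibrium, (p_minus_unique HF).
  - apply terminal_at_infinity.
Qed.

Lemma forward_end_terminal (z : plane) : forward_end z -> terminal X z.
Proof.
  intros [[_ ->]|[HF ->]].
  - apply terminal_at_infinity.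
  - apply terminal_equilibrium, (p_plus_unique HF).
Qed.

(** Since [K] increases, [K + C] is positive on an interval that ends at [L];
    its other end is [0] or a zero of [K + C]. *)
Lemma level_start (C s1 : R) :
  0 < s1 < L -> 0 < K s1 + C ->
  exists a, 0 <= a < s1 /\ (forall s, a < s < L -> 0 < K s + C) /\
    (a = 0 \/ (0 < a /\ K a + C = 0)).
Proof.
  intros Hs1 HC.
  destruct (classic (exists s, 0 < s < s1 /\ K s + C <= 0)) as [(s & Hs & Hle)|Hn].
  - destruct (intermediate_value (fun x => K x + C) s s1 0) as [a [Ha E]]; [lra| |lra|].
    + intros x Hx. apply (continuous_plus K (fun _ => C)); [|apply continuous_const].
      eapply is_derive_continuous. apply K_derive. lra.
    + assert (a <> s1) by (intros ->; lra).
      exists a. split; [lra|]. split; [|right; split; [lra|exact E]].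
      intros x Hx. assert (K a < K x) by (apply sector_K_increasing; lra). lra.
  - exists 0. split; [lra|]. split; [|left; reflexivity].
    intros x Hx. destruct (Rlt_dec x s1) as [Hlt|Hge].
    + apply Rnot_le_lt. intros Hle. apply Hn. exists x. split; [lra|exact Hle].
    + destruct (Req_dec x s1) as [->|Hne]; [exact HC|].
      assert (K s1 < K x) by (apply sector_K_increasing; lra). lra.
Qed.

(** The level decides which end of the graph occurs: for [0 < F 0], or for
    [C < - K0], the graph cannot start at the angle [0], because [K + C] is
    negative there. *)
Lemma sector_solution_ends (w1 : plane) (t1 : R) (z1 z2 : plane) :
  0 < fst w1 < L -> backward_end (level w1) z1 -> forward_end z2 ->
  exists e, solution X e /\ dom e t1 /\ e t1 = chart tm sg w1 /\
    (forall t, dom e t -> exists w, 0 < fst w < L /\ level w = level w1 /\ e t = chart tm sg w) /\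
    (F 0 < 0 -> - K0 <= level w1 ->
       forall w, 0 < fst w < L -> level w = level w1 -> image e (chart tm sg w)) /\
    tends_lo (in_disk e) z1 /\ tends_hi (in_disk e) z2.
Proof.
  intros Hw1 Hz1 Hz2.
  destruct sector_G_derive as [G' HG'].
  destruct (level_start (level w1) (fst w1)) as (a & Ha & Hpos & Hcase);
    [exact Hw1|apply level_graph, Hw1|].
  destruct (sector_solution_exists w1 a t1) as (e & E1 & E2 & E3 & E4 & E5 & E6 & E7);
    [lra|lra|exact Hpos|].
  assert (Id0 : forall x, filterlim (fun s : R => s) (at_right x) (locally x))
    by (intros x; apply (at_right_continuous (fun s => s)), continuous_id).
  assert (IdL : filterlim (fun s : R => s) (at_left L) (locally L))
    by (apply (at_left_continuous (fun s => s)), continuous_id).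
  exists e. split; [exact E1|]. split; [exact E2|]. split; [exact E3|]. split; [exact E4|].
  split.
  { intros HF HC w Hw Ew. apply E5; [|exact Ew].
    destruct Hcase as [->|[Ha0 Ea]]; [exact Hw|].
    assert (K0 < K a) by (apply K0_below; auto; lra). lra. }
  split.
  - apply E6. destruct Hcase as [->|[Ha0 Ea]].
    + destruct Hz1 as [[HF ->]|[HF [[HC ->]|[[HC ->]|[HC ->]]]]].
      * exfalso.
        assert (Hu := K_unbounded_at_0 M lam L F G G' H K M_pos lam_pos L_pos
          sector_F_continuous HG' G_0 G_pos H_pos H_derive K_derive HF (- level w1)).
        generalize (filter_and _ _ Hu (at_right_0_interior L L_pos)). intros N.
        apply at_right_iff in N. destruct N as [d [Hd N]].
        destruct (N (d / 2)) as [N1 N2]; [lra|]. specialize (Hpos (d / 2) N2). lra.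
      * exfalso.
        assert (Hgap : 0 < - K0 - level w1) by lra.
        generalize (filter_and _ _ (K0_limit HF _ Hgap) (at_right_0_interior L L_pos)). intros N.
        apply at_right_iff in N. destruct N as [d [Hd N]].
        destruct (N (d / 2)) as [N1 N2]; [lra|]. specialize (Hpos (d / 2) N2). lra.
      * assert (Hlim := level_disk_limit_finite (at_right 0) (level w1) 0 (- (lam / F 0)) (Id0 0)
          (neg_quotient_pos _ _ lam_pos HF)).
        rewrite Rmult_0_r, Rplus_0_r in Hlim. apply Hlim. rewrite HC.
        apply (separatrix_limit_at_0 M lam L F G G' H K M_pos L_pos sector_F_continuous
                 HG' G_0 G_pos H_pos H_derive K_derive HF K0 (K0_below HF) (K0_limit HF)).
      * assert (Hlim := level_disk_limit_infinite (at_right 0) (level w1) 0 (Id0 0)).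
        rewrite Rmult_0_r, Rplus_0_r in Hlim. apply Hlim.
        apply (level_limit_at_0_above M L F G G' H K) with (K0 := K0); auto using sector_F_continuous.
        lra.
    + assert (z1 = to_disk origin) as ->.
      { destruct Hz1 as [[HF ->]|[HF [[HC ->]|[[HC ->]|[HC ->]]]]]; try reflexivity;
          exfalso; assert (K0 < K a) by (apply K0_below; auto; lra); lra. }
      intros eps. apply level_disk_limit_zero; [lra|exact Ea].
  - apply E7. destruct Hz2 as [[HF ->]|[HF ->]].
    + apply (level_disk_limit_infinite (at_left L) (level w1) L IdL).
      apply (level_limit_at_L_positive M lam L F G G' H K) with (a := a); auto using sector_F_continuous.
      lra.
    + apply (level_disk_limit_finite (at_left L) (level w1) L (- (lam / F L)) IdL (neg_quotient_pos _ _ lam_pos HF)).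
      apply (level_limit_at_L_negative M lam L F G G' H K); auto using sector_F_continuous.
Qed.

(** All trajectories, and not only the explicit ones, because both ends of the
    explicit solution are terminal. *)
Lemma sector_trajectory_limits (c : curve) (t1 : R) (w1 z1 z2 : plane) :
  trajectory X c -> dom c t1 -> c t1 = chart tm sg w1 -> 0 < fst w1 < L ->
  backward_end (level w1) z1 -> forward_end z2 ->
  alpha_limit (in_disk c) z1 /\ omega_limit (in_disk c) z2.
Proof.
  intros Hc Dc Ec Hw1 Hz1 Hz2.
  destruct (sector_solution_ends w1 t1 z1 z2 Hw1 Hz1 Hz2) as (e & E1 & E2 & E3 & _ & _ & E4 & E5).
  assert (LX := system_locally_lipschitz lam (S m) Q1 Q2 Q1_homogeneous Q2_homogeneous).
  assert (Hne : ~ equilibrium X (e t1)) by (rewrite E3; apply sector_no_equilibrium, Hw1).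
  split.
  - apply (alpha_limit_in_disk_of_solution X c e t1 z1); auto.
    + rewrite Ec, E3. reflexivity.
    + apply (backward_end_terminal (level w1)), Hz1.
  - apply (omega_limit_in_disk_of_solution X c e t1 z2); auto.
    + rewrite Ec, E3. reflexivity.
    + apply forward_end_terminal, Hz2.
Qed.

Lemma sector_trajectory_exists (w1 : plane) (z1 z2 : plane) :
  0 < fst w1 < L -> backward_end (level w1) z1 -> forward_end z2 ->
  exists e, trajectory X e /\ image e (chart tm sg w1) /\
    alpha_limit (in_disk e) z1 /\ omega_limit (in_disk e) z2 /\
    (forall t, dom e t -> exists w, 0 < fst w < L /\ level w = level w1 /\ e t = chart tm sg w) /\
    (F 0 < 0 -> - K0 <= level w1 ->
       forall w, 0 < fst w < L -> level w = level w1 -> image e (chart tm sg w)).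
Proof.
  intros Hw1 Hz1 Hz2.
  destruct (sector_solution_ends w1 0 z1 z2 Hw1 Hz1 Hz2) as (e & E1 & E2 & E3 & E6 & E7 & E4 & E5).
  assert (LX := system_locally_lipschitz lam (S m) Q1 Q2 Q1_homogeneous Q2_homogeneous).
  assert (Hne : ~ equilibrium X (e 0)) by (rewrite E3; apply sector_no_equilibrium, Hw1).
  exists e. split.
  - apply (trajectory_of_terminal_limits X e 0 z1 z2); auto.
    + apply (backward_end_terminal (level w1)), Hz1.
    + apply forward_end_terminal, Hz2.
  - split; [exists 0; auto|]. split; [apply tends_lo_alpha_limit, E4|].
    split; [apply tends_hi_omega_limit, E5|]. split; [exact E6|exact E7].
Qed.

Lemma interior_chart (p : plane) : intC p -> exists w, 0 < fst w < L /\ p = chart tm sg w.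
Proof. intros Hp. apply (half_cone_interior_chart tm sg L sign_sg L_pos L_le_PI p), Hp. Qed.

Lemma chart_interior (w : plane) : 0 < fst w < L -> intC (chart tm sg w).
Proof.
  intros Hw. apply (half_cone_interior_chart tm sg L sign_sg L_pos L_le_PI).
  exists w. auto.
Qed.

Lemma no_interior_equilibrium (p : plane) : intC p -> ~ equilibrium X p.
Proof.
  intros Hp. destruct (interior_chart p Hp) as (w & Hw & ->). apply sector_no_equilibrium, Hw.
Qed.

Hypothesis F_0_nonzero : F 0 <> 0.
Hypothesis F_L_nonzero : F L <> 0.

Lemma forward_end_exists : exists z, forward_end z.
Proof.
  destruct (Rdichotomy _ _ F_L_nonzero) as [HF|HF].
  - exists (to_disk p_plus). right. auto.
  - exists (at_infinity (tm + sg * L)). left. auto.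
Qed.

Lemma backward_end_exists (C : R) : exists z, backward_end C z.
Proof.
  destruct (Rdichotomy _ _ F_0_nonzero) as [HF|HF].
  - destruct (Rtotal_order C (- K0)) as [HC|[HC|HC]].
    + exists (to_disk origin). right. auto.
    + exists (to_disk p_minus). right. auto.
    + exists (at_infinity tm). right. auto.
  - exists (to_disk origin). left. auto.
Qed.

Lemma sector_all_omega (z : plane) : forward_end z -> all_omega X intC z.
Proof.
  intros Hz c Hc (t & Dt & Ht). destruct (interior_chart _ Ht) as (w & Hw & Ew).
  destruct (backward_end_exists (level w)) as [z1 Hz1].
  apply (sector_trajectory_limits c t w z1 z Hc Dt Ew Hw Hz1 Hz).
Qed.

Lemma sector_all_alpha : 0 < F 0 -> all_alpha X intC (to_disk origin).
Proof.
  intros HF c Hc (t & Dt & Ht). destruct (interior_chart _ Ht) as (w & Hw & Ew).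
  destruct forward_end_exists as [z2 Hz2].
  apply (sector_trajectory_limits c t w _ z2 Hc Dt Ew Hw); [left; auto|exact Hz2].
Qed.

Lemma alpha_basin_chart (w z z1 : plane) :
  0 < fst w < L -> backward_end (level w) z1 ->
  alpha_basin X z (chart tm sg w) <-> z = z1.
Proof.
  intros Hw Hz1. destruct forward_end_exists as [z2 Hz2]. split.
  - intros (c & Hc & (t & Dt & Et) & Ha).
    destruct (sector_trajectory_limits c t w z1 z2 Hc Dt Et Hw Hz1 Hz2) as [A _].
    exact (alpha_limit_unique _ _ _ Ha A).
  - intros ->. destruct (sector_trajectory_exists w z1 z2 Hw Hz1 Hz2) as (e & E1 & E2 & E3 & _).
    exists e. auto.
Qed.

Section Separatrix.

Hypothesis F_0_neg : F 0 < 0.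

Lemma p_minus_not_origin : p_minus <> origin.
Proof.
  intros E. assert (P : 0 < root M (- (lam / F 0))) by apply exp_pos.
  unfold p_minus, polar_point, origin in E. injection E. intros E2 E1.
  generalize (cos_sin_square tm). intros E3.
  apply Rmult_integral in E1. apply Rmult_integral in E2.
  destruct E1 as [E1|E1]; [lra|]. destruct E2 as [E2|E2]; [lra|].
  rewrite E1, E2 in E3. lra.
Qed.

Lemma alpha_basin_origin (w : plane) :
  0 < fst w < L -> alpha_basin X (to_disk origin) (chart tm sg w) <-> level w < - K0.
Proof.
  intros Hw. destruct (backward_end_exists (level w)) as [z Hz].
  rewrite (alpha_basin_chart w _ z Hw Hz).
  destruct Hz as [[HF _]|[_ [[HC ->]|[[HC ->]|[HC ->]]]]]; [lra| | |]; split; intros E; auto; try lra.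
  - exfalso. apply to_disk_injective in E. exact (p_minus_not_origin (eq_sym E)).
  - exfalso. exact (to_disk_not_at_infinity _ _ E).
Qed.

Lemma alpha_basin_infinity (w : plane) :
  0 < fst w < L -> alpha_basin X (at_infinity tm) (chart tm sg w) <-> - K0 < level w.
Proof.
  intros Hw. destruct (backward_end_exists (level w)) as [z Hz].
  rewrite (alpha_basin_chart w _ z Hw Hz).
  destruct Hz as [[HF _]|[_ [[HC ->]|[[HC ->]|[HC ->]]]]]; [lra| | |]; split; intros E; auto; try lra.
  - exfalso. exact (to_disk_not_at_infinity _ _ (eq_sym E)).
  - exfalso. exact (to_disk_not_at_infinity _ _ (eq_sym E)).
Qed.

Lemma alpha_basin_p_minus (w : plane) :
  0 < fst w < L -> alpha_basin X (to_disk p_minus) (chart tm sg w) <-> level w = - K0.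
Proof.
  intros Hw. destruct (backward_end_exists (level w)) as [z Hz].
  rewrite (alpha_basin_chart w _ z Hw Hz).
  destruct Hz as [[HF _]|[_ [[HC ->]|[[HC ->]|[HC ->]]]]]; [lra| | |]; split; intros E; auto; try lra.
  - exfalso. apply to_disk_injective in E. exact (p_minus_not_origin E).
  - exfalso. exact (to_disk_not_at_infinity _ _ E).
Qed.

Lemma continuous_level_of_point (p : plane) :
  intC p -> continuous (fun p => level (sector_angle tm sg L p, log_radius p)) p.
Proof.
  intros Hp. apply (half_cone_interior_sector tm sg L sign_sg L_pos L_le_PI) in Hp.
  destruct Hp as [Ha Hs].
  assert (CS := continuous_sector_angle tm sg L p Ha).
  assert (CQ := continuous_log_radius tm sg L sign_sg p Ha).
  unfold level. simpl.
  apply (continuous_minus (fun p => H (sector_angle tm sg L p) * exp (M * log_radius p))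
           (fun p => K (sector_angle tm sg L p))).
  - apply (continuous_mult (fun p => H (sector_angle tm sg L p)) (fun p => exp (M * log_radius p))).
    + apply (continuous_comp (sector_angle tm sg L) H); [exact CS|].
      exact (is_derive_continuous _ _ _ (H_derive _ Hs)).
    + apply (continuous_comp log_radius (fun q => exp (M * q))); [exact CQ|].
      apply (ex_derive_continuous (V := R_NormedModule)). auto_derive. exact I.
  - apply (continuous_comp (sector_angle tm sg L) K); [exact CS|].
    exact (is_derive_continuous _ _ _ (K_derive _ Hs)).
Qed.

Lemma chart_coordinates (w : plane) :
  0 < fst w < L -> (sector_angle tm sg L (chart tm sg w), log_radius (chart tm sg w)) = w.
Proof.
  intros Hw. rewrite sector_angle_chart, log_radius_chart by assumption. destruct w; reflexivity.
Qed.

Lemma side_open (A : plane -> Prop) (P : R -> Prop) :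
  open P -> (forall w, 0 < fst w < L -> A (chart tm sg w) <-> P (level w)) ->
  open (fun p => intC p /\ A p).
Proof.
  intros HP HA p [Hp Ap].
  assert (Hopen := half_cone_interior_open tm (tm + sg * L) p Hp).
  assert (E : forall q, intC q -> A q <-> P (level (sector_angle tm sg L q, log_radius q))).
  { intros q Hq. destruct (interior_chart q Hq) as (w & Hw & ->).
    rewrite chart_coordinates by exact Hw. apply HA, Hw. }
  assert (HL : locally p (fun q => P (level (sector_angle tm sg L q, log_radius q)))).
  { apply (continuous_level_of_point p Hp P), HP, E; assumption. }
  generalize (filter_and _ _ Hopen HL). apply filter_imp. intros q [Hq1 Hq2].
  split; [exact Hq1|apply E; assumption].
Qed.

Lemma separatrix_log_radius_continuous (s : R) :
  0 < s < L -> continuous (level_log_radius (- K0)) s.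
Proof.
  intros Hs. assert (HK := K0_below F_0_neg s Hs). assert (PH := H_pos s Hs).
  apply (continuous_comp (fun s => (K s + - K0) / H s) (fun v => ln v / M)).
  - eapply is_derive_continuous.
    apply (level_derive M lam L F G H K G_pos H_pos H_derive K_derive (- K0) s Hs).
  - apply (ex_derive_continuous (V := R_NormedModule)). auto_derive.
    apply Rdiv_lt_0_compat; lra.
Qed.

Lemma level_monotone (s q q' : R) : 0 < s < L -> q < q' -> level (s, q) < level (s, q').
Proof.
  intros Hs Hq. unfold level. simpl. apply Rplus_lt_compat_r, Rmult_lt_compat_l; [apply H_pos, Hs|].
  apply exp_increasing, Rmult_lt_compat_l; assumption.
Qed.

(** The map [chart] identifies the side with the part above or below the
    graph of [level_log_radius (- K0)] (the sign [e] tells which). *)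
Lemma side_region (A : plane -> Prop) (e : R) :
  e = 1 \/ e = -1 ->
  (forall w, 0 < fst w < L -> A (chart tm sg w) <-> 0 < e * (level w - - K0)) ->
  region (fun p => intC p /\ A p).
Proof.
  intros He HA.
  set (f := level_log_radius (- K0)).
  assert (Hf : forall s, 0 < s < L -> level (s, f s) = - K0).
  { intros s Hs. apply level_of_level_log_radius; [exact Hs|].
    generalize (K0_below F_0_neg s Hs). lra. }
  assert (Hside : forall p, intC p /\ A p <->
    exists s d, 0 < s < L /\ 0 < d /\ p = chart tm sg (s, f s + e * d)).
  { intros p. split.
    - intros [Hp Ap]. destruct (interior_chart p Hp) as (w & Hw & ->).
      apply HA in Ap; [|exact Hw].
      exists (fst w), (e * (snd w - f (fst w))). split; [exact Hw|]. split.
      + apply Rnot_le_lt. intros Hle.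
        assert (Ew : w = (fst w, snd w)) by (destruct w; reflexivity).
        destruct He as [-> | ->].
        * destruct (Req_dec (snd w) (f (fst w))) as [E|Hne].
          -- rewrite Ew, E, Hf in Ap by exact Hw. lra.
          -- assert (Hlt := level_monotone (fst w) (snd w) (f (fst w)) Hw ltac:(lra)).
             rewrite Hf, <- Ew in Hlt by exact Hw. lra.
        * destruct (Req_dec (snd w) (f (fst w))) as [E|Hne].
          -- rewrite Ew, E, Hf in Ap by exact Hw. lra.
          -- assert (Hlt := level_monotone (fst w) (f (fst w)) (snd w) Hw ltac:(lra)).
             rewrite Hf, <- Ew in Hlt by exact Hw. lra.
      + f_equal. rewrite <- Rmult_assoc.
        replace (e * e) with 1 by (destruct He as [-> | ->]; ring).
        destruct w as [w1 w2]. simpl. f_equal. ring.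
    - intros (s & d & Hs & Hd & ->). split; [apply chart_interior; exact Hs|].
      apply HA; [exact Hs|]. rewrite <- (Hf s Hs).
      destruct He as [-> | ->].
      + assert (Hlt := level_monotone s (f s) (f s + 1 * d) Hs ltac:(lra)). lra.
      + assert (Hlt := level_monotone s (f s + -1 * d) (f s) Hs ltac:(lra)). lra. }
  split; [|split].
  - exists (chart tm sg (L / 2, f (L / 2) + e * 1)). apply Hside.
    exists (L / 2), 1. repeat split; lra.
  - apply (side_open A (fun C => 0 < e * (C - - K0))); [|exact HA].
    apply (open_comp (fun C => e * (C - - K0)) (fun z => 0 < z)); [|apply open_gt].
    intros C _. apply (is_derive_continuous (fun C => e * (C - - K0)) C e).
    auto_derive; [exact I|ring].
  - apply (graph_side_connected tm sg L e f); [apply separatrix_log_radius_continuous|exact Hside].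
Qed.

(** The set [W] is kept general because the separatrix appears both as an
    unstable manifold and as the image of the connection. *)
Lemma sector_splits (W : plane -> Prop) :
  (forall w, 0 < fst w < L -> W (chart tm sg w) <-> level w = - K0) ->
  splits intC W (alpha_basin X (to_disk origin)) (alpha_basin X (at_infinity tm)).
Proof.
  intros HW. split; [|split; [|split]].
  - intros p Hp. destruct (interior_chart p Hp) as (w & Hw & ->).
    rewrite (HW w Hw), (alpha_basin_origin w Hw), (alpha_basin_infinity w Hw). lra.
  - intros p Hp. destruct (interior_chart p Hp) as (w & Hw & ->).
    rewrite (alpha_basin_origin w Hw), (alpha_basin_infinity w Hw). lra.
  - apply (side_region _ (-1)); [right; reflexivity|].
    intros w Hw. rewrite (alpha_basin_origin w Hw). lra.
  - apply (side_region _ 1); [left; reflexivity|].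
    intros w Hw. rewrite (alpha_basin_infinity w Hw). lra.
Qed.

Lemma unstable_manifold_splits :
  splits intC (unstable_manifold X p_minus)
    (alpha_basin X (to_disk origin)) (alpha_basin X (at_infinity tm)).
Proof. apply sector_splits. exact alpha_basin_p_minus. Qed.

(** A single trajectory runs through the whole level [- K0], since this level is
    a graph over the whole sector. *)
Lemma separatrix_trajectory (z2 : plane) :
  forward_end z2 ->
  exists e, trajectory X e /\ alpha_limit (in_disk e) (to_disk p_minus) /\
    omega_limit (in_disk e) z2 /\ (forall t, dom e t -> intC (e t)) /\
    (forall w, 0 < fst w < L -> image e (chart tm sg w) <-> level w = - K0).
Proof.
  intros Hz2.
  set (w0 := ((L / 2, level_log_radius (- K0) (L / 2)) : plane)).
  assert (Hw0 : 0 < fst w0 < L) by (simpl; lra).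
  assert (E0 : level w0 = - K0).
  { apply level_of_level_log_radius; [exact Hw0|]. generalize (K0_below F_0_neg _ Hw0). simpl. lra. }
  destruct (sector_trajectory_exists w0 (to_disk p_minus) z2 Hw0) as (e & E1 & _ & E3 & E4 & E5 & E6);
    [right; split; [exact F_0_neg|right; left; auto]|exact Hz2|].
  exists e. split; [exact E1|]. split; [exact E3|]. split; [exact E4|]. split.
  - intros t Ht. destruct (E5 t Ht) as (w & Hw & _ & ->). apply chart_interior, Hw.
  - intros w Hw. split.
    + intros (t & Dt & Et). destruct (E5 t Dt) as (w' & Hw' & Lw' & Ew').
      rewrite Et in Ew'.
      rewrite <- (chart_coordinates w Hw), Ew', (chart_coordinates w' Hw'). lra.
    + intros Ew. apply E6; [exact F_0_neg|lra|exact Hw|lra].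
Qed.

End Separatrix.

End Sector.

(** * The angles at the infinite equilibria *)

Lemma meets_reverse (c : curve) (S : plane -> Prop) : meets (reverse_curve c) S <-> meets c S.
Proof.
  split; intros (t & Ht & HS); exists (- t).
  - apply (proj1 (dom_reverse _ _)) in Ht. split; [exact Ht|exact HS].
  - split; [apply dom_reverse; rewrite Ropp_involutive; exact Ht|].
    simpl. rewrite Ropp_involutive. exact HS.
Qed.

Lemma alpha_limit_reverse (c : curve) (z : plane) :
  alpha_limit (reverse_curve c) z <-> omega_limit c z.
Proof. rewrite <- omega_limit_reverse, reverse_curve_involutive. reflexivity. Qed.

Lemma radially_repelling_reverse (Z : plane -> plane) (ta : R) :
  radially_repelling (reverse_field Z) ta <-> radially_attracting Z ta.
Proof.
  split; intros (d & Hd & H); exists d; split; auto; intros c Hc Hm.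
  - apply alpha_limit_reverse. apply H; [|apply meets_reverse, Hm].
    apply trajectory_reverse, Hc.
  - apply omega_limit_reverse. apply H; [|apply meets_reverse, Hm].
    apply trajectory_reverse_iff, Hc.
Qed.

Lemma radially_attracting_reverse (Z : plane -> plane) (ta : R) :
  radially_attracting (reverse_field Z) ta <-> radially_repelling Z ta.
Proof.
  split; intros (d & Hd & H); exists d; split; auto; intros c Hc Hm.
  - apply omega_limit_reverse. apply H; [|apply meets_reverse, Hm].
    apply trajectory_reverse, Hc.
  - apply alpha_limit_reverse. apply H; [|apply meets_reverse, Hm].
    apply trajectory_reverse_iff, Hc.
Qed.

Lemma to_disk_horizontal_limit (y : R) :
  forall eps : posreal, Rbar_locally p_infty (fun x => ball (at_infinity 0) eps (to_disk (x, y))).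
Proof.
  intros eps. assert (Hep : 0 < eps) by apply eps.
  set (B := 1 + y ^ 2). assert (HB : 1 <= B) by (unfold B; generalize (pow2_ge_0 y); lra).
  exists (1 + (B + Rabs y) / eps). intros x Hx.
  assert (Hq : 0 < (B + Rabs y) / eps).
  { apply Rdiv_lt_0_compat; [generalize (Rabs_pos y); lra|exact Hep]. }
  assert (Hxe : B + Rabs y < eps * x).
  { apply Rmult_lt_reg_l with (/ eps); [apply Rinv_0_lt_compat, Hep|].
    rewrite <- (Rmult_assoc (/ eps)), Rinv_l, Rmult_1_l by lra.
    unfold Rdiv in Hx. rewrite Rmult_comm. lra. }
  assert (Hx1 : 1 < x) by lra.
  set (w := sqrt (1 + x ^ 2 + y ^ 2)).
  assert (H1 : 0 < 1 + x ^ 2 + y ^ 2) by (generalize (pow2_ge_0 x) (pow2_ge_0 y); lra).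
  assert (Hw : 0 < w) by (apply sqrt_lt_R0; exact H1).
  assert (Hww : w * w = x ^ 2 + B) by (unfold w, B; rewrite sqrt_sqrt; lra).
  assert (Hxw : x < w) by nra.
  apply (proj2 (ball_plane _ _ _)). unfold to_disk, at_infinity. cbv [fst snd]. fold w.
  rewrite cos_0, sin_0, Rminus_0_r. split.
  - replace (x / w - 1) with (- ((w - x) / w)) by (field; lra).
    rewrite Rabs_Ropp, Rabs_right by (apply Rle_ge, Rlt_le, Rdiv_lt_0_compat; lra).
    apply Rmult_lt_reg_r with w; [exact Hw|].
    unfold Rdiv. rewrite Rmult_assoc, Rinv_l, Rmult_1_r by lra.
    assert (E : (w - x) * (w + x) = B) by (ring_simplify; nra).
    assert (w - x < B) by nra.
    assert (eps * x < eps * w) by (apply Rmult_lt_compat_l; lra).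
    generalize (Rabs_pos y). lra.
  - unfold Rdiv. rewrite Rabs_mult, Rabs_inv, (Rabs_right w) by lra.
    apply Rmult_lt_reg_r with w; [exact Hw|].
    rewrite Rmult_assoc, Rinv_l, Rmult_1_r by lra.
    assert (eps * x < eps * w) by (apply Rmult_lt_compat_l; lra). lra.
Qed.

Lemma pow_lt_compat_pos (x y : R) (m : nat) : m <> O -> 0 < x -> x < y -> x ^ m < y ^ m.
Proof.
  intros Hm H1 H2. destruct m as [|k]; [congruence|]. clear Hm.
  induction k as [|k IH]; [simpl; lra|].
  change (x * x ^ S k < y * y ^ S k).
  apply Rmult_le_0_lt_compat; [lra|left; apply pow_lt; exact H1|exact H2|exact IH].
Qed.

(** The right-hand side [x * (f1 - mu * x ^ m)] is positive up to its first
    positive zero, which exists for [0 < mu] only. *)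
Lemma radial_interval (f1 mu : R) (m : nat) :
  m <> O -> 0 < f1 ->
  exists B : Rbar, Rbar_lt 0 B /\ (forall x, between 0 B x -> 0 < x * (f1 - mu * x ^ m)) /\
    (forall b : R, B = b -> b * (f1 - mu * b ^ m) = 0).
Proof.
  intros Hm Hf. destruct (Rlt_dec 0 mu) as [Hmu|Hmu].
  - set (b := root (INR m) (f1 / mu)).
    assert (Hq : 0 < f1 / mu) by (apply Rdiv_lt_0_compat; assumption).
    assert (Hb : 0 < b) by apply exp_pos.
    assert (Eb : b ^ m = f1 / mu) by (apply root_pow; assumption).
    exists b. split; [exact Hb|]. split.
    + intros x [H1 H2]. simpl in H1, H2. apply Rmult_lt_0_compat; [exact H1|].
      assert (Hpow : x ^ m < b ^ m).
      { apply pow_lt_compat_pos; assumption. }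
      assert (mu * x ^ m < mu * b ^ m) by (apply Rmult_lt_compat_l; assumption).
      rewrite Eb in H. replace (mu * (f1 / mu)) with f1 in H by (field; lra). lra.
    + intros b' E. injection E. intros <-. rewrite Eb. field. lra.
  - exists p_infty. split; [exact I|]. split; [|discriminate].
    intros x [H1 _]. simpl in H1. apply Rmult_lt_0_compat; [exact H1|].
    assert (0 < x ^ m) by (apply pow_lt; exact H1).
    assert (0 <= - mu * x ^ m) by (apply Rmult_le_pos; lra). lra.
Qed.

(** On the radius the field is [x * (f1 - mu * x ^ m)], whose positive
    solutions on the first interval increase from [0] to the first positive zero,
    or to infinity. To refute attraction one needs a trajectory, that is, a
    maximal solution; hence the discussion of the upper end. *)
Lemma radial_field (Z : plane -> plane) (th f1 mu : R) (m : nat) :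
  locally_lipschitz_field Z -> m <> O -> 0 < f1 ->
  (forall x, Z (x, th) = (x * (f1 - mu * x ^ m), 0)) ->
  radially_repelling Z th /\ ~ radially_attracting Z th.
Proof.
  intros LZ Hm Hf HZ.
  destruct (radial_interval f1 mu m Hm Hf) as (B & HB & Hpos & Hend).
  set (h := fun x => x * (f1 - mu * x ^ m)).
  assert (Hh : forall x, continuous h x).
  { intros x. apply (ex_derive_continuous (V := R_NormedModule)). unfold h. auto_derive. exact I. }
  assert (Hsol : forall x0 t0, between 0 B x0 -> exists (e : curve) (phi : R -> R), (forall t, e t = (phi t, th)) /\
    solution Z e /\ dom e t0 /\ e t0 = (x0, th) /\ (forall t, dom e t -> between 0 B (phi t)) /\
    (forall t u, dom e t -> dom e u -> t < u -> phi t < phi u) /\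
    (forall x, between 0 B x -> exists t, dom e t /\ phi t = x)).
  { intros x0 t0 Hx0.
    destruct (scalar_flow 0 B h x0 t0) as (l & r & phi & P1 & P2 & P3 & P4 & P5); auto.
    exists (Curve l r (fun t => (phi t, th))), phi. split; [reflexivity|].
    split; [|split; [exact P1|split; [simpl; rewrite P2; reflexivity|]]].
    - split; [apply Rbar_lt_trans with t0; apply P1|].
      intros t Ht. destruct (P3 t Ht) as [_ D].
      change (is_derive phi t (fst (Z (phi t, th))) /\ is_derive (fun _ => th) t (snd (Z (phi t, th)))).
      rewrite HZ. split; [exact D|apply (is_derive_const (V := R_NormedModule))].
    - split; [intros t Ht; apply P3, Ht|]. split; [exact P4|exact P5]. }
  assert (Heq0 : equilibrium Z (0, th)) by (unfold equilibrium; rewrite HZ; f_equal; ring).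
  assert (Hne : forall x, between 0 B x -> ~ equilibrium Z (x, th)).
  { intros x Hx E. unfold equilibrium in E. rewrite HZ in E. injection E. intros E'.
    specialize (Hpos x Hx). lra. }
  assert (Hlo : forall (e : curve) (phi : R -> R), (forall t, e t = (phi t, th)) ->
    (forall t, dom e t -> between 0 B (phi t)) ->
    (forall t u, dom e t -> dom e u -> t < u -> phi t < phi u) ->
    (forall x, between 0 B x -> exists t, dom e t /\ phi t = x) -> tends_lo e (0, th)).
  { intros e phi E P3 P4 P5 eps. assert (Hep : 0 < eps) by apply eps.
    assert (Hx : exists x, between 0 B x /\ x < eps).
    { destruct B as [b| |]; simpl in HB; [| |tauto].
      - exists (Rmin b eps / 2). assert (0 < Rmin b eps) by (apply Rmin_pos; assumption).
        assert (A1 := Rmin_l b eps). assert (A2 := Rmin_r b eps).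
        unfold between; simpl. lra.
      - exists (eps / 2). unfold between; simpl. lra. }
    destruct Hx as (x & Hx & Hxe). destruct (P5 x Hx) as (t & Dt & Et).
    exists t. split; [exact Dt|]. intros s Ds Hs. rewrite E.
    apply (proj2 (ball_plane _ _ _)). simpl. rewrite Rminus_0_r, Rminus_diag, Rabs_R0.
    split; [|exact Hep].
    assert (Hps : phi s <= x).
    { destruct (Req_dec s t) as [->|Hn]; [lra|]. rewrite <- Et. left. apply P4; auto. lra. }
    destruct (P3 s Ds) as [Hp _]. simpl in Hp. rewrite Rabs_right; lra. }
  assert (Hdelta : exists d, 0 < d /\ forall x, 0 < x < d -> between 0 B x).
  { destruct B as [b| |]; simpl in HB; [| |tauto].
    - exists b. split; [exact HB|]. intros x Hx. unfold between; simpl. lra.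
    - exists 1. split; [lra|]. intros x Hx. unfold between; simpl. lra. }
  destruct Hdelta as (d & Hd & Hdb). split.
  - exists d. split; [exact Hd|]. intros c Hc (t & Dt & Hr & Hth).
    destruct (Hsol (fst (c t)) t (Hdb _ Hr)) as (e & phi & E & S1 & S2 & S3 & S4 & S5 & S6).
    assert (Ect : c t = (fst (c t), th)) by (rewrite <- Hth; destruct (c t); reflexivity).
    apply (alpha_limit_of_solution Z c e t); auto.
    + rewrite S3. exact Ect.
    + apply (Hlo e phi); assumption.
    + rewrite S3. apply Hne, Hdb, Hr.
  - intros (d' & Hd' & Hatt).
    set (x0 := Rmin d d' / 2).
    assert (Hx0 : 0 < x0 < d /\ x0 < d').
    { unfold x0. assert (0 < Rmin d d') by (apply Rmin_pos; assumption).
      generalize (Rmin_l d d') (Rmin_r d d'). lra. }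
    destruct (Hsol x0 0 (Hdb _ (proj1 Hx0))) as (e & phi & E & S1 & S2 & S3 & S4 & S5 & S6).
    assert (Hhi : exists z, terminal Z z /\ tends_hi (in_disk e) z).
    { destruct B as [b| |]; simpl in HB; [| |tauto].
      - exists (to_disk (b, th)). split.
        + apply terminal_equilibrium. unfold equilibrium. rewrite HZ, (Hend b eq_refl). reflexivity.
        + apply tends_hi_to_disk. intros eps. assert (Hep : 0 < eps) by apply eps.
          set (x := b - Rmin b eps / 2).
          assert (Hx : between 0 b x /\ b - eps < x).
          { unfold x, between; simpl. assert (0 < Rmin b eps) by (apply Rmin_pos; assumption).
            assert (A1 := Rmin_l b eps). assert (A2 := Rmin_r b eps). lra. }
          destruct (S6 x (proj1 Hx)) as (t & Dt & Et). exists t. split; [exact Dt|].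
          intros s Ds Hs. rewrite E. apply (proj2 (ball_plane _ _ _)). simpl.
          rewrite Rminus_diag, Rabs_R0. split; [|exact Hep].
          assert (x <= phi s).
          { destruct (Req_dec s t) as [->|Hn]; [lra|]. rewrite <- Et. left. apply S5; auto. lra. }
          destruct (S4 s Ds) as [_ Hp]. simpl in Hp. rewrite Rabs_left; lra.
      - exists (at_infinity 0). split; [apply terminal_at_infinity|].
        intros eps. destruct (to_disk_horizontal_limit th eps) as [A HA].
        assert (Hx : between 0 p_infty (Rmax A 0 + 1)).
        { split; [|exact I]. simpl. generalize (Rmax_r A 0). lra. }
        destruct (S6 _ Hx) as (t & Dt & Et). exists t. split; [exact Dt|].
        intros s Ds Hs. simpl. rewrite E. apply HA.
        assert (Rmax A 0 + 1 <= phi s).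
        { destruct (Req_dec s t) as [->|Hn]; [lra|]. rewrite <- Et. left. apply S5; auto. lra. }
        generalize (Rmax_l A 0). lra. }
    destruct Hhi as (z & Tz & Hz).
    assert (Hlim := Hlo e phi E S4 S5 S6).
    assert (Htraj : trajectory Z e).
    { apply (trajectory_of_terminal_limits Z e 0 (to_disk (0, th)) z); auto.
      - rewrite S3. apply Hne, Hdb, Hx0.
      - apply tends_lo_to_disk, Hlim.
      - apply terminal_equilibrium, Heq0. }
    assert (Hom : omega_limit e (0, th)).
    { apply (Hatt e Htraj). exists 0. split; [exact S2|]. rewrite S3. split; simpl; lra. }
    assert (Hep : 0 < x0) by lra.
    destruct (proj2 (Hom (0, th)) eq_refl (mkposreal x0 Hep) 0 S2) as (s & Ds & Hs & Hb).
    apply (proj1 (ball_plane _ _ _)) in Hb. destruct Hb as [Hb _]. rewrite E in Hb. simpl in Hb.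
    assert (Hp : x0 < phi s).
    { rewrite E in S3. injection S3. intros <-. apply S5; auto. }
    rewrite Rminus_0_r in Hb. apply Rabs_def2 in Hb. lra.
Qed.

Lemma system_at_infinity_radius (lambda : R) (m : nat) (Q1 Q2 : R -> R -> R) (th x : R) :
  polar_g Q1 Q2 th = 0 ->
  system_at_infinity lambda (S m) Q1 Q2 (x, th) =
    (x * (- polar_f Q1 Q2 th - lambda * x ^ m), 0).
Proof.
  intros Hg. unfold system_at_infinity. simpl fst. simpl snd. rewrite Hg. simpl. f_equal. ring.
Qed.

(** The linear part on the radius is [- f * R]; for [0 < f], time is
    reversed. *)
Lemma radially_repelling_iff (lambda : R) (m : nat) (Q1 Q2 : R -> R -> R) (th : R) :
  homogeneous_polynomial (S m) Q1 -> homogeneous_polynomial (S m) Q2 -> m <> O ->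
  polar_g Q1 Q2 th = 0 -> polar_f Q1 Q2 th <> 0 ->
  let Z := system_at_infinity lambda (S m) Q1 Q2 in
  (radially_repelling Z th <-> polar_f Q1 Q2 th < 0) /\
  (radially_attracting Z th <-> 0 < polar_f Q1 Q2 th).
Proof.
  intros H1 H2 Hm Hg Hf Z.
  assert (LZ : locally_lipschitz_field Z) by (apply system_at_infinity_locally_lipschitz; assumption).
  assert (HZ := fun x => system_at_infinity_radius lambda m Q1 Q2 th x Hg).
  destruct (Rdichotomy _ _ Hf) as [Hneg|Hpos].
  - destruct (radial_field Z th (- polar_f Q1 Q2 th) lambda m LZ Hm) as [A B]; [lra|exact HZ|].
    split; split; intros; try lra; tauto.
  - destruct (radial_field (reverse_field Z) th (polar_f Q1 Q2 th) (- lambda) m) as [A B]; auto.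
    + apply locally_lipschitz_reverse, LZ.
    + intros x. unfold reverse_field, Z. rewrite HZ. simpl. f_equal; ring.
    + apply (proj1 (radially_repelling_reverse _ _)) in A.
      assert (B' : ~ radially_repelling Z th).
      { intros K. apply B. apply radially_attracting_reverse, K. }
      split; split; intros; try lra; tauto.
Qed.

(** * The flow on the line at infinity *)

(** On the circle at infinity the field is the scalar equation
    [s' = G s]. *)
Lemma line_trajectory_limits (lambda : R) (m : nat) (Q1 Q2 : R -> R -> R) (tm sg L : R) (c : curve) (t : R) :
  homogeneous_polynomial (S m) Q1 -> homogeneous_polynomial (S m) Q2 ->
  sg = 1 \/ sg = -1 -> 0 < L ->
  polar_g Q1 Q2 tm = 0 -> polar_g Q1 Q2 (tm + sg * L) = 0 ->
  (forall s, 0 < s < L -> 0 < sector_g Q1 Q2 tm sg s) ->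
  trajectory (system_at_infinity lambda (S m) Q1 Q2) c -> dom c t ->
  fst (c t) = 0 -> strictly_between tm (tm + sg * L) (snd (c t)) ->
  alpha_limit c (0, tm) /\ omega_limit c (0, tm + sg * L).
Proof.
  intros H1 H2 Hsg HL Hg0 HgL Hpos Hc Dt Hr Hb.
  set (Z := system_at_infinity lambda (S m) Q1 Q2) in *.
  assert (LZ : locally_lipschitz_field Z) by (apply system_at_infinity_locally_lipschitz; assumption).
  assert (HZ : forall th, Z (0, th) = (0, polar_g Q1 Q2 th)).
  { intros th. unfold Z, system_at_infinity. simpl. f_equal. ring. }
  assert (Hsq : sg * sg = 1) by exact (sign_square sg Hsg).
  set (s0 := sg * (snd (c t) - tm)).
  assert (Hs0 : between 0 L s0).
  { unfold between, s0, strictly_between in *. simpl. destruct Hsg as [E|E]; rewrite E in *; lra. }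
  assert (Es0 : tm + sg * s0 = snd (c t)).
  { unfold s0. rewrite <- Rmult_assoc, Hsq. ring. }
  destruct (scalar_flow 0 L (sector_g Q1 Q2 tm sg) s0 t) as (l & r & phi & P1 & P2 & P3 & P4 & P5).
  - exact Hs0.
  - intros s _. apply (continuous_mult (fun _ => sg) (fun s => polar_g Q1 Q2 (tm + sg * s)));
      [apply continuous_const|].
    apply (continuous_comp (fun s => tm + sg * s) (polar_g Q1 Q2)).
    + apply (is_derive_continuous (fun s => tm + sg * s) s sg). auto_derive; [exact I|ring].
    + apply continuously_differentiable_continuous, (polar_g_continuously_differentiable (S m)); assumption.
  - intros s Hs. apply Hpos, Hs.
  - set (e := Curve l r (fun t => (0, tm + sg * phi t))).
    assert (He : solution Z e).
    { split; [apply Rbar_lt_trans with t; apply P1|].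
      intros u Hu. destruct (P3 u Hu) as [_ D].
      change (is_derive (fun _ : R => 0) u (fst (Z (0, tm + sg * phi u))) /\
              is_derive (fun t => tm + sg * phi t) u (snd (Z (0, tm + sg * phi u)))).
      rewrite HZ. split; [apply (is_derive_const (V := R_NormedModule))|].
      evar_last.
      - apply (is_derive_comp_R (fun s => tm + sg * s) phi); [|exact D].
        auto_derive; [exact I|reflexivity].
      - unfold sector_g. simpl. transitivity ((sg * sg) * polar_g Q1 Q2 (tm + sg * phi u));
          [ring|rewrite Hsq; ring]. }
    assert (Eet : e t = (0, snd (c t))) by (simpl; rewrite P2, Es0; reflexivity).
    assert (Ect : c t = e t) by (rewrite Eet, <- Hr; destruct (c t); reflexivity).
    assert (HR : runs_through l r phi 0 L).
    { split; [intros u Hu; apply P3, Hu|split; [exact P4|exact P5]]. }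
    assert (Hlim : forall b eps : R, 0 < eps -> forall s, Rabs (s - b) < eps ->
      ball ((0, tm + sg * b) : plane) eps ((0, tm + sg * s) : plane)).
    { intros b eps Hep s Hs. apply (proj2 (ball_plane _ _ _)). simpl.
      rewrite Rminus_diag, Rabs_R0. split; [exact Hep|].
      replace (tm + sg * s - (tm + sg * b)) with (sg * (s - b)) by ring.
      rewrite Rabs_mult. replace (Rabs sg) with 1; [lra|].
      destruct Hsg as [->| ->]; [rewrite Rabs_right; lra|rewrite Rabs_left; lra]. }
    assert (Hne : ~ equilibrium Z (e t)).
    { rewrite Eet. unfold equilibrium. rewrite HZ. intros E. injection E. intros E'.
      assert (P := Hpos s0 Hs0). unfold sector_g in P. rewrite Es0, E' in P. lra. }
    split.
    + apply (alpha_limit_of_solution Z c e t); auto.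
      * apply (runs_through_tends_lo l r phi 0 L (fun s => (0, tm + sg * s))); [exact HL|exact HR|].
        intros eps. apply at_right_iff. exists eps. split; [apply eps|]. intros s Hs.
        replace tm with (tm + sg * 0) at 1 by ring. apply Hlim; [apply eps|].
        rewrite Rabs_right; lra.
      * unfold equilibrium. rewrite HZ, Hg0. reflexivity.
    + apply (omega_limit_of_solution Z c e t); auto.
      * apply (runs_through_tends_hi l r phi 0 L (fun s => (0, tm + sg * s))); [exact HL|exact HR|].
        intros eps. apply at_left_iff. exists eps. split; [apply eps|]. intros s Hs.
        apply Hlim; [apply eps|]. rewrite Rabs_left; lra.
      * unfold equilibrium. rewrite HZ, HgL. reflexivity.
Qed.

Lemma strictly_between_comm (a b x : R) : strictly_between a b x <-> strictly_between b a x.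
Proof. unfold strictly_between. tauto. Qed.

Lemma line_angles (lambda : R) (m : nat) (Q1 Q2 : R -> R -> R) (tm sg L : R) :
  homogeneous_polynomial (S m) Q1 -> homogeneous_polynomial (S m) Q2 ->
  sg = 1 \/ sg = -1 -> 0 < L ->
  polar_g Q1 Q2 tm = 0 -> polar_g Q1 Q2 (tm + sg * L) = 0 ->
  (forall s, 0 < s < L -> 0 < sector_g Q1 Q2 tm sg s) ->
  line_repelling (system_at_infinity lambda (S m) Q1 Q2) tm (tm + sg * L) /\
  line_attracting (system_at_infinity lambda (S m) Q1 Q2) (tm + sg * L) tm.
Proof.
  intros H1 H2 Hsg HL Hg0 HgL Hpos.
  split; exists 1; (split; [lra|]); intros c Hc (t & Dt & Hr & Hb & _).
  - apply (line_trajectory_limits lambda m Q1 Q2 tm sg L c t); assumption.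
  - apply strictly_between_comm in Hb.
    apply (line_trajectory_limits lambda m Q1 Q2 tm sg L c t); assumption.
Qed.

(** In the direction of the line, the point [tm] is repelling and the point
    [tp] attracting in all the cases; what distinguishes them is the behaviour
    on the two radii. *)
Lemma cases_iff_signs (lambda : R) (m : nat) (Q1 Q2 : R -> R -> R) (tm sg L : R) :
  homogeneous_polynomial (S m) Q1 -> homogeneous_polynomial (S m) Q2 -> m <> O ->
  sg = 1 \/ sg = -1 -> 0 < L ->
  polar_g Q1 Q2 tm = 0 -> polar_g Q1 Q2 (tm + sg * L) = 0 ->
  (forall s, 0 < s < L -> 0 < sector_g Q1 Q2 tm sg s) ->
  polar_f Q1 Q2 tm <> 0 -> polar_f Q1 Q2 (tm + sg * L) <> 0 ->
  let Z := system_at_infinity lambda (S m) Q1 Q2 in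
  let tp := tm + sg * L in
  (case_a Z tm tp <-> polar_f Q1 Q2 tm < 0 /\ 0 < polar_f Q1 Q2 tp) /\
  (case_b Z tm tp <-> 0 < polar_f Q1 Q2 tm /\ polar_f Q1 Q2 tp < 0) /\
  (case_c Z tm tp <-> 0 < polar_f Q1 Q2 tm /\ 0 < polar_f Q1 Q2 tp) /\
  (case_d Z tm tp <-> polar_f Q1 Q2 tm < 0 /\ polar_f Q1 Q2 tp < 0).
Proof.
  intros H1 H2 Hm Hsg HL Hg0 HgL Hpos Hf0 HfL Z tp.
  destruct (line_angles lambda m Q1 Q2 tm sg L) as [A1 A2]; auto.
  destruct (radially_repelling_iff lambda m Q1 Q2 tm) as [B1 B2]; auto.
  destruct (radially_repelling_iff lambda m Q1 Q2 tp) as [C1 C2]; auto.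
  fold Z in A1, A2, B1, B2, C1, C2. fold tp in A1, A2.
  unfold case_a, case_b, case_c, case_d, angle_Pminus, angle_Pplus, angle_Hminus, angle_Hplus.
  tauto.
Qed.

(** * Orientation and opening of the half-cone *)

(** The angle is close to [ta] at some time and close to [tb] at another, and
    takes the intermediate values. *)
Lemma connection_meets_line (Z : plane -> plane) (c : curve) (ta tb : R) :
  ta <> tb -> connection_at_infinity Z c ta tb ->
  exists t, dom c t /\ fst (c t) = 0 /\ strictly_between ta tb (snd (c t)).
Proof.
  intros Hne (Hc & Hline & Ha & Hb).
  assert (Hd : exists t, dom c t).
  { destruct Hc as [[Hlt _] _].
    destruct (Rbar_lt_lo_hi_point (lo c) (hi c) Hlt) as [t Ht]. exists t. exact Ht. }
  destruct Hd as [t0 Dt0].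
  assert (Hep : 0 < Rabs (tb - ta) / 4).
  { generalize (Rabs_pos_lt (tb - ta) ltac:(lra)). lra. }
  set (eps := mkposreal _ Hep).
  destruct (proj2 (Ha (0, ta)) eq_refl eps t0 Dt0) as (t1 & D1 & _ & B1).
  destruct (proj2 (Hb (0, tb)) eq_refl eps t0 Dt0) as (t2 & D2 & _ & B2).
  apply (proj1 (ball_plane _ _ _)) in B1. apply (proj1 (ball_plane _ _ _)) in B2.
  destruct B1 as [_ B1], B2 as [_ B2].
  change (Rabs (snd (c t1) - ta) < Rabs (tb - ta) / 4) in B1.
  change (Rabs (snd (c t2) - tb) < Rabs (tb - ta) / 4) in B2.
  assert (Cth : forall t, dom c t -> continuous (fun t => snd (c t)) t).
  { intros t Ht. apply (solution_continuous Z c t (proj1 Hc) Ht). }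
  assert (Dbet : forall t, Rmin t1 t2 <= t <= Rmax t1 t2 -> dom c t).
  { intros t Ht. unfold Rmin, Rmax in Ht. destruct (Rle_dec t1 t2).
    - apply (dom_between c t1 t2); auto.
    - apply (dom_between c t2 t1); auto. }
  assert (Hmm : Rmin t1 t2 <= Rmax t1 t2).
  { unfold Rmin, Rmax. destruct (Rle_dec t1 t2); lra. }
  set (mid := (ta + tb) / 2).
  assert (Hmid : exists t, Rmin t1 t2 <= t <= Rmax t1 t2 /\ snd (c t) = mid).
  { set (k := if Rle_dec (snd (c (Rmin t1 t2))) (snd (c (Rmax t1 t2))) then 1 else -1).
    destruct (intermediate_value (fun t => k * snd (c t)) (Rmin t1 t2) (Rmax t1 t2) (k * mid)) as (t & Ht & E).
    - exact Hmm.
    - intros t Ht. apply (continuous_mult (fun _ => k) (fun t => snd (c t)));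
        [apply continuous_const|apply Cth, Dbet, Ht].
    - assert (Hcase : (Rmin t1 t2 = t1 /\ Rmax t1 t2 = t2) \/ (Rmin t1 t2 = t2 /\ Rmax t1 t2 = t1)).
      { unfold Rmin, Rmax. destruct (Rle_dec t1 t2); auto. }
      unfold k, mid. clear k mid. revert B1 B2. unfold Rabs. intros B1 B2.
      destruct Hcase as [[E1 E2]|[E1 E2]]; rewrite E1, E2; destruct (Rle_dec _ _); repeat destruct (Rcase_abs _); lra.
    - exists t. split; [exact Ht|].
      apply Rmult_eq_reg_l with k; [exact E|]. unfold k. destruct (Rle_dec _ _); lra. }
  destruct Hmid as (t & Ht & E). exists t. split; [apply Dbet, Ht|].
  split; [apply Hline, Dbet, Ht|]. rewrite E. unfold strictly_between, mid. lra.
Qed.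

(** * Global solutions of Lipschitz systems *)

Definition lipschitz (h : plane -> R) (K : R) : Prop :=
  forall p q : plane, Rabs (h p - h q) <= K * (Rabs (fst p - fst q) + Rabs (snd p - snd q)).

Definition flows (W : plane -> plane) (x y : R -> R) (t : R) : Prop :=
  is_derive x t (fst (W (x t, y t))) /\ is_derive y t (snd (W (x t, y t))).

(** Integration divides the weight [exp (c * |t|)] by [c], so that for large
    [c] the Picard iteration contracts on the whole line. *)
Lemma derivative_domination (f f' : R -> R) (c B : R) :
  0 < c -> 0 <= B -> f 0 = 0 -> (forall t, is_derive f t (f' t)) ->
  (forall t, Rabs (f' t) <= c * B * exp (c * Rabs t)) ->
  forall t, Rabs (f t) <= B * exp (c * Rabs t).
Proof.
  intros Hc HB.
  assert (Hpos : forall f f' : R -> R, f 0 = 0 -> (forall t, is_derive f t (f' t)) ->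
    (forall t, Rabs (f' t) <= c * B * exp (c * Rabs t)) ->
    forall t, 0 <= t -> Rabs (f t) <= B * exp (c * Rabs t)).
  { clear f f'. intros f f' H0 Hd Hb t Ht.
    assert (De : forall s, is_derive (fun s => B * exp (c * s)) s (c * B * exp (c * s))).
    { intros s. auto_derive; [exact I|ring]. }
    assert (E0 : B * exp (c * 0) = B) by (rewrite Rmult_0_r, exp_0; ring).
    assert (U : B * exp (c * 0) - f 0 <= B * exp (c * t) - f t).
    { apply (nondecreasing_of_derive (fun s => B * exp (c * s) - f s)
               (fun s => c * B * exp (c * s) - f' s)); [exact Ht| |].
      - intros s _. apply is_derive_minus_R; auto.
      - intros s Hs. specialize (Hb s). rewrite (Rabs_right s) in Hb by lra.
        generalize (Rle_abs (f' s)). lra. }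
    assert (V : B * exp (c * 0) + f 0 <= B * exp (c * t) + f t).
    { apply (nondecreasing_of_derive (fun s => B * exp (c * s) + f s)
               (fun s => c * B * exp (c * s) + f' s)); [exact Ht| |].
      - intros s _. apply is_derive_plus_R; auto.
      - intros s Hs. specialize (Hb s). rewrite (Rabs_right s) in Hb by lra.
        generalize (Rle_abs (- f' s)). rewrite Rabs_Ropp. lra. }
    rewrite (Rabs_right t) by lra. apply Rabs_le. lra. }
  intros H0 Hd Hb t. destruct (Rle_dec 0 t) as [Ht|Ht]; [apply (Hpos f f'); auto|].
  assert (E : Rabs (f (- - t)) <= B * exp (c * Rabs (- t))).
  { apply (Hpos (fun u => f (- u)) (fun u => - f' (- u))); [rewrite Ropp_0; exact H0| | |lra].
    - intros s. replace (- f' (- s)) with (f' (- s) * -1) by ring.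
      apply (is_derive_comp_R f (fun u => - u)); [apply Hd|]. auto_derive; [exact I|reflexivity].
    - intros s. rewrite Rabs_Ropp, <- (Rabs_Ropp s). apply Hb. }
  rewrite Ropp_involutive, Rabs_Ropp in E. exact E.
Qed.

Lemma half_pow_small (A e : R) : 0 <= A -> 0 < e -> exists N, forall n, (N <= n)%nat -> A * (1 / 2) ^ n < e.
Proof.
  intros HA He.
  destruct (pow_lt_1_zero (1 / 2) ltac:(rewrite Rabs_right; lra) (e / (A + 1))) as [N HN].
  { apply Rdiv_lt_0_compat; lra. }
  exists N. intros n Hn. specialize (HN n Hn).
  assert (Hp : 0 < (1 / 2) ^ n) by (apply pow_lt; lra).
  rewrite Rabs_right in HN by lra.
  apply Rmult_lt_compat_l with (r := A + 1) in HN; [|lra].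
  replace ((A + 1) * (e / (A + 1))) with e in HN by (field; lra). nra.
Qed.

Section Picard.

Variable W : plane -> plane.
Variable K : R.
Hypothesis K_ge_1 : 1 <= K.
Hypothesis W1_lipschitz : lipschitz (fun p => fst (W p)) K.
Hypothesis W2_lipschitz : lipschitz (fun p => snd (W p)) K.
Variable p0 : plane.

Lemma lipschitz_comp_continuous (h : plane -> R) (x y : R -> R) (t : R) :
  lipschitz h K -> continuous x t -> continuous y t -> continuous (fun s => h (x s, y s)) t.
Proof.
  intros Hh Hx Hy P [eps HP].
  assert (He : 0 < eps / (2 * K)) by (apply Rdiv_lt_0_compat; [apply eps|lra]).
  set (e := mkposreal _ He).
  assert (B1 : locally t (fun s => ball (x t) e (x s))) by exact (Hx _ (locally_ball _ e)).
  assert (B2 : locally t (fun s => ball (y t) e (y s))) by exact (Hy _ (locally_ball _ e)).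
  change (locally t (fun s => P (h (x s, y s)))).
  generalize (filter_and _ _ B1 B2). apply filter_imp. intros s [S1 S2]. apply HP.
  change (Rabs (x s - x t) < eps / (2 * K)) in S1.
  change (Rabs (y s - y t) < eps / (2 * K)) in S2.
  change (Rabs (h (x s, y s) - h (x t, y t)) < eps).
  eapply Rle_lt_trans; [apply Hh|]. simpl.
  assert (E : K * (eps / (2 * K) + eps / (2 * K)) = eps) by (field; lra).
  rewrite <- E. apply Rmult_lt_compat_l; lra.
Qed.

Fixpoint picard (k : nat) : (R -> R) * (R -> R) :=
  match k with
  | O => (fun _ => fst p0, fun _ => snd p0)
  | S k => (fun t => fst p0 + RInt (fun u => fst (W (fst (picard k) u, snd (picard k) u))) 0 t,
            fun t => snd p0 + RInt (fun u => snd (W (fst (picard k) u, snd (picard k) u))) 0 t)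
  end.

Lemma primitive_derive (f : R -> R) (a : R) :
  (forall t, continuous f t) -> forall t, is_derive (fun t => a + RInt f 0 t) t (f t).
Proof.
  intros Hf t. rewrite <- (Rplus_0_l (f t)).
  apply (is_derive_plus_R (fun _ => a) (fun t => RInt f 0 t)); [apply (is_derive_const (V := R_NormedModule))|].
  apply is_derive_RInt with 0; [|apply Hf].
  apply filter_forall. intros u.
  apply (RInt_correct (V := R_CompleteNormedModule)), (ex_RInt_continuous (V := R_CompleteNormedModule)).
  intros z _. apply Hf.
Qed.

Lemma picard_continuous (k : nat) (t : R) :
  continuous (fst (picard k)) t /\ continuous (snd (picard k)) t.
Proof.
  revert t. induction k as [|k IH]; intros t; [split; apply continuous_const|].
  split; simpl; eapply is_derive_continuous, primitive_derive; intros u.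
  - apply (lipschitz_comp_continuous (fun p => fst (W p)) (fst (picard k)) (snd (picard k)) u); auto; apply IH.
  - apply (lipschitz_comp_continuous (fun p => snd (W p)) (fst (picard k)) (snd (picard k)) u); auto; apply IH.
Qed.

Lemma picard_derive (k : nat) (t : R) :
  is_derive (fst (picard (S k))) t (fst (W (fst (picard k) t, snd (picard k) t))) /\
  is_derive (snd (picard (S k))) t (snd (W (fst (picard k) t, snd (picard k) t))).
Proof.
  split; simpl.
  - apply (primitive_derive (fun u => fst (W (fst (picard k) u, snd (picard k) u)))). intros u.
    apply (lipschitz_comp_continuous (fun p => fst (W p))); auto; apply picard_continuous.
  - apply (primitive_derive (fun u => snd (W (fst (picard k) u, snd (picard k) u)))). intros u.
    apply (lipschitz_comp_continuous (fun p => snd (W p))); auto; apply picard_continuous.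
Qed.

Lemma picard_initial (k : nat) : fst (picard k) 0 = fst p0 /\ snd (picard k) 0 = snd p0.
Proof.
  destruct k as [|k]; [split; reflexivity|].
  simpl. rewrite !RInt_point. unfold zero; simpl. split; ring.
Qed.

Let A : R := Rabs (fst (W p0)) + Rabs (snd (W p0)).

(** One step multiplies the weighted bound by [2 * K / (4 * K) = 1 / 2]. *)
Lemma picard_step (k : nat) (t : R) :
  Rabs (fst (picard (S k)) t - fst (picard k) t) <= A * (1 / 2) ^ k * exp (4 * K * Rabs t) /\
  Rabs (snd (picard (S k)) t - snd (picard k) t) <= A * (1 / 2) ^ k * exp (4 * K * Rabs t).
Proof.
  assert (HA : 0 <= A) by (unfold A; generalize (Rabs_pos (fst (W p0))) (Rabs_pos (snd (W p0))); lra).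
  revert t. induction k as [|k IH]; intros t.
  - assert (Hexp : forall t, 1 <= exp (4 * K * Rabs t)).
    { intros u. rewrite <- exp_0. destruct (Req_dec u 0) as [->|Hu].
      - rewrite Rabs_R0, Rmult_0_r. lra.
      - left. apply exp_increasing. apply Rmult_lt_0_compat; [lra|apply Rabs_pos_lt, Hu]. }
    assert (Hconst : forall w, Rabs w <= A -> forall t, Rabs w <= 4 * K * A * exp (4 * K * Rabs t)).
    { intros w Hw u. specialize (Hexp u).
      assert (A * 1 <= A * (4 * K * exp (4 * K * Rabs u))) by (apply Rmult_le_compat_l; nra). lra. }
    destruct (picard_initial 1) as [I1 I2].
    rewrite pow_O, Rmult_1_r. split.
    + apply (derivative_domination (fun t => fst (picard 1) t - fst p0) (fun _ => fst (W p0)) (4 * K) A);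
        [lra|exact HA|rewrite I1; ring| |].
      * intros u. rewrite <- (Rminus_0_r (fst (W p0))).
        apply (is_derive_minus_R (fst (picard 1)) (fun _ => fst p0)).
        -- generalize (proj1 (picard_derive 0 u)). simpl. destruct p0; trivial.
        -- apply (is_derive_const (V := R_NormedModule)).
      * apply Hconst. unfold A. generalize (Rabs_pos (snd (W p0))). lra.
    + apply (derivative_domination (fun t => snd (picard 1) t - snd p0) (fun _ => snd (W p0)) (4 * K) A);
        [lra|exact HA|rewrite I2; ring| |].
      * intros u. rewrite <- (Rminus_0_r (snd (W p0))).
        apply (is_derive_minus_R (snd (picard 1)) (fun _ => snd p0)).
        -- generalize (proj2 (picard_derive 0 u)). simpl. destruct p0; trivial.
        -- apply (is_derive_const (V := R_NormedModule)).
      * apply Hconst. unfold A. generalize (Rabs_pos (fst (W p0))). lra.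
  - destruct (picard_initial (S (S k))) as [I1 I2]. destruct (picard_initial (S k)) as [I3 I4].
    assert (HB : 0 <= A * (1 / 2) ^ S k) by (apply Rmult_le_pos; [exact HA|apply pow_le; lra]).
    assert (Hdom : forall h, lipschitz h K -> forall u,
      Rabs (h (fst (picard (S k)) u, snd (picard (S k)) u) - h (fst (picard k) u, snd (picard k) u))
        <= 4 * K * (A * (1 / 2) ^ S k) * exp (4 * K * Rabs u)).
    { intros h Hh u. destruct (IH u) as [J1 J2].
      eapply Rle_trans; [apply Hh|]. cbv [fst snd]. fold (fst (picard (S k))) (snd (picard (S k))).
      apply Rle_trans with (K * (A * (1 / 2) ^ k * exp (4 * K * Rabs u) + A * (1 / 2) ^ k * exp (4 * K * Rabs u))).
      - apply Rmult_le_compat_l; [lra|]. apply Rplus_le_compat; assumption.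
      - right. rewrite <- tech_pow_Rmult. field. }
    split.
    + apply (derivative_domination (fun t => fst (picard (S (S k))) t - fst (picard (S k)) t)
        (fun u => fst (W (fst (picard (S k)) u, snd (picard (S k)) u)) - fst (W (fst (picard k) u, snd (picard k) u)))
        (4 * K) (A * (1 / 2) ^ S k)); [lra|exact HB|rewrite I1, I3; ring| |].
      * intros u. apply (is_derive_minus_R (fst (picard (S (S k)))) (fst (picard (S k)))); apply picard_derive.
      * intros u. apply (Hdom (fun p => fst (W p)) W1_lipschitz u).
    + apply (derivative_domination (fun t => snd (picard (S (S k))) t - snd (picard (S k)) t)
        (fun u => snd (W (fst (picard (S k)) u, snd (picard (S k)) u)) - snd (W (fst (picard k) u, snd (picard k) u)))
        (4 * K) (A * (1 / 2) ^ S k)); [lra|exact HB|rewrite I2, I4; ring| |].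
      * intros u. apply (is_derive_minus_R (snd (picard (S (S k)))) (snd (picard (S k)))); apply picard_derive.
      * intros u. apply (Hdom (fun p => snd (W p)) W2_lipschitz u).
Qed.

End Picard.

Lemma geometric_limit (u : nat -> R) (B : R) :
  (forall k, Rabs (u (S k) - u k) <= B * (1 / 2) ^ k) ->
  exists l, forall k, Rabs (l - u k) <= 2 * B * (1 / 2) ^ k.
Proof.
  intros Hu.
  assert (HB : 0 <= B).
  { generalize (Hu O) (Rabs_pos (u 1%nat - u O)). rewrite pow_O. lra. }
  assert (Hkj : forall k j, Rabs (u (k + j)%nat - u k) <= 2 * B * (1 / 2) ^ k - 2 * B * (1 / 2) ^ (k + j)).
  { intros k j. induction j as [|j IH].
    - rewrite Nat.add_0_r, Rminus_diag, Rabs_R0. lra.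
    - rewrite Nat.add_succ_r.
      replace (u (S (k + j)) - u k) with ((u (S (k + j)) - u (k + j)%nat) + (u (k + j)%nat - u k)) by ring.
      eapply Rle_trans; [apply Rabs_triang|]. specialize (Hu (k + j)%nat).
      rewrite <- tech_pow_Rmult. lra. }
  assert (Hcv : forall k n, (k <= n)%nat -> Rabs (u n - u k) <= 2 * B * (1 / 2) ^ k).
  { intros k n Hkn. replace n with (k + (n - k))%nat by lia. eapply Rle_trans; [apply Hkj|].
    assert (0 <= 2 * B * (1 / 2) ^ (k + (n - k))) by (apply Rmult_le_pos; [lra|apply pow_le; lra]). lra. }
  destruct (Rcomplete.R_complete u) as [l Hl].
  { intros e He. destruct (half_pow_small (4 * B) e) as [N HN]; [lra|exact He|].
    exists N. intros n m Hn Hm. unfold Rdist.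
    replace (u n - u m) with ((u n - u N) - (u m - u N)) by ring.
    eapply Rle_lt_trans; [apply Rabs_triang|]. rewrite Rabs_Ropp.
    specialize (HN N (le_n N)).
    assert (H1 := Hcv N n Hn). assert (H2 := Hcv N m Hm). lra. }
  exists l. intros k. apply Rnot_lt_le. intros Hlt.
  set (e := Rabs (l - u k) - 2 * B * (1 / 2) ^ k). assert (He : 0 < e) by (unfold e; lra).
  destruct (Hl e He) as [N HN].
  specialize (HN (max N k) (Nat.le_max_l _ _)). unfold Rdist in HN.
  assert (H1 := Hcv k (max N k) (Nat.le_max_r _ _)).
  assert (H2 : Rabs (l - u k) <= Rabs (u (max N k) - l) + Rabs (u (max N k) - u k)).
  { replace (l - u k) with (- (u (max N k) - l) + (u (max N k) - u k)) by ring.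
    eapply Rle_trans; [apply Rabs_triang|]. rewrite Rabs_Ropp. lra. }
  unfold e in HN. lra.
Qed.

(** The iterates converge uniformly on bounded intervals, and so do their
    derivatives. *)
Lemma global_solution_exists (W : plane -> plane) (K : R) (p0 : plane) :
  lipschitz (fun p => fst (W p)) K -> lipschitz (fun p => snd (W p)) K ->
  exists x y, x 0 = fst p0 /\ y 0 = snd p0 /\ forall t, flows W x y t.
Proof.
  intros HW1 HW2. set (K1 := Rabs K + 1).
  assert (HK1 : 1 <= K1) by (unfold K1; generalize (Rabs_pos K); lra).
  assert (Hup : forall h, lipschitz h K -> lipschitz h K1).
  { intros h Hh p q. eapply Rle_trans; [apply Hh|]. apply Rmult_le_compat_r.
    - generalize (Rabs_pos (fst p - fst q)) (Rabs_pos (snd p - snd q)). lra.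
    - unfold K1. generalize (Rle_abs K). lra. }
  apply Hup in HW1. apply Hup in HW2. clear Hup.
  set (A := Rabs (fst (W p0)) + Rabs (snd (W p0))).
  assert (HA : 0 <= A) by (unfold A; generalize (Rabs_pos (fst (W p0))) (Rabs_pos (snd (W p0))); lra).
  set (P := picard W p0).
  assert (Hstep := picard_step W K1 HK1 HW1 HW2 p0). fold P A in Hstep.
  assert (Hx : forall t, exists l, forall k, Rabs (l - fst (P k) t) <= 2 * (A * exp (4 * K1 * Rabs t)) * (1 / 2) ^ k).
  { intros t. apply geometric_limit. intros k. destruct (Hstep k t) as [H _]. lra. }
  assert (Hy : forall t, exists l, forall k, Rabs (l - snd (P k) t) <= 2 * (A * exp (4 * K1 * Rabs t)) * (1 / 2) ^ k).
  { intros t. apply geometric_limit. intros k. destruct (Hstep k t) as [_ H]. lra. }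
  set (x := fun t => proj1_sig (constructive_indefinite_description _ (Hx t))).
  set (y := fun t => proj1_sig (constructive_indefinite_description _ (Hy t))).
  assert (Ex : forall t k, Rabs (x t - fst (P k) t) <= 2 * (A * exp (4 * K1 * Rabs t)) * (1 / 2) ^ k).
  { intros t. unfold x. apply (proj2_sig (constructive_indefinite_description _ (Hx t))). }
  assert (Ey : forall t k, Rabs (y t - snd (P k) t) <= 2 * (A * exp (4 * K1 * Rabs t)) * (1 / 2) ^ k).
  { intros t. unfold y. apply (proj2_sig (constructive_indefinite_description _ (Hy t))). }
  assert (Hball : forall t s : R, Boule t (mkposreal 1 Rlt_0_1) s -> exp (4 * K1 * Rabs s) <= exp (4 * K1 * (Rabs t + 1))).
  { intros t s Hs. unfold Boule in Hs. simpl in Hs.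
    assert (Rabs s <= Rabs t + 1).
    { replace s with (t + (s - t)) by ring. eapply Rle_trans; [apply Rabs_triang|]. lra. }
    destruct (Req_dec (Rabs s) (Rabs t + 1)) as [->|Hne]; [lra|].
    left. apply exp_increasing. apply Rmult_lt_compat_l; lra. }
  assert (Hcvu : forall h, lipschitz h K1 -> forall t,
    CVU (fun k u => h (fst (P k) u, snd (P k) u)) (fun u => h (x u, y u)) t (mkposreal 1 Rlt_0_1)).
  { intros h Hh t e He.
    destruct (half_pow_small (4 * K1 * (A * exp (4 * K1 * (Rabs t + 1)))) e) as [N HN]; [|exact He|].
    { apply Rmult_le_pos; [lra|]. apply Rmult_le_pos; [exact HA|left; apply exp_pos]. }
    exists N. intros n u Hn Hu. eapply Rle_lt_trans; [apply Hh|]. simpl.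
    eapply Rle_lt_trans; [|apply (HN n Hn)].
    specialize (Ex u n). specialize (Ey u n). specialize (Hball t u Hu).
    assert (Hp : 0 <= (1 / 2) ^ n) by (apply pow_le; lra).
    assert (Hb : 2 * (A * exp (4 * K1 * Rabs u)) * (1 / 2) ^ n <= 2 * (A * exp (4 * K1 * (Rabs t + 1))) * (1 / 2) ^ n).
    { apply Rmult_le_compat_r; [exact Hp|]. apply Rmult_le_compat_l; [lra|].
      apply Rmult_le_compat_l; assumption. }
    apply Rle_trans with (K1 * (4 * (A * exp (4 * K1 * (Rabs t + 1))) * (1 / 2) ^ n)); [|lra].
    apply Rmult_le_compat_l; lra. }
  assert (Hcont : forall h, lipschitz h K1 -> forall n t, continuity_pt (fun u => h (fst (P n) u, snd (P n) u)) t).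
  { intros h Hh n t. apply continuity_pt_filterlim.
    apply (lipschitz_comp_continuous K1 HK1 h); [exact Hh| |];
      apply (picard_continuous W K1 HK1 HW1 HW2). }
  assert (Hder : forall h, lipschitz h K1 -> forall (f : R -> R) (fn : nat -> R -> R) (t : R),
    (forall n u, is_derive (fn n) u (h (fst (P n) u, snd (P n) u))) ->
    (forall u, Un_cv (fun n => fn n u) (f u)) -> is_derive f t (h (x t, y t))).
  { intros h Hh f fn t Hfn Hcv. apply is_derive_Reals.
    apply (Ranalysis5.derivable_pt_lim_CVU fn (fun n u => h (fst (P n) u, snd (P n) u)) f
             (fun u => h (x u, y u)) t t (mkposreal 1 Rlt_0_1)).
    - unfold Boule. simpl. rewrite Rminus_diag, Rabs_R0. lra.
    - intros u n _. apply is_derive_Reals, Hfn.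
    - intros u _. apply Hcv.
    - apply Hcvu, Hh.
    - apply (CVU_continuity (fun k u => h (fst (P k) u, snd (P k) u))); [apply Hcvu, Hh|].
      intros n u _. apply Hcont, Hh. }
  assert (Hlim0 : forall (f : R -> R) (u : nat -> R -> R) t,
    (forall k, Rabs (f t - u k t) <= 2 * (A * exp (4 * K1 * Rabs t)) * (1 / 2) ^ k) ->
    Un_cv (fun n => u (S n) t) (f t)).
  { intros f u t H e He.
    destruct (half_pow_small (2 * (A * exp (4 * K1 * Rabs t))) e) as [N HN]; [|exact He|].
    { apply Rmult_le_pos; [lra|]. apply Rmult_le_pos; [exact HA|left; apply exp_pos]. }
    exists N. intros n Hn. unfold Rdist. rewrite Rabs_minus_sym.
    eapply Rle_lt_trans; [apply H|]. apply HN. lia. }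
  assert (Hinit : forall l c : R, (forall k, Rabs (l - c) <= 2 * (A * exp (4 * K1 * Rabs 0)) * (1 / 2) ^ k) -> l = c).
  { intros l c H. apply Rminus_diag_uniq. apply NNPP. intros Hn.
    assert (He := Rabs_pos_lt _ Hn).
    destruct (half_pow_small (2 * (A * exp (4 * K1 * Rabs 0))) (Rabs (l - c))) as [N HN]; [|exact He|].
    { apply Rmult_le_pos; [lra|]. apply Rmult_le_pos; [exact HA|left; apply exp_pos]. }
    specialize (HN N (le_n N)). specialize (H N). lra. }
  exists x, y. split; [|split].
  - apply Hinit. intros k. rewrite <- (proj1 (picard_initial W p0 k)). apply Ex.
  - apply Hinit. intros k. rewrite <- (proj2 (picard_initial W p0 k)). apply Ey.
  - intros t. split.
    + apply (Hder (fun p => fst (W p)) HW1 x (fun n => fst (P (S n)))).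
      * intros n u. apply (picard_derive W K1 HK1 HW1 HW2 p0 n u).
      * intros u. apply (Hlim0 x (fun k => fst (P k))), Ex.
    + apply (Hder (fun p => snd (W p)) HW2 y (fun n => snd (P (S n)))).
      * intros n u. apply (picard_derive W K1 HK1 HW1 HW2 p0 n u).
      * intros u. apply (Hlim0 y (fun k => snd (P k))), Ey.
Qed.

(** * Barriers and continuous dependence *)

(** The local step of the barrier arguments: a boundary where the derivative
    points inwards is not crossed. *)
Lemma at_right_of_negative_derivative (f : R -> R) (x l : R) :
  is_derive f x l -> f x <= 0 -> (f x = 0 -> l < 0) -> at_right x (fun t => f t <= 0).
Proof.
  intros Hd Hx Hl. destruct (Req_dec (f x) 0) as [E|Hne].
  - specialize (Hl E). apply is_derive_Reals in Hd.
    destruct (Hd (- l) ltac:(lra)) as [d Hdd].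
    apply at_right_iff. exists d. split; [apply d|]. intros t Ht.
    specialize (Hdd (t - x) ltac:(lra) ltac:(rewrite Rabs_right; lra)).
    replace (x + (t - x)) with t in Hdd by ring. rewrite E, Rminus_0_r in Hdd.
    apply Rabs_def2 in Hdd.
    assert (Hq : f t / (t - x) < 0) by lra.
    apply Rnot_lt_le. intros Hpos. assert (0 < f t / (t - x)) by (apply Rdiv_lt_0_compat; lra). lra.
  - assert (Hc := is_derive_continuous _ _ _ Hd).
    assert (Hl2 : locally x (fun t => f t < 0)) by (apply (Hc (fun z => z < 0)), open_lt; lra).
    apply filter_le_within. revert Hl2. apply filter_imp. intros t Ht. lra.
Qed.

Lemma closed_at_left_limit (f : R -> R) (a x : R) :
  a < x -> continuous f x -> (forall u, a <= u < x -> f u <= 0) -> f x <= 0.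
Proof.
  intros Hax Hc Hu. apply Rnot_lt_le. intros Hlt.
  assert (Hl : locally x (fun t => 0 < f t)) by (apply (Hc (fun z => 0 < z)), open_gt; exact Hlt).
  destruct Hl as [d Hd]. assert (Hdp : 0 < d) by apply d.
  set (u := Rmax a (x - d / 2)).
  assert (Hux : a <= u < x /\ x - d / 2 <= u).
  { unfold u. split; [split; [apply Rmax_l|apply Rmax_lub_lt; lra]|apply Rmax_r]. }
  assert (H1 := Hu u (proj1 Hux)).
  assert (H2 : 0 < f u); [|lra].
  apply Hd. change (Rabs (u - x) < d). rewrite Rabs_left; lra.
Qed.

Lemma at_right_between (f : R -> R) (x l a b : R) :
  is_derive f x l -> a <= f x <= b -> (f x = a -> 0 < l) -> (f x = b -> l < 0) ->
  at_right x (fun t => a <= f t <= b).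
Proof.
  intros Hd Hx Ha Hb.
  assert (R1 : at_right x (fun t => f t - b <= 0)).
  { apply (at_right_of_negative_derivative (fun t => f t - b) x (l - 0));
      [|lra|intros E; rewrite Rminus_0_r; apply Hb; lra].
    apply (is_derive_minus_R f (fun _ => b)); [exact Hd|apply (is_derive_const (V := R_NormedModule))]. }
  assert (R2 : at_right x (fun t => a - f t <= 0)).
  { apply (at_right_of_negative_derivative (fun t => a - f t) x (0 - l));
      [|lra|intros E; assert (0 < l) by (apply Ha; lra); lra].
    apply (is_derive_minus_R (fun _ => a) f); [apply (is_derive_const (V := R_NormedModule))|exact Hd]. }
  generalize (filter_and _ _ R1 R2). apply filter_imp. intros t Ht. lra.
Qed.

Lemma closed_between_at_left (f : R -> R) (c x a b : R) :
  c < x -> continuous f x -> (forall u, c <= u < x -> a <= f u <= b) -> a <= f x <= b.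
Proof.
  intros Hcx Hc Hu. split.
  - assert (a - f x <= 0); [|lra]. apply (closed_at_left_limit (fun t => a - f t) c); [exact Hcx| |].
    + apply (continuous_minus (fun _ => a) f); [apply continuous_const|exact Hc].
    + intros u Hcu. specialize (Hu u Hcu). lra.
  - assert (f x - b <= 0); [|lra]. apply (closed_at_left_limit (fun t => f t - b) c); [exact Hcx| |].
    + apply (continuous_minus f (fun _ => b)); [exact Hc|apply continuous_const].
    + intros u Hcu. specialize (Hu u Hcu). lra.
Qed.

Lemma barrier (f f' : R -> R) (a : R) :
  (forall t, a <= t -> is_derive f t (f' t)) -> f a <= 0 ->
  (forall t, a <= t -> f t = 0 -> f' t < 0) ->
  forall t, a <= t -> f t <= 0.
Proof.
  intros Hd Ha Hb t Ht.
  apply (real_induction (fun t => f t <= 0) a t); [exact Ht|exact Ha| | |lra].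
  - intros x Hx Hu. apply (at_right_of_negative_derivative f x (f' x)); [apply Hd; lra|apply Hu; lra|].
    apply Hb. lra.
  - intros x Hx Hu. apply (closed_at_left_limit f a); [lra| |exact Hu].
    eapply is_derive_continuous, Hd. lra.
Qed.

Definition sq_dist (x y x' y' : R -> R) (t : R) : R := (x t - x' t) ^ 2 + (y t - y' t) ^ 2.

Lemma sq_dist_derive (W W' : plane -> plane) (x y x' y' : R -> R) (t : R) :
  flows W x y t -> flows W' x' y' t ->
  is_derive (sq_dist x y x' y') t
    (2 * (x t - x' t) * (fst (W (x t, y t)) - fst (W' (x' t, y' t))) +
     2 * (y t - y' t) * (snd (W (x t, y t)) - snd (W' (x' t, y' t)))).
Proof.
  intros [A1 A2] [B1 B2].
  apply (is_derive_plus_R (fun t => (x t - x' t) ^ 2) (fun t => (y t - y' t) ^ 2)).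
  - apply (is_derive_square (fun t => x t - x' t)). apply is_derive_minus_R; assumption.
  - apply (is_derive_square (fun t => y t - y' t)). apply is_derive_minus_R; assumption.
Qed.

Lemma product_bound (a A c : R) : Rabs A <= c -> a * A <= Rabs a * c /\ - (Rabs a * c) <= a * A.
Proof.
  intros H. assert (E : Rabs (a * A) <= Rabs a * c).
  { rewrite Rabs_mult. apply Rmult_le_compat_l; [apply Rabs_pos|exact H]. }
  generalize (Rle_abs (a * A)) (Rle_abs (- (a * A))). rewrite Rabs_Ropp. lra.
Qed.

Lemma Rabs_square (a : R) : a ^ 2 = Rabs a ^ 2.
Proof. symmetry. apply pow2_abs. Qed.

Lemma lipschitz_dependence (W : plane -> plane) (K : R) (x y x' y' : R -> R) :
  0 <= K -> lipschitz (fun p => fst (W p)) K -> lipschitz (fun p => snd (W p)) K ->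
  (forall t, flows W x y t) -> (forall t, flows W x' y' t) ->
  forall t, 0 <= t -> sq_dist x y x' y' t <= sq_dist x y x' y' 0 * exp (4 * K * t).
Proof.
  intros HK H1 H2 Hx Hx' t Ht.
  replace (4 * K * t) with (4 * K * (t - 0)) by ring.
  apply (gronwall_forward (sq_dist x y x' y') (fun t =>
     2 * (x t - x' t) * (fst (W (x t, y t)) - fst (W (x' t, y' t))) +
     2 * (y t - y' t) * (snd (W (x t, y t)) - snd (W (x' t, y' t))))); [exact Ht| |].
  - intros s _. apply sq_dist_derive; auto.
  - intros s _. unfold sq_dist.
    assert (L1 := H1 (x s, y s) (x' s, y' s)). assert (L2 := H2 (x s, y s) (x' s, y' s)).
    simpl in L1, L2.
    rewrite (Rabs_square (x s - x' s)), (Rabs_square (y s - y' s)).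
    destruct (product_bound (x s - x' s) _ _ L1) as [M1 _].
    destruct (product_bound (y s - y' s) _ _ L2) as [M2 _].
    set (a := Rabs (x s - x' s)) in *. set (b := Rabs (y s - y' s)) in *.
    assert (Ha : 0 <= a) by apply Rabs_pos. assert (Hb : 0 <= b) by apply Rabs_pos.
    assert (Hs : 2 * (a * b) <= a ^ 2 + b ^ 2) by (generalize (pow2_ge_0 (a - b)); lra).
    assert (Hk : K * (2 * (a * b)) <= K * (a ^ 2 + b ^ 2)) by (apply Rmult_le_compat_l; assumption).
    lra.
Qed.

(** * Fields that are nearly linear on a square *)

Definition in_square (d : R) (p : plane) : Prop := Rabs (fst p) <= d /\ Rabs (snd p) <= d.

(** The nonlinear part has a small Lipschitz constant, rather than small
    derivatives: this is preserved by the linear changes of coordinates, and all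
    that is used for the difference of two solutions. *)
Definition nearly_linear (V : plane -> plane) (al be kap d : R) : Prop :=
  (forall p q, in_square d p -> in_square d q ->
     Rabs (fst (V p) - fst (V q) - al * (fst p - fst q)) <=
       kap * (Rabs (fst p - fst q) + Rabs (snd p - snd q)) /\
     Rabs (snd (V p) - snd (V q) - be * (snd p - snd q)) <=
       kap * (Rabs (fst p - fst q) + Rabs (snd p - snd q))) /\
  Rabs (fst (V (0, 0))) <= kap * d /\ Rabs (snd (V (0, 0))) <= kap * d.

(** Composition with [clamp] extends a field from a rectangle to a Lipschitz
    field on the plane, which has global solutions. *)
Definition clamp (a b x : R) : R := Rmax a (Rmin x b).

Lemma clamp_bounds (a b x : R) : a <= b -> a <= clamp a b x <= b.
Proof. intros Hab. unfold clamp, Rmax, Rmin. repeat destruct Rle_dec; lra. Qed.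

Lemma clamp_id (a b x : R) : a <= x <= b -> clamp a b x = x.
Proof. intros H. unfold clamp, Rmax, Rmin. repeat destruct Rle_dec; lra. Qed.

Lemma clamp_above (a b x : R) : a <= b -> b <= x -> clamp a b x = b.
Proof. intros Hab H. unfold clamp, Rmax, Rmin. repeat destruct Rle_dec; lra. Qed.

Lemma clamp_below (a b x : R) : a <= b -> x <= a -> clamp a b x = a.
Proof. intros Hab H. unfold clamp, Rmax, Rmin. repeat destruct Rle_dec; lra. Qed.

Lemma clamp_lipschitz (a b x y : R) : a <= b -> Rabs (clamp a b x - clamp a b y) <= Rabs (x - y).
Proof.
  intros Hab. unfold clamp, Rmax, Rmin.
  repeat destruct Rle_dec; unfold Rabs; repeat destruct Rcase_abs; lra.
Qed.

Lemma abs_le_of_square (a b : R) : 0 <= b -> a ^ 2 <= b ^ 2 -> Rabs a <= b.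
Proof.
  intros Hb H. rewrite <- (Rabs_right b) by lra. apply Rsqr_le_abs_0. unfold Rsqr. lra.
Qed.

Lemma exp_decay_small (C k e : R) :
  0 <= C -> 0 < k -> 0 < e -> exists T, 0 <= T /\ forall t, T <= t -> C * exp (- k * t) < e.
Proof.
  intros HC Hk He. exists (C / (e * k)).
  assert (Hek : 0 < e * k) by (apply Rmult_lt_0_compat; assumption).
  assert (HT : 0 <= C / (e * k)) by (apply Rmult_le_pos; [exact HC|left; apply Rinv_0_lt_compat, Hek]).
  split; [exact HT|]. intros t Ht.
  assert (Hkt : 0 <= k * t) by (apply Rmult_le_pos; lra).
  assert (H1 : 1 + k * t <= exp (k * t)) by (apply exp_ineq1_le).
  assert (Hp : 0 < exp (- k * t)) by apply exp_pos.
  assert (E : exp (k * t) * exp (- k * t) = 1).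
  { rewrite <- exp_plus. replace (k * t + - k * t) with 0 by ring. apply exp_0. }
  assert (HCt : C <= e * (k * t)).
  { apply Rmult_le_compat_l with (r := e * k) in Ht; [|lra].
    replace (e * k * (C / (e * k))) with C in Ht by (field; lra). lra. }
  assert (HCe : C < e * exp (k * t)) by nra.
  apply Rmult_lt_compat_r with (r := exp (- k * t)) in HCe; [|exact Hp].
  rewrite Rmult_assoc, E in HCe. lra.
Qed.

Lemma exponential_cauchy_limit (x : R -> R) (C k : R) :
  0 <= C -> 0 < k ->
  (forall t tau, 0 <= t -> 0 <= tau -> Rabs (x (t + tau) - x t) <= C * exp (- k * t)) ->
  exists l, forall t, 0 <= t -> Rabs (l - x t) <= C * exp (- k * t).
Proof.
  intros HC Hk H.
  assert (Hn : forall N n, (N <= n)%nat -> Rabs (x (INR n) - x (INR N)) <= C * exp (- k * INR N)).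
  { intros N n Hle. replace (INR n) with (INR N + (INR n - INR N)) by ring.
    apply H; [apply pos_INR|]. apply le_INR in Hle. lra. }
  destruct (Rcomplete.R_complete (fun n => x (INR n))) as [l Hl].
  { intros e He. destruct (exp_decay_small C k (e / 2) HC Hk ltac:(lra)) as (T & HT & HTe).
    destruct (INR_unbounded T) as [N HN]. exists N. intros n m Hn1 Hm1. unfold Rdist.
    replace (x (INR n) - x (INR m)) with ((x (INR n) - x (INR N)) - (x (INR m) - x (INR N))) by ring.
    eapply Rle_lt_trans; [apply Rabs_triang|]. rewrite Rabs_Ropp.
    assert (A1 := Hn N n Hn1). assert (A2 := Hn N m Hm1).
    specialize (HTe (INR N) ltac:(lra)). lra. }
  exists l. intros t Ht. apply Rnot_lt_le. intros Hlt.
  set (e := Rabs (l - x t) - C * exp (- k * t)). assert (He : 0 < e) by (unfold e; lra).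
  destruct (Hl e He) as [N HN]. destruct (INR_unbounded t) as [N2 HN2].
  specialize (HN (max N N2) (Nat.le_max_l _ _)). unfold Rdist in HN.
  assert (Ht2 : t < INR (max N N2)).
  { eapply Rlt_le_trans; [exact HN2|]. apply le_INR, Nat.le_max_r. }
  assert (H1 := H t (INR (max N N2) - t) Ht ltac:(lra)).
  replace (t + (INR (max N N2) - t)) with (INR (max N N2)) in H1 by ring.
  assert (H2 : Rabs (l - x t) <= Rabs (x (INR (max N N2)) - l) + Rabs (x (INR (max N N2)) - x t)).
  { replace (l - x t) with (- (x (INR (max N N2)) - l) + (x (INR (max N N2)) - x t)) by ring.
    eapply Rle_trans; [apply Rabs_triang|]. rewrite Rabs_Ropp. lra. }
  unfold e in HN. lra.
Qed.

Section NearlyLinear.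

Variable V : plane -> plane.
Variables al be kap d : R.
Hypothesis d_pos : 0 < d.
Hypothesis kap_pos : 0 <= kap.
Hypothesis V_nearly_linear : nearly_linear V al be kap d.

Lemma origin_in_square : in_square d (0, 0).
Proof. split; simpl; rewrite Rabs_R0; lra. Qed.

Lemma nearly_linear_values (p : plane) :
  in_square d p -> Rabs (fst (V p) - al * fst p) <= 3 * (kap * d) /\
                   Rabs (snd (V p) - be * snd p) <= 3 * (kap * d).
Proof.
  intros Hp. destruct V_nearly_linear as (HL & H1 & H2).
  destruct (HL p (0, 0) Hp origin_in_square) as [L1 L2]. simpl fst in *. simpl snd in *.
  rewrite !Rminus_0_r in L1, L2. destruct Hp as [P1 P2].
  assert (Hs : kap * (Rabs (fst p) + Rabs (snd p)) <= kap * (d + d)) by (apply Rmult_le_compat_l; lra).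
  split.
  - replace (fst (V p) - al * fst p) with ((fst (V p) - fst (V (0, 0)) - al * fst p) + fst (V (0, 0))) by ring.
    eapply Rle_trans; [apply Rabs_triang|]. lra.
  - replace (snd (V p) - be * snd p) with ((snd (V p) - snd (V (0, 0)) - be * snd p) + snd (V (0, 0))) by ring.
    eapply Rle_trans; [apply Rabs_triang|]. lra.
Qed.

Let lip : R := Rabs al + Rabs be + kap.

Lemma nearly_linear_lipschitz (p q : plane) :
  in_square d p -> in_square d q ->
  Rabs (fst (V p) - fst (V q)) <= lip * (Rabs (fst p - fst q) + Rabs (snd p - snd q)) /\
  Rabs (snd (V p) - snd (V q)) <= lip * (Rabs (fst p - fst q) + Rabs (snd p - snd q)).
Proof.
  intros Hp Hq. destruct V_nearly_linear as (HL & _). destruct (HL p q Hp Hq) as [L1 L2].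
  unfold lip. set (a := Rabs (fst p - fst q)) in *. set (b := Rabs (snd p - snd q)) in *.
  assert (Ha : 0 <= a) by apply Rabs_pos. assert (Hb : 0 <= b) by apply Rabs_pos.
  assert (Pa := Rabs_pos al). assert (Pb := Rabs_pos be).
  assert (0 <= Rabs al * b) by (apply Rmult_le_pos; lra).
  assert (0 <= Rabs be * b) by (apply Rmult_le_pos; lra).
  assert (0 <= Rabs al * a) by (apply Rmult_le_pos; lra).
  assert (0 <= Rabs be * a) by (apply Rmult_le_pos; lra).
  split.
  - replace (fst (V p) - fst (V q))
      with ((fst (V p) - fst (V q) - al * (fst p - fst q)) + al * (fst p - fst q)) by ring.
    eapply Rle_trans; [apply Rabs_triang|]. rewrite (Rabs_mult al). fold a. lra.
  - replace (snd (V p) - snd (V q))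
      with ((snd (V p) - snd (V q) - be * (snd p - snd q)) + be * (snd p - snd q)) by ring.
    eapply Rle_trans; [apply Rabs_triang|]. rewrite (Rabs_mult be). fold b. lra.
Qed.

(** The solution is a Cauchy family. At its limit the field vanishes, since the
    increments of the solution over time intervals of length [1], which are
    values of the field by the mean value theorem, tend to [0]. *)
Lemma limit_of_contracting_shifts (x y : R -> R) (k : R) :
  0 < k -> (forall t, 0 <= t -> flows V x y t) ->
  (forall t, 0 <= t -> in_square d (x t, y t)) ->
  (forall t tau, 0 <= t -> 0 <= tau ->
     Rabs (x (t + tau) - x t) <= 4 * d * exp (- k * t) /\
     Rabs (y (t + tau) - y t) <= 4 * d * exp (- k * t)) ->
  exists p : plane, in_square d p /\ V p = (0, 0) /\
    forall t, 0 <= t -> Rabs (fst p - x t) <= 4 * d * exp (- k * t) /\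
                        Rabs (snd p - y t) <= 4 * d * exp (- k * t).
Proof.
  intros Hk Hf Hs Hc.
  destruct (exponential_cauchy_limit x (4 * d) k) as [l1 H1]; [lra|exact Hk|intros; apply Hc; assumption|].
  destruct (exponential_cauchy_limit y (4 * d) k) as [l2 H2]; [lra|exact Hk|intros; apply Hc; assumption|].
  assert (Hlim : forall (u : R -> R) (l : R),
    (forall t, 0 <= t -> Rabs (l - u t) <= 4 * d * exp (- k * t)) ->
    (forall t, 0 <= t -> Rabs (u t) <= d) -> Rabs l <= d).
  { intros u l Hu Hd. apply Rnot_lt_le. intros Hlt.
    destruct (exp_decay_small (4 * d) k (Rabs l - d) ltac:(lra) Hk ltac:(lra)) as (T & HT & HTe).
    specialize (HTe T (Rle_refl T)). specialize (Hu T HT). specialize (Hd T HT).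
    assert (Rabs l <= Rabs (l - u T) + Rabs (u T)).
    { replace l with ((l - u T) + u T) at 1 by ring. apply Rabs_triang. }
    lra. }
  assert (Hp : in_square d (l1, l2)).
  { split; simpl; [apply (Hlim x)|apply (Hlim y)]; auto; intros t Ht; apply Hs, Ht. }
  exists (l1, l2). split; [exact Hp|]. split; [|intros t Ht; split; [apply H1|apply H2]; exact Ht].
  assert (Hlip : 0 <= lip) by (unfold lip; generalize (Rabs_pos al) (Rabs_pos be); lra).
  assert (Hzero : forall (u : R -> R) (w : plane -> R),
    (forall t, 0 <= t -> is_derive u t (w (x t, y t))) ->
    (forall t, 0 <= t -> Rabs (u (t + 1) - u t) <= 4 * d * exp (- k * t)) ->
    (forall p q, in_square d p -> in_square d q ->
       Rabs (w p - w q) <= lip * (Rabs (fst p - fst q) + Rabs (snd p - snd q))) ->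
    w (l1, l2) = 0).
  { intros u w Hu Hinc Hw. apply NNPP. intros Hn. assert (He := Rabs_pos_lt _ Hn).
    set (C := 4 * d + lip * (8 * d)).
    assert (HC : 0 <= C) by (unfold C; assert (0 <= lip * (8 * d)) by (apply Rmult_le_pos; lra); lra).
    destruct (exp_decay_small C k _ HC Hk He) as (T & HT & HTe).
    specialize (HTe T (Rle_refl T)).
    destruct (MVT_gen u T (T + 1) (fun t => w (x t, y t))) as [c [Hcc E]].
    - intros t Ht. rewrite Rmin_left, Rmax_right in Ht by lra. apply Hu. lra.
    - intros t Ht. rewrite Rmin_left, Rmax_right in Ht by lra.
      apply continuity_pt_filterlim. eapply is_derive_continuous, Hu. lra.
    - rewrite Rmin_left, Rmax_right in Hcc by lra.
      replace (T + 1 - T) with 1 in E by ring. rewrite Rmult_1_r in E.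
      specialize (Hinc T HT). rewrite E in Hinc.
      assert (Hq := Hw (l1, l2) (x c, y c) Hp (Hs c ltac:(lra))). simpl in Hq.
      assert (A1 := H1 c ltac:(lra)). assert (A2 := H2 c ltac:(lra)).
      assert (Hdec : exp (- k * c) <= exp (- k * T)).
      { destruct (Req_dec c T) as [->|Hne]; [lra|]. left. apply exp_increasing. nra. }
      assert (Hsum : lip * (Rabs (l1 - x c) + Rabs (l2 - y c)) <= lip * (8 * d * exp (- k * T))).
      { apply Rmult_le_compat_l; [exact Hlip|].
        assert (4 * d * exp (- k * c) <= 4 * d * exp (- k * T)) by (apply Rmult_le_compat_l; lra). lra. }
      assert (Hb : Rabs (w (l1, l2)) <= Rabs (w (l1, l2) - w (x c, y c)) + Rabs (w (x c, y c))).
      { replace (w (l1, l2)) with ((w (l1, l2) - w (x c, y c)) + w (x c, y c)) at 1 by ring. apply Rabs_triang. }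
      unfold C in HTe. lra. }
  apply injective_projections; simpl.
  - apply (Hzero x (fun p => fst (V p))).
    + intros t Ht. apply (Hf t Ht).
    + intros t Ht. apply Hc; lra.
    + intros p q P Q. apply nearly_linear_lipschitz; assumption.
  - apply (Hzero y (fun p => snd (V p))).
    + intros t Ht. apply (Hf t Ht).
    + intros t Ht. apply Hc; lra.
    + intros p q P Q. apply nearly_linear_lipschitz; assumption.
Qed.

Lemma flows_shift (W : plane -> plane) (x y : R -> R) (t tau : R) :
  flows W x y (t + tau) -> flows W (fun t => x (t + tau)) (fun t => y (t + tau)) t.
Proof.
  intros [A1 A2]. split.
  - rewrite <- (Rmult_1_r (fst _)). apply (is_derive_comp_R x (fun t => t + tau)); [exact A1|].
    auto_derive; [exact I|reflexivity].
  - rewrite <- (Rmult_1_r (snd _)). apply (is_derive_comp_R y (fun t => t + tau)); [exact A2|].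
    auto_derive; [exact I|reflexivity].
Qed.

Lemma square_diameter (x y x' y' : R) :
  in_square d (x, y) -> in_square d (x', y') -> (x - x') ^ 2 + (y - y') ^ 2 <= (4 * d) ^ 2.
Proof.
  intros [A1 A2] [B1 B2]. simpl in *.
  apply Rabs_le_between in A1. apply Rabs_le_between in A2.
  apply Rabs_le_between in B1. apply Rabs_le_between in B2.
  assert ((x - x') ^ 2 <= (2 * d) ^ 2) by (apply pow_maj_Rabs; apply Rabs_le; lra).
  assert ((y - y') ^ 2 <= (2 * d) ^ 2) by (apply pow_maj_Rabs; apply Rabs_le; lra).
  nra.
Qed.

Lemma decay_from_square (D k t : R) : D ^ 2 <= (4 * d) ^ 2 * exp (- (2 * k) * t) -> Rabs D <= 4 * d * exp (- k * t).
Proof.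
  intros H. assert (Hp : 0 < exp (- k * t)) by apply exp_pos.
  apply abs_le_of_square; [apply Rmult_le_pos; lra|].
  replace ((4 * d * exp (- k * t)) ^ 2) with ((4 * d) ^ 2 * (exp (- k * t) * exp (- k * t))) by ring.
  rewrite <- exp_plus. replace (- k * t + - k * t) with (- (2 * k) * t) by ring. exact H.
Qed.

Section Sink.

Hypothesis al_neg : 8 * kap < - al.
Hypothesis be_neg : 8 * kap < - be.

Lemma kap_d_bounds (c : R) : 8 * kap < c -> 3 * (kap * d) < c * d.
Proof. intros H. assert (8 * kap * d < c * d) by (apply Rmult_lt_compat_r; assumption). nra. Qed.

(** On each side of the square the linear part [al * d] or [be * d] dominates
    the deviation of the field, at most [3 * kap * d]. *)
Lemma sink_square_invariant (x y : R -> R) :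
  (forall t, 0 <= t -> flows V x y t) -> in_square d (x 0, y 0) ->
  forall t, 0 <= t -> in_square d (x t, y t).
Proof.
  intros Hf H0 T HT.
  assert (Ka := kap_d_bounds _ al_neg). assert (Kb := kap_d_bounds _ be_neg).
  assert (Hiff : forall t, in_square d (x t, y t) <-> - d <= x t <= d /\ - d <= y t <= d).
  { intros t. unfold in_square. simpl. rewrite !Rabs_le_between. tauto. }
  apply (real_induction (fun t => in_square d (x t, y t)) 0 T); [exact HT|exact H0| | |lra].
  - intros t Ht Hu. destruct (Hf t ltac:(lra)) as [D1 D2]. assert (Hsq := Hu t ltac:(lra)).
    destruct (nearly_linear_values _ Hsq) as [N1 N2]. simpl in N1, N2.
    apply Rabs_le_between in N1. apply Rabs_le_between in N2.
    apply Hiff in Hsq. destruct Hsq as [S1 S2].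
    set (v1 := fst (V (x t, y t))) in *. set (v2 := snd (V (x t, y t))) in *.
    assert (R1 : at_right t (fun t => - d <= x t <= d))
      by (apply (at_right_between x t _ _ _ D1 S1); intros E; rewrite E in N1; nra).
    assert (R2 : at_right t (fun t => - d <= y t <= d))
      by (apply (at_right_between y t _ _ _ D2 S2); intros E; rewrite E in N2; nra).
    generalize (filter_and _ _ R1 R2). apply filter_imp. intros u Hu'. apply Hiff, Hu'.
  - intros t Ht Hu. destruct (Hf t ltac:(lra)) as [D1 D2]. apply Hiff. split.
    + apply (closed_between_at_left x 0); [lra|exact (is_derive_continuous _ _ _ D1)|].
      intros u Hu'. apply Hiff, Hu, Hu'.
    + apply (closed_between_at_left y 0); [lra|exact (is_derive_continuous _ _ _ D2)|].
      intros u Hu'. apply Hiff, Hu, Hu'.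
Qed.

Lemma sink_limit (x y : R -> R) :
  (forall t, 0 <= t -> flows V x y t) -> in_square d (x 0, y 0) ->
  (forall t, 0 <= t -> in_square d (x t, y t)) /\
  exists (p : plane) (k : R), 0 < k /\ in_square d p /\ V p = (0, 0) /\
    forall t, 0 <= t -> Rabs (fst p - x t) <= 4 * d * exp (- k * t) /\
                        Rabs (snd p - y t) <= 4 * d * exp (- k * t).
Proof.
  intros Hf H0. assert (Hs := sink_square_invariant x y Hf H0). split; [exact Hs|].
  set (k := Rmin (- al) (- be) / 2).
  assert (Hk : 8 * kap < 2 * k /\ k <= - al / 2 /\ k <= - be / 2).
  { unfold k. assert (A1 := Rmin_l (- al) (- be)). assert (A2 := Rmin_r (- al) (- be)).
    assert (8 * kap < Rmin (- al) (- be)) by (apply Rmin_glb_lt; assumption). lra. }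
  assert (Hk0 : 0 < k) by lra.
  destruct (limit_of_contracting_shifts x y k Hk0 Hf Hs) as (p & P1 & P2 & P3); [|exists p, k; auto].
  intros t tau Ht Htau.
  set (x' := fun t => x (t + tau)). set (y' := fun t => y (t + tau)).
  assert (Hf' : forall t, 0 <= t -> flows V x' y' t) by (intros u Hu; apply flows_shift, Hf; lra).
  assert (Hs' : forall t, 0 <= t -> in_square d (x' t, y' t)) by (intros u Hu; apply Hs; lra).
  assert (Hdecay : sq_dist x' y' x y t <= sq_dist x' y' x y 0 * exp (- (2 * k) * (t - 0))).
  { apply (gronwall_forward (sq_dist x' y' x y) (fun t =>
       2 * (x' t - x t) * (fst (V (x' t, y' t)) - fst (V (x t, y t))) +
       2 * (y' t - y t) * (snd (V (x' t, y' t)) - snd (V (x t, y t))))); [exact Ht| |].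
    - intros s Hs1. apply sq_dist_derive; [apply Hf'|apply Hf]; lra.
    - intros s Hs1. destruct V_nearly_linear as (HL & _).
      destruct (HL (x' s, y' s) (x s, y s)) as [L1 L2]; [apply Hs'; lra|apply Hs; lra|].
      simpl in L1, L2. unfold sq_dist.
      set (a := x' s - x s) in *. set (b := y' s - y s) in *.
      destruct (product_bound a _ _ L1) as [M1 _]. destruct (product_bound b _ _ L2) as [M2 _].
      set (X1 := fst (V (x' s, y' s)) - fst (V (x s, y s))) in *.
      set (X2 := snd (V (x' s, y' s)) - snd (V (x s, y s))) in *.
      assert (Pa := Rabs_pos a). assert (Pb := Rabs_pos b).
      assert (Sa := Rabs_square a). assert (Sb := Rabs_square b).
      set (aa := Rabs a) in *. set (bb := Rabs b) in *.
      assert (Hab : 2 * (aa * bb) <= aa ^ 2 + bb ^ 2) by (generalize (pow2_ge_0 (aa - bb)); lra).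
      assert (Hkab : kap * (2 * (aa * bb)) <= kap * (aa ^ 2 + bb ^ 2)) by (apply Rmult_le_compat_l; assumption).
      assert (E1 : k * a ^ 2 <= - al / 2 * a ^ 2) by (apply Rmult_le_compat_r; [apply pow2_ge_0|lra]).
      assert (E2 : k * b ^ 2 <= - be / 2 * b ^ 2) by (apply Rmult_le_compat_r; [apply pow2_ge_0|lra]).
      assert (E3 : 4 * kap * (a ^ 2 + b ^ 2) <= k * (a ^ 2 + b ^ 2)).
      { apply Rmult_le_compat_r; [generalize (pow2_ge_0 a) (pow2_ge_0 b); lra|lra]. }
      rewrite <- Sa, <- Sb in Hkab.
      assert (M1' : a * X1 <= al * a ^ 2 + kap * a ^ 2 + kap * (aa * bb)) by (assert (Ea : kap * a ^ 2 = kap * aa ^ 2) by (rewrite Sa; reflexivity); lra).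
      assert (M2' : b * X2 <= be * b ^ 2 + kap * b ^ 2 + kap * (aa * bb)) by (assert (Eb : kap * b ^ 2 = kap * bb ^ 2) by (rewrite Sb; reflexivity); lra).
      assert (0 <= kap * (a ^ 2 + b ^ 2)) by (apply Rmult_le_pos; [lra|generalize (pow2_ge_0 a) (pow2_ge_0 b); lra]).
      lra. }
  rewrite Rminus_0_r in Hdecay.
  assert (Hini := square_diameter (x' 0) (y' 0) (x 0) (y 0) (Hs' 0 (Rle_refl 0)) (Hs 0 (Rle_refl 0))).
  fold (sq_dist x' y' x y 0) in Hini.
  assert (Hexp : 0 < exp (- (2 * k) * t)) by apply exp_pos.
  assert (Hall : sq_dist x' y' x y t <= (4 * d) ^ 2 * exp (- (2 * k) * t)).
  { eapply Rle_trans; [exact Hdecay|]. apply Rmult_le_compat_r; lra. }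
  unfold sq_dist in Hall.
  split; apply decay_from_square; unfold x', y' in *;
    [generalize (pow2_ge_0 (y (t + tau) - y t))|generalize (pow2_ge_0 (x (t + tau) - x t))]; lra.
Qed.

End Sink.

Section Saddle.

Hypothesis al_neg : 8 * kap < - al.
Hypothesis be_pos : 8 * kap < be.

(** The quadratic form [Q], expanding minus contracting part of the squared
    distance, satisfies [k * Q <= Q']. Were it positive once, it would grow
    beyond the diameter of the square. Hence the contracting part dominates, and
    decays. *)
Lemma saddle_decay (x y x' y' : R -> R) (k : R) :
  0 < k -> 4 * kap <= k -> k <= - al / 2 -> k <= be / 2 ->
  (forall t, 0 <= t -> flows V x y t) -> (forall t, 0 <= t -> in_square d (x t, y t)) ->
  (forall t, 0 <= t -> flows V x' y' t) -> (forall t, 0 <= t -> in_square d (x' t, y' t)) ->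
  forall t, 0 <= t -> Rabs (x' t - x t) <= 4 * d * exp (- (k / 2) * t) /\
                      Rabs (y' t - y t) <= 4 * d * exp (- (k / 2) * t).
Proof.
  intros Hk Hk1 Hk2 Hk3 Hf Hs Hf' Hs'.
  set (Q := fun t => (y' t - y t) ^ 2 - (x' t - x t) ^ 2).
  set (Q' := fun t => 2 * (y' t - y t) * (snd (V (x' t, y' t)) - snd (V (x t, y t))) -
                      2 * (x' t - x t) * (fst (V (x' t, y' t)) - fst (V (x t, y t)))).
  assert (DQ : forall t, 0 <= t -> is_derive Q t (Q' t)).
  { intros t Ht. destruct (Hf t Ht) as [A1 A2]. destruct (Hf' t Ht) as [B1 B2].
    apply (is_derive_minus_R (fun t => (y' t - y t) ^ 2) (fun t => (x' t - x t) ^ 2)).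
    - apply (is_derive_square (fun t => y' t - y t)). apply is_derive_minus_R; assumption.
    - apply (is_derive_square (fun t => x' t - x t)). apply is_derive_minus_R; assumption. }
  assert (Est : forall t, 0 <= t -> k * Q t <= Q' t /\
    (Q t <= 0 -> 2 * (x' t - x t) * (fst (V (x' t, y' t)) - fst (V (x t, y t))) <= - k * (x' t - x t) ^ 2)).
  { intros s Hs1. destruct V_nearly_linear as (HL & _).
    destruct (HL (x' s, y' s) (x s, y s)) as [L1 L2]; [apply Hs'; lra|apply Hs; lra|].
    simpl in L1, L2. unfold Q, Q'.
    set (a := x' s - x s) in *. set (b := y' s - y s) in *.
    destruct (product_bound a _ _ L1) as [M1 _]. destruct (product_bound b _ _ L2) as [_ M2].
    set (X1 := fst (V (x' s, y' s)) - fst (V (x s, y s))) in *.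
    set (X2 := snd (V (x' s, y' s)) - snd (V (x s, y s))) in *.
    assert (Pa := Rabs_pos a). assert (Pb := Rabs_pos b).
    assert (Sa := Rabs_square a). assert (Sb := Rabs_square b).
    set (aa := Rabs a) in *. set (bb := Rabs b) in *.
    assert (Na := pow2_ge_0 a). assert (Nb := pow2_ge_0 b).
    assert (Hab : 2 * (aa * bb) <= aa ^ 2 + bb ^ 2) by (generalize (pow2_ge_0 (aa - bb)); lra).
    assert (Hkab : kap * (2 * (aa * bb)) <= kap * (aa ^ 2 + bb ^ 2)) by (apply Rmult_le_compat_l; assumption).
    rewrite <- Sa, <- Sb in Hkab.
    assert (M1' : a * X1 <= al * a ^ 2 + kap * a ^ 2 + kap * (aa * bb)) by (assert (Ea : kap * a ^ 2 = kap * aa ^ 2) by (rewrite Sa; reflexivity); lra).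
    assert (M2' : be * b ^ 2 - kap * b ^ 2 - kap * (aa * bb) <= b * X2) by (assert (Eb : kap * b ^ 2 = kap * bb ^ 2) by (rewrite Sb; reflexivity); lra).
    assert (E1 : k * a ^ 2 <= - al / 2 * a ^ 2) by (apply Rmult_le_compat_r; lra).
    assert (E2 : k * b ^ 2 <= be / 2 * b ^ 2) by (apply Rmult_le_compat_r; lra).
    assert (E3 : 4 * kap * a ^ 2 <= k * a ^ 2) by (apply Rmult_le_compat_r; lra).
    assert (E4 : 4 * kap * b ^ 2 <= k * b ^ 2) by (apply Rmult_le_compat_r; lra).
    assert (Z1 : 0 <= kap * a ^ 2) by (apply Rmult_le_pos; lra).
    assert (Z2 : 0 <= kap * b ^ 2) by (apply Rmult_le_pos; lra).
    assert (Z3 : 0 <= k * a ^ 2) by (apply Rmult_le_pos; lra).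
    split; [lra|]. intros HQ.
    assert (Hbb : bb <= aa).
    { apply Rsqr_incr_0; [unfold Rsqr; lra|exact Pb|exact Pa]. }
    assert (kap * (aa * bb) <= kap * a ^ 2).
    { apply Rmult_le_compat_l; [exact kap_pos|]. rewrite Sa. nra. }
    lra. }
  assert (HQ : forall t, 0 <= t -> Q t <= 0).
  { intros t Ht. apply Rnot_lt_le. intros Hpos.
    destruct (exp_decay_small ((4 * d) ^ 2) k (Q t) ltac:(apply pow2_ge_0) Hk Hpos) as (T & HT & HTe).
    specialize (HTe T (Rle_refl T)).
    assert (G : Q t <= Q (t + T) * exp (- k * (t + T - t))).
    { apply (gronwall_backward Q Q'); [lra| |].
      - intros s Hs1. apply DQ. lra.
      - intros s Hs1. rewrite Ropp_involutive. apply Est. lra. }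
    replace (t + T - t) with T in G by ring.
    assert (B : Q (t + T) <= (4 * d) ^ 2).
    { assert (D := square_diameter _ _ _ _ (Hs' (t + T) ltac:(lra)) (Hs (t + T) ltac:(lra))).
      unfold Q. generalize (pow2_ge_0 (x' (t + T) - x (t + T))). lra. }
    assert (Q (t + T) * exp (- k * T) <= (4 * d) ^ 2 * exp (- k * T)).
    { apply Rmult_le_compat_r; [left; apply exp_pos|exact B]. }
    lra. }
  intros t Ht.
  assert (Hx : (x' t - x t) ^ 2 <= (4 * d) ^ 2 * exp (- k * t)).
  { apply Rle_trans with ((x' 0 - x 0) ^ 2 * exp (- k * (t - 0))).
    - apply (gronwall_forward (fun t => (x' t - x t) ^ 2)
        (fun t => 2 * (x' t - x t) * (fst (V (x' t, y' t)) - fst (V (x t, y t))))); [exact Ht| |].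
      + intros s Hs1. apply (is_derive_square (fun t => x' t - x t)).
        apply is_derive_minus_R; [apply Hf'|apply Hf]; lra.
      + intros s Hs1. apply Est; [lra|apply HQ; lra].
    - rewrite Rminus_0_r. apply Rmult_le_compat_r; [left; apply exp_pos|].
      assert (D := square_diameter _ _ _ _ (Hs' 0 (Rle_refl 0)) (Hs 0 (Rle_refl 0))).
      generalize (pow2_ge_0 (y' 0 - y 0)). lra. }
  assert (Hy : (y' t - y t) ^ 2 <= (4 * d) ^ 2 * exp (- k * t)).
  { specialize (HQ t Ht). unfold Q in HQ. lra. }
  split; apply decay_from_square; replace (2 * (k / 2)) with k by field; assumption.
Qed.

Definition clamped (p : plane) : plane := V (clamp (- d) d (fst p), clamp (- d) d (snd p)).

Lemma clamp_in_square (p : plane) : in_square d (clamp (- d) d (fst p), clamp (- d) d (snd p)).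
Proof. split; simpl; apply Rabs_le, clamp_bounds; lra. Qed.

Lemma clamped_lipschitz :
  lipschitz (fun p => fst (clamped p)) lip /\ lipschitz (fun p => snd (clamped p)) lip.
Proof.
  assert (Hlip : 0 <= lip) by (unfold lip; generalize (Rabs_pos al) (Rabs_pos be); lra).
  assert (Hc : forall p q : plane,
    lip * (Rabs (clamp (- d) d (fst p) - clamp (- d) d (fst q)) + Rabs (clamp (- d) d (snd p) - clamp (- d) d (snd q))) <=
    lip * (Rabs (fst p - fst q) + Rabs (snd p - snd q))).
  { intros p q. apply Rmult_le_compat_l; [exact Hlip|].
    apply Rplus_le_compat; apply clamp_lipschitz; lra. }
  split; intros p q; (eapply Rle_trans; [|apply Hc]);
    apply (nearly_linear_lipschitz _ _ (clamp_in_square p) (clamp_in_square q)).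
Qed.

(** Outside the square the clamped field points towards it in the contracting
    direction and away from it in the expanding direction. *)
Lemma clamped_signs (p : plane) :
  (d <= fst p -> fst (clamped p) < 0) /\ (fst p <= - d -> 0 < fst (clamped p)) /\
  (d <= snd p -> 0 < snd (clamped p)) /\ (snd p <= - d -> snd (clamped p) < 0).
Proof.
  destruct (nearly_linear_values _ (clamp_in_square p)) as [N1 N2]. simpl in N1, N2.
  apply Rabs_le_between in N1. apply Rabs_le_between in N2.
  assert (Ka := kap_d_bounds _ al_neg). assert (Kb := kap_d_bounds _ be_pos).
  unfold clamped. repeat split; intros H.
  - rewrite (clamp_above (- d) d (fst p)) in * by lra. nra.
  - rewrite (clamp_below (- d) d (fst p)) in * by lra. nra.
  - rewrite (clamp_above (- d) d (snd p)) in * by lra. nra.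
  - rewrite (clamp_below (- d) d (snd p)) in * by lra. nra.
Qed.

Definition starts (v : R) (x y : R -> R) : Prop :=
  x 0 = d /\ y 0 = v /\ forall t, flows clamped x y t.

Definition leaves_up (v : R) : Prop := exists x y t, starts v x y /\ 0 <= t /\ d < y t.
Definition leaves_down (v : R) : Prop := exists x y t, starts v x y /\ 0 <= t /\ y t < - d.

Lemma starts_exists (v : R) : exists x y, starts v x y.
Proof.
  destruct clamped_lipschitz as [L1 L2].
  destruct (global_solution_exists clamped lip (d, v) L1 L2) as (x & y & Hx & Hy & Hf).
  exists x, y. split; [exact Hx|]. split; [exact Hy|exact Hf].
Qed.

Lemma starts_dependence (v v' t : R) (x y x' y' : R -> R) :
  starts v x y -> starts v' x' y' -> 0 <= t -> (y t - y' t) ^ 2 <= (v - v') ^ 2 * exp (4 * lip * t).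
Proof.
  intros (X0 & Y0 & Hf) (X0' & Y0' & Hf') Ht. destruct clamped_lipschitz as [L1 L2].
  assert (Hlip : 0 <= lip) by (unfold lip; generalize (Rabs_pos al) (Rabs_pos be); lra).
  assert (E := lipschitz_dependence clamped lip x y x' y' Hlip L1 L2 Hf Hf' t Ht).
  unfold sq_dist in E. rewrite X0, X0', Y0, Y0' in E.
  replace ((d - d) ^ 2 + (v - v') ^ 2) with ((v - v') ^ 2) in E by ring.
  generalize (pow2_ge_0 (x t - x' t)). lra.
Qed.

Lemma starts_near (v t e : R) (x y : R -> R) :
  starts v x y -> 0 <= t -> 0 < e ->
  exists r, 0 < r /\ forall v' x' y', starts v' x' y' -> Rabs (v - v') < r -> Rabs (y t - y' t) < e.
Proof.
  intros Hst Ht He. set (E := exp (4 * lip * t)). assert (HE : 0 < E) by apply exp_pos.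
  exists (e / (E + 1)). assert (Hr : 0 < e / (E + 1)) by (apply Rdiv_lt_0_compat; lra).
  split; [exact Hr|]. intros v' x' y' Hst' Hv.
  assert (D := starts_dependence v v' t x y x' y' Hst Hst' Ht). fold E in D.
  assert (Hv2 : (v - v') ^ 2 <= (e / (E + 1)) ^ 2).
  { rewrite (Rabs_square (v - v')). apply pow_incr. split; [apply Rabs_pos|lra]. }
  assert (Hb : (v - v') ^ 2 * E < e ^ 2).
  { apply Rle_lt_trans with ((e / (E + 1)) ^ 2 * E); [apply Rmult_le_compat_r; lra|].
    replace (e ^ 2) with ((e / (E + 1)) ^ 2 * (E + 1) ^ 2) by (field; lra).
    apply Rmult_lt_compat_l; [apply pow_lt, Hr|]. nra. }
  apply Rnot_le_lt. intros Hle.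
  assert (e ^ 2 <= (y t - y' t) ^ 2).
  { rewrite (Rabs_square (y t - y' t)). apply pow_incr. lra. }
  lra.
Qed.

(** Above and below the square the second coordinate is monotone, so that a
    solution that has left on one side never comes back to leave on the other. *)
Lemma leaves_exclusive (v : R) : leaves_up v -> leaves_down v -> False.
Proof.
  intros (x & y & t & Hst & Ht & Hup) (x' & y' & t' & Hst' & Ht' & Hdn).
  assert (E : forall s, 0 <= s -> y s = y' s).
  { intros s Hs. assert (D := starts_dependence v v s x y x' y' Hst Hst' Hs).
    replace ((v - v) ^ 2) with 0 in D by ring. rewrite Rmult_0_l in D.
    destruct (sum_squares_zero (y s - y' s) 0) as [Z _]; [nra|lra]. }
  destruct Hst as (_ & _ & Hf).
  assert (Hstay : forall s, t <= s -> y t - y s <= 0).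
  { apply (barrier (fun s => y t - y s) (fun s => 0 - snd (clamped (x s, y s))) t).
    - intros s Hs. apply (is_derive_minus_R (fun _ => y t) y);
        [apply (is_derive_const (V := R_NormedModule))|apply Hf].
    - lra.
    - intros s Hs Es. destruct (clamped_signs (x s, y s)) as (_ & _ & P & _). simpl in P.
      assert (0 < snd (clamped (x s, y s))) by (apply P; lra). lra. }
  assert (Hstay' : forall s, t' <= s -> y s - y t' <= 0).
  { apply (barrier (fun s => y s - y t') (fun s => snd (clamped (x s, y s)) - 0) t').
    - intros s Hs. apply (is_derive_minus_R y (fun _ => y t'));
        [apply Hf|apply (is_derive_const (V := R_NormedModule))].
    - lra.
    - intros s Hs Es. destruct (clamped_signs (x s, y s)) as (_ & _ & _ & P). simpl in P.
      rewrite <- (E t' Ht') in Hdn.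
      assert (snd (clamped (x s, y s)) < 0) by (apply P; lra). lra. }
  rewrite <- (E t' Ht') in Hdn.
  specialize (Hstay (Rmax t t') (Rmax_l _ _)). specialize (Hstay' (Rmax t t') (Rmax_r _ _)). lra.
Qed.

(** The starting points on the line [x = d] whose solutions leave upwards
    and downwards form two disjoint open sets, and the line is connected. The
    supremum [v] of the second set belongs to neither. *)
Lemma staying_point_exists : exists v, ~ leaves_up v /\ ~ leaves_down v.
Proof.
  assert (Htop : leaves_up (d + 1)).
  { destruct (starts_exists (d + 1)) as (x & y & Hst). exists x, y, 0.
    split; [exact Hst|]. split; [lra|]. destruct Hst as (_ & -> & _). lra. }
  assert (Hbot : leaves_down (- d - 1)).
  { destruct (starts_exists (- d - 1)) as (x & y & Hst). exists x, y, 0.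
    split; [exact Hst|]. split; [lra|]. destruct Hst as (_ & -> & _). lra. }
  set (E := fun v => v <= d + 1 /\ leaves_down v).
  destruct (completeness E) as [v [Hub Hleast]].
  { exists (d + 1). intros u [Hu _]. exact Hu. }
  { exists (- d - 1). split; [lra|exact Hbot]. }
  assert (Hv : v <= d + 1) by (apply Hleast; intros u [Hu _]; exact Hu).
  exists v. split.
  - intros (x & y & t & Hst & Ht & Hup).
    destruct (starts_near v t (y t - d) x y Hst Ht ltac:(lra)) as (r & Hr & Hnear).
    assert (v <= v - r / 2); [|lra]. apply Hleast. intros u [Hu1 Hu2].
    apply Rnot_lt_le. intros Hlt.
    assert (Hu3 : u <= v) by (apply Hub; split; assumption).
    apply (leaves_exclusive u); [|exact Hu2].
    destruct (starts_exists u) as (x' & y' & Hst'). exists x', y', t.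
    split; [exact Hst'|]. split; [exact Ht|].
    assert (N := Hnear u x' y' Hst' ltac:(rewrite Rabs_right; lra)).
    apply Rabs_def2 in N. lra.
  - intros Hdown.
    assert (Hne : v <> d + 1) by (intros Ev; rewrite Ev in Hdown; exact (leaves_exclusive _ Htop Hdown)).
    destruct Hdown as (x & y & t & Hst & Ht & Hdn).
    destruct (starts_near v t (- d - y t) x y Hst Ht ltac:(lra)) as (r & Hr & Hnear).
    set (u := Rmin (v + r / 2) (d + 1)).
    assert (Hu : v < u <= d + 1 /\ u <= v + r / 2).
    { unfold u. split; [split; [apply Rmin_glb_lt; lra|apply Rmin_r]|apply Rmin_l]. }
    assert (u <= v); [|lra]. apply Hub. split; [lra|].
    destruct (starts_exists u) as (x' & y' & Hst'). exists x', y', t.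
    split; [exact Hst'|]. split; [exact Ht|].
    assert (N := Hnear u x' y' Hst' ltac:(rewrite Rabs_left; lra)).
    apply Rabs_def2 in N. lra.
Qed.

(** A solution from the side [x = d] that stays in the square: a point of
    the local stable manifold. Its time shifts are solutions of the same kind, and
    [saddle_decay] applies to both. *)
Lemma saddle_stable_solution :
  exists (x y : R -> R) (p : plane) (k : R), x 0 = d /\
    (forall t, 0 <= t -> flows V x y t /\ in_square d (x t, y t)) /\
    0 < k /\ in_square d p /\ V p = (0, 0) /\
    forall t, 0 <= t -> Rabs (fst p - x t) <= 4 * d * exp (- k * t) /\
                        Rabs (snd p - y t) <= 4 * d * exp (- k * t).
Proof.
  destruct staying_point_exists as (v & Hup & Hdn).
  destruct (starts_exists v) as (x & y & Hst).
  assert (Hst' := Hst). destruct Hst' as (X0 & Y0 & Hf).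
  assert (Hx1 : forall t, 0 <= t -> x t - d <= 0).
  { apply (barrier (fun t => x t - d) (fun t => fst (clamped (x t, y t)) - 0) 0).
    - intros t _. apply (is_derive_minus_R x (fun _ => d));
        [apply Hf|apply (is_derive_const (V := R_NormedModule))].
    - lra.
    - intros t _ E. destruct (clamped_signs (x t, y t)) as (P & _). simpl in P.
      specialize (P ltac:(lra)). lra. }
  assert (Hx2 : forall t, 0 <= t -> - x t - d <= 0).
  { apply (barrier (fun t => - x t - d) (fun t => - fst (clamped (x t, y t)) - 0) 0).
    - intros t _. apply (is_derive_minus_R (fun t => - x t) (fun _ => d));
        [apply (is_derive_opp x), Hf|apply (is_derive_const (V := R_NormedModule))].
    - lra.
    - intros t _ E. destruct (clamped_signs (x t, y t)) as (_ & P & _). simpl in P.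
      specialize (P ltac:(lra)). lra. }
  assert (Hs : forall t, 0 <= t -> in_square d (x t, y t)).
  { intros t Ht. specialize (Hx1 t Ht). specialize (Hx2 t Ht). split; simpl; apply Rabs_le; [lra|].
    split; apply Rnot_lt_le; intros Hlt; [apply Hdn|apply Hup]; exists x, y, t; auto. }
  assert (HfV : forall t, 0 <= t -> flows V x y t).
  { intros t Ht. destruct (Hf t) as [A1 A2]. destruct (Hs t Ht) as [S1 S2]. simpl in S1, S2.
    unfold clamped in A1, A2. simpl in A1, A2.
    rewrite (clamp_id (- d) d (x t)), (clamp_id (- d) d (y t)) in A1, A2 by (apply Rabs_le_between; assumption).
    split; assumption. }
  set (k := Rmin (- al) be / 2).
  assert (Hk : 4 * kap < k /\ k <= - al / 2 /\ k <= be / 2).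
  { unfold k. assert (A1 := Rmin_l (- al) be). assert (A2 := Rmin_r (- al) be).
    assert (8 * kap < Rmin (- al) be) by (apply Rmin_glb_lt; assumption). lra. }
  assert (Hk2 : 0 < k / 2) by lra.
  destruct (limit_of_contracting_shifts x y (k / 2) Hk2 HfV Hs) as (p & P1 & P2 & P3).
  - intros t tau Ht Htau.
    apply (saddle_decay x y (fun t => x (t + tau)) (fun t => y (t + tau)) k); try lra; auto.
    + intros s Hs1. apply flows_shift, HfV. lra.
    + intros s Hs1. apply Hs. lra.
  - exists x, y, p, (k / 2). split; [exact X0|]. split; [intros t Ht; split; auto|]. auto.
Qed.

End Saddle.

End NearlyLinear.

(** * Strict differentiability *)

Definition near (r : R) (p q : plane) : Prop :=
  Rabs (fst p - fst q) <= r /\ Rabs (snd p - snd q) <= r.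

(** The increments of [h] between any two points near [p0], not only from
    [p0], are compared with the linear form. This is what [nearly_linear] needs. *)
Definition strictly_differentiable (h : plane -> R) (p0 : plane) (a b : R) : Prop :=
  forall e, 0 < e -> exists d, 0 < d /\ forall p q, near d p p0 -> near d q p0 ->
    Rabs (h p - h q - (a * (fst p - fst q) + b * (snd p - snd q))) <=
      e * (Rabs (fst p - fst q) + Rabs (snd p - snd q)).

Lemma strictly_differentiable_1d (h h' : R -> R) (x0 e : R) :
  (forall x, is_derive h x (h' x)) -> continuous h' x0 -> 0 < e ->
  exists d, 0 < d /\ forall x y, Rabs (x - x0) <= d -> Rabs (y - x0) <= d ->
    Rabs (h x - h y - h' x0 * (x - y)) <= e * Rabs (x - y).
Proof.
  intros Hd Hc He.
  assert (Hl : locally x0 (fun x => Rabs (h' x - h' x0) < e))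
    by exact (Hc _ (locally_ball _ (mkposreal e He))).
  destruct Hl as [d Hd1]. assert (Hdp : 0 < d) by apply d.
  exists (d / 2). split; [lra|]. intros x y Hx Hy.
  destruct (MVT_gen h y x h') as [c [Hcc E]].
  - intros t _. apply Hd.
  - intros t _. apply continuity_pt_filterlim. exact (is_derive_continuous _ _ _ (Hd t)).
  - rewrite E. replace (h' c * (x - y) - h' x0 * (x - y)) with ((h' c - h' x0) * (x - y)) by ring.
    rewrite Rabs_mult. apply Rmult_le_compat_r; [apply Rabs_pos|]. left. apply Hd1.
    change (Rabs (c - x0) < d).
    apply Rabs_le_between in Hx. apply Rabs_le_between in Hy.
    revert Hcc. unfold Rmin, Rmax. destruct Rle_dec; intros Hcc; apply Rabs_def1; lra.
Qed.

Lemma strictly_differentiable_fst (h h' : R -> R) (p0 : plane) :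
  (forall x, is_derive h x (h' x)) -> continuous h' (fst p0) ->
  strictly_differentiable (fun p => h (fst p)) p0 (h' (fst p0)) 0.
Proof.
  intros Hd Hc e He. destruct (strictly_differentiable_1d h h' (fst p0) e Hd Hc He) as (d & Hd0 & H).
  exists d. split; [exact Hd0|]. intros p q [Hp _] [Hq _].
  rewrite Rmult_0_l, Rplus_0_r. eapply Rle_trans; [apply H; assumption|].
  apply Rmult_le_compat_l; [lra|]. generalize (Rabs_pos (snd p - snd q)). lra.
Qed.

Lemma strictly_differentiable_snd (h h' : R -> R) (p0 : plane) :
  (forall x, is_derive h x (h' x)) -> continuous h' (snd p0) ->
  strictly_differentiable (fun p => h (snd p)) p0 0 (h' (snd p0)).
Proof.
  intros Hd Hc e He. destruct (strictly_differentiable_1d h h' (snd p0) e Hd Hc He) as (d & Hd0 & H).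
  exists d. split; [exact Hd0|]. intros p q [_ Hp] [_ Hq].
  rewrite Rmult_0_l, Rplus_0_l. eapply Rle_trans; [apply H; assumption|].
  apply Rmult_le_compat_l; [lra|]. generalize (Rabs_pos (fst p - fst q)). lra.
Qed.

Lemma near_weaken (r r' : R) (p q : plane) : r <= r' -> near r p q -> near r' p q.
Proof. intros Hr [H1 H2]. split; lra. Qed.

Lemma near_refl (r : R) (p : plane) : 0 <= r -> near r p p.
Proof. intros Hr. split; rewrite Rminus_diag, Rabs_R0; exact Hr. Qed.

Lemma strictly_differentiable_mult (u v : plane -> R) (p0 : plane) (a b a' b' : R) :
  strictly_differentiable u p0 a b -> strictly_differentiable v p0 a' b' ->
  strictly_differentiable (fun p => u p * v p) p0 (u p0 * a' + v p0 * a) (u p0 * b' + v p0 * b).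
Proof.
  intros Hu Hv e He.
  set (N := Rabs a + Rabs b + Rabs a' + Rabs b' + Rabs (u p0) + Rabs (v p0)).
  assert (Pa := Rabs_pos a). assert (Pb := Rabs_pos b). assert (Pa' := Rabs_pos a').
  assert (Pb' := Rabs_pos b'). assert (Pu := Rabs_pos (u p0)). assert (Pv := Rabs_pos (v p0)).
  assert (HN : 0 <= N) by (unfold N; lra).
  set (e1 := Rmin 1 (e / (4 * (N + 1)))).
  assert (He1 : 0 < e1) by (apply Rmin_pos; [lra|apply Rdiv_lt_0_compat; lra]).
  assert (He1' : e1 <= 1) by apply Rmin_l.
  assert (He1e : 4 * (N + 1) * e1 <= e).
  { assert (E : e1 <= e / (4 * (N + 1))) by apply Rmin_r.
    apply Rmult_le_compat_l with (r := 4 * (N + 1)) in E; [|lra].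
    replace (4 * (N + 1) * (e / (4 * (N + 1)))) with e in E by (field; lra). exact E. }
  destruct (Hu e1 He1) as (d1 & Hd1 & Hu1). destruct (Hv e1 He1) as (d2 & Hd2 & Hv1).
  set (d := Rmin (Rmin d1 d2) (e1 / (2 * (N + 1)))).
  assert (Hq : 0 < e1 / (2 * (N + 1))) by (apply Rdiv_lt_0_compat; lra).
  assert (Hd : 0 < d) by (repeat apply Rmin_pos; assumption).
  assert (Hdd1 : d <= d1) by (eapply Rle_trans; [apply Rmin_l|apply Rmin_l]).
  assert (Hdd2 : d <= d2) by (eapply Rle_trans; [apply Rmin_l|apply Rmin_r]).
  assert (Hdq : (N + 1) * (d + d) <= e1).
  { assert (E : d <= e1 / (2 * (N + 1))) by apply Rmin_r.
    apply Rmult_le_compat_l with (r := 2 * (N + 1)) in E; [|lra].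
    replace (2 * (N + 1) * (e1 / (2 * (N + 1)))) with e1 in E by (field; lra). lra. }
  assert (Hvar : forall (w : plane -> R) c1 c2, Rabs c1 + Rabs c2 <= N ->
    (forall p q, near d p p0 -> near d q p0 ->
      Rabs (w p - w q - (c1 * (fst p - fst q) + c2 * (snd p - snd q))) <=
        e1 * (Rabs (fst p - fst q) + Rabs (snd p - snd q))) ->
    forall p, near d p p0 -> Rabs (w p - w p0) <= e1).
  { intros w c1 c2 Hc Hw p Hp. specialize (Hw p p0 Hp (near_refl d p0 (Rlt_le _ _ Hd))).
    destruct Hp as [Q1 Q2].
    set (X := fst p - fst p0) in *. set (Y := snd p - snd p0) in *.
    replace (w p - w p0) with ((w p - w p0 - (c1 * X + c2 * Y)) + (c1 * X + c2 * Y)) by ring.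
    eapply Rle_trans; [apply Rabs_triang|].
    assert (Rabs (c1 * X + c2 * Y) <= Rabs c1 * Rabs X + Rabs c2 * Rabs Y).
    { rewrite <- !Rabs_mult. apply Rabs_triang. }
    assert (PX := Rabs_pos X). assert (PY := Rabs_pos Y).
    assert (Rabs c1 * Rabs X <= Rabs c1 * d) by (apply Rmult_le_compat_l; [apply Rabs_pos|exact Q1]).
    assert (Rabs c2 * Rabs Y <= Rabs c2 * d) by (apply Rmult_le_compat_l; [apply Rabs_pos|exact Q2]).
    assert (e1 * (Rabs X + Rabs Y) <= 1 * (d + d)) by (apply Rmult_le_compat; lra).
    assert ((Rabs c1 + Rabs c2) * d <= N * d) by (apply Rmult_le_compat_r; lra).
    nra. }
  exists d. split; [exact Hd|]. intros p q Hp Hq'.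
  assert (U := Hu1 p q (near_weaken _ _ _ _ Hdd1 Hp) (near_weaken _ _ _ _ Hdd1 Hq')).
  assert (V := Hv1 p q (near_weaken _ _ _ _ Hdd2 Hp) (near_weaken _ _ _ _ Hdd2 Hq')).
  assert (Up : Rabs (u p - u p0) <= e1).
  { apply (Hvar u a b); [unfold N; lra| |exact Hp]. intros p' q' P' Q'.
    apply Hu1; apply (near_weaken d); assumption. }
  assert (Vq : Rabs (v q - v p0) <= e1).
  { apply (Hvar v a' b'); [unfold N; lra| |exact Hq']. intros p' q' P' Q'.
    apply Hv1; apply (near_weaken d); assumption. }
  set (X := fst p - fst q) in *. set (Y := snd p - snd q) in *.
  set (S := Rabs X + Rabs Y) in *.
  assert (PX := Rabs_pos X). assert (PY := Rabs_pos Y).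
  assert (HS : 0 <= S) by (unfold S; lra).
  set (lu := a * X + b * Y) in *. set (lv := a' * X + b' * Y) in *.
  assert (Hlin : forall c1 c2, Rabs c1 + Rabs c2 <= N -> Rabs (c1 * X + c2 * Y) <= N * S).
  { intros c1 c2 Hc. eapply Rle_trans; [apply Rabs_triang|]. rewrite !Rabs_mult.
    assert (Rabs c1 * Rabs X <= Rabs c1 * S) by (apply Rmult_le_compat_l; [apply Rabs_pos|unfold S; lra]).
    assert (Rabs c2 * Rabs Y <= Rabs c2 * S) by (apply Rmult_le_compat_l; [apply Rabs_pos|unfold S; lra]).
    assert ((Rabs c1 + Rabs c2) * S <= N * S) by (apply Rmult_le_compat_r; assumption). lra. }
  assert (Lu : Rabs lu <= N * S) by (apply Hlin; unfold N; lra).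
  assert (Lv : Rabs lv <= N * S) by (apply Hlin; unfold N; lra).
  replace (u p * v p - u q * v q - ((u p0 * a' + v p0 * a) * X + (u p0 * b' + v p0 * b) * Y))
    with ((u p * (v p - v q - lv) + (u p - u p0) * lv) + (v q * (u p - u q - lu) + (v q - v p0) * lu))
    by (unfold lu, lv; ring).
  assert (Bu : Rabs (u p) <= N + 1).
  { replace (u p) with ((u p - u p0) + u p0) by ring. eapply Rle_trans; [apply Rabs_triang|]. unfold N. lra. }
  assert (Bv : Rabs (v q) <= N + 1).
  { replace (v q) with ((v q - v p0) + v p0) by ring. eapply Rle_trans; [apply Rabs_triang|]. unfold N. lra. }
  eapply Rle_trans; [apply Rabs_triang|].
  assert (T1 : Rabs (u p * (v p - v q - lv) + (u p - u p0) * lv) <= (N + 1) * (e1 * S) + e1 * (N * S)).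
  { eapply Rle_trans; [apply Rabs_triang|]. rewrite !Rabs_mult.
    apply Rplus_le_compat; apply Rmult_le_compat; auto using Rabs_pos. }
  assert (T2 : Rabs (v q * (u p - u q - lu) + (v q - v p0) * lu) <= (N + 1) * (e1 * S) + e1 * (N * S)).
  { eapply Rle_trans; [apply Rabs_triang|]. rewrite !Rabs_mult.
    apply Rplus_le_compat; apply Rmult_le_compat; auto using Rabs_pos. }
  assert (4 * (N + 1) * e1 * S <= e * S) by (apply Rmult_le_compat_r; assumption).
  assert (0 <= e1 * S) by (apply Rmult_le_pos; lra). lra.
Qed.

(** * Persistence of the connection for the skew product system *)

Section Skew.

Variables M lam L : R.
Variables F F' G G' H K : R -> R.
Variable K0 : R.
Hypothesis M_pos : 0 < M.
Hypothesis lam_pos : 0 < lam.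
Hypothesis L_pos : 0 < L.
Hypothesis F_derive : forall s, is_derive F s (F' s).
Hypothesis F'_continuous : forall s, continuous F' s.
Hypothesis G_derive : forall s, is_derive G s (G' s).
Hypothesis G'_continuous : forall s, continuous G' s.
Hypothesis G_0 : G 0 = 0.
Hypothesis G_L : G L = 0.
Hypothesis G_pos : forall s, 0 < s < L -> 0 < G s.
Hypothesis H_pos : forall s, 0 < s < L -> 0 < H s.
Hypothesis H_derive : forall s, 0 < s < L -> is_derive H s (- (M * F s / G s) * H s).
Hypothesis K_derive : forall s, 0 < s < L -> is_derive K s (M * lam * H s / G s).
Hypothesis F_0_neg : F 0 < 0.
Hypothesis F_L_neg : F L < 0.
Hypothesis K0_below : forall s, 0 < s < L -> K0 < K s.
Hypothesis K0_limit : forall e, 0 < e -> at_right 0 (fun s => K s < K0 + e).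

Definition skew (p : plane) : plane :=
  (G (fst p) * exp (M * snd p), lam + F (fst p) * exp (M * snd p)).

(** Closeness in the C^1 topology, stated without derivatives: the difference
    of the fields is small and has a small Lipschitz constant. *)
Definition close_on (D : plane -> Prop) (e : R) (B : plane -> plane) : Prop :=
  (forall p, D p -> Rabs (fst (B p) - fst (skew p)) <= e /\ Rabs (snd (B p) - snd (skew p)) <= e) /\
  (forall p q, D p -> D q ->
     Rabs ((fst (B p) - fst (skew p)) - (fst (B q) - fst (skew q))) <=
       e * (Rabs (fst p - fst q) + Rabs (snd p - snd q)) /\
     Rabs ((snd (B p) - snd (skew p)) - (snd (B q) - snd (skew q))) <=
       e * (Rabs (fst p - fst q) + Rabs (snd p - snd q))).

(** The field [B] near [(s0, q0)], run in the direction [tau] of time. The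
    linear part of [skew] is triangular, and scaling the second coordinate by a
    small [mu] makes its off-diagonal entry small, so that the rescaled field is
    close to a diagonal one. *)
Definition rescaled (tau mu s0 q0 : R) (B : plane -> plane) (p : plane) : plane :=
  let w := (s0 + fst p, q0 + snd p / mu) in
  (tau * fst (B w), tau * mu * snd (B w)).

Lemma exp_M_derive (x : R) : is_derive (fun x => exp (M * x)) x (M * exp (M * x)).
Proof. auto_derive; [exact I|ring]. Qed.

Lemma exp_M_derive_continuous (x : R) : continuous (fun x => M * exp (M * x)) x.
Proof. apply (ex_derive_continuous (V := R_NormedModule)). auto_derive. exact I. Qed.

Lemma near_of_square (mu d s0 q0 : R) (p : plane) :
  0 < mu <= 1 -> in_square d p -> near (d / mu) (s0 + fst p, q0 + snd p / mu) (s0, q0).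
Proof.
  intros Hmu [S1 S2].
  assert (Hi : 0 < / mu) by (apply Rinv_0_lt_compat; lra).
  assert (Hd : 0 <= d) by (eapply Rle_trans; [apply Rabs_pos|exact S1]).
  assert (Hdm : d <= d / mu).
  { apply Rmult_le_reg_l with mu; [lra|]. replace (mu * (d / mu)) with d by (field; lra). nra. }
  unfold near. simpl. replace (s0 + fst p - s0) with (fst p) by ring.
  replace (q0 + snd p / mu - q0) with (snd p * / mu) by (unfold Rdiv; ring).
  split; [lra|]. rewrite Rabs_mult, (Rabs_right (/ mu)) by lra.
  apply Rmult_le_compat_r; lra.
Qed.

Lemma rescaled_nearly_linear (tau s0 q0 kap : R) :
  tau = 1 \/ tau = -1 -> G s0 = 0 -> lam + F s0 * exp (M * q0) = 0 -> 0 < kap ->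
  exists mu d0, 0 < mu <= 1 /\ 0 < d0 /\ forall d, 0 < d <= d0 ->
    exists e0, 0 < e0 /\ forall B, close_on (fun p => near (d / mu) p (s0, q0)) e0 B ->
      nearly_linear (rescaled tau mu s0 q0 B) (tau * (G' s0 * exp (M * q0))) (tau * - (M * lam)) kap d.
Proof.
  intros Htau HG HF Hkap.
  set (v0 := exp (M * q0)) in *. set (gam := F' s0 * v0). set (alp := G' s0 * v0).
  set (p0 := (s0, q0) : plane).
  assert (D1 : strictly_differentiable (fun p => fst (skew p)) p0 alp 0).
  { replace alp with (G (fst p0) * 0 + exp (M * snd p0) * G' (fst p0))
      by (unfold alp, v0; simpl; ring).
    replace 0 with (G (fst p0) * (M * exp (M * snd p0)) + exp (M * snd p0) * 0) at 2
      by (simpl; rewrite HG; ring).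
    apply (strictly_differentiable_mult (fun p => G (fst p)) (fun p => exp (M * snd p))).
    - apply strictly_differentiable_fst; auto.
    - apply (strictly_differentiable_snd (fun q => exp (M * q)) (fun q => M * exp (M * q)));
        [apply exp_M_derive|apply exp_M_derive_continuous]. }
  assert (D2 : strictly_differentiable (fun p => F (fst p) * exp (M * snd p)) p0 gam (- (M * lam))).
  { replace gam with (F (fst p0) * 0 + exp (M * snd p0) * F' (fst p0))
      by (unfold gam, v0; simpl; ring).
    replace (- (M * lam)) with (F (fst p0) * (M * exp (M * snd p0)) + exp (M * snd p0) * 0).
    2:{ simpl. fold v0. replace lam with (- (F s0 * v0)) by lra. ring. }
    apply (strictly_differentiable_mult (fun p => F (fst p)) (fun p => exp (M * snd p))).
    - apply strictly_differentiable_fst; auto.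
    - apply (strictly_differentiable_snd (fun q => exp (M * q)) (fun q => M * exp (M * q)));
        [apply exp_M_derive|apply exp_M_derive_continuous]. }
  set (mu := Rmin 1 (kap / (2 * (Rabs gam + 1)))).
  assert (Pg := Rabs_pos gam).
  assert (Hmu : 0 < mu) by (apply Rmin_pos; [lra|apply Rdiv_lt_0_compat; lra]).
  assert (Hmu1 : mu <= 1) by apply Rmin_l.
  assert (Hmug : mu * Rabs gam <= kap / 2).
  { assert (E : mu <= kap / (2 * (Rabs gam + 1))) by apply Rmin_r.
    apply Rmult_le_compat_r with (r := Rabs gam + 1) in E; [|lra].
    replace (kap / (2 * (Rabs gam + 1)) * (Rabs gam + 1)) with (kap / 2) in E by (field; lra). lra. }
  set (e1 := kap * mu / 4).
  assert (Hkm : 0 < kap * mu) by (apply Rmult_lt_0_compat; assumption).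
  assert (He1 : 0 < e1) by (unfold e1; lra).
  destruct (D1 e1 He1) as (r1 & Hr1 & L1). destruct (D2 e1 He1) as (r2 & Hr2 & L2).
  assert (Hr : 0 < Rmin r1 r2) by (apply Rmin_pos; assumption).
  exists mu, (mu * Rmin r1 r2). split; [lra|]. split; [apply Rmult_lt_0_compat; assumption|].
  intros d Hd.
  assert (Hdr : d / mu <= Rmin r1 r2).
  { apply Rmult_le_reg_l with mu; [exact Hmu|]. replace (mu * (d / mu)) with d by (field; lra). lra. }
  assert (Hddm : d <= d / mu).
  { apply Rmult_le_reg_l with mu; [exact Hmu|]. replace (mu * (d / mu)) with d by (field; lra). nra. }
  assert (Hkd : 0 < kap * d) by (apply Rmult_lt_0_compat; lra).
  exists (Rmin e1 (kap * d)). split; [apply Rmin_pos; assumption|].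
  set (e0 := Rmin e1 (kap * d)).
  assert (He01 : e0 <= e1) by apply Rmin_l. assert (He0d : e0 <= kap * d) by apply Rmin_r.
  intros B [C0 C1].
  set (loc := fun p : plane => (s0 + fst p, q0 + snd p / mu) : plane).
  assert (Hloc : forall p, in_square d p -> near (d / mu) (loc p) p0).
  { intros p Hp. apply near_of_square; [lra|exact Hp]. }
  assert (Htabs : forall x, Rabs (tau * x) = Rabs x).
  { intros x. rewrite Rabs_mult. destruct Htau as [-> | ->];
      [rewrite Rabs_right by lra|rewrite Rabs_left by lra]; ring. }
  split; [|split].
  - intros p q Hp Hq. unfold rescaled. fold (loc p) (loc q). simpl.
    assert (Np := Hloc p Hp). assert (Nq := Hloc q Hq).
    assert (E1 := L1 (loc p) (loc q) (near_weaken _ _ _ _ (Rle_trans _ _ _ Hdr (Rmin_l _ _)) Np)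
      (near_weaken _ _ _ _ (Rle_trans _ _ _ Hdr (Rmin_l _ _)) Nq)).
    assert (E2 := L2 (loc p) (loc q) (near_weaken _ _ _ _ (Rle_trans _ _ _ Hdr (Rmin_r _ _)) Np)
      (near_weaken _ _ _ _ (Rle_trans _ _ _ Hdr (Rmin_r _ _)) Nq)).
    destruct (C1 (loc p) (loc q) Np Nq) as [Z1 Z2].
    assert (Ef : fst (loc p) - fst (loc q) = fst p - fst q) by (unfold loc; simpl; ring).
    assert (Es : snd (loc p) - snd (loc q) = (snd p - snd q) / mu) by (unfold loc; simpl; unfold Rdiv; ring).
    rewrite Ef, Es in E1, E2, Z1, Z2.
    set (X := fst p - fst q) in *. set (Y := snd p - snd q) in *.
    assert (EY : Rabs (Y / mu) = Rabs Y / mu).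
    { unfold Rdiv. rewrite Rabs_mult, (Rabs_right (/ mu)); [reflexivity|].
      apply Rle_ge, Rlt_le, Rinv_0_lt_compat, Hmu. }
    rewrite EY in E1, E2, Z1, Z2.
    assert (PX := Rabs_pos X). assert (PY := Rabs_pos Y).
    assert (HYm : Rabs Y <= Rabs Y / mu).
    { apply Rmult_le_reg_l with mu; [exact Hmu|]. replace (mu * (Rabs Y / mu)) with (Rabs Y) by (field; lra). nra. }
    assert (HS : mu * (Rabs X + Rabs Y / mu) <= Rabs X + Rabs Y).
    { rewrite Rmult_plus_distr_l. replace (mu * (Rabs Y / mu)) with (Rabs Y) by (field; lra). nra. }
    set (S := Rabs X + Rabs Y / mu) in *.
    assert (HS0 : 0 <= S) by (unfold S; lra).
    assert (HeS : (e1 + e0) * S <= kap / 2 * (Rabs X + Rabs Y)).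
    { apply Rle_trans with (2 * e1 * S); [apply Rmult_le_compat_r; lra|].
      replace (2 * e1 * S) with (kap / 2 * (mu * S)) by (unfold e1; field).
      apply Rmult_le_compat_l; lra. }
    fold v0 alp. split.
    + replace (tau * fst (B (loc p)) - tau * fst (B (loc q)) - tau * alp * X)
        with (tau * ((fst (skew (loc p)) - fst (skew (loc q)) - (alp * X + 0 * (Y / mu))) +
                     ((fst (B (loc p)) - fst (skew (loc p))) - (fst (B (loc q)) - fst (skew (loc q)))))) by ring.
      rewrite Htabs. eapply Rle_trans; [apply Rabs_triang|].
      assert (0 <= kap / 2 * (Rabs X + Rabs Y)) by (apply Rmult_le_pos; lra).
      lra.
    + replace (tau * mu * snd (B (loc p)) - tau * mu * snd (B (loc q)) - tau * - (M * lam) * Y)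
        with (tau * (mu * ((F (fst (loc p)) * exp (M * snd (loc p)) - F (fst (loc q)) * exp (M * snd (loc q)) -
                            (gam * X + - (M * lam) * (Y / mu))) +
                     ((snd (B (loc p)) - snd (skew (loc p))) - (snd (B (loc q)) - snd (skew (loc q))))) +
                     mu * gam * X)) by (unfold skew; simpl; field; lra).
      rewrite Htabs. eapply Rle_trans; [apply Rabs_triang|].
      rewrite !Rabs_mult, (Rabs_right mu) by lra.
      match goal with |- mu * Rabs (?a + ?b) + _ <= _ =>
        assert (T : Rabs (a + b) <= (e1 + e0) * S)
          by (eapply Rle_trans; [apply Rabs_triang|]; lra) end.
      assert (T2 : mu * Rabs gam * Rabs X <= kap / 2 * Rabs X) by (apply Rmult_le_compat_r; assumption).
      match goal with |- mu * ?a + _ <= _ =>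
        assert (T3 : mu * a <= 1 * ((e1 + e0) * S)) by (apply Rmult_le_compat; [lra|apply Rabs_pos|exact Hmu1|exact T]) end.
      assert (0 <= kap / 2 * Rabs Y) by (apply Rmult_le_pos; lra).
      lra.
  - unfold rescaled. simpl. replace (s0 + 0) with s0 by ring. replace (q0 + 0 / mu) with q0 by (field; lra).
    rewrite Htabs. destruct (C0 p0) as [Z _]; [apply near_refl; lra|].
    unfold skew in Z. simpl in Z. rewrite HG, Rmult_0_l, Rminus_0_r in Z. fold p0. lra.
  - unfold rescaled. simpl. replace (s0 + 0) with s0 by ring. replace (q0 + 0 / mu) with q0 by (field; lra).
    rewrite Rmult_assoc, Htabs, Rabs_mult, (Rabs_right mu) by lra.
    destruct (C0 p0) as [_ Z]; [apply near_refl; lra|].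
    unfold skew in Z. simpl in Z. fold v0 in Z. rewrite HF, Rminus_0_r in Z. fold p0.
    assert (PB := Rabs_pos (snd (B p0))). nra.
Qed.

(** The connection, as a graph over the angle. *)
Definition graph (s : R) : R := ln ((K s + - K0) / H s) / M.

Definition q_minus : R := ln (- (lam / F 0)) / M.
Definition q_plus : R := ln (- (lam / F L)) / M.

Lemma skew_equilibrium_height (f : R) : f < 0 -> lam + f * exp (M * (ln (- (lam / f)) / M)) = 0.
Proof.
  intros Hf. replace (M * (ln (- (lam / f)) / M)) with (ln (- (lam / f))) by (field; lra).
  rewrite exp_ln by (apply neg_quotient_pos; assumption). field. lra.
Qed.

Lemma continuous_ln_over_M (v : R) : 0 < v -> continuous (fun v => ln v / M) v.
Proof.
  intros Hv. apply (ex_derive_continuous (V := R_NormedModule)). auto_derive. exact Hv.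
Qed.

Lemma graph_limit_0 : filterlim graph (at_right 0) (locally q_minus).
Proof.
  apply (filterlim_comp _ _ _ (fun s => (K s + - K0) / H s) (fun v => ln v / M) _ (locally (- (lam / F 0)))).
  - apply (separatrix_limit_at_0 M lam L F G G' H K); auto.
    intros s. exact (is_derive_continuous _ _ _ (F_derive s)).
  - apply continuous_ln_over_M, neg_quotient_pos; assumption.
Qed.

Lemma graph_limit_L : filterlim graph (at_left L) (locally q_plus).
Proof.
  apply (filterlim_comp _ _ _ (fun s => (K s + - K0) / H s) (fun v => ln v / M) _ (locally (- (lam / F L)))).
  - apply (level_limit_at_L_negative M lam L F G G' H K); auto.
    intros s. exact (is_derive_continuous _ _ _ (F_derive s)).
  - apply continuous_ln_over_M, neg_quotient_pos; assumption.
Qed.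

Lemma graph_continuous (s : R) : 0 < s < L -> continuous graph s.
Proof.
  intros Hs. assert (HK := K0_below s Hs). assert (PH := H_pos s Hs).
  apply (continuous_comp (fun s => (K s + - K0) / H s) (fun v => ln v / M)).
  - eapply is_derive_continuous.
    apply (level_derive M lam L F G H K G_pos H_pos H_derive K_derive (- K0) s Hs).
  - apply continuous_ln_over_M, Rdiv_lt_0_compat; lra.
Qed.

Lemma graph_near_0 (r : R) : 0 < r -> at_right 0 (fun s => Rabs (graph s - q_minus) < r).
Proof. intros Hr. exact (graph_limit_0 _ (locally_ball _ (mkposreal r Hr))). Qed.

Lemma graph_near_L (r : R) : 0 < r -> at_left L (fun s => Rabs (graph s - q_plus) < r).
Proof. intros Hr. exact (graph_limit_L _ (locally_ball _ (mkposreal r Hr))). Qed.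

(** It has limits at both ends of the interval. *)
Lemma graph_bounded : exists A, 0 <= A /\ forall s, 0 < s < L -> Rabs (graph s) <= A.
Proof.
  destruct (proj1 (at_right_iff 0 _) (graph_near_0 1 Rlt_0_1)) as (d1 & Hd1 & N1).
  destruct (proj1 (at_left_iff L _) (graph_near_L 1 Rlt_0_1)) as (d2 & Hd2 & N2).
  set (a := Rmin d1 L / 2). set (b := L - Rmin d2 L / 2).
  assert (Ha : 0 < a /\ a < d1 /\ a <= L / 2).
  { unfold a. assert (0 < Rmin d1 L) by (apply Rmin_pos; assumption).
    generalize (Rmin_l d1 L) (Rmin_r d1 L). lra. }
  assert (Hb : b < L /\ L - d2 < b /\ L / 2 <= b).
  { unfold b. assert (0 < Rmin d2 L) by (apply Rmin_pos; assumption).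
    generalize (Rmin_l d2 L) (Rmin_r d2 L). lra. }
  destruct (continuous_bounded_on graph a b) as (A & HA & HAb); [lra|intros t Ht; apply graph_continuous; lra|].
  assert (P1 := Rabs_pos q_minus). assert (P2 := Rabs_pos q_plus).
  exists (A + Rabs q_minus + Rabs q_plus + 1). split; [lra|]. intros s Hs.
  destruct (Rlt_dec s a) as [Hsa|Hsa].
  - assert (B := N1 s ltac:(lra)).
    replace (graph s) with ((graph s - q_minus) + q_minus) by ring.
    eapply Rle_trans; [apply Rabs_triang|]. lra.
  - destruct (Rlt_dec b s) as [Hsb|Hsb].
    + assert (B := N2 s ltac:(lra)).
      replace (graph s) with ((graph s - q_plus) + q_plus) by ring.
      eapply Rle_trans; [apply Rabs_triang|]. lra.
    + specialize (HAb s ltac:(lra)). lra.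
Qed.

(** The first integral relative to its value on the connection. *)
Definition defect (p : plane) : R := H (fst p) * exp (M * snd p) - (K (fst p) - K0).

(** A bound for the defect is a bound for the height above the connection,
    uniformly away from [s = 0], where [K - K0] vanishes. *)
Lemma defect_graph (s q : R) :
  0 < s < L -> defect (s, q) = (K s - K0) * (exp (M * (q - graph s)) - 1).
Proof.
  intros Hs. assert (HK := K0_below s Hs). assert (PH := H_pos s Hs). unfold defect. simpl.
  assert (E : exp (M * graph s) = (K s - K0) / H s).
  { unfold graph. replace (M * (ln ((K s + - K0) / H s) / M)) with (ln ((K s + - K0) / H s)) by (field; lra).
    rewrite exp_ln; [reflexivity|apply Rdiv_lt_0_compat; lra]. }
  replace (M * q) with (M * graph s + M * (q - graph s)) by ring.
  rewrite exp_plus, E. field. lra.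
Qed.

Lemma log_small (y k : R) : 0 <= k <= 1 / 2 -> Rabs (exp y - 1) <= k -> Rabs y <= 2 * k.
Proof.
  intros Hk Hy. apply Rabs_le_between in Hy. apply Rabs_le. split.
  - apply Rnot_lt_le. intros Hlt.
    assert (E1 : exp y < exp (- (2 * k))) by (apply exp_increasing; lra).
    assert (E2 : 1 + 2 * k <= exp (2 * k)) by apply exp_ineq1_le.
    assert (E3 : exp (2 * k) * exp (- (2 * k)) = 1) by apply exp_opp_mult.
    assert (E4 : 0 < exp (- (2 * k))) by apply exp_pos.
    assert (E5 : (1 + 2 * k) * exp (- (2 * k)) <= 1) by nra.
    nra.
  - assert (E : 1 + y <= exp y) by apply exp_ineq1_le. lra.
Qed.

Lemma exp_small (k : R) : 0 < k -> exists r, 0 < r /\ forall y, Rabs y <= r -> Rabs (exp y - 1) <= k.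
Proof.
  intros Hk.
  assert (C : continuous exp 0) by (apply is_derive_continuous with (exp 0); apply is_derive_exp).
  assert (N : locally 0 (fun y => Rabs (exp y - exp 0) < k)) by exact (C _ (locally_ball _ (mkposreal k Hk))).
  destruct N as [d Hd]. assert (Hdp : 0 < d) by apply d.
  exists (d / 2). split; [lra|]. intros y Hy. rewrite exp_0 in Hd. left. apply Hd.
  change (Rabs (y - 0) < d). rewrite Rminus_0_r. lra.
Qed.

Lemma K_increasing_skew (x y : R) : 0 < x -> x < y -> y < L -> K x < K y.
Proof. apply (K_increasing M lam L G H K); auto. Qed.

(** The defect is constant along [skew], so that only the difference of the
    fields enters. *)
Lemma defect_derive (B : plane -> plane) (s q : R -> R) (t : R) :
  0 < s t < L -> flows B s q t ->
  is_derive (fun t => defect (s t, q t)) t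
    ((- (M * F (s t) / G (s t)) * H (s t) * exp (M * q t) - M * lam * H (s t) / G (s t)) *
       (fst (B (s t, q t)) - fst (skew (s t, q t))) +
     M * H (s t) * exp (M * q t) * (snd (B (s t, q t)) - snd (skew (s t, q t)))).
Proof.
  intros Hs [D1 D2]. assert (PG := G_pos (s t) Hs).
  unfold defect. simpl.
  evar_last.
  - apply (is_derive_minus_R (fun t => H (s t) * exp (M * q t)) (fun t => K (s t) - K0)).
    + apply (is_derive_mult_R (fun t => H (s t)) (fun t => exp (M * q t))).
      * apply (is_derive_comp_R H s); [apply H_derive, Hs|exact D1].
      * apply (is_derive_comp_R (fun x => exp (M * x)) q); [apply exp_M_derive|exact D2].
    + apply (is_derive_minus_R (fun t => K (s t)) (fun _ => K0)).
      * apply (is_derive_comp_R K s); [apply K_derive, Hs|exact D1].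
      * apply (is_derive_const (V := R_NormedModule)).
  - unfold zero; simpl. unfold skew. simpl. field. lra.
Qed.

(** As long as the solution is in the tube, [s] grows at the rate [c1], which
    leaves at most the time [L / c1], during which the defect changes by less than
    [Em / 2]. So the tube can only be left through the side [s = s2]. *)
Lemma transit (W : plane -> plane) (s q : R -> R) (d1 s2 Em c1 e2 : R) :
  0 < d1 -> d1 < s2 -> s2 < L -> 0 < c1 -> 0 <= e2 -> e2 * (L / c1) < Em / 2 ->
  (forall t, 0 <= t -> flows W s q t) ->
  s 0 = d1 -> Rabs (defect (s 0, q 0)) <= Em / 2 ->
  (forall p, d1 <= fst p <= s2 -> Rabs (defect p) <= Em ->
     c1 <= fst (W p) /\
     Rabs ((- (M * F (fst p) / G (fst p)) * H (fst p) * exp (M * snd p) - M * lam * H (fst p) / G (fst p)) *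
       (fst (W p) - fst (skew p)) +
       M * H (fst p) * exp (M * snd p) * (snd (W p) - snd (skew p))) <= e2) ->
  exists t1, 0 <= t1 /\ s t1 = s2 /\
    forall t, 0 <= t <= t1 -> d1 <= s t <= s2 /\ Rabs (defect (s t, q t)) <= Em.
Proof.
  intros Hd1 Hds HsL Hc1 He2 HeE Hf Hs0 Hdef0 Htube.
  set (tube := fun t => d1 <= s t <= s2 /\ Rabs (defect (s t, q t)) <= Em).
  apply NNPP. intros Hn.
  set (dd := fun t => (- (M * F (s t) / G (s t)) * H (s t) * exp (M * q t) - M * lam * H (s t) / G (s t)) *
       (fst (W (s t, q t)) - fst (skew (s t, q t))) +
       M * H (s t) * exp (M * q t) * (snd (W (s t, q t)) - snd (skew (s t, q t)))).
  assert (Htt : forall t, tube t -> c1 <= fst (W (s t, q t)) /\ - e2 <= dd t <= e2).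
  { intros t [T1 T2]. destruct (Htube (s t, q t) T1 T2) as [A1 A2]. simpl in A1, A2.
    split; [exact A1|]. apply Rabs_le_between. exact A2. }
  assert (Hdd : forall t, 0 <= t -> tube t -> is_derive (fun t => defect (s t, q t)) t (dd t)).
  { intros t Ht [T1 T2]. apply (defect_derive W s q t); [lra|apply Hf, Ht]. }
  assert (HT : 0 < L / c1) by (apply Rdiv_lt_0_compat; assumption).
  assert (Hs_low : forall x, 0 <= x -> (forall u, 0 <= u <= x -> tube u) -> d1 + c1 * x <= s x).
  { intros x Hx Hu.
    assert (E : s 0 - c1 * 0 <= s x - c1 * x).
    { apply (nondecreasing_of_derive (fun t => s t - c1 * t) (fun t => fst (W (s t, q t)) - c1)); [exact Hx| |].
      - intros t Ht. apply (is_derive_minus_R s (fun t => c1 * t)); [apply Hf; lra|]. auto_derive; [exact I|ring].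
      - intros t Ht. destruct (Htt t (Hu t Ht)) as [A _]. lra. }
    rewrite Hs0 in E. lra. }
  assert (Hdef : forall x, 0 <= x <= L / c1 -> (forall u, 0 <= u <= x -> tube u) ->
    Rabs (defect (s x, q x)) < Em).
  { intros x Hx Hu. apply Rabs_le_between in Hdef0.
    assert (Hex : e2 * x <= e2 * (L / c1)) by (apply Rmult_le_compat_l; lra).
    assert (E1 : defect (s x, q x) - e2 * x <= defect (s 0, q 0) - e2 * 0).
    { apply (nonincreasing_of_derive (fun t => defect (s t, q t) - e2 * t) (fun t => dd t - e2)); [lra| |].
      - intros t Ht. apply (is_derive_minus_R (fun t => defect (s t, q t)) (fun t => e2 * t)).
        + apply Hdd; [lra|apply Hu; lra].
        + auto_derive; [exact I|ring].
      - intros t Ht. destruct (Htt t (Hu t ltac:(lra))) as [_ A]. lra. }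
    assert (E2 : defect (s 0, q 0) + e2 * 0 <= defect (s x, q x) + e2 * x).
    { apply (nondecreasing_of_derive (fun t => defect (s t, q t) + e2 * t) (fun t => dd t + e2)); [lra| |].
      - intros t Ht. apply (is_derive_plus_R (fun t => defect (s t, q t)) (fun t => e2 * t)).
        + apply Hdd; [lra|apply Hu; lra].
        + auto_derive; [exact I|ring].
      - intros t Ht. destruct (Htt t (Hu t ltac:(lra))) as [_ A]. lra. }
    apply Rabs_def1; lra. }
  assert (Hall : forall t, 0 <= t <= L / c1 -> tube t).
  { apply real_induction; [lra| | |].
    - split; [lra|]. assert (0 <= Em / 2) by (eapply Rle_trans; [apply Rabs_pos|exact Hdef0]). lra.
    - intros x Hx Hu. destruct (Hf x ltac:(lra)) as [D1 D2].
      assert (Tx := Hu x ltac:(lra)). assert (Ddx := Hdd x ltac:(lra) Tx).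
      assert (Hdx := Hdef x ltac:(lra) Hu). apply Rabs_def2 in Hdx.
      destruct (Htt x Tx) as [Wx _]. destruct Tx as [Tx _].
      assert (Hne : s x <> s2).
      { intros E. apply Hn. exists x. split; [lra|]. split; [exact E|exact Hu]. }
      assert (R1 : at_right x (fun t => d1 <= s t <= s2)).
      { apply (at_right_between s x _ _ _ D1 Tx); intros E; [lra|contradiction]. }
      assert (R2 : at_right x (fun t => - Em <= defect (s t, q t) <= Em)).
      { apply (at_right_between _ x _ _ _ Ddx); [lra|intros E; lra|intros E; lra]. }
      generalize (filter_and _ _ R1 R2). apply filter_imp. intros u [U1 U2].
      split; [exact U1|]. apply Rabs_le, U2.
    - intros x Hx Hu. destruct (Hf x ltac:(lra)) as [D1 D2].
      assert (S1 : d1 <= s x <= s2).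
      { apply (closed_between_at_left s 0); [lra|exact (is_derive_continuous _ _ _ D1)|].
        intros u Hu'. apply Hu, Hu'. }
      split; [exact S1|]. apply Rabs_le.
      apply (closed_between_at_left (fun t => defect (s t, q t)) 0); [lra| |].
      + eapply is_derive_continuous. apply (defect_derive W s q x); [lra|apply Hf; lra].
      + intros u Hu'. apply Rabs_le_between, Hu, Hu'. }
  assert (E := Hs_low (L / c1) ltac:(lra) Hall).
  destruct (Hall (L / c1) ltac:(lra)) as [A _].
  replace (c1 * (L / c1)) with L in E by (field; lra). lra.
Qed.

(** The sector is enlarged by [1] on both sides, since the equilibria of the
    perturbed field need not be on its boundary rays. *)
Definition rectangle (A : R) (p : plane) : Prop := -1 <= fst p <= L + 1 /\ - A <= snd p <= A.

Lemma lipschitz_on_interval (f f' : R -> R) (a b : R) :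
  a <= b -> (forall x, is_derive f x (f' x)) -> (forall x, continuous f' x) ->
  exists B K, 0 <= B /\ 0 <= K /\ (forall x, a <= x <= b -> Rabs (f x) <= B) /\
    forall x y, a <= x <= b -> a <= y <= b -> Rabs (f x - f y) <= K * Rabs (x - y).
Proof.
  intros Hab Hd Hc.
  destruct (continuous_bounded_on f a b Hab) as (B & HB & HfB).
  { intros t _. exact (is_derive_continuous _ _ _ (Hd t)). }
  destruct (continuous_bounded_on f' a b Hab) as (K1 & HK1 & HfK); [intros t _; apply Hc|].
  exists B, K1. split; [exact HB|]. split; [exact HK1|]. split; [exact HfB|].
  intros x y Hx Hy. destruct (MVT_gen f y x f') as [c [Hcc E]].
  - intros t _. apply Hd.
  - intros t _. apply continuity_pt_filterlim. exact (is_derive_continuous _ _ _ (Hd t)).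
  - rewrite E, Rabs_mult. apply Rmult_le_compat_r; [apply Rabs_pos|]. apply HfK.
    revert Hcc. unfold Rmin, Rmax. destruct Rle_dec; lra.
Qed.

Lemma product_lipschitz (f g : R -> R) (x x' y y' Bf Kf Bg Kg : R) :
  0 <= Bf -> 0 <= Kf -> 0 <= Bg -> 0 <= Kg ->
  Rabs (f x) <= Bf -> Rabs (g y') <= Bg ->
  Rabs (f x - f x') <= Kf * Rabs (x - x') -> Rabs (g y - g y') <= Kg * Rabs (y - y') ->
  Rabs (f x * g y - f x' * g y') <= (Bf * Kg + Bg * Kf) * (Rabs (x - x') + Rabs (y - y')).
Proof.
  intros P1 P2 P3 P4 H1 H2 H3 H4.
  replace (f x * g y - f x' * g y') with (f x * (g y - g y') + g y' * (f x - f x')) by ring.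
  eapply Rle_trans; [apply Rabs_triang|]. rewrite !Rabs_mult.
  assert (A1 : Rabs (f x) * Rabs (g y - g y') <= Bf * (Kg * Rabs (y - y')))
    by (apply Rmult_le_compat; auto using Rabs_pos).
  assert (A2 : Rabs (g y') * Rabs (f x - f x') <= Bg * (Kf * Rabs (x - x')))
    by (apply Rmult_le_compat; auto using Rabs_pos).
  assert (0 <= Bf * Kg * Rabs (x - x')) by (repeat apply Rmult_le_pos; auto using Rabs_pos).
  assert (0 <= Bg * Kf * Rabs (y - y')) by (repeat apply Rmult_le_pos; auto using Rabs_pos).
  lra.
Qed.

Lemma skew_lipschitz_on_rectangle (A : R) :
  0 <= A -> exists KA, 0 <= KA /\ forall p q, rectangle A p -> rectangle A q ->
    Rabs (fst (skew p) - fst (skew q)) <= KA * (Rabs (fst p - fst q) + Rabs (snd p - snd q)) /\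
    Rabs (snd (skew p) - snd (skew q)) <= KA * (Rabs (fst p - fst q) + Rabs (snd p - snd q)).
Proof.
  intros HA.
  destruct (lipschitz_on_interval G G' (-1) (L + 1)) as (B1 & K1 & PB1 & PK1 & HB1 & HK1); [lra|auto|auto|].
  destruct (lipschitz_on_interval F F' (-1) (L + 1)) as (B2 & K2 & PB2 & PK2 & HB2 & HK2); [lra|auto|auto|].
  destruct (lipschitz_on_interval (fun x => exp (M * x)) (fun x => M * exp (M * x)) (- A) A)
    as (B3 & K3 & PB3 & PK3 & HB3 & HK3); [lra|apply exp_M_derive|apply exp_M_derive_continuous|].
  set (C1 := B1 * K3 + B3 * K1). set (C2 := B2 * K3 + B3 * K2).
  assert (HC1 : 0 <= C1) by (apply Rplus_le_le_0_compat; apply Rmult_le_pos; assumption).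
  assert (HC2 : 0 <= C2) by (apply Rplus_le_le_0_compat; apply Rmult_le_pos; assumption).
  exists (C1 + C2). split; [lra|]. intros p q [P1 P2] [Q1 Q2].
  set (S := Rabs (fst p - fst q) + Rabs (snd p - snd q)).
  assert (HS : 0 <= S) by (unfold S; generalize (Rabs_pos (fst p - fst q)) (Rabs_pos (snd p - snd q)); lra).
  assert (0 <= C1 * S) by (apply Rmult_le_pos; assumption).
  assert (0 <= C2 * S) by (apply Rmult_le_pos; assumption).
  unfold skew. simpl. split.
  - apply Rle_trans with (C1 * S); [|lra].
    apply (product_lipschitz G (fun x => exp (M * x))); auto.
  - replace (lam + F (fst p) * exp (M * snd p) - (lam + F (fst q) * exp (M * snd q)))
      with (F (fst p) * exp (M * snd p) - F (fst q) * exp (M * snd q)) by ring.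
    apply Rle_trans with (C2 * S); [|lra].
    apply (product_lipschitz F (fun x => exp (M * x))); auto.
Qed.

Lemma is_derive_glue (f g : R -> R) (a l : R) :
  is_derive f a l -> is_derive g a l -> f a = g a ->
  is_derive (fun t => if Rle_dec t a then f t else g t) a l.
Proof.
  intros Hf Hg E. apply is_derive_Reals. apply is_derive_Reals in Hf. apply is_derive_Reals in Hg.
  intros e He. destruct (Hf e He) as [d1 H1]. destruct (Hg e He) as [d2 H2].
  assert (Hd : 0 < Rmin d1 d2) by (apply Rmin_pos; [apply d1|apply d2]).
  exists (mkposreal _ Hd). intros h Hh Hlt. simpl in Hlt.
  assert (A1 := Rmin_l d1 d2). assert (A2 := Rmin_r d1 d2).
  destruct (Rle_dec a a) as [_|N]; [|lra].
  destruct (Rle_dec (a + h) a) as [Hle|Hgt].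
  - apply H1; [exact Hh|lra].
  - rewrite E. apply H2; [exact Hh|lra].
Qed.

Lemma flows_glue (B : plane -> plane) (s1 q1 s2 q2 : R -> R) :
  (forall t, t <= 0 -> flows B s1 q1 t) -> (forall t, 0 <= t -> flows B s2 q2 t) ->
  s1 0 = s2 0 -> q1 0 = q2 0 ->
  forall t, flows B (fun t => if Rle_dec t 0 then s1 t else s2 t)
                    (fun t => if Rle_dec t 0 then q1 t else q2 t) t.
Proof.
  intros H1 H2 Es Eq t. destruct (Rtotal_order t 0) as [Hlt|[->|Hgt]].
  - destruct (H1 t ltac:(lra)) as [D1 D2].
    assert (N : locally t (fun u => u <= 0)).
    { generalize (open_lt 0 t Hlt). apply filter_imp. intros u Hu. lra. }
    split; destruct (Rle_dec t 0) as [_|N0]; try lra.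
    + apply (is_derive_ext_loc s1); [|exact D1].
      revert N. apply filter_imp. intros u Hu. destruct (Rle_dec u 0); [reflexivity|lra].
    + apply (is_derive_ext_loc q1); [|exact D2].
      revert N. apply filter_imp. intros u Hu. destruct (Rle_dec u 0); [reflexivity|lra].
  - destruct (H1 0 ltac:(lra)) as [A1 A2]. destruct (H2 0 ltac:(lra)) as [B1 B2].
    rewrite <- Es, <- Eq in B1, B2.
    split; destruct (Rle_dec 0 0) as [_|N0]; try lra; apply is_derive_glue; assumption.
  - destruct (H2 t ltac:(lra)) as [D1 D2].
    assert (N : locally t (fun u => 0 < u)) by exact (open_gt 0 t Hgt).
    split; destruct (Rle_dec t 0) as [N0|_]; try lra.
    + apply (is_derive_ext_loc s2); [|exact D1].
      revert N. apply filter_imp. intros u Hu. destruct (Rle_dec u 0); [lra|reflexivity].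
    + apply (is_derive_ext_loc q2); [|exact D2].
      revert N. apply filter_imp. intros u Hu. destruct (Rle_dec u 0); [lra|reflexivity].
Qed.

Lemma close_on_weaken (D D' : plane -> Prop) (e e' : R) (B B' : plane -> plane) :
  (forall p, D' p -> D p) -> e <= e' -> (forall p, D p -> B' p = B p) ->
  close_on D e B -> close_on D' e' B'.
Proof.
  intros HD He HB [C0 C1]. split.
  - intros p Hp. rewrite (HB p (HD p Hp)). destruct (C0 p (HD p Hp)). split; lra.
  - intros p q Hp Hq. rewrite (HB p (HD p Hp)), (HB q (HD q Hq)).
    destruct (C1 p q (HD p Hp) (HD q Hq)) as [A1 A2].
    assert (HS : 0 <= Rabs (fst p - fst q) + Rabs (snd p - snd q))
      by (generalize (Rabs_pos (fst p - fst q)) (Rabs_pos (snd p - snd q)); lra).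
    assert (e * (Rabs (fst p - fst q) + Rabs (snd p - snd q)) <=
            e' * (Rabs (fst p - fst q) + Rabs (snd p - snd q))) by (apply Rmult_le_compat_r; assumption).
    split; lra.
Qed.

Definition persistent_connection (A rho : R) (B : plane -> plane) : Prop :=
  exists (s q : R -> R) (pm pp : plane),
    (forall t, flows B s q t) /\ (forall t, rectangle A (s t, q t)) /\
    B pm = (0, 0) /\ B pp = (0, 0) /\
    near rho pm (0, q_minus) /\ near rho pp (L, q_plus) /\
    rectangle A pm /\ rectangle A pp /\
    (forall e, 0 < e -> exists T, forall t, t <= T -> near e (s t, q t) pm) /\
    (forall e, 0 < e -> exists T, forall t, T <= t -> near e (s t, q t) pp) /\
    (forall t, near rho (s t, q t) (0, q_minus) \/ near rho (s t, q t) (L, q_plus) \/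
       (0 < s t < L /\ Rabs (q t - graph (s t)) <= rho)).

Hypothesis G'_0_pos : 0 < G' 0.
Hypothesis G'_L_neg : G' L < 0.

Lemma rescaled_limit (mu d s0 q0 : R) (tau k : R) (B : plane -> plane) (x y : R -> R) (p : plane) :
  tau = 1 \/ tau = -1 -> 0 < mu <= 1 -> 0 < d -> 0 < k ->
  in_square d p -> rescaled tau mu s0 q0 B p = (0, 0) ->
  (forall t, 0 <= t -> Rabs (fst p - x t) <= 4 * d * exp (- k * t) /\
                       Rabs (snd p - y t) <= 4 * d * exp (- k * t)) ->
  let pp := ((s0 + fst p, q0 + snd p / mu) : plane) in
  near (d / mu) pp (s0, q0) /\ B pp = (0, 0) /\
  forall e, 0 < e -> exists T, 0 <= T /\ forall t, T <= t -> near e (s0 + x t, q0 + y t / mu) pp.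
Proof.
  intros Htau Hmu Hd Hk [S1 S2] HV Hlim pp.
  assert (Hi : 0 < / mu) by (apply Rinv_0_lt_compat; lra).
  assert (Hdm : d <= d / mu).
  { apply Rmult_le_reg_l with mu; [lra|]. replace (mu * (d / mu)) with d by (field; lra). nra. }
  split; [|split].
  - apply near_of_square; [exact Hmu|split; assumption].
  - unfold rescaled in HV. fold pp in HV. injection HV. intros E2 E1.
    apply Rmult_integral in E1. apply Rmult_integral in E2.
    destruct E1 as [E1|E1]; [destruct Htau; lra|].
    destruct E2 as [E2|E2]; [apply Rmult_integral in E2; destruct Htau, E2; lra|].
    destruct (B pp) as [b1 b2]. simpl in E1, E2. rewrite E1, E2. reflexivity.
  - intros e He. destruct (exp_decay_small (4 * d / mu) k e) as (T & HT & HTe); [|exact Hk|exact He|].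
    { unfold Rdiv. apply Rmult_le_pos; lra. }
    exists T. split; [exact HT|]. intros t Ht. specialize (HTe t Ht).
    destruct (Hlim t ltac:(lra)) as [A1 A2]. assert (Pe : 0 < exp (- k * t)) by apply exp_pos.
    assert (Hge : 4 * d * exp (- k * t) <= 4 * d / mu * exp (- k * t)).
    { apply Rmult_le_compat_r; [lra|]. unfold Rdiv in Hdm |- *. lra. }
    unfold near, pp. simpl. split.
    + replace (s0 + x t - (s0 + fst p)) with (- (fst p - x t)) by ring. rewrite Rabs_Ropp. lra.
    + replace (q0 + y t / mu - (q0 + snd p / mu)) with (- ((snd p - y t) * / mu)) by (unfold Rdiv; ring).
      rewrite Rabs_Ropp, Rabs_mult, (Rabs_right (/ mu)) by lra.
      apply Rmult_le_compat_r with (r := / mu) in A2; [|lra].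
      unfold Rdiv in HTe. lra.
Qed.

(** Both rates at the sink are negative: [G' L * v0] and [- M * lam]. *)
Lemma sink_end (rho : R) :
  0 < rho ->
  exists mu d e0, 0 < mu <= 1 /\ 0 < d /\ d / mu <= rho /\ 0 < e0 /\
    forall W, close_on (fun p => near (d / mu) p (L, q_plus)) e0 W ->
    forall s q, (forall t, 0 <= t -> flows W s q t) ->
      Rabs (s 0 - L) <= d -> Rabs (q 0 - q_plus) <= d / mu ->
      (forall t, 0 <= t -> near (d / mu) (s t, q t) (L, q_plus)) /\
      exists pp : plane, near (d / mu) pp (L, q_plus) /\ W pp = (0, 0) /\
        forall e, 0 < e -> exists T, forall t, T <= t -> near e (s t, q t) pp.
Proof.
  intros Hrho.
  set (v0 := exp (M * q_plus)). assert (Hv0 : 0 < v0) by apply exp_pos.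
  assert (Hal : 0 < - (G' L * v0)) by nra.
  assert (HMl : 0 < M * lam) by (apply Rmult_lt_0_compat; assumption).
  set (kap := Rmin (- (G' L * v0)) (M * lam) / 16).
  assert (Hkap : 0 < kap /\ 16 * kap <= - (G' L * v0) /\ 16 * kap <= M * lam).
  { unfold kap. assert (0 < Rmin (- (G' L * v0)) (M * lam)) by (apply Rmin_pos; assumption).
    generalize (Rmin_l (- (G' L * v0)) (M * lam)) (Rmin_r (- (G' L * v0)) (M * lam)). lra. }
  destruct Hkap as (Hkap & Hk1 & Hk2).
  destruct (rescaled_nearly_linear 1 L q_plus kap) as (mu & d0 & Hmu & Hd0 & Hnl);
    [left; reflexivity|exact G_L|apply skew_equilibrium_height, F_L_neg|exact Hkap|].
  set (d := Rmin d0 (rho * mu)).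
  assert (Hrm : 0 < rho * mu) by (apply Rmult_lt_0_compat; lra).
  assert (Hd : 0 < d <= d0) by (unfold d; split; [apply Rmin_pos; assumption|apply Rmin_l]).
  assert (Hdrho : d / mu <= rho).
  { apply Rmult_le_reg_r with mu; [lra|]. replace (d / mu * mu) with d by (field; lra). apply Rmin_r. }
  destruct (Hnl d Hd) as (e0 & He0 & Hclose).
  exists mu, d, e0. split; [exact Hmu|]. split; [lra|]. split; [exact Hdrho|]. split; [exact He0|].
  intros W HW s q Hf Hs0 Hq0. assert (NL := Hclose W HW).
  set (V := rescaled 1 mu L q_plus W) in *.
  set (x := fun t => s t - L). set (y := fun t => mu * (q t - q_plus)).
  assert (Hback : forall t, L + x t = s t /\ q_plus + y t / mu = q t).
  { intros t. unfold x, y. split; [ring|field; lra]. }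
  assert (HfV : forall t, 0 <= t -> flows V x y t).
  { intros t Ht. destruct (Hf t Ht) as [D1 D2]. destruct (Hback t) as [E1 E2].
    unfold flows, V, rescaled. simpl. rewrite E1, E2. split.
    - replace (1 * fst (W (s t, q t))) with (fst (W (s t, q t)) - 0) by ring.
      apply (is_derive_minus_R s (fun _ => L)); [exact D1|apply (is_derive_const (V := R_NormedModule))].
    - replace (1 * mu * snd (W (s t, q t))) with (0 * (q t - q_plus) + mu * (snd (W (s t, q t)) - 0)) by ring.
      apply (is_derive_mult_R (fun _ => mu) (fun t => q t - q_plus)); [apply (is_derive_const (V := R_NormedModule))|].
      apply (is_derive_minus_R q (fun _ => q_plus)); [exact D2|apply (is_derive_const (V := R_NormedModule))]. }
  assert (Hsq0 : in_square d (x 0, y 0)).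
  { split; simpl; [exact Hs0|]. unfold y. rewrite Rabs_mult, (Rabs_right mu) by lra.
    apply Rmult_le_compat_l with (r := mu) in Hq0; [|lra].
    replace (mu * (d / mu)) with d in Hq0 by (field; lra). exact Hq0. }
  destruct (sink_limit V _ _ kap d (proj1 Hd) (Rlt_le _ _ Hkap) NL) with (x := x) (y := y)
    as (Hin & p & k & Hk & P1 & P2 & P3); [fold v0; lra|lra|exact HfV|exact Hsq0|].
  split.
  - intros t Ht. assert (N := near_of_square mu d L q_plus _ Hmu (Hin t Ht)). simpl in N.
    destruct (Hback t) as [E1 E2]. rewrite E1, E2 in N. exact N.
  - destruct (rescaled_limit mu d L q_plus 1 k W x y p) as (R1 & R2 & R3); auto; [lra|].
    exists (L + fst p, q_plus + snd p / mu). split; [exact R1|]. split; [exact R2|].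
    intros e He. destruct (R3 e He) as (T & _ & HT). exists T. intros t Ht. specialize (HT t Ht).
    destruct (Hback t) as [E1 E2]. rewrite E1, E2 in HT. exact HT.
Qed.

(** In reversed time the rates at the saddle are [- G' 0 * v0], contracting,
    and [M * lam], expanding; the stable solution of the reversed field is a
    solution that leaves the saddle through the side [s = d]. *)
Lemma saddle_end :
  exists mu d0, 0 < mu <= 1 /\ 0 < d0 /\ forall d, 0 < d <= d0 ->
    exists e0, 0 < e0 /\ forall B, close_on (fun p => near (d / mu) p (0, q_minus)) e0 B ->
      exists (s q : R -> R) (pm : plane),
        (forall t, t <= 0 -> flows B s q t /\ near (d / mu) (s t, q t) (0, q_minus)) /\
        s 0 = d /\ Rabs (q 0 - q_minus) <= d / mu /\
        near (d / mu) pm (0, q_minus) /\ B pm = (0, 0) /\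
        forall e, 0 < e -> exists T, T <= 0 /\ forall t, t <= T -> near e (s t, q t) pm.
Proof.
  set (v0 := exp (M * q_minus)). assert (Hv0 : 0 < v0) by apply exp_pos.
  assert (Hal : 0 < G' 0 * v0) by (apply Rmult_lt_0_compat; assumption).
  assert (HMl : 0 < M * lam) by (apply Rmult_lt_0_compat; assumption).
  set (kap := Rmin (G' 0 * v0) (M * lam) / 16).
  assert (Hkap : 0 < kap /\ 16 * kap <= G' 0 * v0 /\ 16 * kap <= M * lam).
  { unfold kap. assert (0 < Rmin (G' 0 * v0) (M * lam)) by (apply Rmin_pos; assumption).
    generalize (Rmin_l (G' 0 * v0) (M * lam)) (Rmin_r (G' 0 * v0) (M * lam)). lra. }
  destruct Hkap as (Hkap & Hk1 & Hk2).
  destruct (rescaled_nearly_linear (-1) 0 q_minus kap) as (mu & d0 & Hmu & Hd0 & Hnl);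
    [right; reflexivity|exact G_0|apply skew_equilibrium_height, F_0_neg|exact Hkap|].
  exists mu, d0. split; [exact Hmu|]. split; [exact Hd0|]. intros d Hd.
  destruct (Hnl d Hd) as (e0 & He0 & Hclose). exists e0. split; [exact He0|].
  intros B HB. assert (NL := Hclose B HB).
  set (V := rescaled (-1) mu 0 q_minus B) in *.
  destruct (saddle_stable_solution V _ _ kap d (proj1 Hd) (Rlt_le _ _ Hkap) NL)
    as (x & y & p & k & X0 & Hxy & Hk & P1 & P2 & P3); [fold v0; lra|lra|].
  destruct (rescaled_limit mu d 0 q_minus (-1) k B x y p) as (R1 & R2 & R3); auto; [lra|].
  exists (fun t => 0 + x (- t)), (fun t => q_minus + y (- t) / mu), (0 + fst p, q_minus + snd p / mu).
  split; [|split; [|split; [|split; [exact R1|split; [exact R2|]]]]].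
  - intros t Ht. destruct (Hxy (- t) ltac:(lra)) as [[D1 D2] Hin]. split.
    + unfold V, rescaled in D1, D2. simpl in D1, D2.
      set (w := (0 + x (- t), q_minus + y (- t) / mu) : plane) in *.
      change (is_derive (fun t => 0 + x (- t)) t (fst (B w)) /\
              is_derive (fun t => q_minus + y (- t) / mu) t (snd (B w))).
      split.
      * replace (fst (B w)) with (0 + (-1 * fst (B w)) * -1) by ring.
        apply (is_derive_plus_R (fun _ => 0) (fun t => x (- t))); [apply (is_derive_const (V := R_NormedModule))|].
        apply (is_derive_comp_R x (fun t => - t)); [exact D1|auto_derive; [exact I|reflexivity]].
      * replace (snd (B w)) with (0 + ((-1 * mu * snd (B w)) * -1 * / mu + y (- t) * 0)) by (field; lra).
        apply (is_derive_plus_R (fun _ => q_minus) (fun t => y (- t) / mu)); [apply (is_derive_const (V := R_NormedModule))|].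
        apply (is_derive_mult_R (fun t => y (- t)) (fun _ => / mu)); [|apply (is_derive_const (V := R_NormedModule))].
        apply (is_derive_comp_R y (fun t => - t)); [exact D2|auto_derive; [exact I|reflexivity]].
    + exact (near_of_square mu d 0 q_minus _ Hmu Hin).
  - rewrite Ropp_0, X0. ring.
  - destruct (Hxy 0 (Rle_refl 0)) as [_ Hin]. rewrite Ropp_0.
    exact (proj2 (near_of_square mu d 0 q_minus _ Hmu Hin)).
  - intros e He. destruct (R3 e He) as (T & HT & HTt). exists (- T). split; [lra|].
    intros t Ht. apply HTt. lra.
Qed.

(** For [transit]: the speed and the coefficients of the perturbation in
    [defect_derive] are under control on a compact part of the sector. *)
Lemma middle_bounds (A d1 s2 : R) :
  0 <= A -> 0 < d1 -> d1 < s2 -> s2 < L ->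
  exists c C, 0 < c /\ 0 <= C /\ forall p, d1 <= fst p <= s2 -> - A <= snd p <= A ->
    c <= fst (skew p) /\
    Rabs (- (M * F (fst p) / G (fst p)) * H (fst p) * exp (M * snd p) - M * lam * H (fst p) / G (fst p)) <= C /\
    Rabs (M * H (fst p) * exp (M * snd p)) <= C.
Proof.
  intros HA Hd1 Hd Hs2.
  assert (CF := fun s => is_derive_continuous _ _ _ (F_derive s)).
  assert (CG := fun s => is_derive_continuous _ _ _ (G_derive s)).
  assert (CI : forall s, d1 <= s <= s2 -> continuous (fun s => / G s) s).
  { intros s Hs. apply (continuous_comp G Rinv); [apply CG|].
    apply (ex_derive_continuous (V := R_NormedModule)). auto_derive.
    assert (0 < G s) by (apply G_pos; lra). lra. }
  assert (CH : forall s, d1 <= s <= s2 -> continuous H s).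
  { intros s Hs. eapply is_derive_continuous, H_derive. lra. }
  destruct (continuous_bounded_on (fun s => / G s) d1 s2) as (BI & PI0 & HI); [lra|exact CI|].
  destruct (continuous_bounded_on H d1 s2) as (BH & PH & HH); [lra|exact CH|].
  destruct (continuous_bounded_on F d1 s2) as (BF & PF & HF); [lra|intros t _; apply CF|].
  destruct (continuous_bounded_on (fun x => exp (M * x)) (- A) A) as (BE & PE & HE); [lra| |].
  { intros t _. exact (is_derive_continuous _ _ _ (exp_M_derive t)). }
  set (c := / (BI + 1) * exp (M * - A)).
  set (C := M * BF * BI * BH * BE + M * lam * BH * BI + M * BH * BE).
  assert (N1 : 0 <= M * BF * BI * BH * BE) by (repeat apply Rmult_le_pos; lra).
  assert (N2 : 0 <= M * lam * BH * BI) by (repeat apply Rmult_le_pos; lra).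
  assert (N3 : 0 <= M * BH * BE) by (repeat apply Rmult_le_pos; lra).
  exists c, C. split; [apply Rmult_lt_0_compat; [apply Rinv_0_lt_compat; lra|apply exp_pos]|].
  split; [unfold C; lra|]. intros p Hp Hq.
  assert (PG : 0 < G (fst p)) by (apply G_pos; lra).
  specialize (HI (fst p) Hp). specialize (HH (fst p) Hp). specialize (HF (fst p) Hp). specialize (HE (snd p) Hq).
  simpl in HI, HE.
  split; [|split].
  - unfold skew, c. simpl. apply Rmult_le_compat.
    + left. apply Rinv_0_lt_compat. lra.
    + left. apply exp_pos.
    + rewrite <- (Rinv_inv (G (fst p))). apply Rinv_le_contravar; [apply Rinv_0_lt_compat, PG|].
      rewrite Rabs_right in HI by (apply Rle_ge, Rlt_le, Rinv_0_lt_compat, PG). lra.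
    + destruct (Req_dec (snd p) (- A)) as [->|Hne]; [lra|].
      left. apply exp_increasing. apply Rmult_lt_compat_l; lra.
  - assert (E1 : Rabs (M * F (fst p) / G (fst p) * H (fst p) * exp (M * snd p)) <= M * BF * BI * BH * BE).
    { unfold Rdiv. rewrite !Rabs_mult, (Rabs_right M) by lra.
      repeat (apply Rmult_le_compat; try (repeat apply Rmult_le_pos; auto using Rabs_pos; lra)); auto using Rabs_pos; lra. }
    assert (E2 : Rabs (M * lam * H (fst p) / G (fst p)) <= M * lam * BH * BI).
    { unfold Rdiv. rewrite !Rabs_mult, (Rabs_right M), (Rabs_right lam) by lra.
      repeat (apply Rmult_le_compat; try (repeat apply Rmult_le_pos; auto using Rabs_pos; lra)); auto using Rabs_pos; lra. }
    replace (- (M * F (fst p) / G (fst p)) * H (fst p) * exp (M * snd p) - M * lam * H (fst p) / G (fst p))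
      with (- (M * F (fst p) / G (fst p) * H (fst p) * exp (M * snd p) + M * lam * H (fst p) / G (fst p))) by ring.
    rewrite Rabs_Ropp. eapply Rle_trans; [apply Rabs_triang|]. unfold C. lra.
  - apply Rle_trans with (M * BH * BE); [|unfold C; lra].
    rewrite !Rabs_mult, (Rabs_right M) by lra.
    repeat (apply Rmult_le_compat; try (repeat apply Rmult_le_pos; auto using Rabs_pos; lra)); auto using Rabs_pos; lra.
Qed.

Lemma near_in_rectangle (A r a q0 : R) (p : plane) :
  r <= 1 -> 0 <= a <= L -> Rabs q0 <= A - 1 -> near r p (a, q0) -> rectangle A p.
Proof.
  intros Hr Ha Hq [N1 N2]. simpl in N1, N2.
  apply Rabs_le_between in N1. apply Rabs_le_between in N2. apply Rabs_le_between in Hq.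
  split; lra.
Qed.

Lemma rectangle_clamp_lipschitz (A e : R) (B : plane -> plane) :
  0 <= A -> 0 <= e -> close_on (rectangle A) e B ->
  exists Kw, let W := fun p : plane => B (clamp (-1) (L + 1) (fst p), clamp (- A) A (snd p)) in
    lipschitz (fun p => fst (W p)) Kw /\ lipschitz (fun p => snd (W p)) Kw /\
    forall p, rectangle A p -> W p = B p.
Proof.
  intros HA He [_ C1]. destruct (skew_lipschitz_on_rectangle A HA) as (KA & HKA & HL).
  exists (KA + e). intros W.
  assert (Hcl : forall p : plane, rectangle A (clamp (-1) (L + 1) (fst p), clamp (- A) A (snd p))).
  { intros p. split; simpl; apply clamp_bounds; lra. }
  assert (Hmono : forall p q : plane,
    (KA + e) * (Rabs (clamp (-1) (L + 1) (fst p) - clamp (-1) (L + 1) (fst q)) +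
                Rabs (clamp (- A) A (snd p) - clamp (- A) A (snd q))) <=
    (KA + e) * (Rabs (fst p - fst q) + Rabs (snd p - snd q))).
  { intros p q. apply Rmult_le_compat_l; [lra|]. apply Rplus_le_compat; apply clamp_lipschitz; lra. }
  split; [|split].
  - intros p q. eapply Rle_trans; [|apply Hmono]. unfold W.
    destruct (HL _ _ (Hcl p) (Hcl q)) as [S1 _]. destruct (C1 _ _ (Hcl p) (Hcl q)) as [Z1 _].
    set (P := (clamp (-1) (L + 1) (fst p), clamp (- A) A (snd p)) : plane) in *.
    set (Q := (clamp (-1) (L + 1) (fst q), clamp (- A) A (snd q)) : plane) in *.
    replace (fst (B P) - fst (B Q))
      with ((fst (skew P) - fst (skew Q)) + (fst (B P) - fst (skew P) - (fst (B Q) - fst (skew Q)))) by ring.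
    eapply Rle_trans; [apply Rabs_triang|]. rewrite Rmult_plus_distr_r.
    apply Rplus_le_compat; [exact S1|exact Z1].
  - intros p q. eapply Rle_trans; [|apply Hmono]. unfold W.
    destruct (HL _ _ (Hcl p) (Hcl q)) as [_ S1]. destruct (C1 _ _ (Hcl p) (Hcl q)) as [_ Z1].
    set (P := (clamp (-1) (L + 1) (fst p), clamp (- A) A (snd p)) : plane) in *.
    set (Q := (clamp (-1) (L + 1) (fst q), clamp (- A) A (snd q)) : plane) in *.
    replace (snd (B P) - snd (B Q))
      with ((snd (skew P) - snd (skew Q)) + (snd (B P) - snd (skew P) - (snd (B Q) - snd (skew Q)))) by ring.
    eapply Rle_trans; [apply Rabs_triang|]. rewrite Rmult_plus_distr_r.
    apply Rplus_le_compat; [exact S1|exact Z1].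
  - intros p [P1 P2]. unfold W. rewrite !clamp_id by assumption. destruct p; reflexivity.
Qed.

(** The constants are chosen backwards: the square at the sink, then the tube
    that leads into it, then the square at the saddle whose side [s = d1] lies in
    the tube, and last the size [e] of the perturbation, which has to be small for
    the time between the two squares. *)
Lemma skew_connection_persists (A rho : R) :
  0 < rho -> (forall s, 0 < s < L -> Rabs (graph s) <= A - 1) ->
  Rabs q_minus <= A - 1 -> Rabs q_plus <= A - 1 ->
  exists e, 0 < e /\ forall B, close_on (rectangle A) e B -> persistent_connection A rho B.
Proof.
  intros Hrho HgA Hqm Hqp.
  assert (HA : 1 <= A) by (generalize (Rabs_pos q_minus); lra).
  set (rho1 := Rmin rho 1).
  assert (Hrho1 : 0 < rho1 /\ rho1 <= rho /\ rho1 <= 1).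
  { unfold rho1. split; [apply Rmin_pos; lra|]. split; [apply Rmin_l|apply Rmin_r]. }
  destruct (sink_end rho1 (proj1 Hrho1)) as (mu2 & d2 & e2 & Hmu2 & Hd2 & Hdm2 & He2 & Hsink).
  assert (Hdq2 : 0 < d2 / mu2) by (apply Rdiv_lt_0_compat; lra).
  assert (Hdq3 : 0 < d2 / mu2 / 2) by (apply Rdiv_lt_0_compat; lra).
  (* The end [s2] of the middle part is where the connection is well inside the
     trapping rectangle of the sink. *)
  destruct (proj1 (at_left_iff L _) (filter_and _ _ (graph_near_L (d2 / mu2 / 2) Hdq3)
    (at_left_L_interior L L_pos))) as (w2 & Hw2 & Hnear2).
  set (s2 := L - Rmin w2 d2 / 2).
  assert (Hs2 : L - w2 < s2 < L /\ L - s2 <= d2).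
  { unfold s2. assert (0 < Rmin w2 d2) by (apply Rmin_pos; assumption).
    generalize (Rmin_l w2 d2) (Rmin_r w2 d2). lra. }
  destruct (Hnear2 s2 (proj1 Hs2)) as [Hg2 Hs20].
  set (eta := Rmin rho1 (d2 / mu2 / 2)).
  assert (Heta : 0 < eta /\ eta <= rho1 /\ eta <= d2 / mu2 / 2).
  { unfold eta. split; [apply Rmin_pos; lra|]. split; [apply Rmin_l|apply Rmin_r]. }
  assert (HMe : 0 < M * eta) by (apply Rmult_lt_0_compat; lra).
  set (kap1 := Rmin (1 / 2) (M * eta / 2)).
  assert (Hkap1 : 0 < kap1 /\ kap1 <= 1 / 2 /\ 2 * kap1 <= M * eta).
  { unfold kap1. assert (A2 := Rmin_r (1 / 2) (M * eta / 2)).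
    split; [apply Rmin_pos; lra|]. split; [apply Rmin_l|lra]. }
  destruct (exp_small (kap1 / 2) ltac:(lra)) as (r & Hr & Hexp).
  assert (HrM : 0 < r / (2 * M)) by (apply Rdiv_lt_0_compat; lra).
  destruct saddle_end as (mu1 & d0 & Hmu1 & Hd0 & Hsaddle).
  (* The start [d1] of the middle part is so close to the saddle that all
     points of the side [s = d1] of its rectangle have a small defect. *)
  destruct (proj1 (at_right_iff 0 _) (graph_near_0 (r / (2 * M)) HrM)) as (w1 & Hw1 & Hnear1).
  set (bnd := Rmin (Rmin w1 d0) (Rmin s2 (mu1 * Rmin rho1 (r / (2 * M))))).
  assert (Hmr : 0 < mu1 * Rmin rho1 (r / (2 * M))).
  { apply Rmult_lt_0_compat; [lra|apply Rmin_pos; lra]. }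
  assert (Hbnd : 0 < bnd /\ bnd <= w1 /\ bnd <= d0 /\ bnd <= s2 /\ bnd <= mu1 * Rmin rho1 (r / (2 * M))).
  { unfold bnd. assert (B1 := Rmin_l (Rmin w1 d0) (Rmin s2 (mu1 * Rmin rho1 (r / (2 * M))))).
    assert (B2 := Rmin_r (Rmin w1 d0) (Rmin s2 (mu1 * Rmin rho1 (r / (2 * M))))).
    assert (B3 := Rmin_l w1 d0). assert (B4 := Rmin_r w1 d0).
    assert (B5 := Rmin_l s2 (mu1 * Rmin rho1 (r / (2 * M)))).
    assert (B6 := Rmin_r s2 (mu1 * Rmin rho1 (r / (2 * M)))).
    split; [repeat apply Rmin_pos; lra|]. lra. }
  set (d1 := bnd / 2).
  assert (Hd1 : 0 < d1 /\ d1 < w1 /\ d1 <= d0 /\ d1 < s2) by (unfold d1; lra).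
  assert (Hdm1 : d1 / mu1 <= rho1 /\ d1 / mu1 <= r / (2 * M)).
  { assert (E : d1 / mu1 <= Rmin rho1 (r / (2 * M))).
    { apply Rmult_le_reg_l with mu1; [lra|]. replace (mu1 * (d1 / mu1)) with d1 by (field; lra).
      unfold d1. lra. }
    split; (eapply Rle_trans; [exact E|]); [apply Rmin_l|apply Rmin_r]. }
  destruct (Hsaddle d1 ltac:(lra)) as (e1 & He1 & Hsad).
  destruct (middle_bounds A d1 s2) as (c & C & Hc & HC & Hmid); [lra|lra|lra|lra|].
  assert (Hd1L : 0 < d1 < L) by lra.
  assert (HKd := K0_below d1 Hd1L).
  set (Em := kap1 * (K d1 - K0)).
  assert (HEm : 0 < Em) by (apply Rmult_lt_0_compat; lra).
  set (e3 := Em * c / (16 * (C + 1) * L)).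
  assert (Hden : 0 < 16 * (C + 1) * L) by (repeat apply Rmult_lt_0_compat; lra).
  assert (HEc : 0 < Em * c) by (apply Rmult_lt_0_compat; assumption).
  assert (He3 : 0 < e3) by (apply Rdiv_lt_0_compat; assumption).
  set (e := Rmin (Rmin e1 e2) (Rmin (c / 2) e3)).
  assert (He : 0 < e /\ e <= e1 /\ e <= e2 /\ e <= c / 2 /\ e <= e3).
  { unfold e. assert (B1 := Rmin_l (Rmin e1 e2) (Rmin (c / 2) e3)).
    assert (B2 := Rmin_r (Rmin e1 e2) (Rmin (c / 2) e3)).
    assert (B3 := Rmin_l e1 e2). assert (B4 := Rmin_r e1 e2).
    assert (B5 := Rmin_l (c / 2) e3). assert (B6 := Rmin_r (c / 2) e3).
    split; [repeat apply Rmin_pos; lra|]. lra. }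
  exists e. split; [lra|]. intros B HB.
  assert (Hrect1 : forall p, near (d1 / mu1) p (0, q_minus) -> rectangle A p).
  { intros p Hp. apply (near_in_rectangle A (d1 / mu1) 0 q_minus); lra || assumption. }
  assert (Hrect2 : forall p, near (d2 / mu2) p (L, q_plus) -> rectangle A p).
  { intros p Hp. apply (near_in_rectangle A (d2 / mu2) L q_plus); lra || assumption. }
  destruct (Hsad B) as (sm & qm & pm & Hm1 & Hm2 & Hm3 & Hm4 & Hm5 & Hm6).
  { apply (close_on_weaken (rectangle A) _ e _ B); auto; lra. }
  destruct (rectangle_clamp_lipschitz A e B) as (Kw & HW1 & HW2 & HWB); [lra|lra|exact HB|].
  set (W := fun p : plane => B (clamp (-1) (L + 1) (fst p), clamp (- A) A (snd p))) in *.
  change (forall p, rectangle A p -> W p = B p) in HWB.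
  destruct (global_solution_exists W Kw (d1, qm 0) HW1 HW2) as (x & y & X0 & Y0 & HfW).
  simpl in X0, Y0.
  assert (Hgraph : forall p : plane, d1 <= fst p <= s2 -> Rabs (defect p) <= Em ->
    Rabs (snd p - graph (fst p)) <= eta).
  { intros [ps pq] Hp Hdef. simpl in Hp. simpl. assert (Hps : 0 < ps < L) by lra.
    assert (HKp := K0_below ps Hps).
    rewrite (defect_graph ps pq Hps), Rabs_mult, (Rabs_right (K ps - K0)) in Hdef by lra.
    assert (HKK : K d1 - K0 <= K ps - K0).
    { destruct (Req_dec ps d1) as [->|Hne]; [lra|].
      assert (K d1 < K ps) by (apply K_increasing_skew; lra). lra. }
    assert (HEm2 : Em <= kap1 * (K ps - K0)) by (apply Rmult_le_compat_l; lra).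
    assert (Hx : Rabs (exp (M * (pq - graph ps)) - 1) <= kap1).
    { apply Rmult_le_reg_l with (K ps - K0); [lra|]. lra. }
    apply log_small in Hx; [|lra]. rewrite Rabs_mult, (Rabs_right M) in Hx by lra.
    apply Rmult_le_reg_l with M; [exact M_pos|]. lra. }
  assert (Htube : forall p : plane, d1 <= fst p <= s2 -> Rabs (defect p) <= Em -> rectangle A p).
  { intros p Hp Hdef. assert (G1 := Hgraph p Hp Hdef). assert (G2 := HgA (fst p) ltac:(lra)).
    apply Rabs_le_between in G1. apply Rabs_le_between in G2. split; lra. }
  assert (Hini : Rabs (defect (x 0, y 0)) <= Em / 2).
  { rewrite X0, Y0, (defect_graph d1 (qm 0) Hd1L), Rabs_mult, (Rabs_right (K d1 - K0)) by lra.
    replace (Em / 2) with ((K d1 - K0) * (kap1 / 2)) by (unfold Em; field).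
    apply Rmult_le_compat_l; [lra|]. apply Hexp.
    rewrite Rabs_mult, (Rabs_right M) by lra.
    assert (N := Hnear1 d1 ltac:(lra)).
    replace (qm 0 - graph d1) with ((qm 0 - q_minus) - (graph d1 - q_minus)) by ring.
    replace r with (M * (r / (2 * M) + r / (2 * M))) by (field; lra).
    apply Rmult_le_compat_l; [lra|]. eapply Rle_trans; [apply Rabs_triang|]. rewrite Rabs_Ropp. lra. }
  destruct (transit W x y d1 s2 Em (c / 2) (2 * C * e)) as (t1 & Ht1 & Ex1 & Hx1).
  - lra.
  - lra.
  - lra.
  - lra.
  - repeat apply Rmult_le_pos; lra.
  - apply Rle_lt_trans with (4 * (C / (C + 1)) * (Em / 16)).
    + apply Rle_trans with (2 * C * e3 * (L / (c / 2))).
      * apply Rmult_le_compat_r; [left; apply Rdiv_lt_0_compat; lra|].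
        apply Rmult_le_compat_l; lra.
      * right. unfold e3. field. lra.
    + assert (C / (C + 1) < 1).
      { apply Rmult_lt_reg_r with (C + 1); [lra|]. replace (C / (C + 1) * (C + 1)) with C by (field; lra). lra. }
      nra.
  - intros t _. apply HfW.
  - exact X0.
  - exact Hini.
  - intros p Hp Hdef. assert (Rp := Htube p Hp Hdef). rewrite (HWB p Rp).
    destruct HB as [C0 _]. destruct (C0 p Rp) as [Z1 Z2].
    destruct (Hmid p Hp (proj2 Rp)) as (M1 & M2 & M3).
    split; [apply Rabs_le_between in Z1; lra|].
    eapply Rle_trans; [apply Rabs_triang|]. rewrite !(Rabs_mult _ (_ - _)).
    assert (P1 := Rmult_le_compat _ _ _ _ (Rabs_pos _) (Rabs_pos _) M2 Z1).
    assert (P2 := Rmult_le_compat _ _ _ _ (Rabs_pos _) (Rabs_pos _) M3 Z2).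
    lra.
  - assert (Hend := Hx1 t1 ltac:(lra)).
    destruct (Hsink W) with (s := fun t => x (t + t1)) (q := fun t => y (t + t1)) as (Hin2 & pp & Hp1 & Hp2 & Hp3).
    + apply (close_on_weaken (rectangle A) _ e _ B); auto; lra.
    + intros t Ht. apply flows_shift, HfW.
    + rewrite Rplus_0_l, Ex1, Rabs_left1; lra.
    + rewrite Rplus_0_l. assert (G1 := Hgraph (x t1, y t1) (proj1 Hend) (proj2 Hend)). simpl in G1.
      rewrite Ex1 in G1.
      replace (y t1 - q_plus) with ((y t1 - graph s2) + (graph s2 - q_plus)) by ring.
      eapply Rle_trans; [apply Rabs_triang|]. lra.
    + assert (Hlate : forall t, t1 <= t -> near (d2 / mu2) (x t, y t) (L, q_plus)).
      { intros t Ht. assert (N := Hin2 (t - t1) ltac:(lra)). simpl in N.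
        replace (t - t1 + t1) with t in N by ring. exact N. }
      assert (HrectW : forall t, 0 <= t -> rectangle A (x t, y t)).
      { intros t Ht. destruct (Rle_dec t t1) as [Hle|Hgt].
        - destruct (Hx1 t ltac:(lra)) as [T1 T2]. apply Htube; assumption.
        - apply Hrect2, Hlate. lra. }
      assert (HfB : forall t, 0 <= t -> flows B x y t).
      { intros t Ht. unfold flows. rewrite <- (HWB _ (HrectW t Ht)). apply HfW. }
      exists (fun t => if Rle_dec t 0 then sm t else x t), (fun t => if Rle_dec t 0 then qm t else y t), pm, pp.
      split.
      { apply flows_glue; [intros t Ht; apply Hm1, Ht|exact HfB|congruence|congruence]. }
      split.
      { intros t. destruct (Rle_dec t 0) as [Hle|Hgt]; [apply Hrect1, Hm1, Hle|apply HrectW; lra]. }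
      split; [exact Hm5|]. split; [rewrite <- (HWB _ (Hrect2 _ Hp1)); exact Hp2|].
      split; [apply (near_weaken (d1 / mu1)); [lra|exact Hm4]|].
      split; [apply (near_weaken (d2 / mu2)); [lra|exact Hp1]|].
      split; [apply Hrect1, Hm4|]. split; [apply Hrect2, Hp1|].
      split.
      { intros e' He'. destruct (Hm6 e' He') as (T & HT & HTt). exists T. intros t Ht.
        destruct (Rle_dec t 0); [apply HTt, Ht|lra]. }
      split.
      { intros e' He'. destruct (Hp3 e' He') as (T & HTt). exists (Rmax (T + t1) 1). intros t Ht.
        assert (B1 := Rmax_l (T + t1) 1). assert (B2 := Rmax_r (T + t1) 1).
        destruct (Rle_dec t 0); [lra|]. assert (N := HTt (t - t1) ltac:(lra)).
        simpl in N. replace (t - t1 + t1) with t in N by ring. exact N. }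
      intros t. destruct (Rle_dec t 0) as [Hle|Hgt].
      * left. apply (near_weaken (d1 / mu1)); [lra|]. apply Hm1, Hle.
      * right. destruct (Rle_dec t t1) as [Hle1|Hgt1].
        -- right. destruct (Hx1 t ltac:(lra)) as [T1 T2]. split; [lra|].
           assert (G1 := Hgraph (x t, y t) T1 T2). simpl in G1. lra.
        -- left. apply (near_weaken (d2 / mu2)); [lra|]. apply Hlate. lra.
Qed.

End Skew.

(** * Robustness of the connection in the plane *)

Lemma global_solution_trajectory (Y : plane -> plane) (f : R -> plane) :
  solution Y (Curve m_infty p_infty f) -> trajectory Y (Curve m_infty p_infty f).
Proof.
  intros Hs. split; [exact Hs|]. intros c' _ (E1 & E2 & _). simpl in *.
  split; apply Rbar_le_antisym; auto; destruct (lo c'), (hi c'); simpl in *; tauto.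
Qed.

Definition has_partials (h : plane -> R) : Prop :=
  forall p : plane, ex_derive (fun u => h (u, snd p)) (fst p) /\ ex_derive (fun v => h (fst p, v)) (snd p).

(** The increment of the difference [k - h] is split along the two
    coordinate directions, in each of which the mean value theorem applies. *)
Lemma close_function_lipschitz (Mb eps : R) (h k : plane -> R) (p q : plane) :
  has_partials h -> has_partials k -> C1_close_function Mb eps h k ->
  Rabs (fst p) <= Mb -> Rabs (snd p) <= Mb -> Rabs (fst q) <= Mb -> Rabs (snd q) <= Mb ->
  Rabs ((k p - h p) - (k q - h q)) <= eps * (Rabs (fst p - fst q) + Rabs (snd p - snd q)).
Proof.
  intros Hh Hk Hc P1 P2 Q1 Q2. destruct p as [x y], q as [x' y']. simpl in *.
  assert (Hbox : forall a b c, Rmin a b <= c <= Rmax a b -> Rabs a <= Mb -> Rabs b <= Mb -> Rabs c <= Mb).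
  { intros a b c Hcb Ha Hb. apply Rabs_le_between in Ha. apply Rabs_le_between in Hb. apply Rabs_le.
    revert Hcb. unfold Rmin, Rmax. destruct Rle_dec; lra. }
  assert (E1 : Rabs ((k (x, y) - h (x, y)) - (k (x', y) - h (x', y))) <= eps * Rabs (x - x')).
  { assert (Hd : forall u, is_derive (fun u => k (u, y) - h (u, y)) u (Defs.d1 k (u, y) - Defs.d1 h (u, y))).
    { intros u. apply is_derive_minus_R; apply Derive_correct;
        [apply (proj1 (Hk (u, y)))|apply (proj1 (Hh (u, y)))]. }
    destruct (MVT_gen (fun u => k (u, y) - h (u, y)) x' x (fun u => Defs.d1 k (u, y) - Defs.d1 h (u, y))) as [c [Hcc E]].
    - intros t _. apply Hd.
    - intros t _. apply continuity_pt_filterlim. exact (is_derive_continuous _ _ _ (Hd t)).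
    - rewrite E, Rabs_mult. apply Rmult_le_compat_r; [apply Rabs_pos|]. left.
      apply (Hc (c, y)); simpl; [apply (Hbox x' x); assumption|assumption]. }
  assert (E2 : Rabs ((k (x', y) - h (x', y)) - (k (x', y') - h (x', y'))) <= eps * Rabs (y - y')).
  { assert (Hd : forall v, is_derive (fun v => k (x', v) - h (x', v)) v (Defs.d2 k (x', v) - Defs.d2 h (x', v))).
    { intros v. apply is_derive_minus_R; apply Derive_correct;
        [apply (proj2 (Hk (x', v)))|apply (proj2 (Hh (x', v)))]. }
    destruct (MVT_gen (fun v => k (x', v) - h (x', v)) y' y (fun v => Defs.d2 k (x', v) - Defs.d2 h (x', v))) as [c [Hcc E]].
    - intros t _. apply Hd.
    - intros t _. apply continuity_pt_filterlim. exact (is_derive_continuous _ _ _ (Hd t)).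
    - rewrite E, Rabs_mult. apply Rmult_le_compat_r; [apply Rabs_pos|]. left.
      apply (Hc (x', c)); simpl; [assumption|apply (Hbox y' y); assumption]. }
  replace (k (x, y) - h (x, y) - (k (x', y') - h (x', y')))
    with (((k (x, y) - h (x, y)) - (k (x', y) - h (x', y))) + ((k (x', y) - h (x', y)) - (k (x', y') - h (x', y')))) by ring.
  eapply Rle_trans; [apply Rabs_triang|]. lra.
Qed.

Lemma system_has_partials (lambda : R) (n : nat) (Q1 Q2 : R -> R -> R) :
  homogeneous_polynomial n Q1 -> homogeneous_polynomial n Q2 ->
  has_partials (comp1 (system lambda Q1 Q2)) /\ has_partials (comp2 (system lambda Q1 Q2)).
Proof.
  intros H1 H2.
  assert (Id : continuously_differentiable (fun x => x)).
  { exists (fun _ => 1). split; intros x; [apply (is_derive_id (K := R_AbsRing))|apply continuous_const]. }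
  assert (Ex : forall f, continuously_differentiable f -> forall x, ex_derive f x).
  { intros f [f' [Hf _]] x. exists (f' x). apply Hf. }
  assert (Cl : forall u, continuously_differentiable u -> continuously_differentiable (fun x => lambda * u x)).
  { intros u Hu. apply (continuously_differentiable_mult (fun _ => lambda)); [apply continuously_differentiable_const|exact Hu]. }
  split; intros [x y]; unfold comp1, comp2, system; simpl; split; apply Ex.
  - apply (continuously_differentiable_plus (fun u => lambda * u) (fun u => Q1 u y)); [apply Cl, Id|].
    apply (continuously_differentiable_polynomial n Q1 (fun u => u) (fun _ => y)); auto using continuously_differentiable_const.
  - apply (continuously_differentiable_plus (fun v => lambda * x) (fun v => Q1 x v)); [apply continuously_differentiable_const|].
    apply (continuously_differentiable_polynomial n Q1 (fun _ => x) (fun v => v)); auto using continuously_differentiable_const.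
  - apply (continuously_differentiable_plus (fun u => lambda * y) (fun u => Q2 u y)); [apply continuously_differentiable_const|].
    apply (continuously_differentiable_polynomial n Q2 (fun u => u) (fun _ => y)); auto using continuously_differentiable_const.
  - apply (continuously_differentiable_plus (fun v => lambda * v) (fun v => Q2 x v)); [apply Cl, Id|].
    apply (continuously_differentiable_polynomial n Q2 (fun _ => x) (fun v => v)); auto using continuously_differentiable_const.
Qed.

Lemma mult_difference_bound (u u' v v' Bu Bv du dv : R) :
  Rabs u <= Bu -> Rabs v' <= Bv -> Rabs (u - u') <= du -> Rabs (v - v') <= dv ->
  Rabs (u * v - u' * v') <= Bu * dv + Bv * du.
Proof.
  intros H1 H2 H3 H4.
  replace (u * v - u' * v') with (u * (v - v') + v' * (u - u')) by ring.
  eapply Rle_trans; [apply Rabs_triang|]. rewrite !Rabs_mult.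
  apply Rplus_le_compat; apply Rmult_le_compat; auto using Rabs_pos.
Qed.

Lemma cos_abs_le_1 (x : R) : Rabs (cos x) <= 1.
Proof. apply Rabs_le. generalize (COS_bound x). lra. Qed.

Lemma sin_abs_le_1 (x : R) : Rabs (sin x) <= 1.
Proof. apply Rabs_le. generalize (SIN_bound x). lra. Qed.

Lemma exp_increasing_le (x y : R) : x <= y -> exp x <= exp y.
Proof. intros [H|H]; [left; apply exp_increasing, H|rewrite H; lra]. Qed.

Lemma exp_lipschitz (A x y : R) : x <= A -> y <= A -> Rabs (exp x - exp y) <= exp A * Rabs (x - y).
Proof.
  intros Hx Hy. destruct (MVT_gen exp y x exp) as [c [Hcc E]].
  - intros t _. apply is_derive_exp.
  - intros t _. apply continuity_pt_filterlim. exact (is_derive_continuous _ _ _ (is_derive_exp t)).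
  - rewrite E, Rabs_mult. apply Rmult_le_compat_r; [apply Rabs_pos|].
    rewrite Rabs_right by (left; apply exp_pos). apply exp_increasing_le.
    revert Hcc. unfold Rmin, Rmax. destruct Rle_dec; lra.
Qed.

Section ChartEstimates.

Variables tm sg A : R.
Hypothesis sign_sg : sg = 1 \/ sg = -1.

Lemma angle_difference (p q : plane) :
  Rabs ((tm + sg * fst p) - (tm + sg * fst q)) = Rabs (fst p - fst q).
Proof.
  replace (tm + sg * fst p - (tm + sg * fst q)) with (sg * (fst p - fst q)) by ring.
  rewrite Rabs_mult. destruct sign_sg as [-> | ->];
    [rewrite (Rabs_right 1) by lra|rewrite (Rabs_left (-1)) by lra]; ring.
Qed.

Lemma exp_trig_lipschitz (trig : R -> R) (a b : R) (p q : plane) :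
  (forall x, Rabs (trig x) <= 1) -> (forall x y, Rabs (trig x - trig y) <= Rabs (x - y)) ->
  a <= A -> b <= A -> Rabs (a - b) = Rabs (snd p - snd q) ->
  Rabs (exp a * trig (tm + sg * fst p)) <= exp A /\
  Rabs (exp a * trig (tm + sg * fst p) - exp b * trig (tm + sg * fst q)) <=
    exp A * (Rabs (fst p - fst q) + Rabs (snd p - snd q)).
Proof.
  intros Ht1 Ht2 Ha Hb Hab.
  assert (Ea : Rabs (exp a) <= exp A).
  { rewrite Rabs_right by (left; apply exp_pos). apply exp_increasing_le, Ha. }
  split.
  - rewrite Rabs_mult. rewrite <- (Rmult_1_r (exp A)).
    apply Rmult_le_compat; auto using Rabs_pos.
  - replace (exp A * (Rabs (fst p - fst q) + Rabs (snd p - snd q)))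
      with (exp A * Rabs (fst p - fst q) + 1 * (exp A * Rabs (snd p - snd q))) by ring.
    apply mult_difference_bound; auto.
    + rewrite <- Hab. apply exp_lipschitz; assumption.
    + rewrite <- angle_difference. apply Ht2.
Qed.

Lemma chart_lipschitz (p q : plane) :
  snd p <= A -> snd q <= A ->
  Rabs (fst (chart tm sg p) - fst (chart tm sg q)) <= exp A * (Rabs (fst p - fst q) + Rabs (snd p - snd q)) /\
  Rabs (snd (chart tm sg p) - snd (chart tm sg q)) <= exp A * (Rabs (fst p - fst q) + Rabs (snd p - snd q)).
Proof.
  intros Hp Hq. unfold chart. simpl. split.
  - apply (exp_trig_lipschitz cos); auto using cos_abs_le_1, cos_lipschitz.
  - apply (exp_trig_lipschitz sin); auto using sin_abs_le_1, sin_lipschitz.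
Qed.

Lemma chart_bounded (p : plane) :
  snd p <= A -> Rabs (fst (chart tm sg p)) <= exp A /\ Rabs (snd (chart tm sg p)) <= exp A.
Proof.
  intros Hp. unfold chart. simpl. split.
  - apply (exp_trig_lipschitz cos (snd p) (snd p) p p); auto using cos_abs_le_1, cos_lipschitz.
  - apply (exp_trig_lipschitz sin (snd p) (snd p) p p); auto using sin_abs_le_1, sin_lipschitz.
Qed.

Lemma chart_near (r eta : R) (p q : plane) :
  snd p <= A -> snd q <= A -> near r p q -> 2 * exp A * r < eta ->
  ball (chart tm sg p) eta (chart tm sg q).
Proof.
  intros Hp Hq [N1 N2] Hr. destruct (chart_lipschitz q p Hq Hp) as [C1 C2].
  rewrite (Rabs_minus_sym (fst q)), (Rabs_minus_sym (snd q)) in C1, C2.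
  assert (PA : 0 < exp A) by apply exp_pos.
  assert (exp A * (Rabs (fst p - fst q) + Rabs (snd p - snd q)) <= exp A * (r + r))
    by (apply Rmult_le_compat_l; lra).
  apply (proj2 (ball_plane _ _ _)). split; lra.
Qed.

(** The lift is linear in the field, so that the difference of the lifts is
    the lift of the difference, with coefficients of the size [exp A]. *)
Lemma lift_close (X Y : plane -> plane) (eps L : R) (p q : plane) :
  has_partials (comp1 X) -> has_partials (comp2 X) ->
  has_partials (comp1 Y) -> has_partials (comp2 Y) ->
  C1_close (exp A) eps X Y -> rectangle L A p -> rectangle L A q ->
  Rabs (fst (lift tm sg Y p) - fst (lift tm sg X p)) <= 2 * exp A * eps /\
  Rabs (snd (lift tm sg Y p) - snd (lift tm sg X p)) <= 2 * exp A * eps /\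
  Rabs ((fst (lift tm sg Y p) - fst (lift tm sg X p)) - (fst (lift tm sg Y q) - fst (lift tm sg X q))) <=
    4 * exp A * (exp A + 1) * eps * (Rabs (fst p - fst q) + Rabs (snd p - snd q)) /\
  Rabs ((snd (lift tm sg Y p) - snd (lift tm sg X p)) - (snd (lift tm sg Y q) - snd (lift tm sg X q))) <=
    4 * exp A * (exp A + 1) * eps * (Rabs (fst p - fst q) + Rabs (snd p - snd q)).
Proof.
  intros HX1 HX2 HY1 HY2 [C1 C2] [_ Rp] [_ Rq].
  set (P := chart tm sg p). set (Q := chart tm sg q).
  set (z1 := fun w : plane => comp1 Y w - comp1 X w). set (z2 := fun w : plane => comp2 Y w - comp2 X w).
  destruct (chart_bounded p ltac:(lra)) as [BP1 BP2]. destruct (chart_bounded q ltac:(lra)) as [BQ1 BQ2].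
  fold P in BP1, BP2. fold Q in BQ1, BQ2.
  assert (Z1p : Rabs (z1 P) <= eps) by (left; apply (C1 P); assumption).
  assert (Z2p : Rabs (z2 P) <= eps) by (left; apply (C2 P); assumption).
  assert (Z1q : Rabs (z1 Q) <= eps) by (left; apply (C1 Q); assumption).
  assert (Z2q : Rabs (z2 Q) <= eps) by (left; apply (C2 Q); assumption).
  assert (Heps : 0 <= eps) by (eapply Rle_trans; [apply Rabs_pos|exact Z1p]).
  set (S := Rabs (fst p - fst q) + Rabs (snd p - snd q)).
  assert (HS : 0 <= S) by (unfold S; generalize (Rabs_pos (fst p - fst q)) (Rabs_pos (snd p - snd q)); lra).
  set (E := exp A). assert (HE : 0 < E) by apply exp_pos.
  destruct (chart_lipschitz p q ltac:(lra) ltac:(lra)) as [L1 L2]. fold P Q S E in L1, L2.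
  assert (Hd : eps * (Rabs (fst P - fst Q) + Rabs (snd P - snd Q)) <= eps * (2 * E * S))
    by (apply Rmult_le_compat_l; lra).
  assert (D1 : Rabs (z1 P - z1 Q) <= eps * (2 * E * S)).
  { eapply Rle_trans; [apply (close_function_lipschitz (exp A) eps (comp1 X) (comp1 Y) P Q); assumption|exact Hd]. }
  assert (D2 : Rabs (z2 P - z2 Q) <= eps * (2 * E * S)).
  { eapply Rle_trans; [apply (close_function_lipschitz (exp A) eps (comp2 X) (comp2 Y) P Q); assumption|exact Hd]. }
  assert (Hopp : Rabs (- snd p - - snd q) = Rabs (snd p - snd q)).
  { replace (- snd p - - snd q) with (- (snd p - snd q)) by ring. apply Rabs_Ropp. }
  destruct (exp_trig_lipschitz cos (- snd p) (- snd q) p q cos_abs_le_1 cos_lipschitz ltac:(lra) ltac:(lra) Hopp) as [Ucb Ucl].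
  destruct (exp_trig_lipschitz sin (- snd p) (- snd q) p q sin_abs_le_1 sin_lipschitz ltac:(lra) ltac:(lra) Hopp) as [Usb Usl].
  fold S E in Ucb, Ucl, Usb, Usl.
  set (cp := exp (- snd p) * cos (tm + sg * fst p)) in *. set (cq := exp (- snd q) * cos (tm + sg * fst q)) in *.
  set (sp := exp (- snd p) * sin (tm + sg * fst p)) in *. set (sq := exp (- snd q) * sin (tm + sg * fst q)) in *.
  assert (F1p : fst (lift tm sg Y p) - fst (lift tm sg X p) = sg * (cp * z2 P - sp * z1 P))
    by (unfold lift, cp, sp, z1, z2, comp1, comp2, P; simpl; ring).
  assert (F2p : snd (lift tm sg Y p) - snd (lift tm sg X p) = cp * z1 P + sp * z2 P)
    by (unfold lift, cp, sp, z1, z2, comp1, comp2, P; simpl; ring).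
  assert (F1q : fst (lift tm sg Y q) - fst (lift tm sg X q) = sg * (cq * z2 Q - sq * z1 Q))
    by (unfold lift, cq, sq, z1, z2, comp1, comp2, Q; simpl; ring).
  assert (F2q : snd (lift tm sg Y q) - snd (lift tm sg X q) = cq * z1 Q + sq * z2 Q)
    by (unfold lift, cq, sq, z1, z2, comp1, comp2, Q; simpl; ring).
  rewrite F1p, F2p, F1q, F2q.
  assert (Habs : forall x, Rabs (sg * x) = Rabs x).
  { intros x. rewrite Rabs_mult. destruct sign_sg as [-> | ->];
      [rewrite (Rabs_right 1) by lra|rewrite (Rabs_left (-1)) by lra]; ring. }
  assert (Hb : forall u z, Rabs u <= E -> Rabs z <= eps -> Rabs (u * z) <= E * eps).
  { intros u z Hu Hz. rewrite Rabs_mult. apply Rmult_le_compat; auto using Rabs_pos. }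
  assert (M1 := mult_difference_bound cp cq (z1 P) (z1 Q) E eps (E * S) (eps * (2 * E * S)) Ucb Z1q Ucl D1).
  assert (M2 := mult_difference_bound cp cq (z2 P) (z2 Q) E eps (E * S) (eps * (2 * E * S)) Ucb Z2q Ucl D2).
  assert (M3 := mult_difference_bound sp sq (z1 P) (z1 Q) E eps (E * S) (eps * (2 * E * S)) Usb Z1q Usl D1).
  assert (M4 := mult_difference_bound sp sq (z2 P) (z2 Q) E eps (E * S) (eps * (2 * E * S)) Usb Z2q Usl D2).
  assert (Hpos : 0 <= E * eps * S) by (repeat apply Rmult_le_pos; lra).
  split; [|split; [|split]].
  - rewrite Habs. unfold Rminus. eapply Rle_trans; [apply Rabs_triang|]. rewrite Rabs_Ropp.
    assert (N1 := Hb cp (z2 P) Ucb Z2p). assert (N2 := Hb sp (z1 P) Usb Z1p). lra.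
  - eapply Rle_trans; [apply Rabs_triang|].
    assert (N1 := Hb cp (z1 P) Ucb Z1p). assert (N2 := Hb sp (z2 P) Usb Z2p). lra.
  - replace (sg * (cp * z2 P - sp * z1 P) - sg * (cq * z2 Q - sq * z1 Q))
      with (sg * ((cp * z2 P - cq * z2 Q) - (sp * z1 P - sq * z1 Q))) by ring.
    rewrite Habs. unfold Rminus at 1. eapply Rle_trans; [apply Rabs_triang|]. rewrite Rabs_Ropp. lra.
  - replace (cp * z1 P + sp * z2 P - (cq * z1 Q + sq * z2 Q))
      with ((cp * z1 P - cq * z1 Q) + (sp * z2 P - sq * z2 Q)) by ring.
    eapply Rle_trans; [apply Rabs_triang|]. lra.
Qed.

End ChartEstimates.

Section Robust.

Variables (lam : R) (m : nat) (Q1 Q2 : R -> R -> R) (tm sg L : R).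
Hypothesis Q1_homogeneous : homogeneous_polynomial (S m) Q1.
Hypothesis Q2_homogeneous : homogeneous_polynomial (S m) Q2.
Hypothesis m_nonzero : m <> O.
Hypothesis lam_pos : 0 < lam.
Hypothesis sign_sg : sg = 1 \/ sg = -1.
Hypothesis L_pos : 0 < L.

Local Notation X := (system lam Q1 Q2).
Local Notation M := (INR m).
Local Notation F := (sector_f Q1 Q2 tm sg).
Local Notation G := (sector_g Q1 Q2 tm sg).

Variables H K : R -> R.
Variable K0 : R.
Hypothesis G_0 : G 0 = 0.
Hypothesis G_L : G L = 0.
Hypothesis G_pos : forall s, 0 < s < L -> 0 < G s.
Hypothesis H_pos : forall s, 0 < s < L -> 0 < H s.
Hypothesis H_derive : forall s, 0 < s < L -> is_derive H s (- (M * F s / G s) * H s).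
Hypothesis K_derive : forall s, 0 < s < L -> is_derive K s (M * lam * H s / G s).
Hypothesis F_0_neg : F 0 < 0.
Hypothesis F_L_neg : F L < 0.
Hypothesis K0_below : forall s, 0 < s < L -> K0 < K s.
Hypothesis K0_limit : forall e, 0 < e -> at_right 0 (fun s => K s < K0 + e).
Hypothesis G_derivative_nonzero : forall G', (forall s, is_derive G s (G' s)) -> 0 < G' 0 /\ G' L < 0.

Lemma sector_continuously_differentiable :
  continuously_differentiable F /\ continuously_differentiable G.
Proof.
  assert (Hc : forall f, continuously_differentiable f -> continuously_differentiable (fun s => f (tm + sg * s))).
  { intros f [f' [Hf Hf']]. exists (fun s => f' (tm + sg * s) * sg). split; intros s.
    - apply (is_derive_comp_R f (fun s => tm + sg * s)); [apply Hf|]. auto_derive; [exact I|ring].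
    - apply (continuous_mult (fun s => f' (tm + sg * s)) (fun _ => sg)); [|apply continuous_const].
      apply (continuous_comp (fun s => tm + sg * s) f'); [|apply Hf'].
      apply (is_derive_continuous (fun s => tm + sg * s) s sg). auto_derive; [exact I|ring]. }
  split.
  - apply Hc, (polar_f_continuously_differentiable (S m)); assumption.
  - apply (continuously_differentiable_mult (fun _ => sg) (fun s => polar_g Q1 Q2 (tm + sg * s)));
      [apply continuously_differentiable_const|].
    apply Hc, (polar_g_continuously_differentiable (S m)); assumption.
Qed.

(** The lifts are compared on a rectangle of the chart that contains the
    connection, and the perturbed connection is mapped back to the plane. On the
    rectangle, [chart] has the Lipschitz constant [2 * exp A] for the maximum
    norm, which relates [rho] to [eta]. *)
Theorem connection_robust (c : curve) :
  heteroclinic X c (p_minus lam m Q1 Q2 tm sg) (p_plus lam m Q1 Q2 tm sg L) ->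
  (forall s, 0 < s < L -> image c (chart tm sg (s, graph M H K K0 s))) ->
  robust_heteroclinic X c (p_minus lam m Q1 Q2 tm sg) (p_plus lam m Q1 Q2 tm sg L).
Proof.
  intros Hhet Himage. split; [exact Hhet|]. intros eta.
  assert (Heta : 0 < eta) by apply eta.
  destruct sector_continuously_differentiable as [[F' [HF HF']] [G' [HG HG']]].
  destruct (G_derivative_nonzero G' HG) as [G'0 G'L].
  assert (HM : 0 < M) by (apply lt_0_INR; lia).
  set (qm := q_minus M lam F). set (qp := q_plus M lam L F).
  assert (Epm : p_minus lam m Q1 Q2 tm sg = chart tm sg (0, qm)).
  { unfold p_minus, polar_point, chart, qm, q_minus, root. simpl. rewrite Rmult_0_r, Rplus_0_r. reflexivity. }
  assert (Epp : p_plus lam m Q1 Q2 tm sg L = chart tm sg (L, qp)) by reflexivity.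
  destruct (graph_bounded M lam L F F' G G' H K K0) as (A0 & HA0 & HgA); auto.
  set (A := A0 + Rabs qm + Rabs qp + 1).
  assert (Pqm := Rabs_pos qm). assert (Pqp := Rabs_pos qp).
  assert (HE : 0 < exp A) by apply exp_pos.
  set (rho := eta / (8 * exp A)).
  assert (Hrho : 0 < rho) by (apply Rdiv_lt_0_compat; lra).
  assert (Hrho4 : 2 * exp A * (2 * rho) < eta).
  { replace (2 * exp A * (2 * rho)) with (eta / 2) by (unfold rho; field; lra). lra. }
  assert (Hrho2 : 2 * exp A * rho < eta) by nra.
  destruct (skew_connection_persists M lam L F F' G G' H K K0) with (A := A) (rho := rho) as (e & He & Hpers);
    auto; try (unfold A; fold qm qp; lra).
  { intros s Hs. specialize (HgA s Hs). unfold A. lra. }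
  set (kk := 4 * exp A * (exp A + 1)).
  assert (Hkk : 0 < kk) by (unfold kk; repeat apply Rmult_lt_0_compat; lra).
  exists (exp A), (e / kk). split; [exact HE|].
  assert (Hek : 0 < e / kk) by (apply Rdiv_lt_0_compat; assumption).
  split; [exact Hek|].
  intros Y [HY1 HY2] HXY.
  assert (PY1 : has_partials (comp1 Y)) by (intros p; split; apply HY1).
  assert (PY2 : has_partials (comp2 Y)) by (intros p; split; apply HY2).
  destruct (system_has_partials lam (S m) Q1 Q2 Q1_homogeneous Q2_homogeneous) as [PX1 PX2].
  assert (Hlift : forall p, lift tm sg X p = skew M lam F G p).
  { intros p. apply (lift_system tm sg lam m); assumption. }
  assert (Hsq : sg * sg = 1) by exact (sign_square sg sign_sg).
  assert (Hclose : close_on M lam F G (rectangle L A) e (lift tm sg Y)).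
  { assert (Ekk : kk * (e / kk) = e) by (field; lra).
    assert (E2 : 2 * exp A * (e / kk) <= e).
    { rewrite <- Ekk at 2. apply Rmult_le_compat_r; [lra|]. unfold kk. nra. }
    split.
    - intros p Hp. rewrite <- Hlift.
      destruct (lift_close tm sg A sign_sg X Y (e / kk) L p p) as (A1 & A2 & _); auto. split; lra.
    - intros p q Hp Hq. rewrite <- !Hlift.
      destruct (lift_close tm sg A sign_sg X Y (e / kk) L p q) as (_ & _ & A1 & A2); auto.
      fold kk in A1, A2. rewrite Ekk in A1, A2. split; assumption. }
  destruct (Hpers _ Hclose) as (s & q & pm & pp & Hfl & Hrect & Bm & Bp & Nm & Np & Rm & Rp & Lm & Lp & Hnear).
  fold qm in Nm, Hnear. fold qp in Np, Hnear.
  assert (R0 : rectangle L A (0, qm)).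
  { split; simpl; [lra|]. apply Rabs_le_between. unfold A. lra. }
  assert (RL : rectangle L A (L, qp)).
  { split; simpl; [lra|]. apply Rabs_le_between. unfold A. lra. }
  assert (Hball : forall r p p', rectangle L A p -> rectangle L A p' -> near r p p' -> 2 * exp A * r < eta ->
    ball (chart tm sg p) eta (chart tm sg p')).
  { intros r p p' [_ H1] [_ H2] Hn Hr. apply (chart_near tm sg A sign_sg r); try lra; auto. }
  assert (Hsym : forall r (p p' : plane), near r p p' -> near r p' p).
  { intros r p p' [N1 N2]. split; rewrite Rabs_minus_sym; assumption. }
  exists (chart tm sg pm), (chart tm sg pp), (Curve m_infty p_infty (fun t => chart tm sg (s t, q t))).
  split; [apply equilibrium_chart; assumption|].
  split; [apply equilibrium_chart; assumption|].
  split; [rewrite Epm; apply (Hball rho); auto|].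
  split; [rewrite Epp; apply (Hball rho); auto|].
  split.
  - split; [|split].
    + apply global_solution_trajectory.
      apply (chart_curve_solution tm sg Y m_infty p_infty s q Hsq I). intros t _. apply Hfl.
    + apply tends_lo_alpha_limit, tends_lo_to_disk. intros e'.
      assert (He' : 0 < e') by apply e'.
      destruct (Lm (e' / (4 * exp A))) as [T HT]; [apply Rdiv_lt_0_compat; lra|].
      exists T. split; [split; exact I|]. intros u _ Hu. simpl.
      apply (chart_near tm sg A sign_sg (e' / (4 * exp A))); [apply Rm|apply (Hrect u)|apply Hsym, HT, Hu|].
      replace (2 * exp A * (e' / (4 * exp A))) with (e' / 2) by (field; lra). lra.
    + apply tends_hi_omega_limit, tends_hi_to_disk. intros e'.
      assert (He' : 0 < e') by apply e'.
      destruct (Lp (e' / (4 * exp A))) as [T HT]; [apply Rdiv_lt_0_compat; lra|].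
      exists T. split; [split; exact I|]. intros u _ Hu. simpl.
      apply (chart_near tm sg A sign_sg (e' / (4 * exp A))); [apply Rp|apply (Hrect u)|apply Hsym, HT, Hu|].
      replace (2 * exp A * (e' / (4 * exp A))) with (e' / 2) by (field; lra). lra.
  - intros t _. simpl.
    assert (Hg : forall a, 0 < a < L -> rectangle L A (a, graph M H K K0 a)).
    { intros a Ha. split; simpl; [lra|]. apply Rabs_le_between. specialize (HgA a Ha). unfold A. lra. }
    assert (Hfin : forall a, 0 < a < L -> near (2 * rho) (a, graph M H K K0 a) (s t, q t) ->
      exists u, dom c u /\ ball (c u) eta (chart tm sg (s t, q t))).
    { intros a Ha Hn. destruct (Himage a Ha) as (u & Du & Eu). exists u. split; [exact Du|].
      rewrite Eu. apply (Hball (2 * rho)); auto. }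
    assert (Htri : forall a b c', near rho (s t, q t) (b, c') -> near rho (a, graph M H K K0 a) (b, c') ->
      near (2 * rho) (a, graph M H K K0 a) (s t, q t)).
    { intros a b c' [N1 N2] [N3 N4]. simpl in *. apply Rabs_le_between in N1. apply Rabs_le_between in N2.
      apply Rabs_le_between in N3. apply Rabs_le_between in N4.
      split; simpl; apply Rabs_le; lra. }
    destruct (Hnear t) as [N|[N|[Hst N]]].
    + destruct (proj1 (at_right_iff 0 _) (filter_and _ _
        (graph_near_0 M lam L F F' G G' H K K0 HM lam_pos L_pos HF HG G_0 G_pos H_pos H_derive K_derive
           F_0_neg K0_below K0_limit rho Hrho) (at_right_0_interior L L_pos))) as (d & Hd & Hda).
      set (a := Rmin d rho / 2). assert (Ha : 0 < a < d /\ a < rho).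
      { unfold a. assert (0 < Rmin d rho) by (apply Rmin_pos; assumption).
        generalize (Rmin_l d rho) (Rmin_r d rho). lra. }
      destruct (Hda a ltac:(lra)) as [Ga Hia]. apply (Hfin a Hia). apply (Htri a 0 qm N).
      split; simpl; [rewrite Rminus_0_r, Rabs_right; lra|left; exact Ga].
    + destruct (proj1 (at_left_iff L _) (filter_and _ _
        (graph_near_L M lam L F F' G G' H K K0 HM lam_pos L_pos HF HG G_L G_pos H_pos H_derive K_derive
           F_L_neg rho Hrho) (at_left_L_interior L L_pos))) as (d & Hd & Hda).
      set (a := L - Rmin d rho / 2). assert (Ha : L - d < a < L /\ L - rho < a).
      { unfold a. assert (0 < Rmin d rho) by (apply Rmin_pos; assumption).
        generalize (Rmin_l d rho) (Rmin_r d rho). lra. }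
      destruct (Hda a ltac:(lra)) as [Ga Hia]. apply (Hfin a Hia). apply (Htri a L qp N).
      split; simpl; [rewrite Rabs_left; lra|left; exact Ga].
    + apply (Hfin (s t) Hst). split; simpl; [rewrite Rminus_diag, Rabs_R0; lra|].
      rewrite Rabs_minus_sym. lra.
Qed.

End Robust.

(** * Sector portraits for a repelling origin *)

Lemma derivative_nonneg_of_positive_right (f : R -> R) (a l d : R) :
  is_derive f a l -> f a = 0 -> 0 < d -> (forall s, a < s < a + d -> 0 < f s) -> 0 <= l.
Proof.
  intros Hf Ha Hd Hpos. destruct (Rle_lt_dec 0 l) as [H|H]; [exact H|exfalso].
  apply is_derive_Reals in Hf. destruct (Hf (- l) ltac:(lra)) as [e He].
  set (h := Rmin d e / 2).
  assert (Hh : 0 < h < d /\ h < e).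
  { unfold h. assert (He0 : 0 < e) by apply e. assert (0 < Rmin d e) by (apply Rmin_pos; assumption).
    generalize (Rmin_l d e) (Rmin_r d e). lra. }
  assert (Hq := He h ltac:(lra) ltac:(rewrite Rabs_right; lra)).
  rewrite Ha, Rminus_0_r in Hq. assert (Hp := Hpos (a + h) ltac:(lra)).
  assert (0 < f (a + h) / h) by (apply Rdiv_lt_0_compat; lra).
  apply Rabs_lt_between in Hq. lra.
Qed.

Lemma positive_arch_derivatives (G G' : R -> R) (L : R) :
  0 < L -> (forall s, is_derive G s (G' s)) -> G 0 = 0 -> G L = 0 ->
  (forall s, 0 < s < L -> 0 < G s) -> G' 0 <> 0 -> G' L <> 0 -> 0 < G' 0 /\ G' L < 0.
Proof.
  intros HL HG G0 GL Hpos N0 NL. split.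
  - assert (0 <= G' 0).
    { apply (derivative_nonneg_of_positive_right G 0 (G' 0) L (HG 0) G0 HL).
      intros s Hs. apply Hpos. lra. }
    lra.
  - assert (0 <= - G' L).
    { apply (derivative_nonneg_of_positive_right (fun s => G (L - s)) 0 (- G' L) L).
      - apply (is_derive_reflect G L 0). rewrite Rminus_0_r. apply HG.
      - rewrite Rminus_0_r. exact GL.
      - exact HL.
      - intros s Hs. apply Hpos. lra. }
    lra.
Qed.

Section SectorPortrait.

Variables (lam : R) (m : nat) (Q1 Q2 : R -> R -> R) (tm sg L : R).

Local Notation X := (system lam Q1 Q2).
Local Notation tp := (tm + sg * L).
Local Notation intC := (half_cone_interior tm tp).

(** The whole phase portrait for a repelling origin, in terms of the signs of
    [polar_f]; the portraits for an attracting origin are its time reversals. *)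
Lemma sector_portrait :
  homogeneous_polynomial (S m) Q1 -> homogeneous_polynomial (S m) Q2 -> m <> O ->
  0 < lam -> sg = 1 \/ sg = -1 -> 0 < L -> L <= PI ->
  polar_g Q1 Q2 tm = 0 -> polar_g Q1 Q2 tp = 0 ->
  (forall s, 0 < s < L -> 0 < sector_g Q1 Q2 tm sg s) ->
  (forall g', (forall s, is_derive (polar_g Q1 Q2) s (g' s)) -> g' tm <> 0 /\ g' tp <> 0) ->
  polar_f Q1 Q2 tm <> 0 -> polar_f Q1 Q2 tp <> 0 ->
  (polar_f Q1 Q2 tm < 0 -> 0 < polar_f Q1 Q2 tp ->
     no_radius_equilibrium X tp /\ all_omega X intC (at_infinity tp) /\
     exists pm, unique (radius_equilibrium X tm) pm /\
       splits intC (unstable_manifold X pm)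
         (alpha_basin X (to_disk origin)) (alpha_basin X (at_infinity tm))) /\
  (0 < polar_f Q1 Q2 tm -> polar_f Q1 Q2 tp < 0 ->
     no_radius_equilibrium X tm /\ all_alpha X intC (to_disk origin) /\
     exists pp, unique (radius_equilibrium X tp) pp /\ all_omega X intC (to_disk pp)) /\
  (0 < polar_f Q1 Q2 tm -> 0 < polar_f Q1 Q2 tp ->
     no_radius_equilibrium X tm /\ no_radius_equilibrium X tp /\
     all_alpha X intC (to_disk origin) /\ all_omega X intC (at_infinity tp)) /\
  (polar_f Q1 Q2 tm < 0 -> polar_f Q1 Q2 tp < 0 ->
     exists pm pp,
       unique (radius_equilibrium X tm) pm /\ unique (radius_equilibrium X tp) pp /\
       all_omega X intC (to_disk pp) /\
       exists c, robust_heteroclinic X c pm pp /\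
         (forall t, dom c t -> intC (c t)) /\
         splits intC (image c)
           (alpha_basin X (to_disk origin)) (alpha_basin X (at_infinity tm))).
Proof.
  intros H1 H2 Hm Hlam Hsg HL HPI gtm gtp Hpos Hg' Fm Fp.
  set (F := sector_f Q1 Q2 tm sg). set (G := sector_g Q1 Q2 tm sg).
  assert (EF0 : F 0 = polar_f Q1 Q2 tm) by (unfold F, sector_f; f_equal; ring).
  assert (EFL : F L = polar_f Q1 Q2 tp) by reflexivity.
  assert (G0 : G 0 = 0) by (unfold G, sector_g; rewrite Rmult_0_r, Rplus_0_r, gtm; ring).
  assert (GL : G L = 0) by (unfold G, sector_g; rewrite gtp; ring).
  assert (HM : 0 < INR m) by (apply lt_0_INR; lia).
  assert (HFc : forall s, continuous F s) by (intros s; apply (sector_F_continuous m); assumption).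
  destruct (sector_G_derive m Q1 Q2 tm sg H1 H2 Hsg) as [G1 HG1]. fold G in HG1.
  assert (HGc : forall s, continuous G s) by (intros s; exact (is_derive_continuous _ _ _ (HG1 s))).
  destruct (first_integral_exists (INR m) lam L F G HL HFc HGc Hpos) as (H & K & HH & HdH & HdK).
  assert (HK0 : exists K0, (F 0 < 0 -> forall s, 0 < s < L -> K0 < K s) /\
     (F 0 < 0 -> forall e, 0 < e -> at_right 0 (fun s => K s < K0 + e))).
  { destruct (Rlt_dec (F 0) 0) as [Hn|Hn].
    - destruct (K_infimum_exists (INR m) lam L F G H K) as (K0 & HK1 & HK2); auto.
      exists K0. tauto.
    - exists 0. tauto. }
  destruct HK0 as (K0 & HK1 & HK2).
  rewrite <- EF0 in *. rewrite <- EFL in *.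
  assert (Hminus : F 0 < 0 -> unique (radius_equilibrium X tm) (p_minus lam m Q1 Q2 tm sg)).
  { intros Hn. apply (p_minus_unique lam m Q1 Q2 tm sg L) with (K := K) (K0 := K0); auto. }
  assert (Hplus : F L < 0 -> unique (radius_equilibrium X tp) (p_plus lam m Q1 Q2 tm sg L)).
  { intros Hn. apply p_plus_unique; auto. }
  assert (Hnom : 0 < F 0 -> no_radius_equilibrium X tm).
  { intros Hp. rewrite EF0 in Hp. apply (no_radius_equilibrium_of_sign lam m); auto. }
  assert (Hnop : 0 < F L -> no_radius_equilibrium X tp).
  { intros Hp. apply (no_radius_equilibrium_of_sign lam m); auto. }
  assert (Hom : forall z, forward_end lam m Q1 Q2 tm sg L z -> all_omega X intC z).
  { apply (sector_all_omega lam m Q1 Q2 tm sg L) with (H := H) (K := K) (K0 := K0); auto. }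
  assert (Hal : 0 < F 0 -> all_alpha X intC (to_disk origin)).
  { apply (sector_all_alpha lam m Q1 Q2 tm sg L) with (H := H) (K := K) (K0 := K0); auto. }
  split; [|split; [|split]]; intros Sm Sp.
  - split; [auto|]. split; [apply Hom; left; auto|].
    exists (p_minus lam m Q1 Q2 tm sg). split; [auto|].
    apply (unstable_manifold_splits lam m Q1 Q2 tm sg L) with (H := H) (K := K) (K0 := K0); auto.
  - split; [auto|]. split; [auto|].
    exists (p_plus lam m Q1 Q2 tm sg L). split; [auto|]. apply Hom; right; auto.
  - split; [auto|]. split; [auto|]. split; [auto|]. apply Hom; left; auto.
  - exists (p_minus lam m Q1 Q2 tm sg), (p_plus lam m Q1 Q2 tm sg L).
    split; [auto|]. split; [auto|]. split; [apply Hom; right; auto|].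
    destruct (separatrix_trajectory lam m Q1 Q2 tm sg L) with (H := H) (K := K) (K0 := K0)
      (z2 := to_disk (p_plus lam m Q1 Q2 tm sg L)) as (c & Ht & Ha & Ho & Hint & Him); auto.
    { right; auto. }
    exists c. split; [|split; [exact Hint|]].
    + apply (connection_robust lam m Q1 Q2 tm sg L) with (H := H) (K := K) (K0 := K0); auto.
      * intros G' HG'.
        destruct (polar_g_continuously_differentiable (S m) Q1 Q2 H1 H2) as (g' & Hd & _).
        destruct (Hg' g' Hd) as [N0 NL].
        assert (EG : forall s, G' s = g' (tm + sg * s)).
        { intros s. rewrite <- (is_derive_unique _ _ _ (HG' s)). apply is_derive_unique.
          replace (g' (tm + sg * s)) with (sg * (g' (tm + sg * s) * sg))
            by (destruct Hsg as [-> | ->]; ring).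
          apply is_derive_scal. apply (is_derive_comp_R (polar_g Q1 Q2) (fun s => tm + sg * s)); [apply Hd|].
          auto_derive; [exact I|ring]. }
        apply (positive_arch_derivatives G G' L); auto; rewrite EG; auto.
        rewrite Rmult_0_r, Rplus_0_r. exact N0.
      * split; auto.
      * intros s Hs. apply Him; [exact Hs|].
        apply (level_of_level_log_radius m L); auto.
        specialize (HK1 Sm s Hs). lra.
    + apply (sector_splits lam m Q1 Q2 tm sg L) with (H := H) (K := K) (K0 := K0); auto.
Qed.

End SectorPortrait.

(** * Reversal of time *)

Lemma predicate_extensionality (A B : plane -> Prop) : (forall p, A p <-> B p) -> A = B.
Proof. intros H. apply functional_extensionality. intros p. apply propositional_extensionality, H. Qed.

Lemma radius_equilibrium_reverse (X : plane -> plane) (theta : R) :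
  radius_equilibrium (reverse_field X) theta = radius_equilibrium X theta.
Proof.
  apply predicate_extensionality. intros p. unfold radius_equilibrium. rewrite equilibrium_reverse. tauto.
Qed.

Lemma no_radius_equilibrium_reverse (X : plane -> plane) (theta : R) :
  no_radius_equilibrium (reverse_field X) theta = no_radius_equilibrium X theta.
Proof. unfold no_radius_equilibrium. rewrite radius_equilibrium_reverse. reflexivity. Qed.

Lemma image_reverse (c : curve) : image (reverse_curve c) = image c.
Proof.
  apply predicate_extensionality. intros p. split; intros (t & Ht & E).
  - exists (- t). split; [apply dom_reverse, Ht|exact E].
  - exists (- t). split; [apply dom_reverse; rewrite Ropp_involutive; exact Ht|].
    simpl. rewrite Ropp_involutive. exact E.
Qed.

Lemma omega_basin_reverse (X : plane -> plane) (z : plane) :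
  omega_basin (reverse_field X) z = alpha_basin X z.
Proof.
  apply predicate_extensionality. intros p. split; intros (c & Ht & Hi & Hl); exists (reverse_curve c).
  - split; [apply trajectory_reverse_iff, Ht|]. split; [rewrite image_reverse; exact Hi|].
    apply (proj2 (alpha_limit_reverse (in_disk c) z)), Hl.
  - split; [apply trajectory_reverse, Ht|]. split; [rewrite image_reverse; exact Hi|].
    apply (proj2 (omega_limit_reverse (in_disk c) z)), Hl.
Qed.

Lemma all_alpha_reverse (X : plane -> plane) (S : plane -> Prop) (z : plane) :
  all_omega X S z -> all_alpha (reverse_field X) S z.
Proof.
  intros H c Ht Hm. apply (proj1 (omega_limit_reverse (in_disk c) z)).
  apply (H (reverse_curve c)); [apply trajectory_reverse_iff, Ht|apply meets_reverse, Hm].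
Qed.

Lemma all_omega_reverse (X : plane -> plane) (S : plane -> Prop) (z : plane) :
  all_alpha X S z -> all_omega (reverse_field X) S z.
Proof.
  intros H c Ht Hm. apply (proj1 (alpha_limit_reverse (in_disk c) z)).
  apply (H (reverse_curve c)); [apply trajectory_reverse_iff, Ht|apply meets_reverse, Hm].
Qed.

Lemma heteroclinic_reverse (X : plane -> plane) (c : curve) (p q : plane) :
  heteroclinic X c p q -> heteroclinic (reverse_field X) (reverse_curve c) q p.
Proof.
  intros (Ht & Ha & Ho). split; [apply trajectory_reverse, Ht|]. split.
  - apply (proj2 (alpha_limit_reverse (in_disk c) (to_disk q))), Ho.
  - apply (proj2 (omega_limit_reverse (in_disk c) (to_disk p))), Ha.
Qed.

Lemma d1_opp (h : plane -> R) (p : plane) : Defs.d1 (fun q => - h q) p = - Defs.d1 h p.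
Proof. unfold Defs.d1. apply Derive_opp. Qed.

Lemma d2_opp (h : plane -> R) (p : plane) : Defs.d2 (fun q => - h q) p = - Defs.d2 h p.
Proof. unfold Defs.d2. apply Derive_opp. Qed.

Lemma C1_field_reverse (X : plane -> plane) : C1_field X -> C1_field (reverse_field X).
Proof.
  assert (Hopp : forall h : plane -> R, C1_function h -> C1_function (fun q => - h q)).
  { intros h Hh p. destruct (Hh p) as (H1 & H2 & H3 & H4). split; [|split; [|split]].
    - apply (ex_derive_opp (fun u => h (u, snd p))), H1.
    - apply (ex_derive_opp (fun v => h (fst p, v))), H2.
    - apply (continuous_ext (fun q => - Defs.d1 h q)); [intros q; symmetry; apply d1_opp|].
      apply (continuous_opp (Defs.d1 h)), H3.
    - apply (continuous_ext (fun q => - Defs.d2 h q)); [intros q; symmetry; apply d2_opp|].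
      apply (continuous_opp (Defs.d2 h)), H4. }
  intros [H1 H2]. split; [apply (Hopp (comp1 X)), H1|apply (Hopp (comp2 X)), H2].
Qed.

Lemma C1_close_reverse (Mb eps : R) (X Y : plane -> plane) :
  C1_close Mb eps X Y -> C1_close Mb eps (reverse_field X) (reverse_field Y).
Proof.
  assert (Hopp : forall h k : plane -> R, C1_close_function Mb eps h k ->
    C1_close_function Mb eps (fun q => - h q) (fun q => - k q)).
  { intros h k Hc p P1 P2. destruct (Hc p P1 P2) as (H1 & H2 & H3).
    rewrite !d1_opp, !d2_opp.
    assert (E : forall a b : R, - a - - b = - (a - b)) by (intros; ring).
    rewrite !E, !Rabs_Ropp. auto. }
  intros [H1 H2]. split; [apply (Hopp (comp1 X) (comp1 Y)), H1|apply (Hopp (comp2 X) (comp2 Y)), H2].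
Qed.

Lemma robust_heteroclinic_reverse (X : plane -> plane) (c : curve) (p q : plane) :
  robust_heteroclinic X c p q -> robust_heteroclinic (reverse_field X) (reverse_curve c) q p.
Proof.
  intros [Hh Hr]. split; [apply heteroclinic_reverse, Hh|]. intros eta.
  destruct (Hr eta) as (Mb & eps & HM & He & H). exists Mb, eps. split; [exact HM|]. split; [exact He|].
  intros Y HY HXY. apply C1_close_reverse in HXY. rewrite reverse_field_involutive in HXY.
  destruct (H (reverse_field Y) (C1_field_reverse _ HY) HXY)
    as (p' & q' & c' & Ep & Eq & Bp & Bq & Hc' & Hn).
  apply (proj1 (equilibrium_reverse Y p')) in Ep. apply (proj1 (equilibrium_reverse Y q')) in Eq.
  apply heteroclinic_reverse in Hc'. rewrite reverse_field_involutive in Hc'.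
  exists q', p', (reverse_curve c').
  split; [exact Eq|]. split; [exact Ep|]. split; [exact Bq|]. split; [exact Bp|]. split; [exact Hc'|].
  intros t Ht. apply dom_reverse in Ht. destruct (Hn _ Ht) as (s & Hs & Hb).
  exists (- s). split; [apply dom_reverse; rewrite Ropp_involutive; exact Hs|].
  simpl. rewrite Ropp_involutive. exact Hb.
Qed.

Definition negate (Q : R -> R -> R) (x y : R) : R := - Q x y.

Lemma negate_homogeneous (n : nat) (Q : R -> R -> R) :
  homogeneous_polynomial n Q -> homogeneous_polynomial n (negate Q).
Proof.
  intros [a Ha]. exists (fun i => - a i). intros x y. unfold negate. rewrite Ha.
  replace (- sum_f_R0 (fun i => a i * x ^ (n - i) * y ^ i) n)
    with (-1 * sum_f_R0 (fun i => a i * x ^ (n - i) * y ^ i) n) by ring.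
  rewrite scal_sum. apply sum_eq. intros i _. ring.
Qed.

Lemma system_reverse (lambda : R) (Q1 Q2 : R -> R -> R) :
  system lambda Q1 Q2 = reverse_field (system (- lambda) (negate Q1) (negate Q2)).
Proof.
  apply functional_extensionality. intros p. unfold system, reverse_field, negate. simpl. f_equal; ring.
Qed.

Lemma polar_f_negate (Q1 Q2 : R -> R -> R) (theta : R) :
  polar_f (negate Q1) (negate Q2) theta = - polar_f Q1 Q2 theta.
Proof. unfold polar_f, negate. ring. Qed.

Lemma polar_g_negate (Q1 Q2 : R -> R -> R) (theta : R) :
  polar_g (negate Q1) (negate Q2) theta = - polar_g Q1 Q2 theta.
Proof. unfold polar_g, negate. ring. Qed.

(** * The equilibria at infinity *)

(** So the zeros of [polar_g] are invariant under half turns, and consecutive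
    ones are at most [PI] apart. *)
Lemma polar_g_antipode (n : nat) (Q1 Q2 : R -> R -> R) (theta : R) :
  homogeneous_polynomial n Q1 -> homogeneous_polynomial n Q2 ->
  polar_g Q1 Q2 (theta + PI) = (-1) ^ S n * polar_g Q1 Q2 theta.
Proof.
  intros H1 H2. unfold polar_g. rewrite neg_cos, neg_sin.
  replace (- cos theta) with (-1 * cos theta) by ring. replace (- sin theta) with (-1 * sin theta) by ring.
  rewrite (homogeneous_polynomial_scale n Q1), (homogeneous_polynomial_scale n Q2) by assumption.
  simpl. ring.
Qed.

(** At a point of the circle at infinity the Jacobian matrix is diagonal, with
    entries [- f] and [g']. *)
Lemma hyperbolic_at_infinity (lambda : R) (m : nat) (Q1 Q2 : R -> R -> R) (theta : R) :
  m <> O -> hyperbolic_equilibrium (system_at_infinity lambda (S m) Q1 Q2) (0, theta) ->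
  polar_f Q1 Q2 theta <> 0 /\ Derive (polar_g Q1 Q2) theta <> 0.
Proof.
  intros Hm [_ Hh].
  set (Z := system_at_infinity lambda (S m) Q1 Q2) in *.
  assert (E11 : Defs.d1 (comp1 Z) (0, theta) = - polar_f Q1 Q2 theta).
  { unfold Defs.d1, comp1, Z, system_at_infinity. simpl fst; simpl snd.
    apply is_derive_unique. auto_derive; [exact I|].
    change (pred (S m)) with m. rewrite pow_i by lia. ring. }
  assert (E12 : Defs.d2 (comp1 Z) (0, theta) = 0).
  { unfold Defs.d2, comp1, Z, system_at_infinity. simpl fst; simpl snd.
    rewrite (Derive_ext (fun v => - lambda * 0 ^ S m - 0 * polar_f Q1 Q2 v) (fun _ => - lambda * 0 ^ S m))
      by (intros; ring). apply Derive_const. }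
  assert (E21 : Defs.d1 (comp2 Z) (0, theta) = 0).
  { unfold Defs.d1, comp2, Z, system_at_infinity. simpl fst; simpl snd. apply Derive_const. }
  assert (E22 : Defs.d2 (comp2 Z) (0, theta) = Derive (polar_g Q1 Q2) theta) by reflexivity.
  rewrite E11, E12, E21, E22 in Hh. split; intros E.
  - apply (Hh (RtoC (- polar_f Q1 Q2 theta))); [ring|]. simpl. lra.
  - apply (Hh (RtoC (Derive (polar_g Q1 Q2) theta))); [ring|]. simpl. exact E.
Qed.

Lemma constant_sign (h : R -> R) (L : R) :
  (forall s, continuous h s) -> (forall s, 0 < s < L -> h s <> 0) ->
  (forall s, 0 < s < L -> 0 < h s) \/ (forall s, 0 < s < L -> 0 < - h s).
Proof.
  intros Hc Hn.
  destruct (classic (exists a, 0 < a < L /\ 0 < h a)) as [(a & Ha & Hpa)|H].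
  - left. intros s Hs. destruct (Rlt_le_dec 0 (h s)) as [H|H]; [exact H|exfalso].
    destruct (Rle_dec a s) as [Has|Has].
    + destruct (intermediate_value (fun x => - h x) a s 0 Has) as (x & Hx & E); [|lra|apply (Hn x); lra].
      intros x _. apply (continuous_opp h), Hc.
    + destruct (intermediate_value h s a 0) as (x & Hx & E); [lra|intros; apply Hc|lra|apply (Hn x); lra].
  - right. intros s Hs. specialize (Hn s Hs).
    destruct (Rtotal_order (h s) 0) as [H0|[H0|H0]]; [lra|contradiction|].
    exfalso. apply H. exists s. auto.
Qed.

(** The sign [sg] is that of [tp - tm]. The function [sg * polar_g] has a
    constant sign between the zeros, and were it negative, the connection at
    infinity would go from [tp] to [tm]. *)
Lemma consecutive_sector (lambda : R) (m : nat) (Q1 Q2 : R -> R -> R) (tm tp : R) (ginf : curve) :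
  homogeneous_polynomial (S m) Q1 -> homogeneous_polynomial (S m) Q2 ->
  consecutive Q1 Q2 tm tp ->
  connection_at_infinity (system_at_infinity lambda (S m) Q1 Q2) ginf tm tp ->
  exists sg L, (sg = 1 \/ sg = -1) /\ 0 < L <= PI /\ tp = tm + sg * L /\
    forall s, 0 < s < L -> 0 < sector_g Q1 Q2 tm sg s.
Proof.
  intros H1 H2 (gtm & gtp & Hne & Hno) Hconn.
  unfold infinite_equilibrium in *.
  assert (Hsg : exists sg L, (sg = 1 \/ sg = -1) /\ 0 < L /\ tp = tm + sg * L).
  { destruct (Rlt_dec tm tp) as [Hlt|Hlt].
    - exists 1, (tp - tm). split; [auto|]. split; [lra|ring].
    - exists (-1), (tm - tp). split; [auto|]. split; [lra|ring]. }
  destruct Hsg as (sg & L & Hsg & HL & Etp). exists sg, L. split; [exact Hsg|].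
  assert (Hbet : forall s, 0 < s < L -> strictly_between tm tp (tm + sg * s)).
  { intros s Hs. rewrite Etp. unfold strictly_between. destruct Hsg as [-> | ->]; [left|right]; lra. }
  split; [|split; [exact Etp|]].
  - split; [exact HL|]. destruct (Rle_lt_dec L PI) as [H|H]; [exact H|exfalso].
    apply (Hno (tm + sg * PI)); [apply Hbet; generalize PI_RGT_0; lra|].
    destruct Hsg as [-> | ->].
    + rewrite Rmult_1_l, (polar_g_antipode (S m)), gtm by assumption. ring.
    + assert (E := polar_g_antipode (S m) Q1 Q2 (tm + -1 * PI) H1 H2).
      replace (tm + -1 * PI + PI) with tm in E by ring. rewrite gtm in E. symmetry in E.
      destruct (Rmult_integral _ _ E) as [E'|E']; [|exact E'].
      exfalso. revert E'. apply pow_nonzero. lra.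
  - destruct (sector_G_derive m Q1 Q2 tm sg H1 H2 Hsg) as [G' HG'].
    destruct (constant_sign (sector_g Q1 Q2 tm sg) L) as [H|H]; [| |exact H|].
    + intros s. exact (is_derive_continuous _ _ _ (HG' s)).
    + intros s Hs E. apply (Hno _ (Hbet s Hs)). unfold sector_g in E.
      destruct Hsg as [-> | ->]; lra.
    + exfalso. destruct (connection_meets_line _ _ _ _ Hne Hconn) as (t & Ht & Hf & Hs).
      destruct Hconn as (Htr & _ & Ha & _).
      assert (E : tp + - sg * L = tm) by (rewrite Etp; ring).
      destruct (line_trajectory_limits lambda m Q1 Q2 tp (- sg) L ginf t) as [Ha' _]; auto.
      * destruct Hsg as [-> | ->]; [right|left]; ring.
      * rewrite E. exact gtm.
      * intros s Hs'. unfold sector_g. specialize (H (L - s) ltac:(lra)). unfold sector_g in H.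
        replace (tp + - sg * s) with (tm + sg * (L - s)) by (rewrite Etp; ring). lra.
      * rewrite E. apply strictly_between_comm, Hs.
      * apply Hne. assert (E' := alpha_limit_unique _ _ _ Ha Ha'). injection E'. auto.
Qed.

(** * The phase portrait in the half-cone *)

Theorem theorem5p3 (lambda : R) (n : nat) (Q1 Q2 : R -> R -> R)
  (hlambda : lambda <> 0) (hn : (1 < n)%nat)
  (hQ1 : homogeneous_polynomial n Q1) (hQ2 : homogeneous_polynomial n Q2)
  (hQ1nz : exists x y, Q1 x y <> 0) (hQ2nz : exists x y, Q2 x y <> 0)
  (hex : exists theta, infinite_equilibrium Q1 Q2 theta)
  (hhyp : forall theta, infinite_equilibrium Q1 Q2 theta ->
     hyperbolic_equilibrium (system_at_infinity lambda n Q1 Q2) (0, theta))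
  (tm tp : R) (hcons : consecutive Q1 Q2 tm tp)
  (ginf : curve)
  (hginf : connection_at_infinity (system_at_infinity lambda n Q1 Q2) ginf tm tp) :
  let X := system lambda Q1 Q2 in
  let Xinf := system_at_infinity lambda n Q1 Q2 in
  let intC := half_cone_interior tm tp in
  (case_a Xinf tm tp \/ case_b Xinf tm tp \/ case_c Xinf tm tp \/ case_d Xinf tm tp)
  /\ (forall p, intC p -> ~ equilibrium X p)
  /\ (0 < lambda ->
       (case_a Xinf tm tp ->
          no_radius_equilibrium X tp /\
          all_omega X intC (at_infinity tp) /\
          exists pm, unique (radius_equilibrium X tm) pm /\
            splits intC (unstable_manifold X pm)
              (alpha_basin X (to_disk origin)) (alpha_basin X (at_infinity tm)))
       /\ (case_b Xinf tm tp ->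
          no_radius_equilibrium X tm /\
          all_alpha X intC (to_disk origin) /\
          exists pp, unique (radius_equilibrium X tp) pp /\
            all_omega X intC (to_disk pp))
       /\ (case_c Xinf tm tp ->
          no_radius_equilibrium X tm /\ no_radius_equilibrium X tp /\
          all_alpha X intC (to_disk origin) /\
          all_omega X intC (at_infinity tp))
       /\ (case_d Xinf tm tp ->
          exists pm pp,
            unique (radius_equilibrium X tm) pm /\
            unique (radius_equilibrium X tp) pp /\
            all_omega X intC (to_disk pp) /\
            exists c, robust_heteroclinic X c pm pp /\
              (forall t, dom c t -> intC (c t)) /\
              splits intC (image c)
                (alpha_basin X (to_disk origin)) (alpha_basin X (at_infinity tm))))
  /\ (lambda < 0 ->
       (case_a Xinf tm tp ->
          no_radius_equilibrium X tm /\
          all_alpha X intC (at_infinity tm) /\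
          exists pp, unique (radius_equilibrium X tp) pp /\
            splits intC (stable_manifold X pp)
              (omega_basin X (to_disk origin)) (omega_basin X (at_infinity tp)))
       /\ (case_b Xinf tm tp ->
          no_radius_equilibrium X tp /\
          all_omega X intC (to_disk origin) /\
          exists pm, unique (radius_equilibrium X tm) pm /\
            all_alpha X intC (to_disk pm))
       /\ (case_c Xinf tm tp ->
          exists pm pp,
            unique (radius_equilibrium X tm) pm /\
            unique (radius_equilibrium X tp) pp /\
            all_alpha X intC (to_disk pm) /\
            exists c, robust_heteroclinic X c pm pp /\
              (forall t, dom c t -> intC (c t)) /\
              splits intC (image c)
                (omega_basin X (to_disk origin)) (omega_basin X (at_infinity tp)))
       /\ (case_d Xinf tm tp ->
          no_radius_equilibrium X tm /\ no_radius_equilibrium X tp /\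
          all_alpha X intC (at_infinity tm) /\
          all_omega X intC (to_disk origin))).
Proof.
  destruct n as [|m]; [lia|]. assert (Hm : m <> O) by lia. intros X Xinf intC.
  destruct (consecutive_sector lambda m Q1 Q2 tm tp ginf hQ1 hQ2 hcons hginf)
    as (sg & L & Hsg & [HL HPI] & Etp & Hpos).
  destruct hcons as (gtm & gtp & Hne & _).
  destruct (hyperbolic_at_infinity lambda m Q1 Q2 tm Hm (hhyp tm gtm)) as [Fm Dm].
  destruct (hyperbolic_at_infinity lambda m Q1 Q2 tp Hm (hhyp tp gtp)) as [Fp Dp].
  unfold infinite_equilibrium in gtm, gtp.
  assert (Hcases := cases_iff_signs lambda m Q1 Q2 tm sg L hQ1 hQ2 Hm Hsg HL gtm).
  rewrite <- Etp in Hcases. specialize (Hcases gtp Hpos Fm Fp). cbv zeta in Hcases. fold Xinf in Hcases.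
  destruct Hcases as (Ca & Cb & Cc & Cd).
  split; [|split; [|split]].
  - destruct (Rdichotomy _ _ Fm), (Rdichotomy _ _ Fp); tauto.
  - intros p Hp. unfold intC in Hp. rewrite Etp in Hp.
    exact (no_interior_equilibrium lambda m Q1 Q2 tm sg L hQ1 hQ2 Hsg HL HPI Hpos p Hp).
  - intros Hlam.
    assert (HS := sector_portrait lambda m Q1 Q2 tm sg L hQ1 hQ2 Hm Hlam Hsg HL HPI gtm).
    rewrite <- Etp in HS. fold X intC in HS.
    destruct HS as (Sa & Sb & Sc & Sd); auto.
    { intros g' Hg'. rewrite <- (is_derive_unique _ _ _ (Hg' tm)), <- (is_derive_unique _ _ _ (Hg' tp)). auto. }
    split; [|split; [|split]]; intros C.
    + apply Ca in C. apply Sa; apply C.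
    + apply Cb in C. apply Sb; apply C.
    + apply Cc in C. apply Sc; apply C.
    + apply Cd in C. apply Sd; apply C.
  - intros Hlam.
    (* The reversed field is a system of the same kind whose sector runs from [tp] to [tm]. *)
    assert (HS := sector_portrait (- lambda) m (negate Q1) (negate Q2) tp (- sg) L
      (negate_homogeneous _ _ hQ1) (negate_homogeneous _ _ hQ2) Hm).
    assert (E : tp + - sg * L = tm) by (rewrite Etp; ring). rewrite E in HS.
    rewrite !polar_f_negate, !polar_g_negate in HS.
    assert (EC : half_cone_interior tp tm = intC).
    { apply predicate_extensionality. intros p. apply half_cone_interior_comm. }
    rewrite EC in HS.
    destruct HS as (Sa & Sb & Sc & Sd); try lra; auto.
    { intros s Hs. unfold sector_g. rewrite polar_g_negate.
      replace (tp + - sg * s) with (tm + sg * (L - s)) by (rewrite Etp; ring).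
      replace (- sg * - polar_g Q1 Q2 (tm + sg * (L - s))) with (sector_g Q1 Q2 tm sg (L - s))
        by (unfold sector_g; ring).
      apply Hpos. lra. }
    { intros g' Hg'.
      assert (Hd : forall s, Derive (polar_g Q1 Q2) s = - g' s).
      { intros s. apply is_derive_unique.
        apply (is_derive_ext (fun s => - polar_g (negate Q1) (negate Q2) s)).
        - intros t. rewrite polar_g_negate. apply Ropp_involutive.
        - apply (is_derive_opp (polar_g (negate Q1) (negate Q2))), Hg'. }
      rewrite Hd in Dm, Dp. split; lra. }
    set (X' := system (- lambda) (negate Q1) (negate Q2)) in *.
    assert (EX : X = reverse_field X') by apply system_reverse. rewrite EX. clearbody X'. clear EX.
    rewrite !no_radius_equilibrium_reverse, !radius_equilibrium_reverse, !omega_basin_reverse.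
    split; [|split; [|split]]; intros C.
    + apply Ca in C. destruct Sa as (S1 & S2 & pm & S3 & S4); try lra.
      split; [exact S1|]. split; [apply all_alpha_reverse, S2|].
      exists pm. split; [exact S3|]. unfold stable_manifold. rewrite omega_basin_reverse. exact S4.
    + apply Cb in C. destruct Sb as (S1 & S2 & pp & S3 & S4); try lra.
      split; [exact S1|]. split; [apply all_omega_reverse, S2|].
      exists pp. split; [exact S3|]. apply all_alpha_reverse, S4.
    + apply Cc in C. destruct Sd as (pm & pp & S1 & S2 & S3 & c & S4 & S5 & S6); try lra.
      exists pp, pm. split; [exact S2|]. split; [exact S1|]. split; [apply all_alpha_reverse, S3|].
      exists (reverse_curve c). split; [apply robust_heteroclinic_reverse, S4|].
      split; [intros t Ht; apply (S5 (- t)), dom_reverse, Ht|].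
      rewrite image_reverse. exact S6.
    + apply Cd in C. destruct Sc as (S1 & S2 & S3 & S4); try lra.
      split; [exact S2|]. split; [exact S1|]. split; [apply all_alpha_reverse, S4|].
      apply all_omega_reverse, S3.
Qed.
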